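(* Let $(A_N)_N$ and $(B_N)_N$ be two sequences of random hermitian matrices of size $N$, at least one of which is unitarily invariant (its law is invariant under conjugation by unitary matrices for every $N$), and such that $A_N$ is independent of $B_N$ for each $N$. Let $(g_0,n_0)\in\overline{\mathsf{Typ}}$ and assume that both $(A_N)_N$ and $(B_N)_N$ admit a limit distribution up to order $(g_0,n_0)$. Let $\mathscr A=\mathbb C\langle a,b\rangle$ be the algebra of non-commutative polynomials in two letters. Then for every $Q\in\mathscr A$, $(Q(A_N,B_N))_N$ admits a limit distribution up to order $(g_0,n_0)$, so that $\mathscr A$ becomes a surfaced probability space with moments $\varphi_{g,n}$, $(g,n)\preceq(g_0,n_0)$, where $\varphi_{g,n}(Q_1,\ldots,Q_n)$ is the coefficient of $N^{2-2g-n}$ in the $N\to\infty$ expansion of $\mathbb E^\circ[\mathrm{Tr}\,Q_1(A_N,B_N),\ldots,\mathrm{Tr}\,Q_n(A_N,B_N)]$. Moreover, the subalgebras $\mathbb C[a]$ and $\mathbb C[b]$ are $(g_0,n_0)$-free in it.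
   Context: **Types.** $\mathsf{Typ}=\frac12\mathbb Z_{\ge0}\times\mathbb Z_{>0}$, ordered by $(g,n)\preceq(g',n')$ iff $g\le g'$ and $g+n\le g'+n'$; $\overline{\mathsf{Typ}}$ is $\mathsf{Typ}$ together with $(g,\infty)$, $g\in\frac12\mathbb Z_{\ge0}$, and $(\infty,\infty)$, with $(g,n)\preceq(g',\infty)$ iff $g\le g'$ and everything $\preceq(\infty,\infty)$. **Limit distributions.** $\mathbb E^\circ[Y_1,\ldots,Y_n]$ is the joint cumulant of random variables (all moments are assumed finite). A sequence $(A_N)_N$ of random matrices of size $N$ admits a limit distribution up to order $(g_0,n_0)$ if there are numbers $F_{g;k_1,\ldots,k_n}$, independent of $N$, such that for every $n\ge1$ for which some $(g,n)\preceq(g_0,n_0)$ and all $k_1,\ldots,k_n>0$, as $N\to\infty$, $$\mathbb E^\circ[\mathrm{Tr}(A_N^{k_1}),\ldots,\mathrm{Tr}(A_N^{k_n})]=\sum_{g:\,(g,n)\preceq(g_0,n_0)}N^{2-2g-n}F_{g;k_1,\ldots,k_n}+o(N^{2-2g_{\max}-n}),$$ with $g_{\max}=g_0+\min(0,n_0-n)$ the largest $g$ in the sum; if $g_0=\infty$ the expansion is required to hold to every order $o(N^{-K})$. **Surfaced permutations.** $P(d)$ is the lattice of set partitions of $[d]$ ($\vee$ = join, $\mathbf 1_d=\{[d]\}$); $\mathbf 0_\alpha$ is the partition into supports of cycles of $\alpha\in S(d)$. $\mathbb{PS}(d)$ is the set of triples $(\mathcal A,\alpha,g)$, $\mathcal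 A\in P(d)$, $\alpha\in S(d)$, $\mathbf 0_\alpha\le\mathcal A$, $g:\mathcal A\to\frac12\mathbb Z_{\ge0}$. On a set of size $d$: $|(\mathcal A,\alpha)|=2(d-\#\mathcal A)-(d-\#\mathbf 0_\alpha)$, $|(\mathcal A,\alpha,g)|=|(\mathcal A,\alpha)|+\sum_{A\in\mathcal{A}}2g(A)$. $(\mathcal A,\alpha,g)\odot(\mathcal B,\beta,h)=(\mathcal A\vee\mathcal B,\alpha\circ\beta,k)$ with $k(C)=\frac12\big(|(\mathcal A_{|C},\alpha_{|C},g_{|C})|+|(\mathcal B_{|C},\beta_{|C},h_{|C})|-|(\{C\},(\alpha\circ\beta)_{|C})|\big)$ for each block $C$ of $\mathcal A\vee\mathcal B$. $(f_1\circledast f_2)(\mathcal C,\gamma,k)[a_1,\ldots,a_d]=\sum_{(\mathcal A,\alpha,g)\odot(\mathcal B,\beta,h)=(\mathcal C,\gamma,k)}f_1(\mathcal A,\alpha,g)f_2(\mathcal B,\beta,h)[a_1,\ldots,a_d]$. $\boldsymbol\zeta(\mathcal A,\alpha,g)=1$ if $\mathcal A=\mathbf 0_\alpha$, $g=0$, else $0$; $\boldsymbol\mu$ is its two-sided $\circledast$-inverse, the unit being the indicator of $(\mathbf 0_{\mathrm{id}},\mathrm{id},0)$. **Surfaced probability space.** A unital associative $\mathbb C$-algebra $\mathscr A$ with symmetric $n$-linear forms $\varphi_{g,n}$ ($g\in\frac12\mathbb Z_{\ge0},n\ge1$), tracial in each argument, with $\varphi_{0,1}(1)=1$ and $\varphi_{g,n}(1,a_2,\ldots,a_n)=0$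 for $(g,n)\ne(0,1)$. (Here only $\varphi_{g,n}$ with $(g,n)\preceq(g_0,n_0)$ are relevant; the free cumulants of type $\preceq(g_0,n_0)$ depend only on these.) For $\sigma\in S(d)$ with $n$ cycles, $\phi(\mathbf 1_d,\sigma,g)[a_1,\ldots,a_d]=\varphi_{g,n}$ evaluated on the $n$ products $a_{i}a_{\sigma(i)}a_{\sigma^2(i)}\cdots$ along the cycles of $\sigma$, and $\phi(\mathcal A,\alpha,g)[a_1,\dots,a_d]=\prod_{A\in\mathcal A}\phi(\mathbf 1_{\#A},\alpha_{|A},g(A))[(a_i)_{i\in A}]$. Put $\phi^\vee=\boldsymbol\mu\circledast\phi$ and $\kappa_{g;k_1,\ldots,k_n}(a_1,\ldots,a_d)=\phi^\vee(\mathbf 1_d,\pi_\lambda,g)[a_1,\ldots,a_d]$, where $d=\sum k_i$, $\lambda$ is the decreasing rearrangement of $(k_i)$ and $\pi_\lambda=(1\cdots\lambda_1)(\lambda_1+1\cdots\lambda_1+\lambda_2)\cdots$. **Freeness.** Subsets $\mathscr X_1,\mathscr X_2\subset\mathscr A$ are $(g_0,n_0)$-free if for all $(g,n)\in\mathsf{Typ}$ with $(g,n)\preceq(g_0,n_0)$, all $d$, all $a_p\in\mathscr X_{i(p)}$ ($p\in[d]$) and $k_1+\cdots+k_n=d$, $\kappa_{g;k_1,\ldots,k_n}(a_1,\ldots,a_d)=0$ whenever $i(p)\ne i(q)$ for some $p,q$.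
   Formalization: For finite n_0, a limit distribution up to order (g_0,n_0) is also required to have n-th cumulants o(N^{2-2(g_0+n_0-n)-n}) for n>g_0+n_0; without this the claim fails, e.g. for (0,1) with A_N=xi I, B_N=eta I, xi and eta independent signs. *)

(* Defs.v *)
From HB Require Import structures.
From mathcomp Require Import all_boot all_order all_algebra all_fingroup.
From mathcomp Require Import sesquilinear spectral.
From mathcomp Require Import finmap complex monalg.
From mathcomp Require Import all_classical all_reals all_analysis.

Set Implicit Arguments.
Unset Strict Implicit.
Unset Printing Implicit Defensive.

Import Order.TTheory GRing.Theory Num.Theory numFieldNormedType.Exports.

Local Open Scope ring_scope.

(* Half-integer genera are encoded by their doubles: a natural number [G]
   always stands for the genus g = G / 2. *)

(* [XFin G0 n0] is (G0/2, n0), [XInfN G0] is (G0/2, oo), [XInf] is (oo, oo). *)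
Inductive xtyp := XFin of nat & nat | XInfN of nat | XInf.

Definition in_xtyp (t : xtyp) : bool :=
  if t is XFin _ n0 then (0 < n0)%N else true.

(* The condition g + n <= g0 + n0 is doubled. *)
Definition typ_le (G n : nat) (t : xtyp) : bool :=
  match t with
  | XFin G0 n0 => (G <= G0)%N && (G + n.*2 <= G0 + n0.*2)%N
  | XInfN G0 => (G <= G0)%N
  | XInf => true
  end.

Section SurfacedPermutations.
Variable d : nat.

Definition part_le (P Q : {set {set 'I_d}}) : bool :=
  [forall A in P, [exists B in Q, A \subset B]].

Definition part_join (P Q : {set {set 'I_d}}) : {set {set 'I_d}} :=
  equivalence_partition
    (connect [rel x y | (finset.pblock P x == finset.pblock P y)
                  || (finset.pblock Q x == finset.pblock Q y)])
    [set: 'I_d]%SET.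

(* Raw triples (partition, permutation, doubled genus function); only those
   satisfying [is_surfperm] are meant.  The genus function, defined on the
   blocks, is extended by 0 to all subsets so that each surfaced permutation
   has a unique representation. *)
Definition surfperm : choiceType :=
  ({set {set 'I_d}} * {perm 'I_d} * {ffun {set 'I_d} -> nat})%type.

Definition spart (x : surfperm) := x.1.1.
Definition sperm (x : surfperm) := x.1.2.
Definition sgen (x : surfperm) := x.2.

Definition is_surfperm (x : surfperm) : bool :=
  [&& finset.partition (spart x) [set: 'I_d]%SET,
      part_le (porbits (sperm x)) (spart x) &
      [forall A, (A \notin spart x) ==> (sgen x A == 0%N)]].

Definition cycles_in (s : {perm 'I_d}) (C : {set 'I_d}) : {set {set 'I_d}} :=
  [set c in porbits s | c \subset C]%SET.

(* |(P_{|C}, s_{|C})|, for C a union of blocks of P *)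
Definition pnorm_on (P : {set {set 'I_d}}) (s : {perm 'I_d}) (C : {set 'I_d})
  : int :=
  (#|C|%:Z - #|[set A in P | A \subset C]%SET|%:Z) *+ 2
  - (#|C|%:Z - #|cycles_in s C|%:Z).

Definition snorm_on (x : surfperm) (C : {set 'I_d}) : int :=
  pnorm_on (spart x) (sperm x) C
  + \sum_(A in spart x | A \subset C) (sgen x A)%:Z.

(* z is the product of x and y.  MathComp permutations compose from left to
   right, so alpha o beta is [(beta * alpha)%g]. *)
Definition surf_prod (x y z : surfperm) : Prop :=
  [/\ spart z = part_join (spart x) (spart y),
      sperm z = (sperm y * sperm x)%g &
      forall C, C \in spart z ->
        (sgen z C)%:Z =
        snorm_on x C + snorm_on y C - pnorm_on [set C]%SET (sperm z) C].

End SurfacedPermutations.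

Section Convolution.
Variables (K : comNzRingType) (d : nat).

(* A finite sum: the norm is additive along factorizations, so that each z has
   finitely many of them. *)
Definition sconv (f h : surfperm d -> K) (z : surfperm d) : K :=
  \sum_(p \in [set p : surfperm d * surfperm d |
                 [/\ is_surfperm p.1, is_surfperm p.2 &
                     surf_prod p.1 p.2 z]]%classic) f p.1 * h p.2.

Definition sunit (z : surfperm d) : K :=
  (z == (porbits 1%g, 1%g, [ffun=> 0%N]))%:R.

Definition szeta (z : surfperm d) : K :=
  ((spart z == porbits (sperm z)) && (sgen z == [ffun=> 0%N]))%:R.

Definition is_sinv (f h : surfperm d -> K) : Prop :=
  forall z, is_surfperm z -> sconv f h z = sunit z /\ sconv h f z = sunit z.

Definition smobius : surfperm d -> K :=
  xget (fun=> 0) [set m : surfperm d -> K | is_sinv m szeta]%classic.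

End Convolution.

Section SurfacedProbability.
Variables (K : fieldType) (A : algType K).

(* phi_{g,n}(a_1, ..., a_n) is [phi G [:: a_1; ...; a_n]]; the value of [phi G]
   on the empty sequence is never used. *)
Implicit Types (phi : nat -> seq A -> K) (G : nat).

Definition surfaced_space phi : Prop :=
  [/\ forall G s1 s2 (c : K) (x y : A),
        phi G (s1 ++ (c *: x + y) :: s2) =
        c * phi G (s1 ++ x :: s2) + phi G (s1 ++ y :: s2),
      forall G s1 s2, perm_eq s1 s2 -> phi G s1 = phi G s2,
      forall G s1 s2 (x y : A),
        phi G (s1 ++ (x * y) :: s2) = phi G (s1 ++ (y * x) :: s2),
      phi 0%N [:: 1] = 1 &
      forall G s, (G, size s) != (0%N, 0%N) -> phi G (1 :: s) = 0].

(* The product a_i a_(s i) a_(s^2 i) ... along a cycle c of s, for some i in c;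
   the choice of i is immaterial for tracial functionals. *)
Definition cycle_prod d (a : 'I_d -> A) (s : {perm 'I_d}) (c : {set 'I_d}) : A :=
  if [pick i in c] is Some i then \prod_(k < #|c|) a ((s ^+ k)%g i) else 1.

Definition smoment phi d (a : 'I_d -> A) (x : surfperm d) : K :=
  \prod_(B in spart x)
    phi (sgen x B)
        [seq cycle_prod a (sperm x) c | c <- enum (cycles_in (sperm x) B)].

Definition scumulant phi d (a : 'I_d -> A) : surfperm d -> K :=
  sconv (@smobius K d) (smoment phi a).

End SurfacedProbability.

(* pi_lambda (0-based): the j-th element of the r-th interval of length
   lambda_r is sent to element (j + 1) mod lambda_r of the same interval. *)
Section StandardPermutation.
Variable lam : seq nat.

Definition std_next (i : nat) : nat :=
  let r := reshape_index lam i in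
  flatten_index lam r ((reshape_offset lam i).+1 %% nth 0%N lam r).

Lemma std_offset (i : nat) : (i < sumn lam)%N ->
  ((reshape_offset lam i).+1 %% nth 0 lam (reshape_index lam i)
   < nth 0 lam (reshape_index lam i))%N.
Proof.
by move=> /reshape_offsetP lt_o; rewrite ltn_mod (leq_trans _ lt_o).
Qed.

Lemma std_next_lt (i : nat) : (i < sumn lam)%N -> (std_next i < sumn lam)%N.
Proof. by move=> lti; apply: flatten_indexP (std_offset lti). Qed.

Definition std_fun (i : 'I_(sumn lam)) : 'I_(sumn lam) :=
  Ordinal (std_next_lt (ltn_ord i)).

Lemma std_fun_inj : injective std_fun.
Proof.
move=> i j /(congr1 val) /= eq_n; apply: val_inj => /=.
have lei := std_offset (ltn_ord i); have lej := std_offset (ltn_ord j).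
have eq_r : reshape_index lam i = reshape_index lam j.
  by rewrite -(flatten_indexKl lei) -(flatten_indexKl lej); congr reshape_index.
have eq_o : ((reshape_offset lam i).+1 %% nth 0 lam (reshape_index lam i) =
             (reshape_offset lam j).+1 %% nth 0 lam (reshape_index lam j))%N.
  rewrite -(flatten_indexKr lei) -[RHS](flatten_indexKr lej).
  by congr reshape_offset.
rewrite -(reshape_indexK lam i) -(reshape_indexK lam j) eq_r; congr flatten_index.
move: eq_o (reshape_offsetP (ltn_ord i)) (reshape_offsetP (ltn_ord j)).
rewrite eq_r; set n := nth 0%N _ _ => /eqP.
by rewrite -[in X in X == _]addn1 -[in X in _ == X]addn1 eqn_modDr => /eqP eq_o lti ltj;
  move: eq_o; rewrite !modn_small.
Qed.

Definition std_perm : {perm 'I_(sumn lam)} := perm std_fun_inj.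

End StandardPermutation.

Lemma sumn_sort_geq (ks : seq nat) : sumn (sort geq ks) = sumn ks.
Proof. by apply: perm_sumn; rewrite perm_sort. Qed.

Section FreeCumulants.
Variables (K : fieldType) (A : algType K).

Definition free_cumulant (phi : nat -> seq A -> K) (G : nat) (ks : seq nat)
    (a : 'I_(sumn ks) -> A) : K :=
  scumulant phi a
    ([set [set: 'I_(sumn ks)]]%SET,
     cast_perm (sumn_sort_geq ks) (std_perm (sort geq ks)),
     [ffun B : {set 'I_(sumn ks)} => if B == [set: 'I_(sumn ks)]%SET then G else 0%N]).

Definition surf_free (phi : nat -> seq A -> K) (t : xtyp) (X1 X2 : set A) : Prop :=
  forall (G : nat) (ks : seq nat),
    (0 < size ks)%N -> all (leq 1) ks -> typ_le G (size ks) t ->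
  forall (i : 'I_(sumn ks) -> bool) (a : 'I_(sumn ks) -> A),
    (forall p, (if i p then X2 else X1) (a p)) ->
    (exists p q, i p != i q) ->
    free_cumulant phi G a = 0.

End FreeCumulants.

Section NCPoly.
Variable K : comNzRingType.

Definition ncpoly := {malg K[{fmonom bool}]}.
HB.instance Definition _ := GRing.Lalgebra.on ncpoly.

Lemma ncpoly_scaleAr (c : K) (x y : ncpoly) : c *: (x * y) = x * (c *: y).
Proof.
apply/malgP => k; rewrite mcoeffZ mcoeffMl.
rewrite (mcoeffMlw _ (fsubset_refl _) (msuppZ_le c y)) mulr_sumr.
apply: eq_bigr => k1 _; rewrite mulr_sumr; apply: eq_bigr => k2 _.
by rewrite mcoeffZ mulrCA mulrnAr.
Qed.

HB.instance Definition _ :=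
  GRing.Lalgebra_isAlgebra.Build K ncpoly ncpoly_scaleAr.

Definition nc_a : ncpoly := << fmu false >>%R.
Definition nc_b : ncpoly := << fmu true >>%R.

Definition nc_eval (N : nat) (Q : ncpoly) (A B : 'M[K]_N) : 'M[K]_N :=
  \sum_(m <- msupp Q) Q@_m *: \prod_(l <- (m : seq bool)) (if l then B else A).

End NCPoly.

Local Open Scope classical_set_scope.

Section RandomMatrices.
Context {R : realType} {disp : measure_display} {Omega : measurableType disp}.
Variable P : probability Omega R.

Definition cintegrable (X : Omega -> R[i]) : Prop :=
  P.-integrable setT (fun w => (complex.Re (X w))%:E) /\
  P.-integrable setT (fun w => (complex.Im (X w))%:E).

Definition cexpect (X : Omega -> R[i]) : R[i] :=
  Complex (fine ('E_P[fun w => complex.Re (X w)])%E)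
          (fine ('E_P[fun w => complex.Im (X w)])%E).

Definition cumulant (Y : seq (Omega -> R[i])) : R[i] :=
  \sum_(p : {set {set 'I_(size Y)}} | finset.partition p [set: 'I_(size Y)]%SET)
    (-1) ^+ #|p|.-1 * (#|p|.-1)`!%:R *
    \prod_(B in p) cexpect (fun w => \prod_(i in B) nth (fun=> 0) Y i w).

(* Borel sets of 'M[R[i]]_N, generated by the real and imaginary parts of the
   entries. *)
Definition mx_borel (N : nat) : set (set 'M[R[i]]_N) :=
  <<s [set S | exists i j : 'I_N, exists2 U : set R, measurable U &
         S = [set M : 'M[R[i]]_N | U (complex.Re (M i j))] \/
         S = [set M : 'M[R[i]]_N | U (complex.Im (M i j))] ] >>.

Definition random_mx N (X : Omega -> 'M[R[i]]_N) : Prop :=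
  forall S, mx_borel S -> measurable (X @^-1` S).

Definition unitarily_invariant N (X : Omega -> 'M[R[i]]_N) : Prop :=
  forall U : 'M[R[i]]_N, U \is unitarymx ->
  forall S, mx_borel S ->
    P ((fun w => U *m X w *m (U ^t*)%sesqui) @^-1` S) = P (X @^-1` S).

Definition independent_mx N (X Y : Omega -> 'M[R[i]]_N) : Prop :=
  forall S T, mx_borel S -> mx_borel T ->
    P (X @^-1` S `&` Y @^-1` T) = (P (X @^-1` S) * P (Y @^-1` T))%E.

End RandomMatrices.

Definition hermitian_mx (K : numClosedFieldType) N (M : 'M[K]_N) : Prop :=
  (M ^t*)%sesqui = M.

Section Expansions.
Variable R : realType.
Implicit Types (u F : nat -> R[i]).

Definition is_o_pow u (e : int) : Prop :=
  (fun N : nat => Normc.normc (u N) : R^o) =o_\oo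
  (fun N : nat => (N%:R : R) ^ e : R^o).

Definition remainder (n : nat) u F (gs : pred nat) (M : nat) (N : nat) : R[i] :=
  u N - \sum_(G < M | gs G) (N%:R : R[i]) ^ (2 - G%:Z - n%:Z) * F G.

(* Expansion of an n-point cumulant up to the order t, for every n.  For n0
   finite and n > g0 + n0 no type (g, n) is below (g0, n0): the sum is empty,
   gmax = g0 + min(0, n0 - n) is negative, and what remains is the decay
   u N = o(N^(2 - 2 gmax - n)).  It cannot be dropped: if A_N = xi I and
   B_N = eta I with xi, eta independent signs, the 1-point cumulants have
   expansions of order (0, 1), but E Tr(ABAB) = N whereas freeness would give
   o(N).  For g0 = n0 = oo, truncations of every length are considered. *)
Definition has_expansion (t : xtyp) (n : nat) u F : Prop :=
  match t with
  | XFin G0 n0 =>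
      let Gmax : int := G0%:Z + Num.min 0 ((n0%:Z - n%:Z) *+ 2) in
      is_o_pow (remainder n u F (fun G => typ_le G n t) G0.+1) (2 - Gmax - n%:Z)
  | XInfN G0 => is_o_pow (remainder n u F predT G0.+1) (2 - G0%:Z - n%:Z)
  | XInf => forall K : nat,
      is_o_pow (remainder n u F predT K.+1) (2 - K%:Z - n%:Z)
  end.

Context {disp : nat -> measure_display}
        {Omega : forall N, measurableType (disp N)}.
Variable P : forall N, probability (Omega N) R.

Definition admits_limit (X : forall N, Omega N -> 'M[R[i]]_N) (t : xtyp) : Prop :=
  (forall N (ks : seq nat), all (leq 1) ks ->
     cintegrable (P N) (fun w => \prod_(k <- ks) \tr (X N w ^+ k))) /\
  exists F : nat -> seq nat -> R[i],
    forall ks, (0 < size ks)%N -> all (leq 1) ks ->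
      has_expansion t (size ks)
        (fun N => cumulant (P N) [seq (fun w => \tr (X N w ^+ k)) | k <- ks])
        (fun G => F G ks).

End Expansions.

(* Main.v *)
From HB Require Import structures.
From mathcomp Require Import all_boot all_order all_algebra all_fingroup.
From mathcomp Require Import sesquilinear spectral.
From mathcomp Require Import finmap complex monalg.
From mathcomp Require Import all_classical all_reals all_analysis measurable_realfun.
From mathcomp Require Import zify ring lra.
Require Import Defs.

(** Encode the cumulants of traces of a family (X_k), k < d, by a function
nX(Q, s) of a partition Q and a permutation s below it, normalized by N^-d.
Summing over the partitions below Q gives products of expectations of products of
traces, which are contractions of the tensor T_Q = prod_(C in Q) E[tensor_(k in C)
X_k] with permutations.

Let X_k be a polynomial in A for k in J and a polynomial in B otherwise, and write
X_k = Y_k Z_k with Y_k in C[A], Z_k in C[B], one of them trivial. By independence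
T_Q(X) = T_Q(Y) T_Q(Z), and by unitary invariance and Schur-Weyl duality one of the
two factors is a combination of permutation operators; the moments of the other one
are those of such a combination too, since the matrix N^(cycles of s s'^-1) is
invertible for large N. So for all large N the moments of Y, Z, X are c * z, c' * z,
c * c' * z in the group algebra of the permutations below Q, where
z(s) = N^(cycles of s). The Moebius function of surfaced permutations, summed against
powers of 1/N, is an approximate inverse m of N^-d z, whence
nX = nY * m * nZ up to O(N^-E), with E arbitrary.

Expansions of nY and nZ therefore give one of nX, and the additivity of the norm
together with the genus inequality controls the orders that are reached. For the
freeness, m * nX becomes c * c' after summation below Q, and this depends only on the
meet of Q with {J, complement of J}; Moebius inversion shows that (m * nX)(1, s) is
O(N^-E), while the coefficients of its expansion are the mixed free cumulants. *)

(** The obstacle is that the exact inverse of N^-d z depends on N, while the free cumulants come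
    from a purely combinatorial inverse which matches it only up to a truncation. The comparison
    works because c and c' are recovered from moments that are bounded by powers of N: they grow at
    most polynomially, with an exponent fixed before the truncation order M of m is chosen. The
    coefficients are attached to the trace of Q on J, or on its complement, and not to Q itself; the
    dependence on the meet alone rests on this. The matrix that is not invariant need not have
    permutation operators behind its moments, so its coefficients are solved for at these traces and
    carried to Q through the slots filled with identity matrices. For finite n0, the cumulants of
    more than n0 traces are known with a precision that drops by 2, in doubled genus, with each
    further trace. They do enter the expansion of nX at permutations with few cycles; the loss is
    offset there by the growth of the norm. This is where the decay demanded beyond the type (g0,
    n0) is used. *)

Set Implicit Arguments.
Unset Strict Implicit.
Unset Printing Implicit Defensive.
Import Order.TTheory GRing.Theory Num.Theory numFieldNormedType.Exports.
Local Open Scope ring_scope.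

(** * Asymptotic expansions in 1/N *)

Section Asymptotics.
Variable R : realType.
Implicit Types (u v : nat -> R[i]) (e k : int) (P Q : {poly R[i]}).
Local Notation normc := (@Normc.normc R).

(** The explicit thresholds allow a sequence to be changed at finitely many N ([lo_ext]), which is
    needed at N = 0 and below the size from which the finite-N identities hold. *)
Definition lo u e := forall eps : R, 0 < eps ->
  exists N0 : nat, forall N, (N0 <= N)%N -> normc (u N) <= eps * N%:R ^ e.

Definition bo u e := exists2 K : R, 0 < K & exists N0 : nat, forall N, (N0 <= N)%N ->
  normc (u N) <= K * N%:R ^ e.

Lemma normc_ge0 (x : R[i]) : 0 <= normc x.
Proof. by case: x => a b; exact: sqrtr_ge0. Qed.

Lemma normcD_le (x y : R[i]) : normc (x + y) <= normc x + normc y.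
Proof. exact: (@le_normcD R x y). Qed.

Lemma normc_nat (n : nat) : normc n%:R = n%:R.
Proof.
have -> : (n%:R : R[i]) = (n%:R : R)%:C%C by rewrite rmorph_nat.
by rewrite /= expr0n addr0 sqrtr_sqr ger0_norm.
Qed.

Lemma normcX (x : R[i]) n : normc (x ^+ n) = normc x ^+ n.
Proof.
elim: n => [|n IH]; first by rewrite !expr0 Normc.normc1.
by rewrite !exprS Normc.normcM IH.
Qed.

Lemma normc_natX (n : nat) e : normc (n%:R ^ e) = n%:R ^ e.
Proof.
case: e => m; first by rewrite -!exprnP normcX normc_nat.
by rewrite !NegzE -!exprnN Normc.normcV normcX normc_nat.
Qed.

Lemma natX_ge0 (n : nat) e : 0 <= (n%:R : R) ^ e.
Proof. exact: exprz_ge0. Qed.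

Lemma is_o_powE u e : is_o_pow u e <-> lo u e.
Proof.
split=> [/eqoP H eps e0|H].
  have [N0 _ HN] := H _ e0; exists N0 => N leN; have := HN N leN.
  by rewrite !ger0_norm ?normc_ge0 ?natX_ge0.
apply/eqoP => eps e0; have [N0 HN] := H _ e0.
by exists N0 => // N leN; rewrite /= !ger0_norm ?normc_ge0 ?natX_ge0 ?HN.
Qed.

Lemma natX_add (n : nat) (e k : int) : (0 < n)%N ->
  (n%:R : R) ^ (e + k) = n%:R ^ e * n%:R ^ k.
Proof. by move=> n0; rewrite expfzDr // pnatr_eq0 -lt0n. Qed.

Lemma natXC_add (n : nat) (e k : int) : (0 < n)%N ->
  (n%:R : R[i]) ^ (e + k) = n%:R ^ e * n%:R ^ k.
Proof. by move=> n0; rewrite expfzDr // pnatr_eq0 -lt0n. Qed.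

Lemma lo_ext u v e N1 : (forall N, (N1 <= N)%N -> u N = v N) -> lo u e -> lo v e.
Proof.
move=> uv H eps /H[N0 HN]; exists (maxn N0 N1) => N; rewrite geq_max => /andP[a b].
by rewrite -uv // HN.
Qed.

Lemma bo_ext u v e N1 : (forall N, (N1 <= N)%N -> u N = v N) -> bo u e -> bo v e.
Proof.
move=> uv [K K0 [N0 HN]]; exists K => //; exists (maxn N0 N1) => N.
by rewrite geq_max => /andP[a b]; rewrite -uv // HN.
Qed.

Lemma eq_lo u v e : u =1 v -> lo u e -> lo v e.
Proof. by move=> uv; apply: (@lo_ext _ _ _ 0) => N _. Qed.

Lemma eq_bo u v e : u =1 v -> bo u e -> bo v e.
Proof. by move=> uv; apply: (@bo_ext _ _ _ 0) => N _. Qed.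

Lemma lo0 e : lo (fun=> 0) e.
Proof.
move=> eps e0; exists 0%N => N _; rewrite Normc.normc0.
by rewrite mulr_ge0 ?natX_ge0 // ltW.
Qed.

Lemma lo_bo u e : lo u e -> bo u e.
Proof. by move=> /(_ 1 ltr01)[N0 HN]; exists 1 => //; exists N0. Qed.

Lemma bo0 e : bo (fun=> 0) e.
Proof. exact/lo_bo/lo0. Qed.

Lemma loD u v e : lo u e -> lo v e -> lo (fun N => u N + v N) e.
Proof.
move=> Hu Hv eps e0; have e2 : 0 < eps / 2 by rewrite divr_gt0.
have [N1 H1] := Hu _ e2; have [N2 H2] := Hv _ e2.
exists (maxn N1 N2) => N; rewrite geq_max => /andP[/H1 a /H2 b].
apply: le_trans (normcD_le _ _) _; apply: le_trans (lerD a b) _.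
by rewrite -mulrDl -splitr.
Qed.

Lemma boD u v e : bo u e -> bo v e -> bo (fun N => u N + v N) e.
Proof.
move=> [K1 k1 [N1 H1]] [K2 k2 [N2 H2]]; exists (K1 + K2); first exact: addr_gt0.
exists (maxn N1 N2) => N; rewrite geq_max => /andP[/H1 a /H2 b].
by apply: le_trans (normcD_le _ _) _; rewrite mulrDl lerD.
Qed.

Lemma bo_lo_mul u v e k : bo u e -> lo v k -> lo (fun N => u N * v N) (e + k).
Proof.
move=> [K K0 [N0 HN]] Hv eps e0.
have [N1 H1] := Hv (eps / K) (divr_gt0 e0 K0).
exists (maxn 1 (maxn N0 N1)) => N; rewrite !geq_max => /and3P[n0 /HN a /H1 b].
rewrite Normc.normcM natX_add //.
apply: le_trans (ler_pM (normc_ge0 _) (normc_ge0 _) a b) _.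
by rewrite mulrACA [K * _]mulrC divfK ?gt_eqF.
Qed.

Lemma lo_bo_mul u v e k : lo u e -> bo v k -> lo (fun N => u N * v N) (e + k).
Proof.
move=> Hu Hv; rewrite addrC; apply: (@eq_lo (fun N => v N * u N) _ _).
  by move=> N; rewrite mulrC.
exact: bo_lo_mul.
Qed.

Lemma boM u v e k : bo u e -> bo v k -> bo (fun N => u N * v N) (e + k).
Proof.
move=> [K1 k1 [N1 H1]] [K2 k2 [N2 H2]]; exists (K1 * K2); first exact: mulr_gt0.
exists (maxn 1 (maxn N1 N2)) => N; rewrite !geq_max => /and3P[n0 /H1 a /H2 b].
rewrite Normc.normcM natX_add // mulrACA.
exact: ler_pM (normc_ge0 _) (normc_ge0 _) a b.
Qed.

Lemma bo_cst (c : R[i]) : bo (fun=> c) 0.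
Proof.
exists (normc c + 1); first by rewrite ltr_wpDl ?normc_ge0.
by exists 0%N => N _; rewrite expr0z mulr1 lerDl.
Qed.

Lemma bo_pow e : bo (fun N => N%:R ^ e) e.
Proof. by exists 1 => //; exists 0%N => N _; rewrite mul1r normc_natX. Qed.

Lemma natX_le (n : nat) (e k : int) : (0 < n)%N -> e <= k ->
  (n%:R : R) ^ e <= n%:R ^ k.
Proof. by move=> n0 ek; rewrite ler_weXz2l // ler1n. Qed.

Lemma bo_le u e k : e <= k -> bo u e -> bo u k.
Proof.
move=> ek [K K0 [N0 HN]]; exists K => //; exists (maxn 1 N0) => N.
rewrite geq_max => /andP[n0 /HN a]; apply: le_trans a _.
by rewrite ler_pM2l // natX_le.
Qed.

Lemma lo_le u e k : e <= k -> lo u e -> lo u k.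
Proof.
move=> ek H eps e0; have [N0 HN] := H _ e0; exists (maxn 1 N0) => N.
rewrite geq_max => /andP[n0 /HN a]; apply: le_trans a _.
by rewrite ler_pM2l // natX_le.
Qed.

Lemma lo_pow e k : e < k -> lo (fun N => N%:R ^ e) k.
Proof.
move=> ek eps e0; exists (maxn 1 (Num.truncn eps^-1).+1) => N.
rewrite geq_max => /andP[n0 lN]; rewrite normc_natX.
have lN' : eps^-1 <= N%:R.
  by apply: le_trans (ltW (truncnS_gt _)) _; rewrite ler_nat.
have -> : k = 1 + (k - 1) by rewrite addrC subrK.
rewrite natX_add // expr1z mulrA.
have h : 1 <= eps * N%:R by rewrite -ler_pdivrMl // mulr1.
apply: le_trans (_ : N%:R ^ (k - 1) <= _); last by rewrite ler_peMl // natX_ge0.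
by apply: natX_le => //; lia.
Qed.

Lemma bo_lt_lo u e k : e < k -> bo u e -> lo u k.
Proof.
move=> ek Hu.
have := bo_lo_mul Hu (@lo_pow 0 (k - e) _).
rewrite [e + _]addrC subrK => H; apply: eq_lo (H _); last by rewrite subr_gt0.
by move=> N; rewrite expr0z mulr1.
Qed.

Lemma lo_cstM u e (c : R[i]) : lo u e -> lo (fun N => c * u N) e.
Proof. by move=> H; rewrite -[e]add0r; apply: bo_lo_mul (bo_cst c) H. Qed.

Lemma bo_cstM u e (c : R[i]) : bo u e -> bo (fun N => c * u N) e.
Proof. by move=> H; rewrite -[e]add0r; apply: boM (bo_cst c) H. Qed.

Lemma loN u e : lo u e -> lo (fun N => - u N) e.
Proof. by move/(lo_cstM (-1)); apply: eq_lo => N; rewrite mulN1r. Qed.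

Lemma boN u e : bo u e -> bo (fun N => - u N) e.
Proof. by move/(bo_cstM (-1)); apply: eq_bo => N; rewrite mulN1r. Qed.

Lemma loB u v e : lo u e -> lo v e -> lo (fun N => u N - v N) e.
Proof. by move=> Hu /loN; apply: loD. Qed.

Lemma boB u v e : bo u e -> bo v e -> bo (fun N => u N - v N) e.
Proof. by move=> Hu /boN; apply: boD. Qed.

Lemma lo_sum (I : Type) (r : seq I) (p : pred I) (f : I -> nat -> R[i]) e :
  (forall i, p i -> lo (f i) e) -> lo (fun N => \sum_(i <- r | p i) f i N) e.
Proof.
move=> H; elim: r => [|i r IH].
  by apply: eq_lo (lo0 e) => N; rewrite big_nil.
apply: (@eq_lo (fun N => (if p i then f i N else 0) + \sum_(j <- r | p j) f j N) _ _).
  by move=> N; rewrite big_cons; case: ifP => // _; rewrite add0r.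
by apply: loD IH; case: (boolP (p i)) => [/H|_] //; apply: lo0.
Qed.

Lemma bo_sum (I : Type) (r : seq I) (p : pred I) (f : I -> nat -> R[i]) e :
  (forall i, p i -> bo (f i) e) -> bo (fun N => \sum_(i <- r | p i) f i N) e.
Proof.
move=> H; elim: r => [|i r IH].
  by apply: eq_bo (bo0 e) => N; rewrite big_nil.
apply: (@eq_bo (fun N => (if p i then f i N else 0) + \sum_(j <- r | p j) f j N) _ _).
  by move=> N; rewrite big_cons; case: ifP => // _; rewrite add0r.
by apply: boD IH; case: (boolP (p i)) => [/H|_] //; apply: bo0.
Qed.

Lemma lo_cst_eq0 (c : R[i]) : lo (fun=> c) 0 -> c = 0.
Proof.
move=> H; apply: Normc.eq0_normc; apply/eqP; rewrite eq_le normc_ge0 andbT.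
apply/ler_addgt0Pl => eps e0; have [N0 /(_ N0 (leqnn _))] := H _ e0.
by rewrite expr0z mulr1 addr0.
Qed.

Lemma horner_invE P (N : nat) :
  P.[N%:R^-1] = \sum_(G < size P) P`_G * (N%:R : R[i]) ^ (- G%:Z).
Proof.
rewrite horner_coef; apply: eq_bigr => G _; congr (_ * _).
by rewrite -exprnN exprVn.
Qed.

Lemma bo_poly P : bo (fun N => P.[N%:R^-1]) 0.
Proof.
apply: (@eq_bo (fun N => \sum_(G < size P) P`_G * (N%:R : R[i]) ^ (- G%:Z)) _ _).
  by move=> N; rewrite horner_invE.
apply: bo_sum => G _; apply: bo_cstM; apply: bo_le (bo_pow _).
by rewrite oppr_le0.
Qed.

(** Induction on the order: the constant term is the limit, hence zero, and dividing by X costs one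
    power of N. *)
Lemma lo_poly_coef P (m : nat) :
  lo (fun N => P.[N%:R^-1]) (- m%:Z) -> forall G, (G <= m)%N -> P`_G = 0.
Proof.
elim: m P => [|m IH] P H G.
  have HH : lo (fun=> P`_0) 0.
    apply: (@eq_lo (fun N => P.[N%:R^-1] -
         \sum_(1 <= G < size P) P`_G * (N%:R : R[i]) ^ (- G%:Z)) _ _).
      move=> N; case: (ltnP 0 (size P)) => sP; last first.
        move: sP; rewrite leqn0 size_poly_eq0 => /eqP->.
        by rewrite horner0 size_poly0 big_geq // coef0 subr0.
      rewrite horner_invE -(big_mkord xpredT (fun G => P`_G * (N%:R : R[i]) ^ (- G%:Z))).
      by rewrite big_ltn // oppr0 expr0z mulr1 addrK.
    apply: loB; first exact: H.

    apply: (@eq_lo (fun N => \sum_(G <- index_iota 1 (size P) | (0 < G)%N) P`_G * (N%:R : R[i]) ^ (- G%:Z)) _ _).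
      move=> N; rewrite [RHS]big_seq_cond [LHS]big_seq_cond; apply: eq_bigl => i.
      by rewrite mem_index_iota; case: (0 < i)%N; rewrite ?andbT ?andbF.
    apply: lo_sum => i i0; apply: lo_cstM; apply: lo_pow; lia.
  by rewrite leqn0 => /eqP ->; exact: lo_cst_eq0.
have P0 : P`_0 = 0.
  by apply: (IH P _ 0%N) => //; apply: lo_le H; lia.
have [Q PQ] : exists Q, P = Q * 'X.
  have : root P 0 by rewrite /root horner_coef0 P0.
  by move=> /factor_theorem[Q ->]; exists Q; rewrite subr0.
case: G => // G lG; rewrite PQ coefMX /=; apply: IH => //.
apply: (@lo_ext (fun N => P.[N%:R^-1] * N%:R ^ 1) _ _ 1).
  move=> N N0; rewrite PQ hornerM hornerX expr1z divfK //.
  by rewrite pnatr_eq0 -lt0n.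
by apply: lo_le (lo_bo_mul H (bo_pow 1)); lia.
Qed.

(** Expansions are carried by polynomials in 1/N with a separate leading exponent k, so that
    products of expansions are products of polynomials. Coefficients beyond the precision E are
    arbitrary ([AppP_coef_eq]). *)
Definition AppP u k E P :=
  lo (fun N => u N - N%:R ^ (- k) * P.[N%:R^-1]) (- E).

Lemma AppP_ext u v k E P N1 : (forall N, (N1 <= N)%N -> u N = v N) ->
  AppP u k E P -> AppP v k E P.
Proof. by move=> uv; apply: (@lo_ext _ _ _ N1) => N /uv ->. Qed.

Lemma AppP_add u v k E P Q : AppP u k E P -> AppP v k E Q ->
  AppP (fun N => u N + v N) k E (P + Q).
Proof.
move=> Hu Hv; apply: eq_lo (loD Hu Hv) => N.
by rewrite hornerD mulrDr opprD addrACA.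
Qed.

Lemma AppP_lo u k E : lo u (- E) -> AppP u k E 0.
Proof. by apply: eq_lo => N; rewrite horner0 mulr0 subr0. Qed.

Lemma AppP0 k E : AppP (fun=> 0) k E 0.
Proof. exact/AppP_lo/lo0. Qed.

Lemma AppP_sum (I : Type) (r : seq I) (p : pred I) (f : I -> nat -> R[i])
    (PP : I -> {poly R[i]}) k E :
  (forall i, p i -> AppP (f i) k E (PP i)) ->
  AppP (fun N => \sum_(i <- r | p i) f i N) k E (\sum_(i <- r | p i) PP i).
Proof.
move=> H; have := @lo_sum _ r p (fun i N => f i N - N%:R ^ (- k) * (PP i).[N%:R^-1]) _ H.
by apply: eq_lo => N; rewrite sumrB horner_sum mulr_sumr.
Qed.

Lemma AppP_bo u k x P : AppP u k (k - x) P -> 0 <= x -> bo u (x - k).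
Proof.
move=> H x0; apply: (@eq_bo (fun N => (u N - N%:R ^ (- k) * P.[N%:R^-1]) +
   N%:R ^ (- k) * P.[N%:R^-1]) _ _) => [N|]; first by rewrite subrK.
apply: boD; first by apply: bo_le (lo_bo H); lia.
by apply: bo_le (boM (bo_pow (- k)) (bo_poly P)); lia.
Qed.

(* The error exponents k + G0 - x compose additively in x >= 0. *)
Lemma AppP_mul u v k1 k2 (G0 x1 x2 : int) P Q : 0 <= G0 -> 0 <= x1 -> 0 <= x2 ->
  AppP u k1 (k1 + G0 - x1) P -> AppP v k2 (k2 + G0 - x2) Q ->
  AppP (fun N => u N * v N) (k1 + k2) (k1 + k2 + G0 - (x1 + x2)) (P * Q).
Proof.
move=> g0 h1 h2 Hu Hv.
have Bv : bo v (x2 - k2).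
  apply: (@AppP_bo v k2 x2 Q) => //; apply: lo_le Hv; lia.
have Bp : bo (fun N => N%:R ^ (- k1) * P.[N%:R^-1]) (- k1).
  by rewrite -[X in bo _ X]addr0; apply: boM (bo_pow _) (bo_poly _).
have L1 := lo_bo_mul Hu Bv; have L2 := bo_lo_mul Bp Hv.
apply: (@lo_ext (fun N => (u N - N%:R ^ (- k1) * P.[N%:R^-1]) * v N +
   N%:R ^ (- k1) * P.[N%:R^-1] * (v N - N%:R ^ (- k2) * Q.[N%:R^-1])) _ _ 1).
  move=> N N0; rewrite hornerM opprD natXC_add //; ring.
by apply: loD; [apply: lo_le L1 | apply: lo_le L2]; lia.
Qed.

Lemma AppP_le u k E E' P : E' <= E -> AppP u k E P -> AppP u k E' P.
Proof. by move=> EE; apply: lo_le; lia. Qed.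

(** Brings terms of different leading order to a common k: the surplus w moves into the
    polynomial. *)
Lemma AppP_shift u k (w : nat) E P : AppP u (k + w%:Z) E P -> AppP u k E (P * 'X^w).
Proof.
apply: (@lo_ext _ _ _ 1) => N N0; rewrite hornerM hornerXn opprD natXC_add //.
by rewrite -exprnN exprVn; congr (_ - _); rewrite -mulrA; congr (_ * _); exact: mulrC.
Qed.

Lemma AppP_poly k E P : AppP (fun N => N%:R ^ (- k) * P.[N%:R^-1]) k E P.
Proof. by apply: eq_lo (lo0 _) => N; rewrite subrr. Qed.

Lemma AppP_lo_coef u k (m : nat) P : lo u (- (k + m%:Z)) -> AppP u k (k + m%:Z) P ->
  forall G, (G <= m)%N -> P`_G = 0.
Proof.
move=> Hu H; apply: lo_poly_coef.
move: (bo_lo_mul (bo_pow k) (loB Hu H)) => L; apply: (@lo_le _ (k + - (k + m%:Z))); first lia.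
apply: (@lo_ext _ _ _ 1) L => N N0.
by rewrite opprB addrC subrK mulrA -natXC_add // subrr expr0z mul1r.
Qed.


Lemma AppP_coef_eq u k (m : int) P Q : (forall G : nat, G%:Z <= m -> P`_G = Q`_G) ->
  AppP u k (k + m) P -> AppP u k (k + m) Q.
Proof.
move=> PQ H.
have L : lo (fun N => N%:R ^ (- k) * (P - Q).[N%:R^-1]) (- (k + m)).
  apply: (@eq_lo (fun N => \sum_(G < size (P - Q)) (P - Q)`_G * (N%:R ^ (- k) * (N%:R : R[i]) ^ (- G%:Z)))).
    by move=> N; rewrite horner_invE mulr_sumr; apply: eq_bigr => G _; rewrite mulrCA.
  apply: lo_sum => G _; case: (lerP G%:Z m) => Gm.
    apply: eq_lo (lo0 _) => N.
    by rewrite coefB PQ // subrr mul0r.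
  apply: lo_cstM; apply: (@lo_ext (fun N => (N%:R : R[i]) ^ (- k - G%:Z)) _ _ 1).
    by move=> N N0; rewrite natXC_add.
  by apply: lo_pow; lia.
apply: eq_lo (loD H L) => N; rewrite hornerD hornerN; ring.
Qed.

(** The level m is an integer because it becomes negative once n exceeds g0 + n0: the sum is then
    empty and only decay is asserted. The bound [(absz m).+1] merely covers all G up to m. *)
Definition expd (n : nat) (m : int) u (F : nat -> R[i]) :=
  lo (remainder n u F (fun G => G%:Z <= m) (absz m).+1) (2 - m - n%:Z).

Lemma expdP n m u F (M : nat) : m < M%:Z ->
  expd n m u F <-> AppP u (n%:Z - 2) (n%:Z - 2 + m) (\poly_(G < M) F G).
Proof.
move=> mM; set P := \sum_(G < (absz m).+1 | G%:Z <= m) F G *: 'X^G.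
have PE (G : nat) : P`_G = if G%:Z <= m then F G else 0.
  rewrite /P coef_sum; case: ifP => Gm.
    have hG : (G < (absz m).+1)%N by lia.
    rewrite (bigD1 (Ordinal hG)) //= coefZ coefXn eqxx mulr1 big1 ?addr0 // => i /andP[_ iG].
    by rewrite coefZ coefXn; case: eqP => [e|_]; [case/eqP: iG; apply: val_inj|rewrite mulr0].
  rewrite big1 // => i im; rewrite coefZ coefXn; case: eqP => [e|_]; last by rewrite mulr0.
  by move: im; rewrite -e Gm.
have PM (G : nat) : G%:Z <= m -> P`_G = (\poly_(G < M) F G)`_G.
  by move=> Gm; rewrite PE Gm coef_poly; have -> : (G < M)%N by lia.
have -> : expd n m u F <-> AppP u (n%:Z - 2) (n%:Z - 2 + m) P.
  have e1 : - (n%:Z - 2 + m) = 2 - m - n%:Z by lia.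
  rewrite /expd /AppP e1 /remainder.
  have h N : (1 <= N)%N -> \sum_(G < (absz m).+1 | G%:Z <= m) (N%:R : R[i]) ^ (2 - G%:Z - n%:Z) * F G
     = N%:R ^ (- (n%:Z - 2)) * P.[N%:R^-1].
    move=> N0; rewrite /P horner_sum mulr_sumr; apply: eq_bigr => G _.
    have -> : 2 - G%:Z - n%:Z = - (n%:Z - 2) + - G%:Z by lia.
    rewrite natXC_add // hornerZ hornerXn -exprnN exprVn; ring.
  by split; apply: (@lo_ext _ _ _ 1) => N N0; rewrite h.
by split; apply: AppP_coef_eq => G Gm; rewrite PM.
Qed.

Lemma AppP_expd n m u P : AppP u (n%:Z - 2) (n%:Z - 2 + m) P ->
  expd n m u (fun G => P`_G).
Proof.
move=> H; apply/(@expdP n m u _ (absz m).+1); first lia.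
apply: AppP_coef_eq H => G Gm; rewrite coef_poly; case: ifP => //; lia.
Qed.

Lemma expd_ext n m u v F N1 : (forall N, (N1 <= N)%N -> u N = v N) ->
  expd n m u F -> expd n m v F.
Proof. by move=> uv; apply: (@lo_ext _ _ _ N1) => N /uv; rewrite /remainder => ->. Qed.

Lemma expd_eqF n m u F F' : (forall G : nat, G%:Z <= m -> F G = F' G) ->
  expd n m u F -> expd n m u F'.
Proof.
move=> FF; apply: eq_lo => N; rewrite /remainder; congr (_ - _).
by apply: eq_bigr => G Gm; rewrite FF.
Qed.

Lemma expd_le n m m' u F : m' <= m -> expd n m u F -> expd n m' u F.
Proof.
move=> mm; rewrite !(@expdP _ _ _ _ (maxn (absz m) (absz m')).+1); try lia.
by apply: AppP_le; lia.
Qed.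

Lemma expd_linear n m u v F F' (c : R[i]) : expd n m u F -> expd n m v F' ->
  expd n m (fun N => c * u N + v N) (fun G => c * F G + F' G).
Proof.
move=> Hu Hv; apply: eq_lo (loD (lo_cstM c Hu) Hv) => N; rewrite /remainder.
rewrite mulrBr addrACA -opprD mulr_sumr -big_split /=; congr (_ - _).
by apply: eq_bigr => G _; rewrite mulrDr mulrCA.
Qed.

Lemma expd_uniq n m u F F' : expd n m u F -> expd n m u F' ->
  forall G : nat, G%:Z <= m -> F G = F' G.
Proof.
move=> H H' G Gm; case: m Gm H H' => // m; rewrite lez_nat => Gm.
have mm : m%:Z < m.+1%:Z by lia.
move=> /(expdP _ _ _ mm) H /(expdP _ _ _ mm) H'.
have L := loB H H'.
have L0 : lo (fun N => N%:R ^ (- (n%:Z - 2)) * (\poly_(G < m.+1) F' G - \poly_(G < m.+1) F G).[N%:R^-1])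
    (- (n%:Z - 2 + m%:Z)).
  apply: eq_lo L => N; rewrite hornerD hornerN; ring.
have := AppP_lo_coef (L0) (AppP_poly _ _ _) Gm.
by rewrite coefB !coef_poly ltnS Gm => /subr0_eq.
Qed.

(** Reading the coefficient G at its own level G makes the value independent of the level to which
    the expansion is known; 0 is the default when there is none. *)
Definition expcoef (n : nat) u (G : nat) : R[i] :=
  xget 0 [set c | exists2 F, expd n G%:Z u F & F G = c]%classic.

Lemma expcoefE n m u F (G : nat) : expd n m u F -> G%:Z <= m -> expcoef n u G = F G.
Proof.
move=> H Gm; rewrite /expcoef; case: xgetP => [x _ [F' H' <-]|/(_ (F G)) []].
  exact: expd_uniq H' (expd_le Gm H) _ (lexx _).
by exists F => //; apply: expd_le H.
Qed.

Lemma expd_expcoef n m u F : expd n m u F -> expd n m u (expcoef n u).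
Proof. by move=> H; apply: expd_eqF (H) => G Gm; rewrite (expcoefE H). Qed.

(** A relation and not a function, since for (oo, oo) every nonnegative level is required. *)
Definition level (t : xtyp) (n : nat) (m : int) : Prop :=
  match t with
  | XFin G0 n0 => m = G0%:Z + Num.min 0 ((n0%:Z - n%:Z) *+ 2)
  | XInfN G0 => m = G0%:Z
  | XInf => 0 <= m
  end.

Lemma typ_leE G n t : typ_le G n t <-> exists2 m, level t n m & G%:Z <= m.
Proof.
case: t => [G0 n0|G0|] /=; last by split=> // _; exists G%:Z.
  split=> [/andP[a b]|[m -> h]]; last by apply/andP; split; lia.
  by exists (G0%:Z + Num.min 0 ((n0%:Z - n%:Z) *+ 2)) => //; lia.
by split=> [h|[m -> //]]; exists G0%:Z.
Qed.

Lemma remainder_widen n u F (gs gs' : pred nat) M M' (N : nat) :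
  (forall G, (G < M)%N && gs G = (G < M')%N && gs' G) ->
  remainder n u F gs M N = remainder n u F gs' M' N.
Proof.
move=> H; rewrite /remainder; congr (_ - _).
rewrite -!(big_mkord _ (fun G => (N%:R : R[i]) ^ (2 - G%:Z - n%:Z) * F G)) /=.
rewrite (big_nat_widen _ _ (maxn M M')) ?leq_maxl // [RHS](big_nat_widen _ _ (maxn M M')) ?leq_maxr //.
by apply: eq_bigl => G; have := H G; rewrite [gs _ && _]andbC [gs' _ && _]andbC.
Qed.

Lemma has_expansionE t n u F :
  has_expansion t n u F <-> forall m, level t n m -> expd n m u F.
Proof.
case: t => [G0 n0|G0|] /=.
- rewrite is_o_powE; set m := (_ + Num.min _ _).
  have h N : remainder n u F (fun G => typ_le G n (XFin G0 n0)) G0.+1 N =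
             remainder n u F (fun G => G%:Z <= m) (absz m).+1 N.
    by apply: remainder_widen => G; rewrite /m /=; lia.
  split=> [H _ ->|/(_ _ erefl)]; first by apply: eq_lo H.
  by apply: eq_lo => N; rewrite h.
- rewrite is_o_powE.
  have h N : remainder n u F predT G0.+1 N =
             remainder n u F (fun G => G%:Z <= G0%:Z) (absz G0%:Z).+1 N.
    by apply: remainder_widen => G /=; lia.
  split=> [H _ ->|/(_ _ erefl)]; first by apply: eq_lo H.
  by apply: eq_lo => N; rewrite h.
have h (K : nat) N : remainder n u F predT K.+1 N =
             remainder n u F (fun G => G%:Z <= K%:Z) (absz K%:Z).+1 N.
    by apply: remainder_widen => G /=; lia.
split=> [H [m|//] _|H K].
  by have /is_o_powE := H m; apply: eq_lo => N.
by apply/is_o_powE; have := H K%:Z isT; apply: eq_lo => N; rewrite h.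
Qed.

End Asymptotics.
(** * Partitions, convolutions and the genus inequality *)

Local Open Scope set_scope.

Section Partitions.
Variable d : nat.
Local Notation T := 'I_d.
Implicit Types (P Q X C : {set {set T}}) (a b g s : {perm T}) (i j k : T).

Definition isp P := finset.partition P [set: T].
(** Partitions are handled through this relation rather than through their sets of blocks; [isp_eq]
    converts back to equality. *)
Definition prel P i j := finset.pblock P i == finset.pblock P j.

Lemma prel_refl P i : prel P i i. Proof. exact: eqxx. Qed.
Lemma prel_sym P i j : prel P i j = prel P j i. Proof. exact: eq_sym. Qed.
Lemma prel_trans P i j k : prel P i j -> prel P j k -> prel P i k.
Proof. by rewrite /prel => /eqP->. Qed.

Lemma isp_mem P i : isp P -> i \in finset.pblock P i.
Proof. by case/and3P=> /eqP cP _ _; rewrite finset.mem_pblock cP inE. Qed.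

Lemma isp_pblock P i : isp P -> finset.pblock P i \in P.
Proof. by case/and3P=> /eqP cP _ _; rewrite finset.pblock_mem // cP inE. Qed.

Lemma in_pblock P i j : isp P -> (j \in finset.pblock P i) = prel P i j.
Proof.
move=> hP; apply/idP/eqP => [h|->]; last exact: isp_mem.
by case/and3P: hP => _ tP _; apply/esym/finset.same_pblock.
Qed.

Lemma isp_block P (B : {set T}) i : isp P -> B \in P -> i \in B -> finset.pblock P i = B.
Proof. by case/and3P=> _ tP _; apply: finset.def_pblock. Qed.

Lemma isp_ex P (B : {set T}) : isp P -> B \in P -> exists i, i \in B.
Proof.
case/and3P=> _ _ n0 BP; apply/finset.set0Pn; apply: contraNneq n0 => <-; exact: BP.
Qed.

Lemma part_leP P Q : isp P -> isp Q ->
  reflect (forall i j, prel P i j -> prel Q i j) (part_le P Q).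
Proof.
move=> hP hQ; apply: (iffP idP) => [/forallP H i j ij|H].
  have /implyP /(_ (isp_pblock i hP)) /existsP [B /andP[BQ sB]] := H (finset.pblock P i).
  have iB : i \in B by apply: (fintype.subsetP sB); apply: isp_mem.
  have jB : j \in B by apply: (fintype.subsetP sB); rewrite in_pblock.
  by rewrite /prel (isp_block hQ BQ iB) (isp_block hQ BQ jB).
apply/forallP => A; apply/implyP => AP; have [i iA] := isp_ex hP AP.
apply/existsP; exists (finset.pblock Q i); rewrite isp_pblock //=.
apply/fintype.subsetP => j jA; rewrite in_pblock //; apply: H.
by rewrite -in_pblock // (isp_block hP AP iA).
Qed.

Lemma part_le_refl P : isp P -> part_le P P.
Proof. by move=> hP; apply/part_leP. Qed.

Lemma part_le_trans Q P X : isp P -> isp Q -> isp X ->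
  part_le P Q -> part_le Q X -> part_le P X.
Proof.
move=> hP hQ hX /(part_leP hP hQ) h1 /(part_leP hQ hX) h2.
by apply/part_leP => // i j /h1 /h2.
Qed.

Lemma isp_eq P Q : isp P -> isp Q -> (forall i j, prel P i j = prel Q i j) -> P = Q.
Proof.
move=> hP hQ H.
have E i : finset.pblock P i = finset.pblock Q i.
  by apply/setP=> j; rewrite !in_pblock.
apply/setP=> B; apply/idP/idP => BP.
  have [i iB] := isp_ex hP BP; rewrite -(isp_block hP BP iB) E; exact: isp_pblock.
have [i iB] := isp_ex hQ BP; rewrite -(isp_block hQ BP iB) -E; exact: isp_pblock.
Qed.

Lemma part_le_anti P Q : isp P -> isp Q -> part_le P Q -> part_le Q P -> P = Q.
Proof.
move=> hP hQ /(part_leP hP hQ) h1 /(part_leP hQ hP) h2; apply: isp_eq => // i j.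
by apply/idP/idP; auto.
Qed.

Definition eqpart (r : rel T) := equivalence_partition r [set: T].

Lemma isp_eqpart (r : rel T) : equivalence_rel r -> isp (eqpart r).
Proof. by move=> er; apply: equivalence_partitionP => i j k _ _ _; apply: er. Qed.

Lemma prel_eqpart (r : rel T) i j : equivalence_rel r -> prel (eqpart r) i j = r i j.
Proof.
move=> er; by rewrite -in_pblock ?isp_eqpart // pblock_equivalence_partition ?inE.
Qed.

Definition jrel P Q := [rel x y : T | prel P x y || prel Q x y].

Lemma jrel_equiv P Q : equivalence_rel (connect (jrel P Q)).
Proof.
have sy : connect_sym (jrel P Q).
  by apply: fingraph.sym_connect_sym => x y /=; rewrite prel_sym [prel Q _ _]prel_sym.
move=> x y z; split; first exact: connect0.
move=> xy; apply/idP/idP => h.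
  by apply: connect_trans h; rewrite sy.
exact: connect_trans xy h.
Qed.

Lemma isp_join P Q : isp (part_join P Q).
Proof. exact: isp_eqpart (jrel_equiv P Q). Qed.

Lemma prel_join P Q i j : prel (part_join P Q) i j = connect (jrel P Q) i j.
Proof. exact: (@prel_eqpart _ i j (jrel_equiv P Q)). Qed.

Lemma join_ub1 P Q : isp P -> part_le P (part_join P Q).
Proof.
move=> hP; apply/part_leP; rewrite ?isp_join // => i j ij.
by rewrite prel_join; apply: connect1; rewrite /= ij.
Qed.

Lemma join_ub2 P Q : isp Q -> part_le Q (part_join P Q).
Proof.
move=> hP; apply/part_leP; rewrite ?isp_join // => i j ij.
by rewrite prel_join; apply: connect1; rewrite /= ij orbT.
Qed.

Lemma join_le P Q X : isp P -> isp Q -> isp X ->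
  part_le (part_join P Q) X = part_le P X && part_le Q X.
Proof.
move=> hP hQ hX; apply/idP/andP => [h|[/(part_leP hP hX) h1 /(part_leP hQ hX) h2]].
  by split; [apply: (part_le_trans hP (isp_join P Q) hX (join_ub1 Q hP) h)
            |apply: (part_le_trans hQ (isp_join P Q) hX (join_ub2 P hQ) h)].
apply/part_leP; rewrite ?isp_join // => i j; rewrite prel_join => /connectP[p].
elim: p i => [|k p IH] i /=; first by move=> _ ->; apply: prel_refl.
case/andP=> /orP[/h1|/h2] ik kp jp; exact: prel_trans ik (IH _ kp jp).
Qed.

Lemma isp_porbits s : isp (porbits s).
Proof.
rewrite /isp /finset.partition; apply/and3P; split.
- apply/eqP/setP => x; rewrite inE; apply/bigcupP; exists (porbit s x).
    by apply: imset_f.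
  exact: porbit_id.
- apply/finset.trivIsetP => A B /imsetP[x _ ->] /imsetP[y _ ->] ne.
  rewrite -setI_eq0; apply: contraNT ne => /finset.set0Pn[z /setIP[zx zy]].
  by move: zx zy; rewrite -!eq_porbit_mem => /eqP<- /eqP<-.
apply/imsetP => -[x _ e]; have := porbit_id s x; by rewrite -e inE.
Qed.

Lemma prel_porbits s i j : prel (porbits s) i j = (j \in porbit s i).
Proof.
rewrite -in_pblock ?isp_porbits //.
by rewrite (isp_block (isp_porbits s) (imset_f _ _) (porbit_id s i)) ?inE.
Qed.

Lemma porbits_leP s P : isp P ->
  reflect (forall i, prel P i (s i)) (part_le (porbits s) P).
Proof.
move=> hP; apply: (iffP (part_leP (isp_porbits s) hP)) => [H i|H i j].
  by apply: H; rewrite prel_porbits; have := mem_porbit s 1 i; rewrite expg1.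
rewrite prel_porbits => /porbitP[n ->]; elim: n => [|n IH].
  by rewrite expg0 perm1 prel_refl.
by apply: prel_trans IH _; rewrite expgSr permM.
Qed.

Lemma porbits_le1 P : isp P -> part_le (porbits 1%g) P.
Proof. by move=> hP; apply/porbits_leP => // i; rewrite perm1 prel_refl. Qed.

Lemma porbits_leM s g P : isp P -> part_le (porbits s) P -> part_le (porbits g) P ->
  part_le (porbits (s * g)%g) P.
Proof.
move=> hP /(porbits_leP _ hP) h1 /(porbits_leP _ hP) h2; apply/porbits_leP => // i.
by rewrite permM; apply: prel_trans (h1 i) (h2 _).
Qed.

Lemma porbits_leV s P : isp P -> part_le (porbits s^-1%g) P = part_le (porbits s) P.
Proof.
move=> hP; have h u : part_le (porbits u) P -> part_le (porbits u^-1%g) P.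
  move=> /(porbits_leP _ hP) h1; apply/porbits_leP => // i.
  by have := h1 (u^-1%g i); rewrite permKV prel_sym.
by apply/idP/idP => /h //; rewrite invgK.
Qed.

Definition ptop : {set {set T}} := [set [set: T]].

Lemma isp_top : (0 < d)%N -> isp ptop.
Proof.
move=> d0; apply/and3P; split; rewrite /ptop.
- by rewrite finset.cover1.
- exact: finset.trivIset1.
- rewrite inE eq_sym -cards_eq0 cardsT card_ord -lt0n //.
Qed.

Lemma le_top P : isp P -> part_le P ptop.
Proof.
move=> hP; apply/forallP => A; apply/implyP => _; apply/existsP.
by exists [set: T]; rewrite inE eqxx finset.subsetT.
Qed.

Definition okp P a := isp P && part_le (porbits a) P.

Lemma okp_join P Q a b : okp P a -> okp Q b -> okp (part_join P Q) (b * a)%g.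
Proof.
move=> /andP[hP aP] /andP[hQ bQ]; rewrite /okp isp_join /=; apply: porbits_leM.
- exact: isp_join.
- by apply: part_le_trans bQ (join_ub2 _ hQ); rewrite ?isp_porbits ?isp_join.
- by apply: part_le_trans aP (join_ub1 _ hP); rewrite ?isp_porbits ?isp_join.
Qed.

Section Hat.
Variable K : comNzRingType.
Implicit Types (f h : {set {set T}} -> {perm T} -> K) (F H : {perm T} -> K).

(* Summation over the partitions below [C] turns the convolution of functions of
   pairs (partition, permutation) into a product in the group algebra of the
   permutations below [C]. *)
Definition hat f C a := \sum_(P | okp P a && part_le P C) f P a.

(** No genus appears here: it will survive as the power of N in the values. The second permutation
    is [g * a^-1] because alpha o beta reads [b * a]. *)
Definition conv f h C g := \sum_(a : {perm T}) \sum_(P | okp P a)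
  \sum_(Q | okp Q (g * a^-1)%g && (part_join P Q == C)) f P a * h Q (g * a^-1)%g.

Definition gconv C F H g :=
  \sum_(a : {perm T} | part_le (porbits a) C) F a * H (g * a^-1)%g.

(** A join lies below C exactly when both partitions do, so the summation below C decouples the two
    factors. *)
Lemma hat_conv f h C g : isp C -> part_le (porbits g) C ->
  hat (conv f h) C g = gconv C (hat f C) (hat h C) g.
Proof.
move=> hC gC; rewrite /hat /conv /gconv.
rewrite exchange_big /=.
transitivity (\sum_a \sum_(P | okp P a && part_le P C)
   \sum_(Q | okp Q (g * a^-1)%g && part_le Q C) f P a * h Q (g * a^-1)%g).
  apply: eq_bigr => a _; rewrite exchange_big [RHS]big_mkcondr /=.
  apply: eq_bigr => P okP.
  rewrite (exchange_big_dep (fun Q => okp Q (g * a^-1)%g)) /=; last by move=> X Q _ /andP[].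
  case: (boolP (part_le P C)) => PC; last first.
    rewrite big1 // => Q okQ; rewrite big_pred0 // => X.
    apply/negP => /and3P[/andP[/andP[hX _] XC] _ /eqP e]; case/negP: PC; subst X.
    by move: XC; rewrite join_le //; [case/andP| case/andP: okP|case/andP: okQ].
  rewrite [RHS]big_mkcondr /=; apply: eq_bigr => Q okQ.
  have hP : isp P by case/andP: okP.
  have hQ : isp Q by case/andP: okQ.
  have e X : [&& okp X g && part_le X C, okp Q (g * a^-1)%g & part_join P Q == X]
     = (X == part_join P Q) && part_le Q C.
    apply/idP/idP => [/and3P[/andP[_ XC] _ /eqP e]|/andP[/eqP-> QC]].
      by rewrite -e eqxx /=; move: XC; rewrite -e join_le // => /andP[].
    rewrite eqxx okQ join_le // PC QC !andbT.
    by have := okp_join okP okQ; rewrite mulgVK.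
  rewrite (eq_bigl _ _ e); case: ifP => QC.
    by rewrite (big_pred1 (part_join P Q)) // => X; rewrite andbT.
  by rewrite big_pred0 // => X; rewrite andbF.
rewrite [RHS]big_mkcond /=; apply: eq_bigr => a _; case: ifP => aC.
  by rewrite big_distrl /=; apply: eq_bigr => P _; rewrite big_distrr.
rewrite big_pred0 // => P; apply/negP => /andP[/andP[hP aP] PC].
by case/negP: (negbT aC); apply: part_le_trans PC => //; exact: isp_porbits.
Qed.

Lemma gconvA C F H L g : isp C -> part_le (porbits g) C ->
  gconv C F (gconv C H L) g = gconv C (gconv C F H) L g.
Proof.
move=> hC gC; rewrite /gconv.
transitivity (\sum_(a | part_le (porbits a) C) \sum_(b | part_le (porbits b) C)
   F a * H (b * a^-1)%g * L (g * b^-1)%g).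
  apply: eq_bigr => a aC; rewrite big_distrr /=.
  rewrite (reindex_inj (mulIg a^-1%g)) /=; apply: eq_big => [b|b _].
    apply/idP/idP => h; last by apply: porbits_leM; rewrite ?porbits_leV.
    by have := porbits_leM hC h aC; rewrite mulgVK.
  by rewrite invMg invgK mulrA; congr (_ * _ * L _); rewrite mulgA mulgVK.
rewrite exchange_big /=; apply: eq_bigr => b bC; rewrite big_distrl /=.
by [].
Qed.

Lemma eq_gconv C F F' H H' g : isp C -> part_le (porbits g) C ->
  (forall a, part_le (porbits a) C -> F a = F' a) ->
  (forall a, part_le (porbits a) C -> H a = H' a) ->
  gconv C F H g = gconv C F' H' g.
Proof.
move=> hC gC FF HH; apply: eq_bigr => a aC; rewrite FF // HH //.
by apply: porbits_leM; rewrite ?porbits_leV.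
Qed.

Lemma gconvDl C F F' H g :
  gconv C (fun a => F a + F' a) H g = gconv C F H g + gconv C F' H g.
Proof. by rewrite /gconv -big_split; apply: eq_bigr => a _; rewrite mulrDl. Qed.

Lemma gconvDr C F H H' g :
  gconv C F (fun a => H a + H' a) g = gconv C F H g + gconv C F H' g.
Proof. by rewrite /gconv -big_split; apply: eq_bigr => a _; rewrite mulrDr. Qed.

Lemma gconv1l C H g : isp C -> gconv C (fun a => (a == 1%g)%:R) H g = H g.
Proof.
move=> hC; rewrite /gconv (bigD1 1%g) /= ?porbits_le1 // eqxx mul1r invg1 mulg1.
by rewrite big1 ?addr0 // => a /andP[_ /negbTE->]; rewrite mul0r.
Qed.

Lemma gconv1r C F g : isp C -> part_le (porbits g) C ->
  gconv C F (fun a => (a == 1%g)%:R) g = F g.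
Proof.
move=> hC gC; rewrite /gconv (bigD1 g) //= mulgV eqxx mulr1.
rewrite big1 ?addr0 // => a /andP[_ ag]; case: eqP; rewrite ?mulr0 // => /eqP.
by rewrite -eq_mulgV1 eq_sym (negbTE ag).
Qed.

(** A class function is central in the group algebra, whatever F is. *)
Lemma gconvC C F H g : isp C -> part_le (porbits g) C ->
  (forall a b, H (a * b)%g = H (b * a)%g) -> gconv C F H g = gconv C H F g.
Proof.
move=> hC gC HH; rewrite /gconv [RHS](reindex_inj (inj_comp (mulIg g) (@invg_inj _))) /=.
apply: eq_big => [a|a aC]; last by rewrite invMg invgK mulKVg mulrC HH.
apply/idP/idP => h; first by apply: porbits_leM; rewrite ?porbits_leV.
rewrite -porbits_leV // -[a^-1%g](mulgK g); apply: porbits_leM => //.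
by rewrite porbits_leV.
Qed.

End Hat.

(** Serves for Moebius inversion on the partition lattice: estimates on [hat f] pass to f by
    induction on the number of partitions below C. *)
Lemma part_lt_ind (S : {set {set T}} -> Prop) :
  (forall C, isp C -> (forall P, isp P -> part_le P C -> P != C -> S P) -> S C) ->
  forall C, isp C -> S C.
Proof.
move=> H C; move: {2}(#|[set P | isp P & part_le P C]|) (leqnn #|[set P | isp P & part_le P C]|) => n.
elim: n C => [|n IH] C hn hC.
  move: hn; rewrite leqn0 cards_eq0 => /eqP e.
  by have := finset.in_set0 C; rewrite -e inE hC part_le_refl.
apply: H => // P hP PC neq; apply: IH => //; rewrite -ltnS; apply: leq_trans hn.
apply: proper_card; apply/properP; split.
  by apply/fintype.subsetP => Q; rewrite !inE => /andP[hQ QP]; rewrite hQ (part_le_trans hQ hP hC).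
exists C; first by rewrite inE hC part_le_refl.
rewrite inE hC /=; apply: contra neq => CP; apply/eqP; exact: part_le_anti.
Qed.

Lemma pnorm_onT P a : isp P ->
  pnorm_on P a [set: T] = (d%:Z - #|P|%:Z) *+ 2 - (d%:Z - #|porbits a|%:Z).
Proof.
move=> hP; rewrite /pnorm_on cardsT card_ord; congr (_ *+ 2 - _).
  by congr (_ - Posz _); apply: eq_card => A; rewrite inE finset.subsetT andbT.
by congr (_ - Posz _); apply: eq_card => A; rewrite inE finset.subsetT andbT.
Qed.

End Partitions.
Local Close Scope set_scope.
Local Open Scope set_scope.

(** * The genus inequality through ranks of matrices *)

Section Genus.
Variable d : nat.
Local Notation T := 'I_d.
Implicit Types (P Q X : {set {set T}}) (a b g s : {perm T}) (i j k : T).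

Definition blk P (i : 'I_#|P|) : {set T} := enum_val i.

Lemma blkP P (i : 'I_#|P|) : blk i \in P. Proof. exact: enum_valP. Qed.

(** Its rows span the vectors that are constant on blocks: numbers of blocks become ranks and joins
    become intersections. *)
Definition pmx P : 'M[rat]_(#|P|, d) := \matrix_(i, j) (j \in blk i)%:R.

Lemma rank_pmx P : isp P -> \rank (pmx P) = #|P|.
Proof.
move=> hP; apply/eqP; change (row_free (pmx P)); apply/row_freeP.
have ex (i : 'I_#|P|) : {j : T | j \in blk i}.
  by apply: sigW; apply: isp_ex hP (blkP i).
exists (\matrix_(j, i) (j == sval (ex i))%:R); apply/matrixP => i i'; rewrite !mxE.
rewrite (bigD1 (sval (ex i'))) //= !mxE eqxx mulr1 big1 ?addr0 => [|j /negbTE ne]; last first.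
  by rewrite !mxE ne mulr0.
congr (nat_of_bool _)%:R; apply/idP/eqP => [h|->]; last exact: (svalP (ex i')).
apply: enum_val_inj; rewrite -!/(blk _) -(isp_block hP (blkP i) h).
exact: (isp_block hP (blkP i') (svalP (ex i'))).
Qed.

Lemma sub_pmx P (u : 'rV[rat]_d) : isp P ->
  reflect (forall i j, prel P i j -> u 0 i = u 0 j) (u <= pmx P)%MS.
Proof.
move=> hP; apply: (iffP idP) => [/submxP[v ->] i j ij|H].
  rewrite !mxE; apply: eq_bigr => k _; rewrite !mxE; congr (_ * (nat_of_bool _)%:R).
  have kP := blkP k; apply/idP/idP => h.
    by rewrite -(isp_block hP kP h) in_pblock.
  by rewrite -(isp_block hP kP h) in_pblock // prel_sym.
have ex (i : 'I_#|P|) : {j : T | j \in blk i}.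
  by apply: sigW; apply: isp_ex hP (blkP i).
apply/submxP; exists (\row_i u 0 (sval (ex i))); apply/rowP => j; rewrite !mxE.
have jP := isp_pblock j hP.
have [k0 k0E] : exists k0 : 'I_#|P|, blk k0 = finset.pblock P j.
  by exists (enum_rank_in jP (finset.pblock P j)); rewrite /blk enum_rankK_in.
have jk0 : j \in blk k0 by rewrite k0E isp_mem.
rewrite (bigD1 k0) //= mxE [pmx _ _ _]mxE jk0 mulr1 big1 ?addr0 => [|k ne]; last first.
  rewrite !mxE; case: (boolP (j \in blk k)) => h; last by rewrite mulr0.
  case/eqP: ne; apply: enum_val_inj; rewrite -!/(blk _) k0E.
  by rewrite (isp_block hP (blkP k) h).
apply: H; rewrite -in_pblock //.
by rewrite -k0E; exact: (svalP (ex k0)).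
Qed.

Lemma pmx_le P Q : isp P -> isp Q -> part_le P Q -> (pmx Q <= pmx P)%MS.
Proof.
move=> hP hQ /(part_leP hP hQ) PQ; apply/rV_subP => u /(sub_pmx _ hQ) H.
by apply/sub_pmx => // i j /PQ; apply: H.
Qed.

Lemma pmx_join P Q : isp P -> isp Q -> (pmx (part_join P Q) :=: pmx P :&: pmx Q)%MS.
Proof.
move=> hP hQ; have hJ := isp_join P Q.
apply/eqmxP; apply/andP; split.
  by rewrite sub_capmx (pmx_le hP hJ (join_ub1 Q hP)) (pmx_le hQ hJ (join_ub2 P hQ)).
apply/rV_subP => u; rewrite sub_capmx => /andP[/(sub_pmx _ hP) h1 /(sub_pmx _ hQ) h2].
apply/sub_pmx => // i j; rewrite prel_join => /connectP[p].
elim: p i => [|k p IH] i /=; first by move=> _ ->.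
by case/andP=> /orP[/h1|/h2] -> kp jp; apply: IH.
Qed.

(** Semimodularity of the partition lattice: it is the dimension formula for the row spaces of P and
    Q, whose sum lies in that of X. *)
Lemma card_join P Q X : isp P -> isp Q -> isp X -> part_le X P -> part_le X Q ->
  (#|P| + #|Q| <= #|part_join P Q| + #|X|)%N.
Proof.
move=> hP hQ hX XP XQ; have hJ := isp_join P Q.
rewrite -(rank_pmx hP) -(rank_pmx hQ) -(rank_pmx hJ) -(rank_pmx hX) (pmx_join hP hQ).
rewrite -mxrank_sum_cap addnC leq_add2l.
by apply: mxrankS; rewrite addsmx_sub (pmx_le hX hP XP) (pmx_le hX hQ XQ).
Qed.

Definition dmx s : 'M[rat]_d := 1%:M - perm_mx s.

Definition pfix s := kermx (dmx s).

Lemma sub_pfix s (u : 'rV[rat]_d) :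
  reflect (forall i, u 0 (s i) = u 0 i) (u <= pfix s)%MS.
Proof.
have E : (u *m dmx s = 0) <-> (forall i, u 0 (s i) = u 0 i).
  rewrite /dmx mulmxBr mulmx1; split=> [/eqP|H].
    rewrite subr_eq0 => /eqP e i.
    by rewrite {1}e -{1}[s]invgK -col_permE mxE permK.
  apply/eqP; rewrite subr_eq0 -[s]invgK -col_permE; apply/eqP/rowP => i; rewrite mxE.
  by rewrite -[LHS](f_equal (u 0) (permKV s i)) H.
by apply: (iffP sub_kermxP) => /E.
Qed.

Lemma pfixE s : (pfix s :=: pmx (porbits s))%MS.
Proof.
have hS := isp_porbits s.
apply/eqmxP/andP; split; apply/rV_subP => u.
  move=> /sub_pfix H; apply/sub_pmx => // i j; rewrite prel_porbits => /porbitP[n ->].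
  elim: n => [|n IH]; first by rewrite expg0 perm1.
  by rewrite expgSr permM H.
move=> /(sub_pmx _ hS) H; apply/sub_pfix => i; apply/esym/H.
by rewrite prel_porbits; have := mem_porbit s 1 i; rewrite expg1.
Qed.

Lemma rank_perm s : (\rank (dmx s) + #|porbits s| = d)%N.
Proof.
rewrite -(rank_pmx (isp_porbits s)) -pfixE /pfix mxrank_ker subnKC //.
exact: rank_leq_row.
Qed.

(** Orbits count the kernel of 1 - s, and 1 - ba = (1 - b) + b(1 - a) bounds the rank on the
    left. *)
Lemma porbits_triangle a b : (#|porbits a| + #|porbits b| <= d + #|porbits (b * a)%g|)%N.
Proof.
have ha := rank_perm a; have hb := rank_perm b; have hab := rank_perm (b * a)%g.
suff : (\rank (dmx (b * a)%g) <=
   \rank (dmx b) + \rank (dmx a))%N by lia.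
have -> : dmx (b * a)%g = dmx b + perm_mx b *m dmx a.
  by rewrite /dmx perm_mxM mulmxBr mulmx1 addrA subrK.
apply: leq_trans (mxrank_add _ _) _; rewrite leq_add2l; exact: mxrankM_maxr.
Qed.

(* Riemann-Hurwitz: [x - x b] embeds the vectors fixed by [b * a], modulo the
   common fixed vectors of [a] and [b], into the intersection of the ranges of
   [1 - a] and [1 - b]. *)
Lemma genus_ge0 a b : (#|porbits (b * a)%g| + #|porbits a| + #|porbits b|
   <= 2 * #|part_join (porbits a) (porbits b)| + d)%N.
Proof.
set A := dmx a; set B := dmx b.
have hJ := isp_join (porbits a) (porbits b).
set q := #|part_join _ _|.
have ha := rank_perm a; have hb := rank_perm b; rewrite -/A -/B in ha hb.
have h1 : (\rank (pfix (b * a)%g *m B) + \rank (pfix (b * a)%g :&: kermx B)%MS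
    = \rank (pfix (b * a)%g))%N by rewrite mxrank_mul_ker.
have h2 : (\rank (pfix (b * a)%g) = #|porbits (b * a)%g|)%N.
  by rewrite pfixE rank_pmx ?isp_porbits.
have Jq : forall M : 'M[rat]_d, (M <= pfix a)%MS -> (M <= pfix b)%MS -> (\rank M <= q)%N.
  move=> M Ma Mb; rewrite /q -rank_pmx // (pmx_join (isp_porbits a) (isp_porbits b)).
  by apply: mxrankS; rewrite sub_capmx -!pfixE Ma.
have h3 : (\rank (pfix (b * a)%g :&: kermx B)%MS <= q)%N.
  apply: Jq; last exact: capmxSr.
  apply/rV_subP => u; rewrite sub_capmx => /andP[/sub_pfix uba /sub_pfix ub].
  apply/sub_pfix => i; have := uba (b^-1%g i); rewrite permM permKV => ->.
  by rewrite -[in RHS](permKV b i) ub.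
have h4 : (pfix (b * a)%g *m B <= A :&: B)%MS.
  rewrite sub_capmx submxMl andbT.
  suff -> : pfix (b * a)%g *m B = (- pfix (b * a)%g *m perm_mx a^-1%g) *m A.
    exact: submxMl.
  rewrite /A /B /dmx -mulmxA !mulmxBr !mulmx1 mulNmx -perm_mxM mulVg perm_mx1 mulmx1.
  rewrite opprK [RHS]addrC; congr (_ + - _).
  have e : pfix (b * a)%g = pfix (b * a)%g *m perm_mx (b * a)%g.
    apply/eqP; rewrite -subr_eq0 -{1}[pfix _]mulmx1 -mulmxBr -/(dmx _); apply/eqP.
    exact: mulmx_ker.
  transitivity (pfix (b * a)%g *m perm_mx (b * a)%g *m perm_mx a^-1%g); last by rewrite -e.
  by rewrite -[RHS]mulmxA -perm_mxM mulgK.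
(* By transposition, a vector orthogonal to both ranges is fixed by a and by b, so the ranges
   together miss at most q dimensions. *)
have h5 : (d <= \rank (A + B)%MS + q)%N.
  have -> : \rank (A + B)%MS = \rank ((A + B)%MS^T) by rewrite mxrank_tr.
  have : (\rank (kermx (A + B)%MS^T) <= q)%N.
    have aux s (M : 'M[rat]_d) (u : 'rV[rat]_d) : (dmx s <= M)%MS ->
        u *m M^T = 0 -> (u <= pfix s)%MS.
      move=> /submxP[D e] uM; have : u *m (dmx s)^T = 0.
        by rewrite e trmx_mul mulmxA uM mul0mx.
      rewrite /dmx linearB /= tr_perm_mx trmx1 => us.
      have /sub_pfix H : (u <= pfix s^-1%g)%MS by apply/sub_kermxP.
      by apply/sub_pfix => i; have := H (s i); rewrite permK => ->.
    apply: Jq; apply/rV_subP => u /sub_kermxP uM; apply: (aux _ _ _ _ uM).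
      exact: addsmxSl.
    exact: addsmxSr.
  rewrite mxrank_ker; move: (rank_leq_row (A + B)%MS^T); lia.
have h6 := mxrank_sum_cap A B; have h7 := mxrankS h4.
rewrite -/A -/B; move: h1 h2 h3 h5 h6 h7 ha hb; lia.
Qed.

Definition pn P a : int := pnorm_on P a [set: T].

(** The genus inequality treats the join of the two orbit partitions; enlarging this join by P and
    then by Q is controlled by semimodularity, with the orbits of a, respectively b, as common lower
    bound. *)
Lemma pn_join P Q a b : okp P a -> okp Q b ->
  pn (part_join P Q) (b * a)%g <= pn P a + pn Q b.
Proof.
move=> /andP[hP aP] /andP[hQ bQ]; rewrite /pn (pnorm_onT _ hP) (pnorm_onT _ hQ) (pnorm_onT _ (isp_join P Q)).
have ha := isp_porbits a; have hb := isp_porbits b.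
pose X0 := part_join (porbits a) (porbits b).
have hX0 : isp X0 := isp_join _ _.
pose X1 := part_join X0 P; have hX1 : isp X1 := isp_join _ _.
pose X2 := part_join X1 Q; have hX2 : isp X2 := isp_join _ _.
have h1 : (#|X0| + #|P| <= #|X1| + #|porbits a|)%N.
  exact: card_join hX0 hP ha (join_ub1 _ ha) aP.
have bX1 : part_le (porbits b) X1.
  by apply: (part_le_trans hb hX0 hX1 (join_ub2 _ hb) (join_ub1 _ hX0)).
have h2 : (#|X1| + #|Q| <= #|X2| + #|porbits b|)%N by exact: card_join hX1 hQ hb bX1 bQ.
have hJ := isp_join P Q.
have PJ := join_ub1 Q hP; have QJ := join_ub2 P hQ.
have e : X2 = part_join P Q.
  apply: (part_le_anti hX2 hJ).
    rewrite (join_le hX1 hQ hJ) (join_le hX0 hP hJ) (join_le ha hb hJ) PJ QJ !andbT.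
    by rewrite (part_le_trans ha hP hJ aP PJ) (part_le_trans hb hQ hJ bQ QJ).
  rewrite (join_le hP hQ hX2) /X2 (join_ub2 _ hQ) andbT.
  exact: (part_le_trans hP hX1 hX2 (join_ub2 _ hP) (join_ub1 _ hX1)).
have h0 := genus_ge0 a b; rewrite -/X0 in h0; rewrite e in h2.
move: h0 h1 h2.
move: #|X0| #|X1| #|part_join P Q| #|P| #|Q| #|porbits a| #|porbits b| #|porbits (b * a)%g|.
by clear; lia.
Qed.

Lemma card_porbits_ge P a : okp P a -> (#|P| <= #|porbits a|)%N.
Proof.
case/andP=> hP aP; rewrite -(rank_pmx hP) -(rank_pmx (isp_porbits a)).
by apply: mxrankS; apply: pmx_le (isp_porbits a) hP aP.
Qed.

End Genus.
Local Close Scope set_scope.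
(** * Surfaced permutations and the Moebius function *)

Local Open Scope set_scope.
Section Restriction.
Variable d : nat.
Local Notation T := 'I_d.
Implicit Types (P Q X C : {set {set T}}) (a b g s : {perm T}) (i j k : T) (D B : {set T}).

(** The complement of D is filled with singletons instead of passing to a smaller ground set, so
    that the results on ['I_d] apply as they are; a fixed singleton has norm zero. *)
Definition resp D P : {set {set T}} :=
  [set B in P | B \subset D] :|: [set [set i] | i in ~: D].

Definition closed_in P D := forall i j, prel P i j -> i \in D -> j \in D.

Lemma closed_block P Q D : isp P -> isp Q -> part_le P Q -> D \in Q -> closed_in P D.
Proof.
move=> hP hQ /(part_leP hP hQ) PQ DQ i j /PQ ij iD.
by rewrite -(isp_block hQ DQ iD) in_pblock.
Qed.

Lemma closed_sub P D B i : isp P -> closed_in P D -> B \in P -> i \in B ->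
  (B \subset D) = (i \in D).
Proof.
move=> hP cD BP iB; apply/idP/idP => [/fintype.subsetP/(_ i iB) //|iD].
apply/fintype.subsetP => j jB; apply: cD iD.
by rewrite -in_pblock // (isp_block hP BP iB).
Qed.

Lemma resp_block P D i : isp P -> closed_in P D ->
  (if i \in D then finset.pblock P i else [set i]) \in resp D P.
Proof.
move=> hP cD; rewrite inE; case: ifP => iD.
  by rewrite inE isp_pblock //= (closed_sub hP cD (isp_pblock i hP) (isp_mem i hP)) iD.
by apply/orP; right; apply/imsetP; exists i; rewrite // inE iD.
Qed.

Lemma isp_resp P D : isp P -> closed_in P D -> isp (resp D P).
Proof.
move=> hP cD; apply/and3P; split.
- apply/eqP/setP => i; rewrite inE; apply/bigcupP.
  exists (if i \in D then finset.pblock P i else [set i]); first exact: resp_block.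
  by case: ifP; rewrite ?inE // isp_mem.
- have hh (A : {set T}) i : A \in resp D P -> i \in A ->
     A = if i \in D then finset.pblock P i else [set i].
    rewrite inE => /orP[|/imsetP[j]]; rewrite !inE.
      move=> /andP[AP AD] iA; rewrite (fintype.subsetP AD _ iA).
      by rewrite (isp_block hP AP iA).
    by move=> jD ->; rewrite inE => /eqP->; rewrite (negbTE jD).
  apply/finset.trivIsetP => A B AR BR ne; rewrite -setI_eq0; apply: contraNT ne.
  by move=> /finset.set0Pn[i /setIP[iA iB]]; rewrite (hh A i AR iA) (hh B i BR iB).
apply/negP; rewrite inE => /orP[|/imsetP[j _ e]].
  rewrite inE => /andP[h _]; by case: (isp_ex hP h) => i; rewrite inE.
by have := set11 j; rewrite -e inE.
Qed.

Lemma prel_resp P D i j : isp P -> closed_in P D ->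
  prel (resp D P) i j = (i == j) || [&& i \in D, j \in D & prel P i j].
Proof.
move=> hP cD; have hR := isp_resp hP cD.
rewrite -in_pblock // (isp_block hR (resp_block i hP cD)); last first.
  by case: ifP; rewrite ?inE // isp_mem.
case: ifP => iD; last by rewrite inE eq_sym orbF.
rewrite in_pblock //; case: (eqVneq i j) => [->|_] /=; first by rewrite prel_refl.
by apply/idP/andP => [h|[] //]; split => //; apply: cD h iD.
Qed.

Lemma card_resp P D : isp P ->
  #|resp D P| = (#|[set B in P | B \subset D]| + #|~: D|)%N.
Proof.
move=> hP; rewrite /resp cardsU [#|_ @: _|]card_imset; last exact: set1_inj.
rewrite (_ : _ :&: _ = finset.set0) ?cards0 ?subn0 //.
apply/setP => B; rewrite !inE; apply/negP => /andP[/andP[_ BD] h].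
case/imsetP: h => i; rewrite inE => iD e; case/negP: iD.
by apply: (fintype.subsetP BD); rewrite e inE.
Qed.

Definition stab D s := forall i, (s i \in D) = (i \in D).

Lemma restr_in D s i : stab D s -> i \in D -> restr_perm D s i = s i.
Proof.
move=> st iD; apply: restr_permE => //; apply/astabsP => j; exact: st.
Qed.

Lemma restr_out D s i : i \notin D -> restr_perm D s i = i.
Proof. by move=> iD; apply: (out_perm (restr_perm_on D s)). Qed.

Lemma restr_mul D s g i : stab D s -> stab D g ->
  restr_perm D (s * g)%g i = (restr_perm D s * restr_perm D g)%g i.
Proof.
move=> ss sg; rewrite permM; case: (boolP (i \in D)) => iD; last by rewrite !restr_out.
rewrite [restr_perm D s i]restr_in // !restr_in ?permM ?ss //.
by move=> k; rewrite permM sg ss.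
Qed.

Lemma stab_closed P D s : isp P -> closed_in P D -> part_le (porbits s) P -> stab D s.
Proof.
move=> hP cD /(porbits_leP _ hP) sP i; apply/idP/idP => h.
  by apply: cD h; rewrite prel_sym.
exact: cD h.
Qed.

Lemma porbits_restr D s : closed_in (porbits s) D ->
  porbits (restr_perm D s) = resp D (porbits s).
Proof.
move=> cD; have hS := isp_porbits s; have hR := isp_resp hS cD.
have st := stab_closed hS cD (part_le_refl hS).
apply: isp_eq => //; first exact: isp_porbits.
move=> i j; rewrite prel_resp // !prel_porbits.
have E n : i \in D -> (restr_perm D s ^+ n)%g i = (s ^+ n)%g i /\ (s ^+ n)%g i \in D.
  move=> iD; elim: n => [|n [IH1 IH2]]; first by rewrite !expg0 !perm1.
  by rewrite !expgSr !permM IH1 restr_in // st.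
apply/porbitP/orP => [[n ->]|[/eqP <-|/and3P[iD jD /porbitP[n jE]]]].
- case: (boolP (i \in D)) => iD.
    have [-> h] := E n iD; right; rewrite h /=; exact: mem_porbit.
  left; apply/eqP; elim: n => [|n IH]; first by rewrite expg0 perm1.
  by rewrite expgSr permM -IH restr_out.
- by exists 0%N; rewrite expg0 perm1.
by exists n; have [-> _] := E n iD.
Qed.

Lemma pn_restr P s D : okp P s -> closed_in P D ->
  okp (resp D P) (restr_perm D s) /\ pn (resp D P) (restr_perm D s) = pnorm_on P s D.
Proof.
move=> /andP[hP sP] cD; have hR := isp_resp hP cD; have hS := isp_porbits s.
have cS : closed_in (porbits s) D.
  by move=> i j /(part_leP hS hP sP); apply: cD.
have st := stab_closed hP cD sP.
split.
  rewrite /okp hR; apply/porbits_leP => // i; rewrite prel_resp //.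
  case: (boolP (i \in D)) => iD; last by rewrite restr_out // eqxx.
  by rewrite restr_in // st iD /= (porbits_leP _ hP sP) orbT.
rewrite /pn pnorm_onT // porbits_restr // !card_resp // /pnorm_on.
have := cardsC D; rewrite card_ord.
rewrite -/(cycles_in s D).
move: #|D| #|~: D| #|_| #|cycles_in s D| => n1 n2 n3 n4; clear; lia.
Qed.

(** Restriction to D leaves D as the only block where anything happens, so the global inequality
    [pn_join] localizes. *)
Lemma genus_block P Q a b D : okp P a -> okp Q b -> D \in part_join P Q ->
  pnorm_on [set D] (b * a)%g D <= pnorm_on P a D + pnorm_on Q b D.
Proof.
move=> okP okQ DJ; have /andP[hP aP] := okP; have /andP[hQ bQ] := okQ.
have hJ := isp_join P Q; have okJ := okp_join okP okQ; have /andP[_ gJ] := okJ.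
have cP := closed_block hP hJ (join_ub1 Q hP) DJ.
have cQ := closed_block hQ hJ (join_ub2 P hQ) DJ.
have cJ := closed_block hJ hJ (part_le_refl hJ) DJ.
have [oP <-] := pn_restr okP cP; have [oQ <-] := pn_restr okQ cQ.
apply: le_trans (pn_join oP oQ).
have [oJ e] := pn_restr okJ cJ.
have -> : pnorm_on [set D] (b * a)%g D = pnorm_on (part_join P Q) (b * a)%g D.
  rewrite /pnorm_on; congr ((_ - Posz _) *+ 2 - _).
  apply: eq_card => B; rewrite !inE; apply/andP/andP => [[/eqP-> //]|[BJ BD]].
  split=> //; have [i iB] := isp_ex hJ BJ.
  rewrite -(isp_block hJ BJ iB) (isp_block hJ DJ) //.
  exact: (fintype.subsetP BD).
(* It remains to see that restriction commutes with joins and products: a chain that starts in D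
   never leaves D, which is closed for both partitions. *)
rewrite -e le_eqVlt; apply/orP; left; apply/eqP; congr pn.
  have hRP := isp_resp hP cP; have hRQ := isp_resp hQ cQ.
  have hRJ := isp_resp hJ cJ; have hJR := isp_join (resp D P) (resp D Q).
  apply: (part_le_anti hRJ hJR); last first.
    rewrite join_le //; apply/andP; split; apply/part_leP => // i j; rewrite !prel_resp //.
      case: (i == j) => //= /and3P[-> ->] /= h; apply: (part_leP hP hJ) h; exact: join_ub1.
    case: (i == j) => //= /and3P[-> ->] /= h; apply: (part_leP hQ hJ) h; exact: join_ub2.
  apply/part_leP => // i j; rewrite prel_resp //.
  case: (eqVneq i j) => [->|_] /=; first by rewrite prel_refl.
  case/and3P=> iD _; rewrite prel_join => /connectP[p].
  elim: p i iD => [|k p IH] i iD /=; first by move=> _ ->; apply: prel_refl.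
  case/andP=> ik kp jp.
  have kD : k \in D by case/orP: ik => [/cP|/cQ]; apply.
  apply: prel_trans (IH k kD kp jp); rewrite prel_join; apply: connect1 => /=.
  by rewrite !prel_resp // iD kD /= -orbA; case/orP: ik => ->; rewrite !orbT.
apply/permP => i; rewrite restr_mul //.
  exact: stab_closed hQ cQ bQ.
exact: stab_closed hP cP aP.
Qed.

End Restriction.
Local Close Scope set_scope.
Local Open Scope set_scope.

(** * Additivity of the norm and finiteness of factorizations *)

Section BoundedSums.
Variables (d : nat).
Local Notation T := 'I_d.
Implicit Types (x y z : surfperm d) (s a b g : {perm T}) (P Q C : {set {set T}}) (D B : {set T}).

Lemma sum_sub_blocks (P Q : {set {set T}}) (V : zmodType) (F : {set T} -> V) :
  isp P -> isp Q -> part_le P Q ->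
  \sum_(C in Q) \sum_(A in P | A \subset C) F A = \sum_(A in P) F A.
Proof.
move=> hP hQ PQ; rewrite (exchange_big_dep (fun A => A \in P)) /=; last by move=> C A _ /andP[].
apply: eq_bigr => A AP; have [i iA] := isp_ex hP AP.
rewrite (big_pred1 (finset.pblock Q i)) // => C; apply/and3P/eqP => [[CQ _ AC]|->].
  by rewrite (isp_block hQ CQ (fintype.subsetP AC _ iA)).
split=> //; first exact: isp_pblock.
apply/fintype.subsetP => j jA; rewrite in_pblock //; apply: (part_leP hP hQ PQ).
by rewrite -in_pblock // (isp_block hP AP iA).
Qed.

Lemma sum_card_sub (P Q : {set {set T}}) :
  isp P -> isp Q -> part_le P Q ->
  \sum_(C in Q) #|[set A in P | A \subset C]|%:Z = #|P|%:Z.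
Proof.
move=> hP hQ PQ.
transitivity (\sum_(A in P) (1 : int)); last by rewrite sumr_const natz.
rewrite -(sum_sub_blocks _ hP hQ PQ); apply: eq_bigr => C _.
by rewrite -natz -sumr_const; apply: eq_bigl => A; rewrite inE.
Qed.

Lemma card_isp P : isp P -> \sum_(C in P) #|C|%:Z = d%:Z.
Proof.
move=> hP; have /card_partition e : finset.partition P [set: T] by [].
rewrite cardsT card_ord in e; transitivity (Posz (\sum_(A in P) #|A|)).
  by rewrite (big_morph Posz PoszD (erefl 0%:Z)).
by rewrite -e.
Qed.

Definition sn x : int := snorm_on x [set: T].

Lemma is_surfpermP x : is_surfperm x ->
  [/\ isp (spart x), part_le (porbits (sperm x)) (spart x), okp (spart x) (sperm x) &
      forall A, A \notin spart x -> sgen x A = 0%N].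
Proof.
case/and3P=> h1 h2 /forallP h3; split => //; first by rewrite /okp /isp h1.
by move=> A nA; apply/eqP; apply: (implyP (h3 A)).
Qed.

Lemma snE x : sn x = pn (spart x) (sperm x) + \sum_(A in spart x) (sgen x A)%:Z.
Proof. by rewrite /sn /snorm_on; congr (_ + _); apply: eq_bigl => A; rewrite finset.subsetT andbT. Qed.

Lemma pn_ge P a : okp P a -> (#|P| <= d)%N /\ 0 <= pn P a /\ (d%:Z - #|porbits a|%:Z <= pn P a).
Proof.
move=> okP; have /andP[hP _] := okP; have h := card_porbits_ge okP.
have ho : (#|porbits a| <= d)%N by have := rank_perm a; move: #|porbits a| => n; lia.
rewrite /pn pnorm_onT //; move: h ho; move: #|P| #|porbits a| => n m; clear; lia.
Qed.

Lemma sum_sgen_ge0 x : 0 <= \sum_(A in spart x) (sgen x A)%:Z.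
Proof. by apply: sumr_ge0. Qed.

Lemma sn_ge0 x : is_surfperm x -> 0 <= sn x.
Proof.
move=> /is_surfpermP[_ _ /pn_ge[_ [h _]] _]; rewrite snE; apply: addr_ge0 => //.
exact: sum_sgen_ge0.
Qed.

Lemma sgen_le_sn x A : is_surfperm x -> (sgen x A)%:Z <= sn x.
Proof.
move=> hx; have [_ _ /pn_ge[_ [h _]] h0] := is_surfpermP hx.
case: (boolP (A \in spart x)) => AP; last by rewrite (h0 _ AP) sn_ge0.
rewrite snE (bigD1 A) //=.
by rewrite addrCA lerDl addr_ge0 // sumr_ge0.
Qed.

Definition sprodb x y z := [&& spart z == part_join (spart x) (spart y),
  sperm z == (sperm y * sperm x)%g &
  [forall C in spart z, (sgen z C)%:Z ==
        snorm_on x C + snorm_on y C - pnorm_on [set C] (sperm z) C]].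

Lemma sprodP x y z : reflect (surf_prod x y z) (sprodb x y z).
Proof.
apply: (iffP and3P) => [[/eqP h1 /eqP h2 /forallP h3]|[h1 h2 h3]]; split=> //.
- by move=> C Cz; apply/eqP; apply: (implyP (h3 C)).
- exact/eqP.
- exact/eqP.
- by apply/forallP => C; apply/implyP => /h3 ->.
Qed.

Lemma sum_pnorm_on P s Q : isp P -> isp Q -> part_le P Q -> part_le (porbits s) Q ->
  \sum_(C in Q) pnorm_on P s C = pn P s.
Proof.
move=> hP hQ PQ sQ; rewrite /pn pnorm_onT // /pnorm_on sumrB.
have hs := isp_porbits s.
rewrite sumrMnl !sumrB card_isp // !sum_card_sub //.
Qed.

Lemma sum_snorm_on x Q : is_surfperm x -> isp Q -> part_le (spart x) Q ->
  \sum_(C in Q) snorm_on x C = sn x.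
Proof.
move=> /is_surfpermP[hP aP _ _] hQ PQ; rewrite /snorm_on big_split /= snE.
rewrite sum_pnorm_on ?sum_sub_blocks //.
exact: (part_le_trans (isp_porbits _) hP hQ aP PQ).
Qed.

Lemma pnorm_on_single C s D : isp C -> D \in C -> pnorm_on [set D] s D = pnorm_on C s D.
Proof.
move=> hC DC; rewrite /pnorm_on; congr ((_ - Posz _) *+ 2 - _).
apply: eq_card => B; rewrite !inE; apply/andP/andP => [[/eqP-> //]|[BC BD]].
split=> //; have [i iB] := isp_ex hC BC.
by rewrite -(isp_block hC BC iB) (isp_block hC DC) // (fintype.subsetP BD).
Qed.

(** Summing the equations that define the genus of z over its blocks turns blockwise norms into
    total norms. *)
Lemma sn_prod x y z : is_surfperm x -> is_surfperm y -> is_surfperm z ->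
  sprodb x y z -> sn z = sn x + sn y.
Proof.
move=> hx hy hz /sprodP[h1 h2 h3].
have [hP aP _ _] := is_surfpermP hx; have [hQ bQ _ _] := is_surfpermP hy.
have [hC cC _ _] := is_surfpermP hz.
have PC : part_le (spart x) (spart z) by rewrite h1; exact: join_ub1.
have QC : part_le (spart y) (spart z) by rewrite h1; exact: join_ub2.
rewrite snE (eq_bigr _ h3) sumrB big_split /= (sum_snorm_on hx hC PC) (sum_snorm_on hy hC QC).
rewrite (eq_bigr _ (fun D DC => pnorm_on_single (sperm z) hC DC)).
by rewrite (sum_pnorm_on hC hC (part_le_refl hC) cC) subrKC.
Qed.

(** Bounding the genera by M gives a finite type. All genera in a factor of z are at most the norm
    of z, so for M above this norm [sconv] becomes an ordinary finite sum ([sconvE]). *)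
Definition bsp (M : nat) : finType :=
  ({set {set T}} * {perm T} * {ffun {set T} -> 'I_M.+1})%type.

Definition bval M (u : bsp M) : surfperm d :=
  (u.1.1, u.1.2, [ffun A => val (u.2 A)]).

Lemma bval_inj M : injective (@bval M).
Proof.
move=> [[P a] f] [[P' a'] f'] [-> -> e]; congr (_, _, _).
by apply/ffunP => A; apply: val_inj; have := f_equal (fun h => fun_of_fin h A) e; rewrite !ffunE.
Qed.

Lemma bval_ex M x : (forall A, (sgen x A <= M)%N) -> exists u : bsp M, bval u = x.
Proof.
case: x => [[P a] f] H; exists (P, a, [ffun A => inord (f A)]).
congr (_, _, _); apply/ffunP => A; rewrite !ffunE /= inordK // ltnS; exact: (H A).
Qed.

Lemma sconvE (K : comNzRingType) (f h : surfperm d -> K) z (M : nat) : is_surfperm z -> sn z <= M%:Z ->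
  sconv f h z = \sum_(u : bsp M | is_surfperm (bval u))
     \sum_(v : bsp M | is_surfperm (bval v) && sprodb (bval u) (bval v) z)
        f (bval u) * h (bval v).
Proof.
move=> hz zM; rewrite /sconv.
pose r := [seq (bval p.1, bval p.2) | p <- enum [pred p : bsp M * bsp M |
   [&& is_surfperm (bval p.1), is_surfperm (bval p.2) & sprodb (bval p.1) (bval p.2) z]]].
have ur : uniq r.
  rewrite map_inj_uniq ?enum_uniq // => -[u v] [u' v'] [].
  by move=> e1 e2 e3 e4 e5 e6; congr (_, _); apply: bval_inj; rewrite /bval ?e1 ?e2 ?e3 ?e4 ?e5 ?e6.
have E : [set p : surfperm d * surfperm d | [/\ is_surfperm p.1, is_surfperm p.2 &
                     surf_prod p.1 p.2 z]]%classic = [set` r]%classic.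
  apply/seteqP; split=> [[x y] /= [hx hy hp]|[x y] /=].
    have e := sn_prod hx hy hz (introT (sprodP _ _ _) hp).
    have [u ux] : exists u : bsp M, bval u = x.
      apply: bval_ex => A; have := sgen_le_sn A hx; have := sn_ge0 hy; move: zM e; lia.
    have [v vy] : exists v : bsp M, bval v = y.
      apply: bval_ex => A; have := sgen_le_sn A hy; have := sn_ge0 hx; move: zM e; lia.
    apply/mapP; exists (u, v); last by rewrite /= ux vy.
    by rewrite mem_enum inE /= ux vy hx hy; apply/sprodP.
  by case/mapP=> -[u v]; rewrite mem_enum inE /= => /and3P[hu hv /sprodP hp] [-> ->].
rewrite E -(fsbig_seq _ _ ur) /=.
rewrite /r big_map big_enum_cond /= pair_big_dep /=.
by apply: eq_bigl => -[u v]; rewrite inE /= andbT.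
Qed.

End BoundedSums.
Local Close Scope set_scope.
Local Open Scope set_scope.

(** * Centrality and inversion of the zeta function *)

Section Moebius.
Variables (K : comNzRingType) (d : nat).
Local Notation T := 'I_d.
Implicit Types (x y z : surfperm d) (s a b g : {perm T}) (P Q C : {set {set T}}) (D B : {set T}).
Implicit Types f : surfperm d -> K.

Definition zet a : surfperm d := (porbits a, a, [ffun=> 0%N]).

Lemma szetaE x : szeta K x = (x == zet (sperm x))%:R.
Proof.
case: x => [[P a] g]; rewrite /szeta /zet /spart /sperm /sgen /=; congr (nat_of_bool _)%:R.
by rewrite [RHS]xpair_eqE xpair_eqE eqxx andbT.
Qed.

Lemma is_surfperm_zet a : is_surfperm (zet a).
Proof.
have h := isp_porbits a; apply/and3P; split=> //; first exact: part_le_refl.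
by apply/forallP => A; apply/implyP => _; rewrite /sgen ffunE.
Qed.

Lemma snorm_zet a D : snorm_on (zet a) D = #|D|%:Z - #|cycles_in a D|%:Z.
Proof.
rewrite /snorm_on /pnorm_on big1 => [|A _]; last by rewrite /sgen ffunE.
rewrite -/(cycles_in a D) addr0; move: #|D| #|cycles_in a D| => n m; clear; lia.
Qed.

Lemma sn_zet a : sn (zet a) = d%:Z - #|porbits a|%:Z.
Proof.
rewrite /sn snorm_zet cardsT card_ord; congr (_ - Posz _).
by apply: eq_card => A; rewrite inE finset.subsetT andbT.
Qed.

Lemma card_porbits_eq a : #|porbits a| = d -> a = 1%g.
Proof.
move=> e; have := rank_perm a; rewrite e => hr.
have /eqP : \rank (dmx a) = 0%N by move: hr; move: (\rank _) => n; lia.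
rewrite mxrank_eq0 /dmx subr_eq0 => /eqP h; apply/permP => i.
have := f_equal (fun M : 'M[rat]_d => M i (a i)) h; rewrite /= !mxE eqxx perm1.
by case: eqVneq.
Qed.

Lemma sn_zet_gt0 a : a != 1%g -> 1 <= sn (zet a).
Proof.
move=> a1; rewrite sn_zet; have h1 := rank_perm a.
have h2 : #|porbits a| <> d by move=> /card_porbits_eq; apply/eqP.
move: h1 h2; move: #|porbits a| => n; lia.
Qed.

(** Zeta is supported on the elements [zet a], and a is determined by the permutations of z and of
    the other factor: only one summation is left. *)
Lemma sconv_zeta_l f z (M : nat) : is_surfperm z -> sn z <= M%:Z ->
  sconv (@szeta K d) f z =
  \sum_(v : bsp d M | is_surfperm (bval v) &&
     sprodb (zet ((sperm (bval v))^-1 * sperm z)%g) (bval v) z) f (bval v).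
Proof.
move=> hz zM; rewrite (sconvE _ _ hz zM) (exchange_big_dep (fun v => is_surfperm (bval v))) /=; last first.
  by move=> u v _ /andP[].
rewrite [RHS]big_mkcondr /=; apply: eq_bigr => v hv.
set a := (_^-1 * _)%g; have [u0 u0E] : exists u : bsp d M, bval u = zet a.
  by apply: bval_ex => A; rewrite /sgen ffunE.
case: ifP => h.
  rewrite (bigD1 u0) /=; last by rewrite u0E is_surfperm_zet hv.
  rewrite u0E szetaE eqxx mul1r big1 ?addr0 // => u /andP[/andP[hu /andP[_ /and3P[_ /eqP e _]]] ne].
  rewrite szetaE; case: eqP => [e'|]; last by rewrite mul0r.
  case/eqP: ne; apply: (@bval_inj d M); rewrite u0E e'; congr zet.
  by rewrite /a e mulKg.
rewrite big1 // => u /andP[hu /andP[_ hp]]; rewrite szetaE; case: eqP => [e'|]; last by rewrite mul0r.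
move: h; rewrite (_ : zet a = bval u) ?hp // e'; congr zet.
by case/and3P: hp => _ /eqP e _; rewrite /a e mulKg.
Qed.

Lemma sconv_zeta_r f z (M : nat) : is_surfperm z -> sn z <= M%:Z ->
  sconv f (@szeta K d) z =
  \sum_(v : bsp d M | is_surfperm (bval v) &&
     sprodb (bval v) (zet (sperm z * (sperm (bval v))^-1)%g) z) f (bval v).
Proof.
move=> hz zM; rewrite (sconvE _ _ hz zM).
rewrite [RHS]big_mkcondr /=; apply: eq_bigr => v hv.
set a := (_ * _^-1)%g; have [u0 u0E] : exists u : bsp d M, bval u = zet a.
  by apply: bval_ex => A; rewrite /sgen ffunE.
case: ifP => h.
  rewrite (bigD1 u0) /=; last by rewrite u0E is_surfperm_zet.
  rewrite u0E szetaE eqxx mulr1 big1 ?addr0 // => u /andP[/andP[hu /and3P[_ /eqP e _]] ne].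
  rewrite szetaE; case: eqP => [e'|]; last by rewrite mulr0.
  case/eqP: ne; apply: (@bval_inj d M); rewrite u0E e'; congr zet.
  by rewrite /a e mulgK.
rewrite big1 // => u /andP[hu hp]; rewrite szetaE; case: eqP => [e'|]; last by rewrite mulr0.
move: h; rewrite (_ : zet a = bval u) ?hp // e'; congr zet.
by case/and3P: hp => _ /eqP e _; rewrite /a e mulgK.
Qed.

Lemma card_cycles_conj_le D s a : stab D s ->
  (#|cycles_in (s * a * s^-1)%g D| <= #|cycles_in a D|)%N.
Proof.
move=> st; rewrite -(card_imset _ (imset_inj (@perm_inj _ s))).
apply: subset_leq_card; apply/fintype.subsetP => B /imsetP[A]; rewrite inE => /andP[/imsetP[i _ ->] sub ->].
have e : [set s x | x in porbit (s * a * s^-1)%g i] = porbit a (s i).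
  have E n : s (((s * a * s^-1) ^+ n)%g i) = (a ^+ n)%g (s i).
    elim: n => [|n IH]; first by rewrite !expg0 !perm1.
    by rewrite !expgSr !permM permKV IH.
  apply/setP => j; apply/imsetP/porbitP => [[k /porbitP[n ->] ->]|[n ->]].
    by exists n; rewrite E.
  by exists (((s * a * s^-1) ^+ n)%g i); rewrite ?E // mem_porbit.
rewrite e inE; apply/andP; split; first by apply: imset_f.
rewrite -e; apply/fintype.subsetP => j /imsetP[k /(fintype.subsetP sub) kD ->].
by rewrite st.
Qed.

Lemma card_cycles_conj D s a : stab D s ->
  #|cycles_in (s * a * s^-1)%g D| = #|cycles_in a D|.
Proof.
move=> st; apply/eqP; rewrite eqn_leq card_cycles_conj_le //=.
have st' : stab D s^-1%g by move=> i; rewrite -(st (s^-1%g i)) permKV.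
have := @card_cycles_conj_le D s^-1%g (s * a * s^-1)%g st'.
by rewrite invgK !mulgA mulVg mul1g mulgVK.
Qed.

(** Moving the [zet] factor to the other side conjugates its permutation by that of y, which stays
    inside each block of z and so preserves the number of cycles there. Hence zeta is central. *)
Lemma sprodb_zet_comm y z : is_surfperm y -> is_surfperm z ->
  sprodb (zet ((sperm y)^-1 * sperm z)%g) y z =
  sprodb y (zet (sperm z * (sperm y)^-1)%g) z.
Proof.
move=> hy hz; set s := sperm y; set a := (_^-1 * _)%g; set a' := (_ * _^-1)%g.
have [hP bP _ _] := is_surfpermP hy; have [hC cC _ _] := is_surfpermP hz.
have aE : a' = (s * a * s^-1)%g by rewrite /a mulKVg.
have aE' : a = (s^-1 * a' * s)%g by rewrite aE !mulgA mulVg mul1g mulgVK.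
have ha := isp_porbits a; have ha' := isp_porbits a'.
have hJ := isp_join (porbits a) (spart y); have hJ' := isp_join (spart y) (porbits a').
have sJ := part_le_trans (isp_porbits s) hP hJ bP (join_ub2 _ hP).
have sJ' := part_le_trans (isp_porbits s) hP hJ' bP (join_ub1 _ hP).
have J : part_join (porbits a) (spart y) = part_join (spart y) (porbits a').
  apply: (part_le_anti hJ hJ').
    rewrite (join_le ha hP hJ') (join_ub1 _ hP) andbT aE'.
    apply: (porbits_leM hJ' _ sJ'); apply: (porbits_leM hJ' _ (join_ub2 _ ha')).
    rewrite (porbits_leV s hJ'); exact: sJ'.
  rewrite (join_le hP ha' hJ) (join_ub2 _ hP) /= aE.
  apply: (porbits_leM hJ (porbits_leM hJ sJ (join_ub1 _ ha))).
  rewrite (porbits_leV s hJ); exact: sJ.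
rewrite /sprodb -!/(spart (zet _)) {1 5}/spart /= J; case: (spart z =P _) => //= zJ.
rewrite /sperm /= -/(sperm y) -/s -/(sperm z) /a /a' mulKVg mulgVK eqxx /=.
apply: eq_forallb_in => D DJ; rewrite -/a -/a'.
rewrite !snorm_zet [snorm_on y D + _]addrC; congr (_ == _ - (Posz _) + _ - _).
rewrite aE card_cycles_conj //; move=> i.
rewrite zJ in DJ; have cD := closed_block hJ' hJ' (part_le_refl hJ') DJ.
exact: (stab_closed hJ' cD sJ').
Qed.

Lemma sconv_zetaC f z : is_surfperm z -> sconv (@szeta K d) f z = sconv f (@szeta K d) z.
Proof.
move=> hz; have zM : sn z <= (absz (sn z))%:Z by have := sn_ge0 hz; lia.
rewrite (sconv_zeta_l f hz zM) (sconv_zeta_r f hz zM); apply: eq_bigl => v.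
by case: (boolP (is_surfperm (bval v))) => //= hv; rewrite sprodb_zet_comm.
Qed.

Lemma porbit1 (i : T) : porbit (1%g : {perm T}) i = [set i].
Proof.
apply/setP => j; rewrite inE; apply/porbitP/eqP => [[n ->]|->].
  by rewrite expg1n perm1.
by exists 0%N; rewrite expg0 perm1.
Qed.

Lemma sprodb_1 y z : is_surfperm y -> is_surfperm z -> sprodb (zet 1%g) y z = (y == z).
Proof.
move=> hy hz; have [hP bP _ y0] := is_surfpermP hy; have [hC cC _ z0] := is_surfpermP hz.
have h1 := isp_porbits (1%g : {perm T}).
have J : part_join (porbits (1%g : {perm T})) (spart y) = spart y.
  apply: (part_le_anti (isp_join _ _) hP).
    by rewrite (join_le h1 hP hP) porbits_le1 // part_le_refl.
  exact: join_ub2.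
have n1 D : snorm_on (zet 1%g) D = 0.
  rewrite snorm_zet; have -> : cycles_in (1%g : {perm T}) D = [set [set i] | i in D].
    apply/setP => B; rewrite inE; apply/andP/imsetP => [[/imsetP[i _ ->]]|[i iD ->]].
      by rewrite porbit1 finset.sub1set => iD; exists i.
    split; last by rewrite finset.sub1set.
    by rewrite -porbit1; apply: imset_f.
  by rewrite card_imset ?subrr //; exact: set1_inj.
have nE D : D \in spart y -> snorm_on y D - pnorm_on [set D] (sperm y) D = (sgen y D)%:Z.
  move=> Dy; rewrite /snorm_on (pnorm_on_single _ hP Dy) addrAC subrr add0r.
  rewrite (big_pred1 D) // => A; apply/andP/eqP => [[Ay AD]|-> //].
  by have [i iA] := isp_ex hP Ay; rewrite -(isp_block hP Ay iA) (isp_block hP Dy) // (fintype.subsetP AD).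
apply/idP/eqP => [/and3P[/eqP e1 /eqP e2 /forallP e3]|<-].
  have {}e1 : spart z = spart y by rewrite -[RHS]J; exact: e1.
  have {}e2 : sperm z = sperm y by rewrite e2; exact: mulg1.
  have e : sgen y = sgen z.
    apply/ffunP => D; case: (boolP (D \in spart y)) => Dy; last first.
      by rewrite (y0 _ Dy) (z0 D) // e1.
    have := implyP (e3 D); rewrite e1 => /(_ Dy) /eqP.
    by rewrite n1 add0r e2 nE // => -[->].
  by case: (y) (z) e1 e2 e => [[? ?] ?] [[? ?] ?]; rewrite /spart /sperm /sgen /= => -> -> ->.
apply/and3P; split; rewrite ?J //.
  by apply/eqP; exact: (esym (mulg1 _)).
by apply/forallP => D; apply/implyP => Dy; rewrite n1 add0r nE.
Qed.

(** Recursion for a right inverse of zeta. The terms subtracted have strictly smaller norm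
    ([sn_lt]), so n is only fuel: all values of n above the norm agree. *)
Fixpoint rinv n z : K :=
  if n is m.+1 then
    sunit K z - \sum_(v : bsp d (absz (sn z)) | [&& is_surfperm (bval v),
     sprodb (zet ((sperm (bval v))^-1 * sperm z)%g) (bval v) z & sperm (bval v) != sperm z])
      rinv m (bval v)
  else 0.

Lemma sn_lt y z : is_surfperm y -> is_surfperm z -> sperm y != sperm z ->
  sprodb (zet ((sperm y)^-1 * sperm z)%g) y z -> sn y < sn z.
Proof.
move=> hy hz ne /(sn_prod (is_surfperm_zet _) hy hz) ->.
have : 1 <= sn (zet ((sperm y)^-1 * sperm z)%g).
  apply: sn_zet_gt0; apply: contra ne => /eqP e.
  by rewrite -[sperm z](mulKVg (sperm y)) e mulg1.
lia.
Qed.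

Lemma rinv_stable n n' z : is_surfperm z -> sn z < n%:Z -> sn z < n'%:Z -> rinv n z = rinv n' z.
Proof.
elim: n n' z => [|n IH] [|n'] z hz zn zn'; try by have := sn_ge0 hz; lia.
rewrite /=; congr (_ - _); apply: eq_bigr => v /and3P[hv hp ne].
have := sn_lt hv hz ne hp; move=> h; apply: IH => //; lia.
Qed.

Lemma smobius_exists : exists m : surfperm d -> K, is_sinv m (@szeta K d).
Proof.
pose r z := rinv (absz (sn z)).+1 z; exists r => z hz.
(* By centrality the two one-sided identities are the same. *)
rewrite -sconv_zetaC //; suff h : sconv (@szeta K d) r z = sunit K z by [].
have zM : sn z <= (absz (sn z))%:Z by have := sn_ge0 hz; lia.
rewrite (sconv_zeta_l r hz zM) (bigID (fun v : bsp d _ => sperm (bval v) == sperm z)) /=.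
have [u0 u0E] : exists u : bsp d (absz (sn z)), bval u = z.
  by apply: bval_ex => A; have := sgen_le_sn A hz; have := sn_ge0 hz; lia.
rewrite (big_pred1 u0) => [|v]; last first.
  apply/idP/eqP => [/andP[/andP[hv hp] /eqP e]|->].
    apply: (@bval_inj d _); rewrite u0E; apply/eqP.
    by move: hp; rewrite e mulVg sprodb_1.
  by rewrite u0E hz eqxx mulVg sprodb_1 // eqxx.
rewrite u0E {1}/r /= -addrA [X in _ + X](_ : _ = 0) ?addr0 //.
rewrite addrC; apply/eqP; rewrite subr_eq0; apply/eqP; apply: eq_big => [v|v /andP[/andP[hv hp] ne]].
  by rewrite andbA.
have h := sn_lt hv hz ne hp; apply: rinv_stable => //; have := sn_ge0 hv; lia.
Qed.

Lemma smobiusP : is_sinv (@smobius K d) (@szeta K d).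
Proof.
rewrite /smobius; have [m hm] := smobius_exists.
by case: xgetP => [x _ //|/(_ m)].
Qed.

End Moebius.
Local Close Scope set_scope.
Local Open Scope set_scope.

(** * Powers of 1/N in place of the genus *)

Section Evaluation.
Variables (R : realType) (d : nat).
Local Notation T := 'I_d.
Implicit Types (x y z : surfperm d) (s a b g : {perm T}) (P Q C : {set {set T}}) (D B : {set T}).
Implicit Types f h : surfperm d -> R[i].

(** The absolute value changes nothing, as the integer is nonnegative by [genus_block]; hence any
    two surfaced permutations have exactly one product. *)
Definition smul x y : surfperm d :=
  (part_join (spart x) (spart y), (sperm y * sperm x)%g,
   [ffun C => if C \in part_join (spart x) (spart y) then
      absz (snorm_on x C + snorm_on y C - pnorm_on [set C] (sperm y * sperm x)%g C)%R
      else 0%N]).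

Lemma snorm_smul x y (C : {set T}) : is_surfperm x -> is_surfperm y -> C \in part_join (spart x) (spart y) ->
  0 <= snorm_on x C + snorm_on y C - pnorm_on [set C] (sperm y * sperm x)%g C.
Proof.
move=> /is_surfpermP[_ _ okx _] /is_surfpermP[_ _ oky _] Cj.
rewrite subr_ge0; apply: le_trans (genus_block okx oky Cj) _.
by apply: lerD; rewrite /snorm_on lerDl sumr_ge0.
Qed.

Lemma is_surfperm_smul x y : is_surfperm x -> is_surfperm y -> is_surfperm (smul x y).
Proof.
move=> hx hy; have [_ _ okx _] := is_surfpermP hx; have [_ _ oky _] := is_surfpermP hy.
have /andP[h1 h2] := okp_join okx oky.
apply/and3P; split=> //; apply/forallP => A; apply/implyP => nA.
by rewrite /sgen /= ffunE (negbTE nA).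
Qed.

Lemma sprodb_smul x y z : is_surfperm x -> is_surfperm y -> is_surfperm z ->
  sprodb x y z = (z == smul x y).
Proof.
move=> hx hy hz; apply/idP/eqP => [/sprodP[h1 h2 h3]|->].
  have [_ _ _ z0] := is_surfpermP hz.
  have e : sgen z = sgen (smul x y).
    apply/ffunP => C; rewrite /sgen /= ffunE -/(sgen z) -h1.
    case: ifP => Cz; last by rewrite z0 // Cz.
    by apply/eqP; rewrite -eqz_nat (h3 _ Cz) -h2 gez0_abs // h2 snorm_smul // -h1.
  by case: z h1 h2 e {h3 hz z0} => [[Pz az] gz] /=; rewrite /spart /sperm /sgen /= => -> -> ->.
apply/sprodP; split=> // C Cz; rewrite /sgen /= ffunE ifT //.
by rewrite gez0_abs // snorm_smul.
Qed.

(* Truncated generating function of [f] in 1/N, graded by the norm. The norm is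
   additive along factorizations, so [evN] turns [sconv] into [conv] up to higher
   order terms. *)
Definition evN (M : nat) f (N : nat) P a : R[i] :=
  \sum_(u : bsp d M | [&& is_surfperm (bval u), spart (bval u) == P & sperm (bval u) == a])
     N%:R ^ (- sn (bval u)) * f (bval u).

Lemma conv_evN (M : nat) f h (N : nat) C g :
  conv (evN M f N) (evN M h N) C g =
  \sum_(u : bsp d M | is_surfperm (bval u)) \sum_(v : bsp d M | is_surfperm (bval v) &&
     ((part_join (spart (bval u)) (spart (bval v)) == C) &&
      ((sperm (bval v) * sperm (bval u))%g == g)))
    (N%:R ^ (- sn (bval u)) * f (bval u)) * (N%:R ^ (- sn (bval v)) * h (bval v)).
Proof.
rewrite /conv /evN.
transitivity (\sum_(a : {perm T}) \sum_(P | okp P a)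
  \sum_(u : bsp d M | is_surfperm (bval u) && ((spart (bval u), sperm (bval u)) == (P, a)))
   \sum_(Q | okp Q (g * a^-1)%g && (part_join P Q == C))
     \sum_(v : bsp d M | is_surfperm (bval v) && ((spart (bval v), sperm (bval v)) == (Q, (g * a^-1)%g)))
       (N%:R ^ (- sn (bval u)) * f (bval u)) * (N%:R ^ (- sn (bval v)) * h (bval v))).
  apply: eq_bigr => a _; apply: eq_bigr => P _; rewrite [RHS]exchange_big /=; apply: eq_bigr => Q _.
  by rewrite big_distrl /=; apply: eq_bigr => u _; rewrite big_distrr.
rewrite pair_big_dep /=.
rewrite (exchange_big_dep (fun u : bsp d M => is_surfperm (bval u))) /=; last by move=> i u _ /andP[].
apply: eq_bigr => u hu; have [_ _ oku _] := is_surfpermP hu.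
rewrite (big_pred1 (sperm (bval u), spart (bval u))) => [|[a P]]; last first.
  rewrite hu /= -[RHS]andbT; apply/andP/andP => [[okP /eqP[-> ->]]//|[/eqP[-> ->] _]].
  by split.
rewrite /= (exchange_big_dep (fun v : bsp d M => is_surfperm (bval v))) /=; last by move=> i v _ /andP[].
rewrite [RHS]big_mkcondr /=; apply: eq_bigr => v hv; have [_ _ okv _] := is_surfpermP hv.
case: ifP => [/andP[/eqP hj /eqP hm]|hne].
  rewrite (big_pred1 (spart (bval v))) => // Q; rewrite hv /=.
  apply/andP/eqP => [[_ /eqP[-> _]]//|->].
  by rewrite hj eqxx andbT -hm mulgK okv.
rewrite big_pred0 // => Q; apply/negP => /andP[/andP[_ jC] /andP[_ /eqP[eQ es]]].
by move: hne; rewrite eQ jC es mulgVK eqxx.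
Qed.

(** Pairs of total norm at most M are regrouped by their product. The second sum is the truncation
    error: [evN] bounds the genera of each factor separately and not the total norm. *)
Lemma conv_evN_sconv (M : nat) f h (N : nat) C g : (0 < N)%N ->
  conv (evN M f N) (evN M h N) C g =
  \sum_(w : bsp d M | [&& is_surfperm (bval w), spart (bval w) == C, sperm (bval w) == g
        & sn (bval w) <= M%:Z]) N%:R ^ (- sn (bval w)) * sconv f h (bval w) +
  \sum_(u : bsp d M | is_surfperm (bval u)) \sum_(v : bsp d M | is_surfperm (bval v) &&
     [&& part_join (spart (bval u)) (spart (bval v)) == C,
      (sperm (bval v) * sperm (bval u))%g == g & M%:Z < sn (bval u) + sn (bval v)])
    N%:R ^ (- (sn (bval u) + sn (bval v))) * (f (bval u) * h (bval v)).
Proof.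
move=> N0; rewrite conv_evN.
have E u v : (N%:R ^ (- sn (bval u)) * f (bval u)) * (N%:R ^ (- sn (bval v)) * h (bval v)) =
   (N%:R : R[i]) ^ (- (sn (@bval d M u) + sn (@bval d M v))) * (f (bval u) * h (bval v)).
  by rewrite [LHS]mulrACA (opprD (sn (bval u)) (sn (bval v))) natXC_add.
under eq_bigr => u hu do under eq_bigr => v hv do rewrite E.
transitivity (\sum_(u : bsp d M | is_surfperm (bval u)) (
  \sum_(v : bsp d M | is_surfperm (bval v) &&
     [&& part_join (spart (bval u)) (spart (bval v)) == C,
      (sperm (bval v) * sperm (bval u))%g == g & sn (bval u) + sn (bval v) <= M%:Z])
    N%:R ^ (- (sn (bval u) + sn (bval v))) * (f (bval u) * h (bval v)) +
  \sum_(v : bsp d M | is_surfperm (bval v) &&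
     [&& part_join (spart (bval u)) (spart (bval v)) == C,
      (sperm (bval v) * sperm (bval u))%g == g & M%:Z < sn (bval u) + sn (bval v)])
    N%:R ^ (- (sn (bval u) + sn (bval v))) * (f (bval u) * h (bval v)))).
  apply: eq_bigr => u hu; rewrite (bigID (fun v : bsp d M => sn (bval u) + sn (bval v) <= M%:Z)) /=.
  by congr (_ + _); apply: eq_bigl => v; rewrite -?ltNge -!andbA.
rewrite big_split /=; congr (_ + _).
transitivity (\sum_(w : bsp d M | [&& is_surfperm (bval w), spart (bval w) == C, sperm (bval w) == g
        & sn (bval w) <= M%:Z]) \sum_(u : bsp d M | is_surfperm (bval u))
     \sum_(v : bsp d M | is_surfperm (bval v) && sprodb (bval u) (bval v) (bval w))
    N%:R ^ (- (sn (bval u) + sn (bval v))) * (f (bval u) * h (bval v))); last first.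
  apply: eq_bigr => w /and4P[hw _ _ wM]; rewrite (sconvE f h hw wM) big_distrr /=.
  apply: eq_bigr => u hu; rewrite big_distrr /=; apply: eq_bigr => v /andP[hv hp].
  by rewrite (sn_prod hu hv hw hp).
rewrite [RHS]exchange_big /=; apply: eq_bigr => u hu.
rewrite (exchange_big_dep (fun v : bsp d M => is_surfperm (bval v))) /=; last by move=> i v _ /andP[].
rewrite big_mkcondr /=; apply: eq_bigr => v hv.
have hm := is_surfperm_smul hu hv.
have hs : sprodb (bval u) (bval v) (smul (bval u) (bval v)) by rewrite sprodb_smul.
have sE := sn_prod hu hv hm hs.
case: ifP => [/and3P[/eqP jC /eqP mg le]|hne].
  have [w0 w0E] : exists w : bsp d M, bval w = smul (bval u) (bval v).
    apply: bval_ex => A; have := sgen_le_sn A hm; rewrite sE.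
    by move: le; lia.
  rewrite (big_pred1 w0) // => w; apply/idP/eqP => [/andP[/and4P[hw _ _ _] /andP[_]]|->].
    by rewrite sprodb_smul // -w0E => /eqP /bval_inj.
  by rewrite w0E hm hv hs sE le -{1}jC -{1}mg !eqxx.
rewrite big_pred0 // => w; apply/negP => /andP[/and4P[hw wC wg wM] /andP[_ hp]].
move: hne; rewrite sprodb_smul // in hp; rewrite (eqP hp) in wC wg wM.
by rewrite sE in wM; rewrite wM [_ == C]wC [_ == g]wg.
Qed.

Lemma bo_evN (M : nat) f P a : okp P a -> bo (fun N => evN M f N P a) (- pn P a).
Proof.
move=> okP; apply: bo_sum => u /and3P[hu /eqP uP /eqP ua].
apply: (@eq_bo _ (fun N => f (bval u) * N%:R ^ (- sn (bval u)))) => [N|]; first by rewrite mulrC.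
apply: bo_cstM; apply: bo_le (bo_pow _ _); rewrite lerN2 snE uP ua lerDl.
by rewrite sumr_ge0.
Qed.

(** In terms of traces this is the moment function of identity matrices, divided by N^d;
    [hat_ev_zeta] identifies it with the evaluated zeta function. *)
Definition zt (N : nat) a : R[i] := N%:R ^ (- (d%:Z - #|porbits a|%:Z)).

Lemma ev_zeta M N P a : evN M (@szeta R[i] d) N P a = (P == porbits a)%:R * zt N a.
Proof.
rewrite /evN; have [u0 u0E] : exists u : bsp d M, bval u = zet a.
  by apply: bval_ex => A; rewrite /sgen ffunE.
case: (eqVneq P (porbits a)) => [->|ne] /=.
  rewrite (bigD1 u0) /= ?u0E ?is_surfperm_zet ?eqxx // sn_zet szetaE eqxx mulr1 mul1r.
  rewrite big1 ?addr0 // => u /andP[/and3P[_ _ /eqP e] ne]; rewrite szetaE e.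
  by case: eqP => [ue|]; [case/eqP: ne; apply: (@bval_inj d M); rewrite ue u0E|rewrite mulr0].
rewrite mul0r big1 // => u /and3P[_ /eqP uP /eqP ua]; rewrite szetaE ua.
case: eqP => [e|]; last by rewrite mulr0.
by case/eqP: ne; rewrite -uP e.
Qed.

Lemma hat_ev_zeta M N C a : isp C -> part_le (porbits a) C ->
  hat (evN M (@szeta R[i] d) N) C a = zt N a.
Proof.
move=> hC aC; rewrite /hat (bigD1 (porbits a)) /=; last first.
  by rewrite /okp isp_porbits aC part_le_refl // isp_porbits.
rewrite ev_zeta eqxx mul1r big1 ?addr0 // => P /andP[_ /negbTE ne].
by rewrite ev_zeta ne mul0r.
Qed.

Definition muN M N P a : R[i] := evN M (@smobius R[i] d) N P a.

(** The exact identity between mu and zeta is carried over by [hat_conv] and [conv_evN_sconv]; only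
    the tail of norm above M is lost. *)
Lemma muN_zeta M C g : isp C -> part_le (porbits g) C ->
  exists2 e : nat -> R[i], bo e (- (M.+1)%:Z) &
  forall N, (0 < N)%N -> gconv C (hat (muN M N) C) (zt N) g = (g == 1%g)%:R + e N.
Proof.
move=> hC gC.
pose r P N : R[i] :=   \sum_(u : bsp d M | is_surfperm (bval u)) \sum_(v : bsp d M | is_surfperm (bval v) &&
     [&& part_join (spart (bval u)) (spart (bval v)) == P,
      (sperm (bval v) * sperm (bval u))%g == g & M%:Z < sn (bval u) + sn (bval v)])
    N%:R ^ (- (sn (bval u) + sn (bval v))) * (smobius R[i] (bval u) * szeta R[i] (bval v)).
exists (fun N => \sum_(P | okp P g && part_le P C) r P N).
  apply: bo_sum => P _; apply: bo_sum => u _; apply: bo_sum => v /andP[_ /and3P[_ _ h]].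
  set c := (_ * szeta _ _).
  apply: (@eq_bo _ (fun N => c * N%:R ^ (- (sn (bval u) + sn (bval v))))) => [N|]; first by rewrite mulrC.
  by apply: bo_cstM; apply: bo_le (bo_pow _ _); lia.
move=> N N0.
have -> : gconv C (hat (muN M N) C) (zt N) g =
    gconv C (hat (muN M N) C) (hat (evN M (@szeta R[i] d) N) C) g.
  by apply: eq_gconv => // a aC; rewrite hat_ev_zeta.
rewrite -hat_conv // /hat.
under eq_bigr => P hP do rewrite conv_evN_sconv //.
rewrite big_split /=; congr (_ + _).
have h1 := isp_porbits (1%g : {perm T}).
have S0 w : is_surfperm w -> sconv (@smobius R[i] d) (@szeta R[i] d) w = (w == zet 1%g)%:R.
  by move=> hw; have [->] := smobiusP R[i] hw.
have [w0 w0E] : exists w : bsp d M, bval w = zet 1%g.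
  by apply: bval_ex => A; rewrite /sgen ffunE.
have Z P : \sum_(w : bsp d M | [&& is_surfperm (bval w), spart (bval w) == P, sperm (bval w) == g
        & sn (bval w) <= M%:Z]) N%:R ^ (- sn (bval w)) * sconv (@smobius R[i] d) (@szeta R[i] d) (bval w)
   = ((P == porbits (1%g : {perm T})) && (g == 1%g))%:R.
  rewrite big_mkcond (bigD1 w0) //= w0E is_surfperm_zet big1 ?addr0; last first.
    move=> w ne; case: ifP => // /and4P[hw _ _ _]; rewrite S0 //.
    case: eqP => [e|]; last by rewrite mulr0.
    by case/eqP: ne; apply: (@bval_inj d M); rewrite e.
  rewrite S0 ?is_surfperm_zet // eqxx mulr1 sn_zet.
  have -> : #|porbits (1%g : {perm T})| = d by have := rank_perm (1%g : {perm T}); rewrite /dmx perm_mx1 subrr mxrank0.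
  rewrite subrr /= [spart _ == _]eq_sym [sperm _ == _]eq_sym expr0z.
  by case: (_ == _) => //; case: (_ == _).
under eq_bigr => P hP do rewrite Z.
case: (eqVneq g 1%g) => [->|ne] /=; last by rewrite big1 // => P _; rewrite andbF.
rewrite (bigD1 (porbits 1%g)) /=; last by rewrite /okp h1 part_le_refl //= porbits_le1.
by rewrite eqxx big1 ?addr0 // => P /andP[_ /negbTE->].
Qed.

End Evaluation.
Local Close Scope set_scope.
(** * Moment-cumulant relation *)

Local Open Scope set_scope.
Section Cumulants.
Variables (T : finType) (K : comNzRingType).
Implicit Types (S B C D : {set T}) (p q Q : {set {set T}}) (i j : T).

Definition cumf (n : nat) : K := (-1) ^+ n.-1 * (n.-1)`!%:R.

Variable ok : pred {set T}.
Definition okpart p S := finset.partition p S && [forall B in p, ok B].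

Lemma okpartP p S : reflect (finset.partition p S /\ forall B, B \in p -> ok B) (okpart p S).
Proof.
apply: (iffP andP) => -[h1 h2]; split=> //.
  by move=> B Bp; apply: (implyP (forallP h2 B)).
by apply/forallP => B; apply/implyP => /h2.
Qed.

Lemma partition_sub p S B : finset.partition p S -> B \in p -> B \subset S.
Proof. by case/and3P=> /eqP <- _ _ Bp; apply: (finset.bigcup_sup B). Qed.

Lemma sum_part_block (G : {set {set T}} -> K) S C : C \subset S -> C != finset.set0 ->
  \sum_(p | okpart p S && (C \in p)) G p =
  if ok C then \sum_(q | okpart q (S :\: C)) G (C |: q) else 0.
Proof.
move=> CS C0; case: ifP => okC; last first.
  rewrite big_pred0 // => p; apply/negP => /andP[/okpartP[_ h] /h]; by rewrite okC.
rewrite (reindex_onto (fun q => C |: q) (fun p => p :\ C)) /=; last first.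
  by move=> p /andP[_ Cp]; rewrite finset.setD1K.
apply: eq_bigl => q; rewrite setU11 andbT.
apply/andP/idP => [[/okpartP[pS okB] /eqP e]|/okpartP[pS okB]].
  apply/okpartP; split; last by move=> B Bq; apply: okB; rewrite finset.inE Bq orbT.
  by rewrite -e; apply: partitionD1 => //; rewrite setU11.
have Cq : C \notin q.
  apply: contra C0 => Cq; have := partition_sub pS Cq.
  move=> /fintype.subsetP h; rewrite -finset.subset0; apply/fintype.subsetP => i iC.
  by have := h i iC; rewrite !finset.inE iC.
split; last by rewrite setU1K.
apply/okpartP; split; last by move=> B /setU1P[->//|/okB].
have -> : S = C :|: (S :\: C) by apply/setP => i; rewrite !finset.inE; case: (boolP (i \in C)) => //= /(fintype.subsetP CS) ->.
apply: partitionU1 => //; rewrite disjoint_sym finset.disjoints_subset; apply/fintype.subsetP => i.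
by rewrite !finset.inE => /andP[].
Qed.

Lemma sum_part_peel (G : {set {set T}} -> K) S i : i \in S ->
  \sum_(p | okpart p S) G p =
  \sum_(B : {set T} | [&& B \subset S, i \in B & ok B]) \sum_(q | okpart q (S :\: B)) G (B |: q).
Proof.
move=> iS.
transitivity (\sum_(B : {set T} | (B \subset S) && (i \in B)) \sum_(p | okpart p S && (B \in p)) G p).
  rewrite (exchange_big_dep (fun p => okpart p S)) /=; last by move=> B p _ /andP[].
  apply: eq_bigr => p okp; have /okpartP[pS _] := okp.
  have ip : i \in finset.cover p by case/and3P: pS => /eqP ->.
  rewrite (big_pred1 (finset.pblock p i)) // => B.
  apply/andP/eqP => [[/andP[_ iB] /andP[_ Bp]]|->].
    by apply/esym/finset.def_pblock => //; case/and3P: pS.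
  have Bp := finset.pblock_mem ip.
  rewrite (partition_sub pS Bp) Bp finset.mem_pblock ip; split=> //.
  by rewrite andbT.
rewrite [RHS](eq_bigl (fun B => ((B \subset S) && (i \in B)) && ok B)); last by move=> B; rewrite andbA.
rewrite [RHS]big_mkcondr; apply: eq_bigr => B /andP[BS iB].
by rewrite sum_part_block //; apply/finset.set0Pn; exists i.
Qed.

Variable e : {set T} -> K.
Hypothesis e0 : e finset.set0 = 1.
Hypothesis okD : forall B C, ok B -> ok C -> ok (B :\: C).

(* The cumulant over the partitions of [S] into [ok] blocks; with [ok] the stable
   sets of a permutation this is the cumulant of a family indexed by its cycles. *)
Definition kap S := \sum_(p | okpart p S) cumf #|p| * \prod_(B in p) e B.

Lemma okpart1 S p : S != finset.set0 -> ok S -> okpart p S && (#|p| == 1)%N = (p == [set S]).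
Proof.
move=> S0 okS; apply/andP/eqP => [[/okpartP[pS _] /cards1P[B pB]]|->].
  by case/and3P: pS => /eqP <- _ _; rewrite pB finset.cover1.
rewrite cards1; split=> //; apply/okpartP; split; last by move=> B /set1P->.
by apply/and3P; rewrite finset.cover1 finset.trivIset1 finset.inE eq_sym.
Qed.

Lemma kap_rec S i : i \in S -> ok S ->
  e S = \sum_(B : {set T} | [&& B \subset S, i \in B & ok B]) kap B * e (S :\: B).
Proof.
move=> iS okS; have S0 : S != finset.set0 by apply/finset.set0Pn; exists i.
rewrite (bigD1 S) /=; last by rewrite fintype.subxx iS okS.
rewrite finset.setDv e0 mulr1.
(* With C the complement of B in S, a partition of B completed by C is a partition of S with a
   marked block that avoids i; its weight counts one block less. *)
have -> : \sum_(B : {set T} | [&& B \subset S, i \in B & ok B] && (B != S)) kap B * e (S :\: B) =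
   \sum_(p | okpart p S) \sum_(C in p | i \notin C) cumf #|p|.-1 * \prod_(B in p) e B.
  rewrite (exchange_big_dep (fun C : {set T} => (i \notin C) && (C \subset S) && (C != finset.set0))) /=; last first.
    move=> p C /okpartP[pS _] /andP[Cp ->] /=; rewrite (partition_sub pS Cp) /=.
    by case/and3P: pS => _ _; apply: contraNneq => <-.
  rewrite (reindex_onto (fun C => S :\: C) (fun C => S :\: C)) /=; last first.
    by move=> B /andP[/and3P[BS _ _] _]; rewrite finset.setDDr finset.setDv finset.set0U; apply/finset.setIidPr.
  rewrite [LHS](eq_bigl (fun C => ((i \notin C) && (C \subset S) && (C != finset.set0)) && ok C)); last first.
    move=> C; rewrite finset.subsetDl finset.inE iS andbT /=.
    apply/andP/andP => [[/andP[/andP[iC okC] CS] /eqP e1]|[/andP[/andP[iC CS] C0] okC]].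
      have eC : C \subset S by rewrite -e1 finset.subsetDl.
      split; last by rewrite -e1; apply: okD.
      by rewrite iC eC /=; apply: contraNneq CS => ->; rewrite finset.setD0.
    have e1 : S :\: (S :\: C) = C by rewrite finset.setDDr finset.setDv finset.set0U; apply/finset.setIidPr.
    split; last by rewrite e1.
    rewrite iC okD //=; apply: contraNneq C0 => h; move: e1; rewrite h finset.setDv => <-; by [].
  rewrite [LHS]big_mkcondr /=; apply: eq_bigr => C /andP[/andP[iC CS] C0].
  have e1 : S :\: (S :\: C) = C by rewrite finset.setDDr finset.setDv finset.set0U; apply/finset.setIidPr.
  rewrite [RHS](eq_bigl (fun p => okpart p S && (C \in p))); last by move=> p; rewrite iC andbT.
  rewrite sum_part_block //; case: ifP => // okC.
  rewrite /kap big_distrl /= e1; apply: eq_bigr => q /okpartP[pS _].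
  have Cq : C \notin q.
    apply: contra C0 => Cq; have := partition_sub pS Cq.
    move=> /fintype.subsetP h; rewrite -finset.subset0; apply/fintype.subsetP => j jC.
    by have := h j jC; rewrite !finset.inE jC.
  by rewrite cardsU1 Cq big_setU1 //= [e C * _]mulrC mulrA.
rewrite /kap -big_split /=.
rewrite (bigD1 [set S]) /=; last by have := okpart1 [set S] S0 okS; rewrite eqxx => /andP[].
rewrite cards1 big_set1 /cumf /= expr0 fact0 !mul1r big_pred0 ?addr0; last first.
  by move=> C; rewrite finset.inE; case: eqP => //= ->; rewrite iS.
rewrite big1 ?addr0 // => p /andP[okp pS].
have /okpartP[pp _] := okp.
have ip : i \in finset.cover p by case/and3P: pp => /eqP ->.
(* Every block but that of i can be marked, and (n - 1) [cumf (n - 1)] = - [cumf n] then cancels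
   each partition other than {S}. *)
have -> : \sum_(C in p | i \notin C) cumf #|p|.-1 * \prod_(B in p) e B =
   (#|p|.-1)%:R * (cumf #|p|.-1 * \prod_(B in p) e B).
  rewrite sumr_const mulr_natl; congr (_ *+ _).
  have := cardsD1 (finset.pblock p i) p; rewrite finset.pblock_mem // add1n => ->/=.
  transitivity #|[set C in p | i \notin C]|; first by apply: eq_card => C; rewrite !finset.inE.
  apply: eq_card => C; rewrite !finset.inE [RHS]andbC.
  case: (boolP (C \in p)) => Cp; rewrite ?andbF ?andbT //=.
  case: (boolP (i \in C)) => iC /=.
    by rewrite (finset.def_pblock _ Cp iC) ?eqxx //; case/and3P: pp.
  by apply/esym; apply: contraNneq iC => ->; rewrite finset.mem_pblock.
rewrite mulrA -mulrDl; have := okpart1 p S0 okS; rewrite okp (negbTE pS) /= => /negbT p1.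
have : (0 < #|p|)%N by apply/card_gt0P; exists (finset.pblock p i); apply: finset.pblock_mem.
case: #|p| p1 => // -[//|n] _ _ /=.
by rewrite /cumf /= factS natrM exprS; ring.
Qed.

Hypothesis okI : forall B C, ok B -> ok C -> ok (B :&: C).

(** Induction on S, peeling off the block of a point i: it lies in the block of Q that contains i,
    where [kap_rec] applies. *)
Lemma moment_cumulant Q S : finset.partition Q [set: T] -> (forall C, C \in Q -> ok C) -> ok S ->
  \sum_(p | okpart p S && [forall B in p, [exists C in Q, B \subset C]]) \prod_(B in p) kap B =
  \prod_(C in Q) e (S :&: C).
Proof.
move=> pQ okQ; move: {2}#|S| (leqnn #|S|) => n; elim: n S => [|n IH] S hn okS.
  move: hn; rewrite leqn0 cards_eq0 => /eqP ->.
  rewrite [RHS]big1 => [|C _]; last by rewrite finset.set0I e0.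
  rewrite (big_pred1 finset.set0) ?big_set0 // => p; apply/andP/eqP => [[/okpartP[pS _] _]|->].
    apply/eqP; rewrite -finset.subset0; apply/fintype.subsetP => B Bp.
    have := partition_sub pS Bp; rewrite finset.subset0 => /eqP e1.
    by case/and3P: pS => _ _ /negP[]; rewrite -e1.
  split; last by apply/forallP => B; rewrite finset.inE.
  apply/okpartP; split; last by move=> B; rewrite finset.inE.
  apply/and3P; split; rewrite ?finset.inE //; first by rewrite /finset.cover big_set0.
  by apply/finset.trivIsetP => A B; rewrite finset.inE.
have [->|/finset.set0Pn[i iS]] := eqVneq S finset.set0; first by apply: IH; rewrite ?cards0 // -(finset.setDv S); apply: okD.
rewrite big_mkcondr /= (sum_part_peel _ iS).
have iQ : i \in finset.cover Q by case/and3P: pQ => /eqP -> _ _; rewrite finset.inE.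
set C0 := finset.pblock Q i; have C0Q : C0 \in Q := finset.pblock_mem iQ.
have tQ : finset.trivIset Q by case/and3P: pQ.
rewrite [RHS](bigD1 C0) //=.
have iSC : i \in S :&: C0 by rewrite finset.inE iS /C0 finset.mem_pblock iQ.
rewrite (kap_rec iSC (okI okS (okQ _ C0Q))).
rewrite big_distrl /= big_mkcond [RHS]big_mkcond /=; apply: eq_bigr => B _.
rewrite finset.subsetI.
case: (boolP [&& B \subset S, i \in B & ok B]) => [/and3P[BS iB okB]|h]; last first.
  by rewrite ifN //; apply: contra h => /and3P[/andP[-> _] -> ->].
rewrite BS iB okB /= andbT.
have BQ : [exists C in Q, B \subset C] = (B \subset C0).
  apply/existsP/idP => [[C /andP[CQ BC]]|BC0]; last by exists C0; rewrite C0Q.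
  by rewrite /C0 (finset.def_pblock tQ CQ (fintype.subsetP BC _ iB)).
have q_notin q : okpart q (S :\: B) -> B \notin q.
  move=> /okpartP[pS _]; apply/negP => Bq; have := partition_sub pS Bq.
  by move=> /fintype.subsetP/(_ i iB); rewrite !finset.inE iB.
have allU q : [forall A in B |: q, [exists C in Q, A \subset C]] =
    (B \subset C0) && [forall A in q, [exists C in Q, A \subset C]].
  rewrite -BQ; apply/forallP/andP => [h|[h1 /forallP h2] A].
    split; first by have := h B; rewrite setU11.
    by apply/forallP => A; apply/implyP => Aq; have := h A; rewrite finset.inE Aq orbT.
  by apply/implyP => /setU1P[->//|]; apply/implyP.
case: ifP => BC0; last first.
  by rewrite big1 // => q _; rewrite allU BC0.
transitivity (kap B * \sum_(q | okpart q (S :\: B) && [forall A in q, [exists C in Q, A \subset C]])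
   \prod_(A in q) kap A).
  rewrite big_distrr /= [RHS]big_mkcondr; apply: eq_bigr => q hq.
  by rewrite allU BC0 /=; case: ifP => // _; rewrite big_setU1 //= q_notin.
rewrite IH; last 2 first.
- rewrite -ltnS; apply: leq_trans hn; apply: proper_card; apply/properP; split.
    exact: finset.subsetDl.
  by exists i => //; rewrite !finset.inE iB.
- exact: okD.
rewrite (bigD1 C0) //= mulrA; congr (_ * _ * _).
  by congr e; apply/setP => j; rewrite !finset.inE andbA.
apply: eq_bigr => C /andP[CQ ne]; congr e; apply/setP => j; rewrite !finset.inE.
case: (boolP (j \in B)) => //= jB; case: (boolP (j \in C)) => jC; rewrite ?andbF //.
case/eqP: ne; rewrite -(finset.def_pblock tQ CQ jC).
by rewrite (finset.def_pblock tQ C0Q (fintype.subsetP BC0 _ jB)).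
Qed.

(** By induction only B = {i} and B = S contribute to the recursion at i, and the first of them
    already gives all of e S. *)
Lemma kap_const i (c : K) : (forall B, ok B) ->
  (forall S, i \in S -> e S = c * e (S :\ i)) ->
  forall S, i \in S -> S != [set i] -> kap S = 0.
Proof.
move=> okT hc S; move: {2}#|S| (leqnn #|S|) => n; elim: n S => [|n IH] S hn iS ne.
  by move: hn; rewrite leqn0 cards_eq0 => /eqP S0; rewrite S0 finset.inE in iS.
have ki : kap [set i] = c.
  have := kap_rec (set11 i) (okT [set i]); rewrite (big_pred1 [set i]) => [|B]; last first.
    rewrite okT andbT; apply/andP/eqP => [[/fintype.subsetP h iB]|->]; last by rewrite fintype.subxx set11.
    apply/setP => j; rewrite finset.inE; apply/idP/eqP => [/h/set1P//|->//].
  by rewrite finset.setDv e0 mulr1 => <-; rewrite hc ?set11 // finset.setDv e0 mulr1.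
have := kap_rec iS (okT S); rewrite (bigD1 S) /=; last by rewrite fintype.subxx iS okT.
rewrite (bigD1 [set i]) /=; last by rewrite finset.sub1set iS set11 okT eq_sym ne.
rewrite ki finset.setDv e0 mulr1 hc // big1 ?addr0.
  by move=> /eqP; rewrite -{1}[c * _]add0r => /eqP /addIr.
move=> B /andP[/andP[/and3P[BS iB _] BneS] ne1]; rewrite IH ?mul0r //.
rewrite -ltnS; apply: leq_trans hn; apply: proper_card.
by rewrite finset.properEneq BneS.
Qed.

End Cumulants.
Local Close Scope set_scope.
Local Open Scope set_scope.

(** * Cumulants indexed by disjoint sets *)

Section CumulantTransfer.
Variables (I T : finType) (K : comNzRingType) (c : I -> {set T}) (ok : pred {set T}).
Variables (e : {set T} -> K) (E : {set I} -> K).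
Let F (B : {set I}) := \bigcup_(i in B) c i.
Let G (A : {set T}) := [set i | c i \subset A].
Hypothesis c0 : forall i, c i != finset.set0.
Hypothesis cI : forall i j k, k \in c i -> k \in c j -> i = j.
Hypothesis eF : forall B, E B = e (F B).
Hypothesis okF : forall A : {set T}, A \subset F [set: I] -> ok A = (F (G A) == A).

Let inF i k B : k \in c i -> (k \in F B) = (i \in B).
Proof.
move=> ki; apply/bigcupP/idP => [[j jB kj]|iB]; last by exists i.
by rewrite (cI ki kj).
Qed.

Let GF B : G (F B) = B.
Proof.
apply/setP => i; rewrite finset.inE; have /finset.set0Pn[k ki] := c0 i.
apply/idP/idP => [/fintype.subsetP/(_ k ki)|iB]; first by rewrite (inF _ ki).
by apply/fintype.subsetP => l li; rewrite (inF _ li).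
Qed.

Let F_inj : injective F. Proof. exact: can_inj GF. Qed.

Let F_sub B : F B \subset F [set: I].
Proof. by apply/bigcupsP => i _; apply: (finset.bigcup_sup i). Qed.

(** F and G are inverse bijections between subsets of I and [ok] subsets of the union, so partitions
    correspond block by block. It is applied to singletons, for reordering a list, and to the cycles
    of a permutation. *)
Lemma kap_transfer :
  \sum_(p : {set {set I}} | finset.partition p [set: I]) cumf K #|p| * \prod_(B in p) E B =
  kap ok e (F [set: I]).
Proof.
rewrite /kap (reindex_onto (fun p : {set {set I}} => F @: p) (fun q => G @: q)) /=; last first.
  move=> q /okpartP[qS okq]; rewrite -imset_comp -[RHS]imset_id; apply: eq_in_imset => A Aq /=.
  by apply/eqP; rewrite -okF ?okq //; exact: partition_sub qS Aq.
apply: eq_big => [p|p pp]; last first.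
  rewrite card_imset // big_imset /=; last by move=> ? ? _ _ /F_inj.
  by congr (_ * _); apply: eq_bigr => B _; rewrite eF.
have Gp : G @: (F @: p) = p.
  by rewrite -imset_comp -[RHS]imset_id; apply: eq_imset => B /=.
rewrite Gp eqxx andbT.
have cov : finset.cover (F @: p) = F (finset.cover p).
  apply/setP => k; rewrite cover_imset; apply/bigcupP/bigcupP => [[B Bp /bigcupP[i iB ki]]|[i /bigcupP[B Bp iB] ki]].
    by exists i => //; apply/bigcupP; exists B.
  by exists B => //; apply/bigcupP; exists i.
apply/idP/okpartP => [/and3P[/eqP cp tp n0]|[/and3P[/eqP cp tp n0] _]].
  split; last by move=> A /imsetP[B Bp ->]; rewrite okF ?F_sub // GF.
  apply/and3P; split; first by rewrite cov cp.
    apply/finset.trivIsetP => _ _ /imsetP[A Ap ->] /imsetP[B Bp ->] ne.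
    have neAB : A != B by apply: contraNneq ne => ->.
    rewrite -setI_eq0; apply: contraNT neAB => /finset.set0Pn[k /setIP[/bigcupP[i iA ki]]].
    rewrite (inF _ ki) => iB.
    by rewrite -(finset.def_pblock tp Ap iA) (finset.def_pblock tp Bp iB).
  apply/negP => /imsetP[B Bp /esym e0].
  have B0 : B = finset.set0 by rewrite -(GF B) e0; apply/setP => i; rewrite !finset.inE finset.subset0 (negbTE (c0 i)).
  by case/negP: n0; rewrite -B0.
apply/and3P; split.
- by apply/eqP; apply: F_inj; rewrite -cov cp.
- apply/finset.trivIsetP => A B Ap Bp ne.
  rewrite -setI_eq0; apply: contraNT ne => /finset.set0Pn[i /setIP[iA iB]].
  have /finset.set0Pn[k ki] := c0 i.
  apply/eqP; apply: F_inj.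
  have kA : k \in F A by rewrite (inF _ ki).
  have kB : k \in F B by rewrite (inF _ ki).
  have FA : F A \in F @: p by apply: imset_f.
  have FB : F B \in F @: p by apply: imset_f.
  by rewrite -(finset.def_pblock tp FA kA) (finset.def_pblock tp FB kB).
apply/negP => Bp; case/negP: n0; apply/imsetP; exists finset.set0 => //.
by rewrite /F big_set0.
Qed.

End CumulantTransfer.
Local Close Scope set_scope.
(** * Expectations of polynomials in independent random matrices *)

Local Open Scope classical_set_scope.
Section RealExpectation.
Context {R : realType} {disp : measure_display} {Omega : measurableType disp}.
Variable P : probability Omega R.
Implicit Types (F G : Omega -> R).

Definition rint F := P.-integrable setT (fun w => (F w)%:E).
Definition rex F : R := fine (\int[P]_w (F w)%:E)%E.

Lemma rint_meas F : rint F -> measurable_fun setT F.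
Proof. by move=> /integrableP[/measurable_EFinP]. Qed.

Lemma rint_cst (c : R) : rint (fun=> c).
Proof. exact: (finite_measure_integrable_cst P c measurableT). Qed.

Lemma rintD F G : rint F -> rint G -> rint (fun w => F w + G w).
Proof. by move=> hF hG; have := integrableD measurableT hF hG. Qed.

Lemma rintZ (c : R) F : rint F -> rint (fun w => c * F w).
Proof. by move=> hF; have := integrableZl measurableT c hF. Qed.

Lemma rintB F G : rint F -> rint G -> rint (fun w => F w - G w).
Proof.
move=> hF /(rintZ (-1)) hG; have := rintD hF hG; congr rint; apply/funext => w.
by rewrite mulN1r.
Qed.

Lemma rint_dom F G : measurable_fun setT F -> (forall w, `|F w| <= G w) -> rint G -> rint F.
Proof.
move=> mF FG hG; apply: (le_integrable measurableT _ _ hG); first exact/measurable_EFinP.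
by move=> w _ /=; rewrite lee_fin (le_trans (FG w)) // ler_norm.
Qed.

Lemma rexD F G : rint F -> rint G -> rex (fun w => F w + G w) = rex F + rex G.
Proof. exact: (@RintegralD _ _ _ P setT F G measurableT). Qed.

Lemma rexZ (c : R) F : rint F -> rex (fun w => c * F w) = c * rex F.
Proof. exact: (@RintegralZl _ _ _ P setT F c measurableT). Qed.

Lemma rexB F G : rint F -> rint G -> rex (fun w => F w - G w) = rex F - rex G.
Proof. exact: (@RintegralB _ _ _ P setT F G measurableT). Qed.

Lemma rex_cst (c : R) : rex (fun=> c) = c.
Proof.
rewrite /rex; have -> : (\int[P]_w c%:E = c%:E * P setT)%E by rewrite integral_cst.
rewrite -[RHS]/(fine c%:E); congr fine; have := probability_setT P; move=> ->; exact: mule1.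
Qed.

Definition mfun_of (d : measure_display) (T : measurableType d) (F : Omega -> T)
  (mF : measurable_fun setT F) : {mfun Omega >-> T} :=
  HB.pack F (isMeasurableFun.Build _ _ _ _ F mF).

(** Independence makes the joint law agree with the product law on rectangles, hence everywhere;
    Fubini then separates the integrals. *)
Lemma rex_indep F G : rint F -> rint G ->
  (forall U V : set R, measurable U -> measurable V ->
     P (F @^-1` U `&` G @^-1` V) = (P (F @^-1` U) * P (G @^-1` V))%E) ->
  rint (fun w => F w * G w) /\ rex (fun w => F w * G w) = rex F * rex G.
Proof.
move=> hF hG ind; have mF := rint_meas hF; have mG := rint_meas hG.
pose m1 : probability R R := distribution P (mfun_of mF).
pose m2 : probability R R := distribution P (mfun_of mG).
have mFG : measurable_fun setT (fun w => (F w, G w)) by exact: measurable_fun_pair.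
pose m : probability (R * R)%type R := distribution P (mfun_of mFG).
have mE X : measurable X -> m X = (m1 \x m2)%E X.
  move=> mX; apply/esym; by apply: product_measure_unique.
pose f (z : R * R) : \bar R := (z.1 * z.2)%:E.
have mf : measurable_fun setT f.
  by apply/measurable_EFinP; apply: measurable_funM; [exact: measurable_fst|exact: measurable_snd].
have mabs : measurable_fun setT (fun z => `|f z|%E) by exact: measurableT_comp.
have eI (h : R * R -> \bar R) : (\int[m]_z h z = \int[(m1 \x m2)%E]_z h z)%E.
  apply: eq_measure_integral => A mA _; exact: (mE A mA).
have I1 (h : R -> R) H (mH : measurable_fun setT H) : measurable_fun setT h ->
   (forall x, 0 <= h x) -> (\int[distribution P (mfun_of mH)]_x (h x)%:E = \int[P]_w (h (H w))%:E)%E.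
  move=> mh h0; rewrite ge0_integral_distribution //; first exact/measurable_EFinP.
have mabsR : measurable_fun setT (fun x : R => `|x|) by exact: measurableT_comp.
have finF : (\int[P]_w `|F w|%:E < +oo)%E by case/integrableP: hF.
have finG : (\int[P]_w `|G w|%:E < +oo)%E by case/integrableP: hG.
have intm : (m1 \x m2)%E.-integrable setT f.
  apply/integrable12ltyP => //.
  have -> : (\int[m1]_x \int[m2]_y `|f (x, y)| = \int[m1]_x (`|x|%:E * \int[m2]_y `|y|%:E))%E.
    apply: eq_integral => x _; rewrite -ge0_integralZl //.
    - by apply: eq_integral => y _; rewrite /f /= normrM EFinM.
    - by apply/measurable_EFinP.
  rewrite ge0_integralZr //; last first.
    + by apply: integral_ge0 => y _; rewrite lee_fin.
    + by apply/measurable_EFinP.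
  rewrite /m1 /m2 !I1 // lte_mul_pinfty ?ge0_fin_numE //.
  - by apply: integral_ge0 => y _; rewrite lee_fin.
  - by apply: integral_ge0 => y _; rewrite lee_fin.
have intP : rint (fun w => F w * G w).
  apply/integrableP; split; first by apply/measurable_EFinP; exact: measurable_funM.
  case/integrableP: intm => _; rewrite -eI /m.
  by rewrite ge0_integral_distribution.
split=> //; rewrite /rex.
have -> : (\int[P]_w (F w * G w)%:E = \int[m]_z f z)%E.
  by rewrite /m integral_distribution.
rewrite eI -integral12_prod_meas1 //.
have I2 H (mH : measurable_fun setT H) : rint H ->
   (\int[distribution P (mfun_of mH)]_x x%:E = \int[P]_w (H w)%:E)%E.
  by move=> hH; rewrite integral_distribution //; exact/measurable_EFinP.
have i1 : m1.-integrable setT (fun x => x%:E).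
  apply/integrableP; split; first exact/measurable_EFinP.
  by rewrite /m1 (I1 (fun x => `|x|)).
have i2 : m2.-integrable setT (fun x => x%:E).
  apply/integrableP; split; first exact/measurable_EFinP.
  by rewrite /m2 (I1 (fun x => `|x|)).
have -> : (\int[m1]_x fubini_F m2 f x = \int[m1]_x (x%:E * \int[m2]_y y%:E))%E.
  by apply: eq_integral => x _; rewrite /fubini_F /f /= -integralZl.
rewrite -(fineK (integrable_fin_num _ i2)) // integralZr // fineM ?fine_fin_num //.
  by rewrite /= /m1 /m2 !I2.
by apply: integrable_fin_num.
Qed.

End RealExpectation.
Local Close Scope classical_set_scope.
Local Open Scope classical_set_scope.

(** * Polynomial functions of the entries of a matrix *)

Section MatrixFunctions.
Context {R : realType} (N : nat).
Local Notation MN := 'M[R[i]]_N.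
Local Notation Re := (@complex.Re R).
Local Notation Im := (@complex.Im R).

Definition mx_gen : set (set MN) := [set S | exists i j : 'I_N, exists2 U : set R, measurable U &
         S = [set M : MN | U (Re (M i j))] \/ S = [set M : MN | U (Im (M i j))] ].

(** A copy of the matrix type to carry the sigma-algebra of the statement, so that [measurable_fun]
    speaks of [mx_borel] ([bmP]). *)
Definition MNp : Type := MN.
HB.instance Definition _ := Choice.on MNp.
HB.instance Definition _ := isPointed.Build MNp (0 : MN).
Definition MNm := g_sigma_algebraType (mx_gen : set (set MNp)).

Definition bm (h : MN -> R) := measurable_fun setT (h : MNm -> R).

Lemma bmP (h : MN -> R) : bm h <-> forall U : set R, measurable U -> mx_borel (h @^-1` U).
Proof.
split=> [mh U mU|H _ U mU]; last by rewrite setTI; exact: H.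
by have := mh measurableT U mU; rewrite setTI.
Qed.

Lemma bm_Re i j : bm (fun M => Re (M i j)).
Proof. by apply/bmP => U mU; apply: sub_sigma_algebra; exists i, j, U => //; left. Qed.

Lemma bm_Im i j : bm (fun M => Im (M i j)).
Proof. by apply/bmP => U mU; apply: sub_sigma_algebra; exists i, j, U => //; right. Qed.

Inductive polyf : (MN -> R[i]) -> Prop :=
| polyf_cst c : polyf (fun=> c)
| polyf_entry i j : polyf (fun M => M i j)
| polyf_add f g : polyf f -> polyf g -> polyf (fun M => f M + g M)
| polyf_mul f g : polyf f -> polyf g -> polyf (fun M => f M * g M).

Lemma ReM (x y : R[i]) : Re (x * y) = Re x * Re y - Im x * Im y.
Proof. by case: x y => [a b] [c d]. Qed.
Lemma ImM (x y : R[i]) : Im (x * y) = Re x * Im y + Im x * Re y.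
Proof. by case: x y => [a b] [c d]. Qed.
Lemma ReD (x y : R[i]) : Re (x + y) = Re x + Re y.
Proof. by case: x y => [a b] [c d]. Qed.
Lemma ImD (x y : R[i]) : Im (x + y) = Im x + Im y.
Proof. by case: x y => [a b] [c d]. Qed.

Lemma polyf_bm f : polyf f -> bm (fun M => Re (f M)) /\ bm (fun M => Im (f M)).
Proof.
elim=> [c|i j|g h _ [g1 g2] _ [h1 h2]|g h _ [g1 g2] _ [h1 h2]].
- by split; exact: measurable_cst.
- by split; [exact: bm_Re|exact: bm_Im].
- split.
    by under eq_fun do rewrite ReD; exact: measurable_funD.
  by under eq_fun do rewrite ImD; exact: measurable_funD.
split.
  by under eq_fun do rewrite ReM; apply: measurable_funB; exact: measurable_funM.
by under eq_fun do rewrite ImM; apply: measurable_funD; exact: measurable_funM.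
Qed.

(** For hermitian M this is Tr(M^2), whose moments exist by hypothesis. It dominates every entry, so
    it makes all polynomial functions of the entries integrable. *)
Definition tn (M : MN) : R := \sum_i \sum_j (Re (M i j) ^+ 2 + Im (M i j) ^+ 2).

Lemma normc_sqr (x : R[i]) : Normc.normc x ^+ 2 = Re x ^+ 2 + Im x ^+ 2.
Proof. by case: x => a b; rewrite /= sqr_sqrtr // addr_ge0 ?sqr_ge0. Qed.

Lemma tn_ge0 M : 0 <= tn M.
Proof. by apply: sumr_ge0 => i _; apply: sumr_ge0 => j _; rewrite addr_ge0 ?sqr_ge0. Qed.

Lemma entry_le_tn (M : MN) i j : Normc.normc (M i j) <= 1 + tn M.
Proof.
have h : Normc.normc (M i j) ^+ 2 <= tn M.
  rewrite normc_sqr /tn (bigD1 i) //= (bigD1 j) //= -addrA lerDl.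
  apply: addr_ge0; first by apply: sumr_ge0 => k _; rewrite addr_ge0 ?sqr_ge0.
  by apply: sumr_ge0 => k _; apply: sumr_ge0 => l _; rewrite addr_ge0 ?sqr_ge0.
have := normc_ge0 (M i j); move: (Normc.normc (M i j)) h => x h x0.
have : 0 <= (x - 1) ^+ 2 by exact: sqr_ge0.
move: h; move: (tn M) (tn_ge0 M) => t t0; nra.
Qed.

Lemma polyf_bound f : polyf f -> exists K : R, exists p : nat, 0 <= K /\
  forall M, Normc.normc (f M) <= K * (1 + tn M) ^+ p.
Proof.
have h1 M : 1 <= 1 + tn M by rewrite lerDl tn_ge0.
have h0 M : 0 <= 1 + tn M by rewrite addr_ge0 ?tn_ge0.
elim=> [c|i j|g h _ [K1 [p1 [k1 H1]]] _ [K2 [p2 [k2 H2]]]|g h _ [K1 [p1 [k1 H1]]] _ [K2 [p2 [k2 H2]]]].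
- exists (Normc.normc c), 0%N; split; first exact: normc_ge0.
  by move=> M; rewrite expr0 mulr1.
- by exists 1, 1%N; split=> // M; rewrite mul1r expr1 entry_le_tn.
- exists (K1 + K2), (maxn p1 p2); split; first exact: addr_ge0.
  move=> M; apply: le_trans (normcD_le _ _) _; rewrite mulrDl; apply: lerD.
    apply: le_trans (H1 M) _; apply: ler_wpM2l => //.
    by apply: ler_weXn2l; rewrite ?leq_maxl.
  apply: le_trans (H2 M) _; apply: ler_wpM2l => //.
  by apply: ler_weXn2l; rewrite ?leq_maxr.
exists (K1 * K2), (p1 + p2)%N; split; first exact: mulr_ge0.
move=> M; rewrite Normc.normcM exprD mulrACA.
by apply: ler_pM; rewrite ?normc_ge0.
Qed.

Lemma polyf_sum (I : Type) (r : seq I) (p : pred I) (f : I -> MN -> R[i]) :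
  (forall i, p i -> polyf (f i)) -> polyf (fun M => \sum_(i <- r | p i) f i M).
Proof.
move=> H; elim: r => [|i r IH].
  by under eq_fun do rewrite big_nil; exact: polyf_cst.
under eq_fun do rewrite big_cons; case: (boolP (p i)) => pi //.
by apply: polyf_add => //; exact: H.
Qed.

Lemma polyf_prod (I : Type) (r : seq I) (p : pred I) (f : I -> MN -> R[i]) :
  (forall i, p i -> polyf (f i)) -> polyf (fun M => \prod_(i <- r | p i) f i M).
Proof.
move=> H; elim: r => [|i r IH].
  by under eq_fun do rewrite big_nil; exact: polyf_cst.
under eq_fun do rewrite big_cons; case: (boolP (p i)) => pi //.
by apply: polyf_mul => //; exact: H.
Qed.

End MatrixFunctions.
Local Close Scope classical_set_scope.
Local Open Scope classical_set_scope.

(** * Complex-valued expectations *)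

Section ComplexExpectation.
Context {R : realType} {disp : measure_display} {Omega : measurableType disp}.
Variable P : probability Omega R.
Implicit Types (X Y : Omega -> R[i]).
Local Notation Re := (@complex.Re R).
Local Notation Im := (@complex.Im R).

Lemma cintE X : cintegrable P X <-> rint P (fun w => Re (X w)) /\ rint P (fun w => Im (X w)).
Proof. by []. Qed.

Lemma cexpectE X : cexpect P X = Complex (rex P (fun w => Re (X w))) (rex P (fun w => Im (X w))).
Proof. by rewrite /cexpect unlock. Qed.

Lemma cint_cst (c : R[i]) : cintegrable P (fun=> c).
Proof. by split; exact: rint_cst. Qed.

Lemma cintD X Y : cintegrable P X -> cintegrable P Y -> cintegrable P (fun w => X w + Y w).
Proof.
move=> [x1 x2] [y1 y2]; apply/cintE; split.
  by under eq_fun do rewrite ReD; exact: rintD.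
by under eq_fun do rewrite ImD; exact: rintD.
Qed.

Lemma cintZ (c : R[i]) X : cintegrable P X -> cintegrable P (fun w => c * X w).
Proof.
move=> [x1 x2]; apply/cintE; split.
  by under eq_fun do rewrite ReM; apply: rintB; exact: rintZ.
by under eq_fun do rewrite ImM; apply: rintD; exact: rintZ.
Qed.

Lemma cint_sum (I : Type) (r : seq I) (p : pred I) (X : I -> Omega -> R[i]) :
  (forall i, p i -> cintegrable P (X i)) -> cintegrable P (fun w => \sum_(i <- r | p i) X i w).
Proof.
move=> H; elim: r => [|i r IH].
  by under eq_fun do rewrite big_nil; exact: cint_cst.
under eq_fun do rewrite big_cons; case: (boolP (p i)) => pi //.
by apply: cintD => //; exact: H.
Qed.

Lemma complexP (x y : R[i]) : Re x = Re y -> Im x = Im y -> x = y.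
Proof. by case: x y => [a b] [c d] /= -> ->. Qed.

Lemma cexpectD X Y : cintegrable P X -> cintegrable P Y ->
  cexpect P (fun w => X w + Y w) = cexpect P X + cexpect P Y.
Proof.
move=> [x1 x2] [y1 y2]; rewrite !cexpectE; apply: complexP; rewrite ?ReD ?ImD /=.
  by rewrite -rexD //; congr (rex _ _); apply/funext => w; rewrite ReD.
by rewrite -rexD //; congr (rex _ _); apply/funext => w; rewrite ImD.
Qed.

Lemma cexpectZ (c : R[i]) X : cintegrable P X ->
  cexpect P (fun w => c * X w) = c * cexpect P X.
Proof.
move=> [x1 x2]; rewrite !cexpectE; apply: complexP; rewrite ?ReM ?ImM /=.
  rewrite -!rexZ // -rexB //; try exact: rintZ.
  by congr (rex _ _); apply/funext => w; rewrite ReM.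
rewrite -!rexZ // -rexD //; try exact: rintZ.
by congr (rex _ _); apply/funext => w; rewrite ImM.
Qed.

Lemma cexpect_cst (c : R[i]) : cexpect P (fun=> c) = c.
Proof. by rewrite cexpectE !rex_cst; case: c. Qed.

Lemma cexpect_sum (I : Type) (r : seq I) (p : pred I) (X : I -> Omega -> R[i]) :
  (forall i, p i -> cintegrable P (X i)) ->
  cexpect P (fun w => \sum_(i <- r | p i) X i w) = \sum_(i <- r | p i) cexpect P (X i).
Proof.
move=> H; elim: r => [|i r IH].
  by under eq_fun do rewrite big_nil; rewrite cexpect_cst big_nil.
under eq_fun do rewrite big_cons; rewrite big_cons; case: (boolP (p i)) => pi //.
by rewrite cexpectD ?IH //; [exact: H|exact: cint_sum].
Qed.

Lemma rex_dist (F G : Omega -> R) : rint P F -> rint P G ->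
  (forall U : set R, measurable U -> P (F @^-1` U) = P (G @^-1` U)) -> rex P F = rex P G.
Proof.
move=> hF hG FG; have mF := rint_meas hF; have mG := rint_meas hG.
have I2 H (mH : measurable_fun setT H) : rint P H ->
   (\int[distribution P (mfun_of mH)]_x x%:E = \int[P]_w (H w)%:E)%E.
  by move=> hH; rewrite integral_distribution //; exact/measurable_EFinP.
rewrite /rex -(I2 _ mF) // -(I2 _ mG) //; congr fine.
by apply: eq_measure_integral => U mU _; exact: FG.
Qed.

End ComplexExpectation.

(** * Integrability, independence and invariance for polynomial observables *)

Section RandomMatrix.
Context {R : realType} {disp : measure_display} {Omega : measurableType disp}.
Variables (P : probability Omega R) (N : nat).
Local Notation MN := 'M[R[i]]_N.
Local Notation Re := (@complex.Re R).
Local Notation Im := (@complex.Im R).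
Implicit Types (A B : Omega -> MN) (f g : MN -> R[i]).

Definition has_moments A := forall p : nat, rint P (fun w => tn (A w) ^+ p).

Lemma bm_meas A (h : MN -> R) : random_mx A -> bm h -> measurable_fun setT (fun w => h (A w)).
Proof.
move=> rA /bmP H _ U mU; rewrite setTI.
by have := rA _ (H U mU).
Qed.

Lemma rint_tn A p : has_moments A -> rint P (fun w => (1 + tn (A w)) ^+ p).
Proof.
move=> hA; suff H : forall p q, rint P (fun w => tn (A w) ^+ q * (1 + tn (A w)) ^+ p).
  have := H p 0%N; congr (rint P); apply/funext => w; by rewrite expr0 mul1r.
elim=> [|n IH] q.
  by have := hA q; congr (rint P); apply/funext => w; rewrite expr0 mulr1.
have := rintD (IH q) (IH q.+1); congr (rint P); apply/funext => w.
by rewrite !exprS; ring.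
Qed.

Lemma Re_le (x : R[i]) : `|Re x| <= Normc.normc x.
Proof.
rewrite -(ler_pXn2r (n := 2)) ?nnegrE ?normc_ge0 //; rewrite normc_sqr real_normK ?num_real //.
by rewrite lerDl sqr_ge0.
Qed.

Lemma Im_le (x : R[i]) : `|Im x| <= Normc.normc x.
Proof.
rewrite -(ler_pXn2r (n := 2)) ?nnegrE ?normc_ge0 //; rewrite normc_sqr real_normK ?num_real //.
by rewrite lerDr sqr_ge0.
Qed.

Lemma polyf_cint A f : random_mx A -> has_moments A -> polyf f ->
  cintegrable P (fun w => f (A w)).
Proof.
move=> rA hA pf; have [K [p [K0 H]]] := polyf_bound pf.
have [m1 m2] := polyf_bm pf.
have hK := rintZ K (rint_tn p hA).
apply/cintE; split.
  apply: (rint_dom _ _ hK); first exact: (bm_meas rA m1).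
  by move=> w; apply: le_trans (Re_le _) (H _).
apply: (rint_dom _ _ hK); first exact: (bm_meas rA m2).
by move=> w; apply: le_trans (Im_le _) (H _).
Qed.

Lemma cexpect_indep A B f g : random_mx A -> random_mx B -> has_moments A -> has_moments B ->
  independent_mx P A B -> polyf f -> polyf g ->
  cintegrable P (fun w => f (A w) * g (B w)) /\
  cexpect P (fun w => f (A w) * g (B w)) =
    cexpect P (fun w => f (A w)) * cexpect P (fun w => g (B w)).
Proof.
move=> rA rB hA hB ind pf pg.
have [f1 f2] := polyf_cint rA hA pf; have [g1 g2] := polyf_cint rB hB pg.
have [bf1 bf2] := polyf_bm pf; have [bg1 bg2] := polyf_bm pg.
have I (h k : MN -> R) : bm h -> bm k -> rint P (fun w => h (A w)) -> rint P (fun w => k (B w)) ->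
   rint P (fun w => h (A w) * k (B w)) /\
   rex P (fun w => h (A w) * k (B w)) = rex P (fun w => h (A w)) * rex P (fun w => k (B w)).
  move=> /bmP bh /bmP bk ih ik; apply: rex_indep => // U V mU mV.
  exact: (ind _ _ (bh U mU) (bk V mV)).
have [i11 e11] := I _ _ bf1 bg1 f1 g1; have [i22 e22] := I _ _ bf2 bg2 f2 g2.
have [i12 e12] := I _ _ bf1 bg2 f1 g2; have [i21 e21] := I _ _ bf2 bg1 f2 g1.
split.
  apply/cintE; split.
    by under eq_fun do rewrite ReM; exact: rintB.
  by under eq_fun do rewrite ImM; exact: rintD.
rewrite !cexpectE; apply: complexP; rewrite ?ReM ?ImM /=.
  rewrite -e11 -e22 -rexB //; congr (rex _ _); apply/funext => w; exact: ReM.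
rewrite -e12 -e21 -rexD //; congr (rex _ _); apply/funext => w; exact: ImM.
Qed.

Lemma polyf_conj (U : MN) f : polyf f -> polyf (fun M => f (U *m M *m (U ^t*)%sesqui)).
Proof.
elim=> [c|i j|g h _ IH1 _ IH2|g h _ IH1 _ IH2].
- exact: polyf_cst.
- under eq_fun do rewrite mxE; apply: polyf_sum => k _.
  apply: polyf_mul; last exact: polyf_cst.
  under eq_fun do rewrite mxE; apply: polyf_sum => l _.
  by apply: polyf_mul; [exact: polyf_cst|exact: polyf_entry].
- exact: polyf_add IH1 IH2.
exact: polyf_mul IH1 IH2.
Qed.

Lemma cexpect_inv A f (U : MN) : random_mx A -> has_moments A -> unitarily_invariant P A ->
  U \is unitarymx -> polyf f ->
  cexpect P (fun w => f (U *m A w *m (U ^t*)%sesqui)) = cexpect P (fun w => f (A w)).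
Proof.
move=> rA hA inv uU pf; have pf' := polyf_conj U pf.
have [f1 f2] := polyf_cint rA hA pf; have [g1 g2] := polyf_cint rA hA pf'.
have [bf1 bf2] := polyf_bm pf.
rewrite !cexpectE; congr Complex; apply: rex_dist => // V mV.
  exact: (inv U uU _ ((bmP _).1 bf1 V mV)).
exact: (inv U uU _ ((bmP _).1 bf2 V mV)).
Qed.

(** Each summand f(A) g(B) is integrable by independence, from the moments of A and of B separately;
    the sums form an algebra that contains all entries of polynomials in A and B. *)
Inductive mixf A B : (Omega -> R[i]) -> Prop :=
| mixf_one f g : polyf f -> polyf g -> mixf A B (fun w => f (A w) * g (B w))
| mixf_add X Y : mixf A B X -> mixf A B Y -> mixf A B (fun w => X w + Y w).

Lemma mixf_mul A B X Y : mixf A B X -> mixf A B Y -> mixf A B (fun w => X w * Y w).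
Proof.
move=> mX; elim: mX Y => [f g pf pg|X1 X2 _ IH1 _ IH2] Y mY; last first.
  by under eq_fun do rewrite mulrDl; apply: mixf_add; [exact: IH1|exact: IH2].
elim: mY => [f' g' pf' pg'|Y1 Y2 _ IH1 _ IH2].
  under eq_fun do rewrite mulrACA.
  exact: (@mixf_one A B (fun M => f M * f' M) (fun M => g M * g' M) (polyf_mul pf pf') (polyf_mul pg pg')).
by under eq_fun do rewrite mulrDr; exact: mixf_add.
Qed.

Lemma mixf_l A B f : polyf f -> mixf A B (fun w => f (A w)).
Proof.
by move=> pf; have := mixf_one A B pf (polyf_cst N (1 : R[i])); under eq_fun do rewrite mulr1.
Qed.

Lemma mixf_r A B f : polyf f -> mixf A B (fun w => f (B w)).
Proof.
by move=> pf; have := mixf_one A B (polyf_cst N (1 : R[i])) pf; under eq_fun do rewrite mul1r.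
Qed.

Lemma mixf_cst A B c : mixf A B (fun=> c).
Proof. exact: (mixf_l A B (polyf_cst N c)). Qed.

Lemma mixf_sum A B (I : Type) (r : seq I) (p : pred I) (X : I -> Omega -> R[i]) :
  (forall i, p i -> mixf A B (X i)) -> mixf A B (fun w => \sum_(i <- r | p i) X i w).
Proof.
move=> H; elim: r => [|i r IH].
  by under eq_fun do rewrite big_nil; exact: mixf_cst.
under eq_fun do rewrite big_cons; case: (boolP (p i)) => pi //.
by apply: mixf_add => //; exact: H.
Qed.

Lemma mixf_prod A B (I : Type) (r : seq I) (p : pred I) (X : I -> Omega -> R[i]) :
  (forall i, p i -> mixf A B (X i)) -> mixf A B (fun w => \prod_(i <- r | p i) X i w).
Proof.
move=> H; elim: r => [|i r IH].
  by under eq_fun do rewrite big_nil; exact: mixf_cst.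
under eq_fun do rewrite big_cons; case: (boolP (p i)) => pi //.
by apply: mixf_mul => //; exact: H.
Qed.

Lemma mixf_cint A B X : random_mx A -> random_mx B -> has_moments A -> has_moments B ->
  independent_mx P A B -> mixf A B X -> cintegrable P X.
Proof.
move=> rA rB hA hB ind; elim=> [f g pf pg|Y Z _ IH1 _ IH2]; last exact: cintD.
by have [] := cexpect_indep rA rB hA hB ind pf pg.
Qed.

Lemma tn_herm (M : MN) : hermitian_mx M -> \tr (M ^+ 2) = (tn M)%:C%C.
Proof.
move=> hM; have e i j : M j i = (M i j)^*%C by rewrite -{1}hM !mxE.
rewrite /mxtrace /tn expr2 rmorph_sum; apply: eq_bigr => i _.
rewrite [LHS]mxE rmorph_sum; apply: eq_bigr => j _.
by rewrite (e i j); case: (M i j) => a b; apply: complexP; rewrite ?ReM ?ImM /=; ring.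
Qed.

(** A list of p exponents equal to 2 turns the hypothesis into the p-th moment of [tn]. *)
Lemma herm_moments A : (forall w, hermitian_mx (A w)) ->
  (forall ks : seq nat, all (leq 1) ks ->
     cintegrable P (fun w => \prod_(k <- ks) \tr (A w ^+ k))) -> has_moments A.
Proof.
move=> hA H p; have hp : all (leq 1) (nseq p 2%N) by rewrite all_nseq orbT.
have [h _] := H _ hp; move: h; congr (rint P); apply/funext => w.
have -> : \prod_(k <- nseq p 2%N) \tr (A w ^+ k) = (tn (A w) ^+ p)%:C%C.
  by rewrite big_nseq tn_herm // iter_mulr_1 rmorphXn.
by [].
Qed.

End RandomMatrix.
Local Close Scope classical_set_scope.
(** * Tensors of moments *)

Section Tensors.
Variables (K : numFieldType) (N d : nat).
Local Notation T := 'I_d.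
Local Notation idx := {ffun T -> 'I_N}.
Implicit Types (i j : idx) (l p : T) (a b : 'I_N) (g s : {perm T}).

Definition comp i g : idx := [ffun k => i (g k)].
Definition upd i (k : T) a : idx := [ffun l => if l == k then a else i l].

Lemma updE i k a l : upd i k a l = if l == k then a else i l.
Proof. by rewrite ffunE. Qed.

Lemma upd_id i k a : upd (upd i k a) k (i k) = i.
Proof. by apply/ffunP => l; rewrite !updE; case: eqP => // ->. Qed.

(** Exchanging the old value at k with the fresh one is an involution on pairs. The factor N pays
    for the extra index, so index functions never have to be split along a set of slots. *)
Lemma resample (F : idx -> K) k : N%:R * \sum_i F i = \sum_i \sum_a F (upd i k a).
Proof.
rewrite pair_big /= (reindex_inj (h := fun q : idx * 'I_N => (upd q.1 k q.2, q.1 k))) /=; last first.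
  apply: (can_inj (g := fun q : idx * 'I_N => (upd q.1 k q.2, q.1 k))) => -[i a] /=.
  by rewrite upd_id updE eqxx.
rewrite (eq_bigr (fun q : idx * 'I_N => F q.1)) => [|[i a] _ /=]; last by rewrite upd_id.
rewrite -(pair_big xpredT xpredT (fun i (_ : 'I_N) => F i)) /= mulr_sumr.
by apply: eq_bigr => i _; rewrite sumr_const card_ord mulr_natl.
Qed.

Definition indep (h : idx -> K) k := forall i a, h (upd i k a) = h i.

Variable X : T -> 'M[K]_N.
Variable g : {perm T}.

Let xf i k := X k (i k) (i (g k)).

(** Each factor N resamples the index at the next point of the orbit, and summing over it performs
    one matrix multiplication. Only the interior indices of the chain must be invisible to h; the
    ends stay free. *)
Lemma chain p m (h : idx -> K) : (m.+1 <= #|porbit g p|)%N ->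
  (forall k, (0 < k < m.+1)%N -> indep h ((g ^+ k)%g p)) ->
  N%:R ^+ m * \sum_(i : idx) (\prod_(k < m.+1) xf i ((g ^+ k)%g p)) * h i =
  \sum_(i : idx) (\prod_(k < m.+1) X ((g ^+ k)%g p)) (i p) (i ((g ^+ m.+1)%g p)) * h i.
Proof.
have inj k k' : (k < #|porbit g p|)%N -> (k' < #|porbit g p|)%N ->
     (g ^+ k)%g p = (g ^+ k')%g p -> k = k'.
  move=> lk lk' e; have := uniq_traject_porbit g p.
  move=> u; have := nth_uniq p _ _ u; rewrite !size_traject => /(_ k k' lk lk').
  by rewrite !nth_traject // -!permX e eqxx => /esym/eqP.
elim: m h => [|m IH] h hm hh.
  rewrite expr0 mul1r; apply: eq_bigr => i _.
  by rewrite !big_ord_recl !big_ord0 !mulr1 /xf !expg0 expg1 !perm1.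
set y := (g ^+ m.+1)%g p; set y' := (g ^+ m.+2)%g p.
have yE : g y = y' by rewrite /y' [in RHS]expgSr permM.
pose h' i := xf i y * h i.
have y'ne k : (0 < k < m.+2)%N -> y' != (g ^+ k)%g p.
  case/andP=> k0 km; case: (ltnP m.+2 #|porbit g p|) => hm'.
    by apply/eqP => /inj; move/(_ hm' (ltn_trans km hm')) => e; move: km; rewrite e ltnn.
  have em : m.+2 = #|porbit g p| by apply/eqP; rewrite eqn_leq hm hm'.
  have -> : y' = (g ^+ 0)%g p.
    rewrite /y' em expg0 perm1 permX; exact: iter_porbit.
  apply/eqP => /inj; rewrite -em => /(_ isT km) e; by rewrite -e in k0.
have h'i k : (0 < k < m.+1)%N -> indep h' ((g ^+ k)%g p).
  case/andP=> k0 km i a; rewrite /h' hh ?k0 ?(ltnW km) //; last by rewrite ltnW.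
  congr (_ * _); rewrite /xf !updE yE.
  rewrite (negbTE (y'ne k _)) ?k0 ?(ltnW km) //; last by rewrite ltnW.
  case: eqP => // /inj e; have e' := e hm (ltn_trans km hm).
  by move: km; rewrite -e' ltnn.
rewrite exprS -mulrA.
have -> : \sum_(i : idx) (\prod_(k < m.+2) xf i ((g ^+ k)%g p)) * h i =
   \sum_(i : idx) (\prod_(k < m.+1) xf i ((g ^+ k)%g p)) * h' i.
  by apply: eq_bigr => i _; rewrite big_ord_recr /= -mulrA.
rewrite IH ?(ltnW hm) // (resample _ y); apply: eq_bigr => i _.
rewrite [in RHS]big_ord_recr /= mxE mulr_suml; apply: eq_bigr => a _.
have pne : p != y.
  apply/eqP => e; have /inj : (g ^+ 0)%g p = (g ^+ m.+1)%g p by rewrite expg0 perm1 -/y -e.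
  by move=> /(_ _ hm); case: #|_| hm => // n _ /(_ isT).
rewrite /h' hh ?ltnSn //; rewrite /xf -/y !updE eqxx (negbTE pne) yE.
by rewrite ifN ?mulrA //; apply: y'ne; rewrite ltnSn.
Qed.

Definition mcyc (c : {set T}) : 'M[K]_N :=
  if [pick i in c] is Some i then \prod_(k < #|c|) X ((g ^+ k)%g i) else 1.

(** Closing the chain into a trace costs one more factor N, for the common end point. *)
Lemma cycle_trace (c : {set T}) (h : idx -> K) : c \in porbits g ->
  (forall k, k \in c -> indep h k) ->
  N%:R ^+ #|c| * \sum_(i : idx) (\prod_(k in c) xf i k) * h i = \tr (mcyc c) * \sum_i h i.
Proof.
move=> /imsetP[q _ cq] hh; rewrite /mcyc; case: pickP => [p pc|/(_ q)]; last first.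
  by rewrite cq porbit_id.
have {q}cq : c = porbit g p.
  by rewrite cq; apply/eqP; rewrite eq_porbit_mem porbit_sym -cq.
have [m mE] : exists m, #|c| = m.+1.
  by have : (0 < #|c|)%N; [apply/card_gt0P; exists p|case: #|c| => // m _; exists m].
have prodE i : \prod_(k in c) xf i k = \prod_(k < m.+1) xf i ((g ^+ k)%g p).
  rewrite cq; rewrite (eq_bigl (mem (traject g p #|porbit g p|))); last first.
    by move=> k; rewrite porbit_traject.
  rewrite -big_uniq ?uniq_traject_porbit //= -cq mE.
  rewrite (big_nth p) size_traject big_mkord; apply: eq_bigr => k _.
  by rewrite nth_traject // permX.
under eq_bigr => i _ do rewrite prodE.
rewrite mE exprS -mulrA chain ?mE -?cq ?mE //; last first.
  by move=> k _; apply: hh; rewrite cq mem_porbit.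
rewrite (resample _ p) mulr_sumr; apply: eq_bigr => i _.
rewrite /mxtrace mulr_suml; apply: eq_bigr => a _.
have e : (g ^+ m.+1)%g p = p by rewrite -mE cq permX; exact: iter_porbit.
by rewrite e !updE eqxx hh.
Qed.

Lemma cycles_trace (S : seq {set T}) (h : idx -> K) : uniq S -> {subset S <= porbits g} ->
  (forall c k, c \in S -> k \in c -> indep h k) ->
  N%:R ^+ (\sum_(c <- S) #|c|) * \sum_(i : idx) (\prod_(c <- S) \prod_(k in c) xf i k) * h i =
  (\prod_(c <- S) \tr (mcyc c)) * \sum_i h i.
Proof.
elim: S h => [|c S IH] h /=; first by rewrite !big_nil expr0 !mul1r => *; apply: eq_bigr => i _; rewrite big_nil mul1r.
case/andP=> cS uS sub hh; rewrite !big_cons exprD [N%:R ^+ _ * N%:R ^+ _]mulrC -[LHS]mulrA -[RHS]mulrA.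
have cp : c \in porbits g by apply: sub; rewrite inE eqxx.
pose h' i := (\prod_(c <- S) \prod_(k in c) xf i k) * h i.
have -> : \sum_(i : idx) (\prod_(c <- c :: S) \prod_(k in c) xf i k) * h i =
  \sum_(i : idx) (\prod_(k in c) xf i k) * h' i.
  by apply: eq_bigr => i _; rewrite big_cons mulrA.
rewrite cycle_trace // => [|k kc i a].
  rewrite mulrCA IH //; first by move=> x xS; apply: sub; rewrite inE xS orbT.
  by move=> x k xS; apply: hh; rewrite inE xS orbT.
rewrite /h' (hh c k (mem_head _ _) kc); congr (_ * _).
rewrite !big_seq; apply: eq_bigr => c' c'S; apply: eq_bigr => l lc'.
have c'p : c' \in porbits g by apply: sub; rewrite inE c'S orbT.
have kn l' : l' \in c' -> l' != k.
  move=> l'c'; apply: contraNneq cS => e; rewrite e in l'c'.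
  case/imsetP: cp kc => q _ -> kq; case/imsetP: c'p l'c' c'S => q' _ -> kq' qS.
  have -> : porbit g q = porbit g q'.
    by apply/eqP; rewrite eq_porbit_mem porbit_sym -eq_porbit_mem; move: kq kq'; rewrite -!eq_porbit_mem => /eqP <- /eqP <-.
  exact: qS.
have gl : g l \in c'.
  case/imsetP: c'p lc' => q' _ ->; rewrite -!eq_porbit_mem => /eqP <-.
  by rewrite eq_porbit_mem; have := mem_porbit g 1 l; rewrite expg1.
by rewrite /xf !updE (negbTE (kn _ lc')) (negbTE (kn _ gl)).
Qed.

End Tensors.
Local Open Scope set_scope.

(** * Contractions of moment tensors *)

Section TensorMoments.
Context {R : realType} {disp : measure_display} {Omega : measurableType disp}.
Variables (P : probability Omega R) (N d : nat).
Hypothesis N0 : (0 < N)%N.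
Local Notation MN := 'M[R[i]]_N.
Local Notation T := 'I_d.
Local Notation idx := {ffun T -> 'I_N}.
Variables (A B : Omega -> MN).
Hypotheses (rA : random_mx A) (rB : random_mx B) (hA : has_moments P A) (hB : has_moments P B).
Hypothesis ind : independent_mx P A B.
Implicit Types (Q : {set {set T}}) (g : {perm T}) (i j : idx).
Variable X : T -> Omega -> MN.
Hypothesis mX : forall k a b, mixf A B (fun w => X k w a b).

(* The contraction of the tensor [S] with the permutation operator of [g]; for
   [tens P X Q] it is the product over the blocks of [Q] of the expectations of
   products of traces along the cycles of [g]. *)
Definition LT (S : idx -> idx -> R[i]) g := \sum_i S i (comp i g).

Definition tens1 (C : {set T}) i j := cexpect P (fun w => \prod_(k in C) X k w (i k) (j k)).
Definition tens Q i j := \prod_(C in Q) tens1 C i j.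

Definition mom1 g (C : {set T}) : R[i] :=
  cexpect P (fun w => \prod_(c in cycles_in g C) \tr (mcyc (X^~ w) g c)).
Definition mom g Q := \prod_(C in Q) mom1 g C.

Lemma cover_cycles g (Q : {set {set T}}) (C : {set T}) : isp Q -> part_le (porbits g) Q -> C \in Q ->
  finset.cover (cycles_in g C) = C /\ finset.trivIset (cycles_in g C).
Proof.
move=> hQ gQ CQ; have hg := isp_porbits g.
have cC := closed_block hg hQ gQ CQ.
split; last by apply: finset.trivIsetS (partition_trivIset hg); apply/fintype.subsetP => c; rewrite finset.inE => /andP[].
apply/setP => k; apply/bigcupP/idP => [[c]|kC].
  by rewrite finset.inE => /andP[_ /fintype.subsetP h] /h.
exists (porbit g k); last exact: porbit_id.
rewrite finset.inE imset_f //=; rewrite (closed_sub hg cC (imset_f _ _) (porbit_id g k)) //.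
Qed.

Lemma closed_perm g Q (C : {set T}) k : isp Q -> part_le (porbits g) Q -> C \in Q ->
  k \in C -> g k \in C.
Proof.
move=> hQ gQ CQ kC; have := porbits_leP g hQ gQ k; rewrite -in_pblock //.
by rewrite (isp_block hQ CQ kC).
Qed.

Lemma LT_block Q (C : {set T}) g (h : idx -> R[i]) : isp Q -> part_le (porbits g) Q -> C \in Q ->
  (forall k, k \in C -> indep h k) ->
  N%:R ^+ #|C| * \sum_i tens1 C i (comp i g) * h i = mom1 g C * \sum_i h i.
Proof.
move=> hQ gQ CQ hh; have [cov tri] := cover_cycles hQ gQ CQ.
have mF i : mixf A B (fun w => \prod_(k in C) X k w (i k) (i (g k))).
  by apply: mixf_prod => k _; exact: mX.
have iF i := mixf_cint rA rB hA hB ind (mF i).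
transitivity (cexpect P (fun w => N%:R ^+ #|C| * \sum_i h i * \prod_(k in C) X k w (i k) (i (g k)))).
  rewrite cexpectZ; last by apply: cint_sum => i _; apply: cintZ.
  rewrite cexpect_sum; last by move=> i _; apply: cintZ.
  congr (_ * _); apply: eq_bigr => i _; rewrite cexpectZ // mulrC; congr (_ * cexpect _ _).
  by apply/funext => w; apply: eq_bigr => k _; rewrite ffunE.
rewrite /mom1 mulrC -cexpectZ; last first.
  apply: (mixf_cint rA rB hA hB ind); apply: mixf_prod => c _.
  have mprod (n : nat) (f : nat -> T) a b : mixf A B (fun w => (\prod_(k < n) X (f k) w) a b).
    elim: n a b => [|n IH] a b.
      under eq_fun do rewrite big_ord0; rewrite /=.
      have -> : (fun _ : Omega => (1 : MN) a b) = (fun=> (a == b)%:R) by apply/funext => w; rewrite mxE.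
      exact: mixf_cst.
    under eq_fun do rewrite big_ord_recr /= mxE.
    by apply: mixf_sum => l _; apply: mixf_mul.
  rewrite /mcyc; case: pickP => [p _|_].
    by rewrite /mxtrace; apply: mixf_sum => a _; apply: (mprod _ (fun n => (g ^+ n)%g p)).
  rewrite /mxtrace; apply: mixf_sum => a _.
  have -> : (fun _ : Omega => (1 : MN) a a) = (fun=> 1) by apply/funext => w; rewrite mxE eqxx.
  exact: mixf_cst.
congr (cexpect _ _); apply/funext => w.
have := @cycles_trace _ N d (X^~ w) g _ h (enum_uniq (cycles_in g C)).
have s1 : {subset enum (cycles_in g C) <= porbits g}.
  by move=> c; rewrite mem_enum finset.inE => /andP[].
have s2 : forall (c : {set T}) (k : T), c \in enum (cycles_in g C) -> k \in c -> indep h k.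
  by move=> c k; rewrite mem_enum finset.inE => /andP[_ /fintype.subsetP cC] /cC; exact: hh.
move=> /(_ s1 s2); rewrite !big_enum /= [RHS]mulrC => <-.
congr (_ ^+ _ * _); first by rewrite -{1}cov; have := tri; rewrite /finset.trivIset => /eqP ->.
apply: eq_bigr => i _; rewrite mulrC; congr (_ * _).
by rewrite -[in LHS]cov finset.big_trivIset // big_enum.
Qed.

(** The powers of N produced by the blocks multiply to N^d, the number of index functions, and
    cancel. *)
Lemma LT_tens Q g : isp Q -> part_le (porbits g) Q -> LT (tens Q) g = mom g Q.
Proof.
move=> hQ gQ; rewrite /LT /mom /tens.
suff H : forall (S : seq {set T}) (h : idx -> R[i]), uniq S -> {subset S <= Q} ->
   (forall C k, C \in S -> k \in C -> indep h k) ->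
   N%:R ^+ (\sum_(C <- S) #|C|) * \sum_i (\prod_(C <- S) tens1 C i (comp i g)) * h i =
   (\prod_(C <- S) mom1 g C) * \sum_i h i.
  have := H (enum Q) (fun=> 1) (enum_uniq _); rewrite !big_enum /=.
  have s : {subset enum Q <= Q} by move=> C; rewrite mem_enum.
  move=> /(_ s (fun _ _ _ _ _ _ => erefl)) e0; move: e0.
  have -> : (\sum_(C in Q) #|C|)%N = d by rewrite -(card_partition hQ) cardsT card_ord.
  rewrite sumr_const card_ffun !card_ord -[1 *+ _]/(_%:R) natrX [RHS]mulrC => /mulfI e.
  rewrite -e ?expf_neq0 ?pnatr_eq0 -?lt0n //.
  by apply: eq_bigr => i _; rewrite big_enum mulr1.
elim=> [|C S IH] h /=; first by rewrite !big_nil expr0 !mul1r => *; apply: eq_bigr => i _; rewrite big_nil mul1r.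
case/andP=> CS uS sub hh; rewrite !big_cons exprD [N%:R ^+ _ * N%:R ^+ _]mulrC -[LHS]mulrA -[RHS]mulrA.
have CQ : C \in Q by apply: sub; rewrite finset.inE eqxx.
pose h' i := (\prod_(D <- S) tens1 D i (comp i g)) * h i.
have -> : \sum_(i : idx) (\prod_(D <- C :: S) tens1 D i (comp i g)) * h i =
  \sum_(i : idx) tens1 C i (comp i g) * h' i.
  by apply: eq_bigr => i _; rewrite big_cons mulrA.
rewrite (LT_block hQ gQ CQ) => [|k kC i a].
  rewrite mulrCA IH //; first by move=> x xS; apply: sub; rewrite finset.inE xS orbT.
  by move=> x k xS; apply: hh; rewrite finset.inE xS orbT.
rewrite /h' (hh C k (mem_head _ _) kC); congr (_ * _).
rewrite !big_seq; apply: eq_bigr => D DS.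
have DQ : D \in Q by apply: sub; rewrite finset.inE DS orbT.
have kn l : l \in D -> l != k.
  move=> lD; apply: contraNneq CS => e; rewrite e in lD.
  by rewrite -(isp_block hQ CQ kC) (isp_block hQ DQ lD).
congr (cexpect _ _); apply/funext => w; apply: eq_bigr => l lD.
have glD := closed_perm hQ gQ DQ lD.
by rewrite !ffunE (negbTE (kn _ lD)) (negbTE (kn _ glD)).
Qed.

End TensorMoments.
Local Close Scope set_scope.
(** * Schur-Weyl duality and unitary invariance *)

Local Open Scope set_scope.
Section SchurWeyl.
Variables (K : numFieldType) (N d : nat).
Local Notation T := 'I_d.
Local Notation idx := {ffun T -> 'I_N}.
Implicit Types (i j : idx) (a b : 'I_N) (g s : {perm T}) (Q : {set {set T}}) (S : idx -> idx -> K).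

Lemma ffE i j : i = j -> forall k, i k = j k. Proof. by move->. Qed.

(* Commutation of [S] with the derivation action of the matrix units [E_ab] on
   the tensor factors indexed by a block of [Q]. *)
Definition commQ Q S := forall (C : {set T}) a b i j, C \in Q ->
  \sum_(k in C) (i k == a)%:R * S (upd i k b) j =
  \sum_(k in C) (j k == b)%:R * S i (upd j k a).

Definition rho g i j : K := (j == comp i g)%:R.

Lemma commQ_rho Q g : isp Q -> part_le (porbits g) Q -> commQ Q (rho g).
Proof.
move=> hQ gQ C a b i j CQ.
have gC k : (g k \in C) = (k \in C).
  have cC := closed_block hQ hQ (part_le_refl hQ) CQ.
  exact: (stab_closed hQ cC gQ).
rewrite (reindex_inj (@perm_inj _ g)) /=; apply: eq_big => [k|k _]; first exact: gC.
rewrite /rho -!natrM !mulnb; congr (nat_of_bool _)%:R.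
apply/andP/andP => [[/eqP ia /eqP jE]|[/eqP jb /eqP e]].
  split; first by rewrite jE ffunE updE eqxx.
  apply/eqP/ffunP => l; rewrite updE jE !ffunE; case: eqP => [->|ne]; first by rewrite ia.
  by case: eqP => // /perm_inj.
split; first by have := ffE e k; rewrite updE eqxx ffunE => <-.
apply/eqP/ffunP => l; rewrite ffunE updE; case: (eqVneq (g l) (g k)) => [/perm_inj -> //|ne].
have := ffE e l; rewrite updE ffunE; case: eqP => [elk|_ -> //].
by rewrite elk eqxx in ne.
Qed.

Lemma commQ_sum Q (I : finType) (p : pred I) (c : I -> K) (F : I -> idx -> idx -> K) :
  (forall x, p x -> commQ Q (F x)) -> commQ Q (fun i j => \sum_(x | p x) c x * F x i j).
Proof.
move=> H C a b i j CQ.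
transitivity (\sum_(x | p x) c x * \sum_(k in C) (i k == a)%:R * F x (upd i k b) j).
  under [RHS]eq_bigr => x _ do rewrite mulr_sumr.
  rewrite exchange_big /=; apply: eq_bigr => k _; rewrite mulr_sumr; apply: eq_bigr => x _.
  by rewrite mulrCA.
transitivity (\sum_(x | p x) c x * \sum_(k in C) (j k == b)%:R * F x i (upd j k a)).
  by apply: eq_bigr => x px; rewrite (H x px).
under eq_bigr => x _ do rewrite mulr_sumr.
rewrite exchange_big /=; apply: eq_bigr => k _; rewrite mulr_sumr; apply: eq_bigr => x _.
by rewrite mulrCA.
Qed.

Lemma commQ_sub Q S S' : commQ Q S -> commQ Q S' -> commQ Q (fun i j => S i j - S' i j).
Proof.
move=> H H' C a b i j CQ.
under eq_bigr => k _ do rewrite mulrBr.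
under [RHS]eq_bigr => k _ do rewrite mulrBr.
by rewrite !sumrB (H C a b i j CQ) (H' C a b i j CQ).
Qed.

Lemma upd_same i k a : i k = a -> upd i k a = i.
Proof. by move=> e; apply/ffunP => l; rewrite updE; case: eqP => // ->. Qed.

(** The diagonal unit E_aa counts the indices equal to a within the block, and a nonzero entry
    forces the two counts to agree. *)
Lemma commQ_weight Q S i j (C : {set T}) a : commQ Q S -> C \in Q -> S i j != 0 ->
  #|[set k in C | i k == a]| = #|[set k in C | j k == a]|.
Proof.
move=> cS CQ Sij; have := cS C a a i j CQ.
have E (f : idx) (F : idx -> K) : \sum_(k in C) (f k == a)%:R * F (upd f k a) =
    #|[set k in C | f k == a]|%:R * F f.
  rewrite mulr_natl -sumr_const [in RHS]big_mkcond [LHS]big_mkcond /=.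
  apply: eq_bigr => k _; rewrite finset.inE; case: (k \in C) => //=; case: eqP => [e|_].
    by rewrite mul1r upd_same.
  by rewrite mul0r.
rewrite (E i (S^~ j)) (E j (S i)) => /(mulIf Sij) /eqP; by rewrite eqr_nat => /eqP.
Qed.

Lemma commQ_perm Q S i j : isp Q -> commQ Q S -> injective j -> S i j != 0 ->
  exists2 g, part_le (porbits g) Q & j = comp i g.
Proof.
move=> hQ cS ij Sij.
have ex k : exists l, (l \in finset.pblock Q k) && (i l == j k).
  have := commQ_weight (j k) cS (isp_pblock k hQ) Sij.
  have -> : [set l in finset.pblock Q k | j l == j k] = [set k].
    apply/setP => l; rewrite !finset.inE; apply/andP/eqP => [[_ /eqP/ij]//|->].
    by rewrite eqxx isp_mem.
  rewrite cards1 => /eqP/cards1P[l e]; exists l.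
  by have := set11 l; rewrite -e finset.inE.
pose f k := xchoose (ex k).
have fP k : (f k \in finset.pblock Q k) && (i (f k) == j k) by exact: (xchooseP (ex k)).
have f_inj : injective f.
  move=> k l e; apply: ij; have /andP[_ /eqP <-] := fP k; have /andP[_ /eqP <-] := fP l.
  by rewrite e.
exists (perm f_inj); last first.
  by apply/ffunP => k; rewrite ffunE permE; have /andP[_ /eqP] := fP k.
apply/porbits_leP => // k; rewrite permE -in_pblock //.
by have /andP[] := fP k.
Qed.

Definition zcol S j := forall i, S i j = 0.

(** Since the value [j k0] occurs only at k0, the relation with b = [j k0] reduces to the single
    term in which this index becomes a. *)
Lemma zcol_move Q S j (k0 : T) a : isp Q -> commQ Q S -> zcol S j ->
  (forall l, l != k0 -> j l != j k0) -> zcol S (upd j k0 a).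
Proof.
move=> hQ cS zj un i.
have := cS (finset.pblock Q k0) a (j k0) i j (isp_pblock k0 hQ).
rewrite big1 => [|k _]; last by rewrite zj mulr0.
rewrite (bigD1 k0) ?isp_mem //= eqxx mul1r big1 ?addr0 // => l /andP[_ ne].
by rewrite (negbTE (un l ne)) mul0r.
Qed.

(** Slots are changed one at a time; as the values of w avoid those of j, the index about to move is
    always the only one with its value. Here w may have repeated values. *)
Lemma zcol_transport Q S j (w : idx) : isp Q -> commQ Q S -> zcol S j -> injective j ->
  (forall k l : T, w k != j l) -> zcol S w.
Proof.
move=> hQ cS zj ij wj.
pose jm (m : nat) : idx := [ffun k : T => if (k < m)%N then w k else j k].
have H m : (m <= d)%N -> zcol S (jm m).
  elim: m => [|m IH] hm.
    by have -> : jm 0%N = j by apply/ffunP => k; rewrite ffunE.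
  have -> : jm m.+1 = upd (jm m) (Ordinal hm) (w (Ordinal hm)).
    apply/ffunP => k; rewrite updE !ffunE ltnS leq_eqVlt -val_eqE /=.
    case: eqP => [e|_] //=; by rewrite (_ : k = Ordinal hm) //; apply: val_inj.
  apply: (zcol_move _ hQ cS (IH (ltnW hm))) => l ne.
  rewrite !ffunE ltnn; case: ifP => _; first exact: wj.
  by apply: contra_neq ne => /ij.
have -> : w = jm d by apply/ffunP => k; rewrite ffunE ltn_ord.
exact: H.
Qed.

(** Leaves d fresh values besides the at most 2d values of [col0] and of any other column. *)
Hypothesis hN : (3 * d <= N)%N.

Lemma fresh (V : {set 'I_N}) : (#|V| <= 2 * d)%N ->
  exists j : idx, injective j /\ forall k, j k \notin V.
Proof.
move=> hV; have h : (d <= #|~: V|)%N by have := cardsC V; rewrite card_ord; move: hV hN; lia.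
exists [ffun k => enum_val (widen_ord h k)]; split.
  by move=> k l; rewrite !ffunE => /enum_val_inj /(f_equal val) /= e; apply: val_inj.
by move=> k; rewrite ffunE; have := enum_valP (widen_ord h k); rewrite finset.inE.
Qed.

Lemma hNd : (d <= N)%N. Proof. by move: hN; lia. Qed.

Definition col0 : idx := [ffun k => widen_ord hNd k].

Lemma col0_inj : injective col0.
Proof. by move=> k l; rewrite !ffunE => /(f_equal val) /= e; apply: val_inj. Qed.

(** Read off in the column [col0]: its indices being distinct, the operators of different
    permutations meet it in different rows. *)
Definition swcoef S g := S (comp col0 g^-1%g) col0.

(* Schur-Weyl duality: the defect of the expansion commutes with the matrix units
   and vanishes on the column [col0], which has distinct indices; any other column
   is reached from it by moving indices through fresh values. *)
Theorem schur_weyl Q S : isp Q -> commQ Q S ->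
  forall i j, S i j = \sum_(g | part_le (porbits g) Q) swcoef S g * rho g i j.
Proof.
move=> hQ cS; set D := fun i j => S i j - \sum_(g | part_le (porbits g) Q) swcoef S g * rho g i j.
have cD : commQ Q D.
  by apply: commQ_sub cS _; apply: commQ_sum => g gQ; exact: commQ_rho.
suff H : forall j, zcol D j by move=> i j; apply/eqP; rewrite -subr_eq0; apply/eqP; exact: (H j i).
have z0 : zcol D col0.
  move=> i; rewrite /D.
  have un g g' : col0 = comp i g -> col0 = comp i g' -> g = g'.
    move=> e e'; have h : i = comp col0 g^-1%g.
      by apply/ffunP => k; rewrite [RHS]ffunE {1}e [RHS]ffunE permKV.
    apply/permP => k; have := ffE e' k; rewrite [comp i g' k]ffunE {1}h [comp _ _ _]ffunE.
    by move=> /col0_inj e1; rewrite [in LHS]e1 permKV.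
  case: (boolP [exists g : {perm T}, part_le (porbits g) Q && (col0 == comp i g)]) => [/existsP[g /andP[gQ /eqP e]]|ne].
    rewrite (bigD1 g) //= [rho g i col0]/rho -e eqxx mulr1 big1 ?addr0 => [|g' /andP[_ ne]]; last first.
      rewrite /rho; case: eqP => [e'|_]; last by rewrite mulr0.
      by rewrite (un g' g e' e) eqxx in ne.
    rewrite /swcoef; have -> : comp col0 g^-1%g = i.
      by apply/ffunP => k; rewrite [LHS]ffunE {1}e [LHS]ffunE permKV.
    by rewrite subrr.
  rewrite big1 ?subr0 => [|g gQ]; last first.
    rewrite /rho; case: eqP => [e|_]; last by rewrite mulr0.
    by case/negP: ne; apply/existsP; exists g; rewrite gQ -e eqxx.
  apply/eqP; apply: contraNT ne => /(commQ_perm hQ cS col0_inj)[g gQ e].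
  by apply/existsP; exists g; rewrite gQ -e eqxx.
move=> w.
pose V := [set col0 k | k : T] :|: [set w k | k : T].
have hV : (#|V| <= 2 * d)%N.
  apply: leq_trans (leq_card_setU _ _) _; rewrite mul2n -addnn.
  by apply: leq_add; apply: leq_trans (leq_imset_card _ _) _; rewrite card_ord.
have [j' [ij' nV]] := fresh hV.
have zj' : zcol D j'.
  apply: (zcol_transport hQ cD z0 col0_inj) => k l; apply: contraNneq (nV k) => ->.
  by rewrite finset.inE imset_f.
apply: (zcol_transport hQ cD zj' ij') => k l; apply: contraNneq (nV l) => <-.
by apply/setUP; right; apply: imset_f.
Qed.

End SchurWeyl.
Local Close Scope set_scope.
Local Open Scope set_scope.

(** * Contractions and the group algebra *)

Section TensorAlgebra.
Variables (R : realType) (N d : nat).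
Hypothesis N0 : (0 < N)%N.
Local Notation K := R[i].
Local Notation T := 'I_d.
Local Notation idx := {ffun T -> 'I_N}.
Implicit Types (i j : idx) (a b : 'I_N) (g s : {perm T}) (Q C : {set {set T}}) (S : idx -> idx -> K).

Definition zz g : K := N%:R ^+ #|porbits g|.

Lemma natN0 : (N%:R : K) != 0. Proof. by rewrite pnatr_eq0 -lt0n. Qed.

Lemma tr1 : \tr (1 : 'M[K]_N) = N%:R.
Proof. exact: mxtrace1. Qed.

(** The case of identity matrices in [cycles_trace]: each cycle contributes the trace N. *)
Lemma fix_count g : \sum_(i : idx) (comp i g == i)%:R = zz g.
Proof.
have := @cycles_trace (K : numFieldType) N d (fun=> (1 : 'M[K]_N)) g _ (fun=> 1) (enum_uniq (porbits g)).
have s1 : {subset enum (porbits g) <= porbits g} by move=> c; rewrite mem_enum.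
move=> /(_ s1 (fun _ _ _ _ _ _ => erefl)).
have hP := isp_porbits g.
rewrite !big_enum /= -(card_partition hP) cardsT card_ord.
rewrite [X in _ = X * _ -> _](eq_bigr (fun=> N%:R)); last first.
  by move=> c _; rewrite -tr1; congr (\tr _); rewrite /mcyc; case: pickP => // p _; exact: big1.
rewrite prodr_const [X in _ = _ * X]sumr_const card_ffun !card_ord -[1 *+ _]/(_%:R) natrX [RHS]mulrC.
move=> /(mulfI (expf_neq0 _ natN0)); rewrite -/(zz g) => <-; apply: eq_bigr => i _; rewrite mulr1 big_enum /=.
have <- : \prod_(k in finset.cover (porbits g)) (1 : 'M[K]_N) (i k) (i (g k)) =
   \prod_(c in porbits g) \prod_(k in c) (1 : 'M[K]_N) (i k) (i (g k)).
  by rewrite finset.big_trivIset // (partition_trivIset hP).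
rewrite (finset.cover_partition hP).
case: eqP => [e|ne].
  by rewrite big1 // => k _; rewrite mxE -{1}e ffunE eqxx.
have [k hk] : exists k, i k != i (g k).
  apply/existsP; apply: contra_notT ne => /existsPn h; apply/ffunP => k.
  by rewrite ffunE; apply/esym/eqP; have := h k; rewrite negbK.
by rewrite (bigD1 k) ?finset.inE //= mxE (negbTE hk) mul0r.
Qed.

Lemma comp_comp i g s : comp (comp i g) s = comp i (s * g)%g.
Proof. by apply/ffunP => k; rewrite !ffunE permM. Qed.

Lemma comp1 i : comp i 1%g = i.
Proof. by apply/ffunP => k; rewrite ffunE perm1. Qed.

Lemma comp_inj g : injective (fun i => comp i g).
Proof. by apply: (can_inj (g := fun i => comp i g^-1%g)) => i; rewrite comp_comp mulVg comp1. Qed.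

Lemma LT_rho s g : LT (@rho K N d s) g = zz (g * s^-1)%g.
Proof.
rewrite -fix_count /LT (reindex_inj (@comp_inj s^-1%g)); apply: eq_bigr => i _.
by rewrite /rho !comp_comp mulgV comp1.
Qed.

Lemma eq_LT S S' g : (forall i j, S i j = S' i j) -> LT S g = LT S' g.
Proof. by move=> H; apply: eq_bigr => i _. Qed.

Lemma LT_sum_rho Q (c : {perm T} -> K) g :
  LT (fun i j => \sum_(s | part_le (porbits s) Q) c s * @rho K N d s i j) g = gconv Q c zz g.
Proof.
rewrite /LT exchange_big; apply: eq_bigr => s sQ.
by rewrite -mulr_sumr -LT_rho.
Qed.

Definition tmul S S' i j : K := \sum_(l : idx) S i l * S' l j.

(** Only S has to be a combination of permutation operators; S' enters through its contractions
    alone. This leaves the second matrix arbitrary. *)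
Lemma LT_tmul_l Q (c : {perm T} -> K) S S' g :
  (forall i j, S i j = \sum_(s | part_le (porbits s) Q) c s * rho K s i j) ->
  LT (tmul S S') g = gconv Q c (LT S') g.
Proof.
move=> HS; rewrite /LT /tmul.
transitivity (\sum_i \sum_(s | part_le (porbits s) Q) c s * S' (comp i s) (comp i g)).
  apply: eq_bigr => i _.
  under eq_bigr => l _ do rewrite HS mulr_suml.
  rewrite exchange_big; apply: eq_bigr => s sQ.
  rewrite (bigD1 (comp i s)) //= /rho eqxx mulr1 big1 ?addr0 // => l /negbTE ->.
  by rewrite mulr0 mul0r.
rewrite exchange_big; apply: eq_bigr => s sQ; rewrite -mulr_sumr; congr (_ * _).
rewrite (reindex_inj (@comp_inj s^-1%g)); apply: eq_bigr => i _.
by rewrite !comp_comp mulgV comp1.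
Qed.

Lemma LT_tmul_r Q (c : {perm T} -> K) S S' g : isp Q -> part_le (porbits g) Q ->
  (forall i j, S' i j = \sum_(s | part_le (porbits s) Q) c s * rho K s i j) ->
  LT (tmul S S') g = gconv Q (LT S) c g.
Proof.
move=> hQ gQ HS; rewrite /LT /tmul.
transitivity (\sum_i \sum_(s | part_le (porbits s) Q) c s * S i (comp i (s^-1 * g)%g)).
  apply: eq_bigr => i _.
  under eq_bigr => l _ do rewrite HS mulr_sumr.
  rewrite exchange_big; apply: eq_bigr => s sQ.
  rewrite (bigD1 (comp i (s^-1 * g)%g)) //= /rho comp_comp mulKVg eqxx mulr1 mulrC big1 ?addr0 // => l ne.
  case: eqP => [e|]; last by rewrite !mulr0.
  by case/eqP: ne; apply: (@comp_inj s); rewrite -e comp_comp mulKVg.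
rewrite exchange_big /= /gconv.
rewrite [RHS](reindex_inj (inj_comp (mulIg g) (@invg_inj _))) /=.
apply: eq_big => [s|s sQ]; last first.
  by rewrite -mulr_sumr invMg invgK mulKVg mulrC.
apply/idP/idP => h; first by apply: porbits_leM; rewrite ?porbits_leV.
rewrite -(porbits_leV s hQ) -[s^-1%g](mulgK g); apply: porbits_leM => //.
by rewrite (porbits_leV g hQ).
Qed.

(* The tensor [S] is the identity matrix in the slot [k]. *)
Definition slotunit S (k : T) :=
  (forall i j, i k != j k -> S i j = 0) /\
  (forall i j a, i k = j k -> S (upd i k a) (upd j k a) = S i j).

Lemma slotunit_rho s k : s k = k -> slotunit (@rho K N d s) k.
Proof.
move=> sk; have sl l : l != k -> (s l == k) = false.
  by move=> ne; apply: contraNF ne => /eqP e; rewrite -(inj_eq (@perm_inj _ s)) sk e.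
split=> [i j ne|i j a e]; rewrite /rho.
  by case: eqP => // e; move: ne; rewrite e ffunE sk eqxx.
congr (nat_of_bool _)%:R; apply/eqP/eqP => [h|->].
  apply/ffunP => l; have := ffE h l; rewrite !(ffunE, updE).
  case: (eqVneq l k) => [-> _|ne]; first by rewrite sk e.
  by rewrite sl.
apply/ffunP => l; rewrite !(ffunE, updE); case: (eqVneq l k) => [->|ne]; first by rewrite sk eqxx.
by rewrite sl.
Qed.

Lemma slotunit_sum (I : finType) (p : pred I) (c : I -> K) (F : I -> idx -> idx -> K) k :
  (forall x, p x -> slotunit (F x) k) -> slotunit (fun i j => \sum_(x | p x) c x * F x i j) k.
Proof.
move=> H; split=> [i j ne|i j a e].
  by rewrite big1 // => x px; have [->] := H x px; rewrite ?mulr0.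
by apply: eq_bigr => x px; have [_ ->] := H x px.
Qed.

(** Contraction bypasses an identity slot: k is cut out of its cycle, and the loop it leaves behind
    is worth N. *)
Lemma unit_step S k g : slotunit S k -> g k != k ->
  N%:R * LT S g = LT S (g * tperm k (g k))%g.
Proof.
move=> [S0 Su] gk; rewrite /LT (resample _ k); apply: eq_bigr => i _.
rewrite (bigD1 (i (g k))) //= big1 ?addr0 => [|a ne]; last first.
  by apply: S0; rewrite !ffunE eqxx (negbTE gk).
have -> : comp (upd i k (i (g k))) g = upd (comp i (g * tperm k (g k))%g) k (i (g k)).
  apply/ffunP => l; rewrite !(ffunE, updE) permM.
  case: (eqVneq l k) => [->|ne]; first by rewrite (negbTE gk).
  case: tpermP => [->|e|h1 h2]; rewrite ?eqxx //; last by rewrite ifN //; exact/eqP.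
  by case/eqP: ne; exact: (perm_inj e).
by apply: Su; rewrite ffunE permM tpermR.
Qed.

(** Cutting out the identity slots one after another reduces any permutation to one that fixes them
    all. *)
Lemma unit_ext Q S S' (I : {set T}) : isp Q -> (forall k, k \notin I -> slotunit S k) ->
  (forall k, k \notin I -> slotunit S' k) ->
  (forall g, part_le (porbits g) Q -> (forall k, k \notin I -> g k = k) -> LT S g = LT S' g) ->
  forall g, part_le (porbits g) Q -> LT S g = LT S' g.
Proof.
move=> hQ uS uS' H g; move: {2}#|_| (leqnn #|[set k in ~: I | g k != k]|) => n.
elim: n g => [|n IH] g hn gQ.
  apply: H => // k kI; apply/eqP; apply: contraTT hn => gk.
  by rewrite -ltnNge; apply/card_gt0P; exists k; rewrite !finset.inE kI.
case: (pickP (fun k => (k \notin I) && (g k != k))) => [k /andP[kI gk]|h]; last first.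
  by apply: H => // k kI; apply/eqP; have := h k; rewrite kI /= => /negbFE.
apply: (mulfI natN0); rewrite !(unit_step _ gk); [|exact: uS'|exact: uS].
set t := tperm k (g k).
have tQ : part_le (porbits (g * t)%g) Q.
  apply: porbits_leM => //; apply/porbits_leP => // l; rewrite /t; case: tpermP => [->|->|_ _].
  - exact: (porbits_leP _ hQ gQ).
  - by rewrite prel_sym; exact: (porbits_leP _ hQ gQ).
  exact: prel_refl.
apply: IH => //; rewrite -ltnS; apply: leq_trans hn; apply: proper_card; apply/properP; split.
  apply/fintype.subsetP => l; rewrite !finset.inE => /andP[-> ] /=; apply: contraNN => /eqP gl.
  rewrite permM gl /t; case: tpermP => // e; first by move: gk; rewrite -e gl eqxx.
  by apply/eqP; apply: (@perm_inj _ g); rewrite gl -e.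
exists k; first by rewrite !finset.inE kI.
by rewrite !finset.inE permM /t tpermR eqxx kI.
Qed.

Local Notation normc := (@Normc.normc R).

Lemma normc_sum (I : Type) (r : seq I) (p : pred I) (F : I -> K) :
  normc (\sum_(x <- r | p x) F x) <= \sum_(x <- r | p x) normc (F x).
Proof.
elim: r => [|x r IH]; first by rewrite !big_nil Normc.normc0.
rewrite !big_cons; case: (p x) => //; apply: le_trans (normcD_le _ _) _.
by rewrite lerD2l.
Qed.

Hypotheses (d0 : (0 < d)%N) (hN : (2 * d`! <= N)%N).

(* [zz] is invertible for large [N]: it equals N^d at the identity and is smaller
   by a factor [N] elsewhere. *)
Lemma gconv_zz_bound Q (c : {perm T} -> K) (B : R) : isp Q ->
  (forall g, part_le (porbits g) Q -> normc (gconv Q c zz g) <= B) ->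
  forall g, part_le (porbits g) Q -> normc (c g) <= 2 * B / N%:R ^+ d.
Proof.
move=> hQ H g gQ.
case: (@arg_maxP _ _ _ g (fun s => part_le (porbits s) Q) (fun s => normc (c s)) gQ) => g0 g0Q hmax.
apply: le_trans (hmax g gQ) _; set m : R := normc (c g0).
have Np : (0 : R) < N%:R ^+ d by rewrite exprn_gt0 // ltr0n.
rewrite ler_pdivlMr //.
have m0 : 0 <= m by exact: normc_ge0.
have z1 : zz 1%g = N%:R ^+ d.
  by rewrite /zz; have := rank_perm (1%g : {perm T}); rewrite /dmx perm_mx1 subrr mxrank0 add0n => ->.
have zle s : s != 1%g -> normc (zz s) <= N%:R ^+ d.-1.
  move=> s1; rewrite /zz normcX normc_nat; apply: ler_weXn2l; first by rewrite ler1n.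
  have h1 := rank_perm s; have h2 : #|porbits s| <> d by move=> /card_porbits_eq; apply/eqP.
  by move: h1 h2; move: #|porbits s| => n; lia.
have e : c g0 * N%:R ^+ d = gconv Q c zz g0 -
    \sum_(s | part_le (porbits s) Q && (s != g0)) c s * zz (g0 * s^-1)%g.
  by rewrite /gconv (bigD1 g0) //= mulgV z1 addrK.
have h1 : m * N%:R ^+ d <= B + d`!%:R * (m * N%:R ^+ d.-1).
  have -> : m * N%:R ^+ d = normc (c g0 * N%:R ^+ d) by rewrite Normc.normcM normcX normc_nat.
  rewrite e; apply: le_trans (normcD_le _ _) _; apply: lerD; first exact: H.
  rewrite (_ : normc (- _) = normc (\sum_(s | part_le (porbits s) Q && (s != g0)) c s * zz (g0 * s^-1)%g)); last first.
    exact: (@normcN R).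
  apply: le_trans (normc_sum _ _ _) _.
  apply: (@le_trans _ _ (\sum_(s : {perm T}) m * N%:R ^+ d.-1)).
    rewrite [leLHS]big_mkcond; apply: ler_sum => s _; case: ifP => [/andP[sQ ne]|_]; last first.
      by rewrite mulr_ge0 // exprn_ge0.
    rewrite Normc.normcM; apply: ler_pM; [exact: normc_ge0|exact: normc_ge0|exact: hmax s sQ|].
    by apply: zle; apply: contra ne => /eqP h; rewrite -[s]mul1g -h mulgVK.
  by rewrite sumr_const (_ : #|_| = d`!) ?card_Sn // mulr_natl.
(* At most d! terms, each bounded by m N^(d - 1) with N at least 2 d!, amount to at most half of m
   N^d. *)
have h2 : d`!%:R * (m * N%:R ^+ d.-1) <= m * N%:R ^+ d / 2.
  have -> : (N%:R : R) ^+ d = N%:R * N%:R ^+ d.-1 by rewrite -exprS prednK.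
  have q : (2 * d`!%:R : R) <= N%:R by rewrite -natrM ler_nat.
  have p0 : 0 <= m * N%:R ^+ d.-1 by rewrite mulr_ge0 // exprn_ge0.
  have aux (x n u v : R) : 2 * x * (u * v) <= n * (u * v) -> x * (u * v) <= u * (n * v) / 2.
    by move=> h; nra.
  exact: aux (d`!%:R) N%:R m (N%:R ^+ d.-1) (ler_wpM2r p0 q).
move: h1 h2; move: (d`!%:R * _) (m * _) => x y; lra.
Qed.

(** A square linear system, injective by [gconv_zz_bound] with B = 0. Its matrix is indexed by all
    permutations and completed by the identity outside those below Q. *)
Lemma gconv_zz_solve Q (f : {perm T} -> K) : isp Q -> exists c : {perm T} -> K,
  forall g, part_le (porbits g) Q -> gconv Q c zz g = f g.
Proof.
move=> hQ; pose H s := part_le (porbits s) Q.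
pose Z : 'M[K]_#|{perm T}| := \matrix_(x, y) (if H (enum_val x) && H (enum_val y) then
   zz (enum_val y * (enum_val x)^-1)%g else (x == y)%:R).
have uZ : Z \in unitmx.
  rewrite -row_free_unit -kermx_eq0; apply/eqP/row_matrixP => r; rewrite row0.
  have : row r (kermx Z) *m Z = 0 by rewrite -row_mul mulmx_ker row0.
  move: (row r (kermx Z)) => u uZ.
  have E y : \sum_x u 0 x * Z x y = 0 by have := f_equal (fun M : 'rV[K]__ => M 0 y) uZ; rewrite !mxE.
  have offH y : ~~ H (enum_val y) -> u 0 y = 0.
    move=> ny; have := E y; rewrite (bigD1 y) //= !mxE (negbTE ny) andbF eqxx mulr1.
    rewrite big1 ?addr0 // => x ne; by rewrite mxE (negbTE ny) andbF (negbTE ne) mulr0.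
  apply/rowP => y; rewrite mxE; case: (boolP (H (enum_val y))) => hy; last exact: offH.
  have G g : H g -> gconv Q (fun s => u 0 (enum_rank s)) zz g = 0.
    move=> hg; rewrite /gconv -[RHS](E (enum_rank g)) [RHS](bigID (fun x => H (enum_val x))) /=.
    rewrite [X in _ = _ + X]big1 ?addr0 => [|x nx]; last by rewrite offH ?mul0r.
    rewrite (reindex (enum_val : 'I_#|{perm T}| -> {perm T})) /=; last first.
      by apply: onW_bij; exact: enum_val_bij.
    by apply: eq_bigr => x hx; rewrite enum_valK mxE enum_rankK (_ : H (enum_val x)) ?hg.
  have h0 g : H g -> normc (gconv Q (fun s => u 0 (enum_rank s)) zz g) <= 0.
    by move=> hg; rewrite G // Normc.normc0.
  have := gconv_zz_bound hQ h0 hy; rewrite mulr0 mul0r enum_valK => h.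
  by apply: Normc.eq0_normc; apply/eqP; rewrite eq_le normc_ge0 andbT.
pose v : 'rV[K]_#|{perm T}| := \row_y f (enum_val y).
pose w := v *m invmx Z.
have wE y : \sum_x w 0 x * Z x y = f (enum_val y).
  have e : w *m Z = v by rewrite /w mulmxKV.
  by have := f_equal (fun M : 'rV[K]__ => M 0 y) e; rewrite !mxE.
clearbody w; exists (fun s => w 0 (enum_rank s)) => g hg.
have := wE (enum_rank g); rewrite enum_rankK => <-; rewrite /gconv.
rewrite [RHS](bigID (fun x => H (enum_val x))) /= [X in _ = _ + X]big1 ?addr0 => [|x nx]; last first.
  rewrite mxE (negbTE nx) /=; case: eqP => [e|_]; last by rewrite mulr0.
  by case/negP: nx; rewrite e enum_rankK.
rewrite (reindex (enum_val : 'I_#|{perm T}| -> {perm T})) /=; last first.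
  by apply: onW_bij; exact: enum_val_bij.
apply: eq_bigr => x hx; rewrite enum_valK mxE enum_rankK.
have -> : H (enum_val x) = true by exact: hx.
have -> : H g = true by exact: hg.
by [].
Qed.


End TensorAlgebra.
Local Close Scope set_scope.
Local Open Scope set_scope.

(** * From unitary invariance to commutation with matrix units *)

Section UnitaryCommutation.
Context {R : realType} {disp : measure_display} {Omega : measurableType disp}.
Variables (P : probability Omega R) (N d : nat).
Local Notation K := R[i].
Local Notation MN := 'M[K]_N.
Local Notation T := 'I_d.
Local Notation idx := {ffun T -> 'I_N}.
Variable A : Omega -> MN.
Hypotheses (rA : random_mx A) (hA : has_moments P A) (inv : unitarily_invariant P A).
Implicit Types (Q : {set {set T}}) (C : {set T}) (i j : idx) (U M : MN).

Definition equivariant (h : MN -> MN) := (forall a b, polyf (fun M => h M a b)) /\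
  forall U M, U \is unitarymx -> h (U *m M *m (U ^t*)%sesqui) = U *m h M *m (U ^t*)%sesqui.

Variable h : T -> MN -> MN.
Hypothesis eh : forall k, equivariant (h k).

Local Notation tn1 := (tens1 P (fun k w => h k (A w))).

(** Replacing A by its conjugate under U turns h(A) U into U h(A). *)
Lemma cexpect_comm C U i j : U \is unitarymx ->
  cexpect P (fun w => \prod_(k in C) (U *m h k (A w)) (i k) (j k)) =
  cexpect P (fun w => \prod_(k in C) (h k (A w) *m U) (i k) (j k)).
Proof.
move=> uU.
have pf : polyf (fun M => \prod_(k in C) (h k M *m U) (i k) (j k)).
  apply: polyf_prod => k _; under eq_fun do rewrite mxE.
  apply: polyf_sum => l _; apply: polyf_mul; last exact: polyf_cst.
  by have [pe _] := eh k; exact: pe.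
rewrite -(cexpect_inv rA hA inv uU pf); congr (cexpect _ _); apply/funext => w.
apply: eq_bigr => k _; have [_ e] := eh k; rewrite e //.
by rewrite -[_ *m U]mulmxA (mulmx1C (unitarymxP uU)) mulmx1.
Qed.

Variables (C : {set T}) (i j : idx).

(** The term in which y is taken from the factors in J. The value 0 outside C discards every J that
    is not contained in C, so the subsets can range over all of T. *)
Let subs (x y : T -> MN -> K) (J : {set T}) : K :=
  cexpect P (fun w => \prod_k (if k \in J then (if k \in C then y k (A w) else 0)
                               else (if k \in C then x k (A w) else 1))).

Lemma cexpect_pencil (x y : T -> MN -> K) s : (forall k, polyf (x k)) -> (forall k, polyf (y k)) ->
  cexpect P (fun w => \prod_(k in C) (x k (A w) + s * y k (A w))) =
  \sum_(J : {set T}) s ^+ #|J| * subs x y J.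
Proof.
move=> px py.
have pJ (J : {set T}) : polyf (fun M => \prod_k (if k \in J then (if k \in C then y k M else 0)
                               else (if k \in C then x k M else 1))).
  by apply: polyf_prod => k _; case: (k \in J); case: (k \in C) => //; exact: polyf_cst.
transitivity (\sum_(J : {set T}) cexpect P (fun w => s ^+ #|J| *
   (\prod_k (if k \in J then (if k \in C then y k (A w) else 0) else (if k \in C then x k (A w) else 1))))); last first.
  by apply: eq_bigr => J _; rewrite cexpectZ //; exact: (polyf_cint rA hA (pJ J)).
rewrite -cexpect_sum; last by move=> J _; apply: cintZ; exact: (polyf_cint rA hA (pJ J)).
congr (cexpect _ _); apply/funext => w; rewrite big_mkcond /=.
transitivity (\prod_k (s * (if k \in C then y k (A w) else 0) + (if k \in C then x k (A w) else 1))).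
  by apply: eq_bigr => k _; case: (k \in C); rewrite ?mulr0 ?add0r // addrC.
rewrite bigA_distr; apply: eq_bigr => J _.
rewrite -prodr_const [in RHS]big_mkcond -big_split /=; apply: eq_bigr => k _.
by case: (k \in J); rewrite ?mul1r.
Qed.

Lemma sum_card1 (V : nmodType) (f : {set T} -> V) :
  \sum_(J : {set T} | #|J| == 1%N) f J = \sum_k f [set k].
Proof.
rewrite -(big_imset f (h := fun k : T => [set k]) (A := predT)) /=; last by move=> k l _ _ /set1_inj.
apply: eq_bigl => J; apply/cards1P/imsetP => [[k ->]|[k _ ->]]; last by exists k.
by exists k.
Qed.

Lemma subs1 (x y : T -> MN -> K) k : subs x y [set k] = if k \in C then
   cexpect P (fun w => y k (A w) * \prod_(l in C | l != k) x l (A w)) else 0.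
Proof.
rewrite /subs; case: (boolP (k \in C)) => kC; last first.
  rewrite -[RHS](cexpect_cst P); congr (cexpect _ _); apply/funext => w.
  by rewrite (bigD1 k) //= set11 (negbTE kC) mul0r.
congr (cexpect _ _); apply/funext => w.
rewrite (bigD1 k) //= set11 kC; congr (_ * _).
rewrite big_mkcond [RHS]big_mkcond /=; apply: eq_bigr => l _.
by rewrite finset.inE; case: (l == k); case: (l \in C).
Qed.

(* The coefficient of [s] in the commutation relation [cexpect_comm] for the
   unitary matrix [1 + s M], when [M] is an orthogonal projection. *)
Definition lam (M : MN) := \sum_(k in C) (\sum_c M (i k) c * tn1 C (upd i k c) j
   - \sum_c M c (j k) * tn1 C i (upd j k c)).

Lemma lamD M1 M2 : lam (M1 + M2) = lam M1 + lam M2.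
Proof.
rewrite /lam -big_split; apply: eq_bigr => k _ /=.
under eq_bigr => c _ do rewrite mxE mulrDl.
under [X in _ - X]eq_bigr => c _ do rewrite mxE mulrDl.
by rewrite !big_split /= opprD addrACA.
Qed.

Lemma lamZ c M : lam (c *: M) = c * lam M.
Proof.
rewrite /lam mulr_sumr; apply: eq_bigr => k _ /=.
rewrite mulrBr !mulr_sumr.
by congr (_ - _); apply: eq_bigr => l _; rewrite mxE mulrA.
Qed.

(* The hypothesis says that [1 + s] has modulus one. *)
Lemma eq_poly0 (p : {poly K}) : (forall s, s + s^* + s * s^* = 0 -> p.[s] = 0) -> p = 0.
Proof.
(* Here 1 + [f n] = (in - 1) / (in + 1) is the Cayley transform of n, which gives infinitely many
   points of the unit circle. *)
move=> H; pose f (n : nat) : K := - (2%:R / (1 + 'i * n%:R)).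
have cD n : (1 + 'i * n%:R : K)^* = 1 - 'i * n%:R by rewrite rmorphD rmorph1 rmorphM /= conjCi conjC_nat mulNr.
have nz (n : nat) : (1 + 'i * n%:R : K) != 0.
  apply/eqP => e; have := f_equal (fun z : K => 'Re z) e.
  by rewrite Re_rect ?rpred1 ?realn // raddf0 => /eqP; rewrite oner_eq0.
have fC n : (f n)^* = - (2%:R / (1 - 'i * n%:R)).
  by rewrite /f rmorphN fmorph_div /= cD conjC_nat.
have nz' n : (1 - 'i * n%:R : K) != 0.
  by rewrite -cD conjC_eq0.
have fS n : f n + (f n)^* + f n * (f n)^* = 0.
  by rewrite fC /f; have := nz n; have := nz' n; move=> h1 h2; field; rewrite h1 h2.
have fi : injective f.
  move=> n m /oppr_inj /(mulfI _) h1; have := h1; rewrite pnatr_eq0 => /(_ isT) /invr_inj /addrI /(mulfI _) {}h1; have := h1.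
  by rewrite neq0Ci => /(_ isT) /eqP; rewrite eqr_nat => /eqP.
apply/eqP; apply: contraT => p0.
have := @max_poly_roots _ p (map f (iota 0 (size p))) p0.
rewrite map_inj_uniq // iota_uniq size_map size_iota ltnn.
have -> : all (root p) (map f (iota 0 (size p))).
  by apply/allP => _ /mapP[n _ ->]; apply/eqP/H.
by move=> /(_ isT isT).
Qed.

(** Scaling by the squared norm n makes M a projection, and 1 + s M is unitary on the whole circle
    of [eq_poly0]. Both sides of [cexpect_comm] are polynomials in s, hence equal, and [lam M] is
    the difference of their linear coefficients. *)
Lemma lam_proj (u : 'cV[K]_N) (n : K) : n != 0 -> n^* = n -> (u ^t*)%sesqui *m u = n%:M ->
  lam (u *m (u ^t*)%sesqui) = 0.
Proof.
move=> n0 nC un; pose M := n^-1 *: (u *m (u ^t*)%sesqui).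
have MM : M *m M = M.
  rewrite /M -scalemxAl -scalemxAr mulmxA -[u *m _ *m u]mulmxA un mul_mx_scalar -scalemxAl.
  by rewrite !scalerA mulVf // mulr1.
have MC : (M ^t*)%sesqui = M.
  rewrite /M; apply/matrixP => x y; rewrite !mxE rmorphM fmorphV /= nC rmorph_sum /=; congr (_ * _).
  by apply: eq_bigr => z _; rewrite !mxE rmorphM /= conjCK mulrC.
suff lM : lam M = 0 by have := lM; rewrite lamZ => /eqP; rewrite mulf_eq0 invr_eq0 (negbTE n0) => /eqP.
clearbody M; pose x k M' : K := h k M' (i k) (j k).
pose y1 k M' : K := (M *m h k M') (i k) (j k).
pose y2 k M' : K := (h k M' *m M) (i k) (j k).
have px k : polyf (x k) by have [pe _] := eh k; exact: pe.
have py1 k : polyf (y1 k).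
  rewrite /y1; under eq_fun do rewrite mxE; apply: polyf_sum => l _; apply: polyf_mul; first exact: polyf_cst.
  by have [pe _] := eh k; exact: pe.
have py2 k : polyf (y2 k).
  rewrite /y2; under eq_fun do rewrite mxE; apply: polyf_sum => l _; apply: polyf_mul; last exact: polyf_cst.
  by have [pe _] := eh k; exact: pe.
pose p : {poly K} := \sum_(J : {set T}) (subs x y1 J - subs x y2 J) *: 'X^#|J|.
have p0 : p = 0.
  apply: eq_poly0 => s hs.
  have uU : (1%:M + s *: M) \is unitarymx.
    apply/unitarymxP.
    have -> : ((1%:M + s *: M) ^t*)%sesqui = 1%:M + s^* *: M.
      rewrite -[in RHS]MC; apply/matrixP => a b; rewrite !mxE rmorphD rmorphM /= conjC_nat.
      by rewrite eq_sym.
    rewrite mulmxDl mul1mx mulmxDr mulmx1 -scalemxAl -scalemxAr MM scalerA.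
    by rewrite -addrA -!scalerDl addrA [s^* + s]addrC hs scale0r addr0.
  have := cexpect_comm C i j uU.
  have -> : (fun w => \prod_(k in C) ((1%:M + s *: M) *m h k (A w)) (i k) (j k)) =
            (fun w => \prod_(k in C) (x k (A w) + s * y1 k (A w))).
    apply/funext => w; apply: eq_bigr => k _; rewrite mulmxDl mul1mx -scalemxAl.
    by rewrite mxE [in LHS]mxE.
  have -> : (fun w => \prod_(k in C) (h k (A w) *m (1%:M + s *: M)) (i k) (j k)) =
            (fun w => \prod_(k in C) (x k (A w) + s * y2 k (A w))).
    apply/funext => w; apply: eq_bigr => k _; rewrite mulmxDr mulmx1 -scalemxAr.
    by rewrite mxE [in LHS]mxE.
  rewrite !cexpect_pencil // => /eqP; rewrite -subr_eq0 -sumrB => /eqP e.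
  rewrite /p horner_sum -[RHS]e; apply: eq_bigr => J _.
  by rewrite hornerZ hornerXn -mulrBr mulrC.
have := f_equal (fun q : {poly K} => q`_1) p0; rewrite coef0 /p coef_sum.
rewrite (eq_bigr (fun J : {set T} => if #|J| == 1%N then subs x y1 J - subs x y2 J else 0)); last first.
  by move=> J _; rewrite coefZ coefXn eq_sym; case: eqP; rewrite ?mulr1 ?mulr0.
rewrite -big_mkcond sum_card1 => <-; rewrite /lam big_mkcond; apply: eq_bigr => k _.
rewrite !subs1; case: (boolP (k \in C)) => kC; last by rewrite subrr.
have cint (l : T -> idx * idx) : cintegrable P (fun w => \prod_(k in C) h k (A w) ((l k).1 k) ((l k).2 k)).
  by apply: (polyf_cint rA hA (f := fun M => \prod_(k in C) h k M ((l k).1 k) ((l k).2 k))); apply: polyf_prod => k' _; have [] := eh k'.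
congr (_ - _).
  transitivity (\sum_c cexpect P (fun w => M (i k) c * \prod_(l in C) h l (A w) (upd i k c l) (j l))).
    by apply: eq_bigr => c _; rewrite cexpectZ //; exact: (cint (fun=> (upd i k c, j))).
  rewrite -cexpect_sum; last by move=> c _; apply: cintZ; exact: (cint (fun=> (upd i k c, j))).
  congr (cexpect _ _); apply/funext => w; rewrite /y1 mxE mulr_suml; apply: eq_bigr => c _.
  rewrite (bigD1 k) //= updE eqxx mulrA; congr (_ * _); apply: eq_bigr => l /andP[_ ne].
  by rewrite updE (negbTE ne).
transitivity (\sum_c cexpect P (fun w => M c (j k) * \prod_(l in C) h l (A w) (i l) (upd j k c l))).
  by apply: eq_bigr => c _; rewrite cexpectZ //; exact: (cint (fun=> (i, upd j k c))).
rewrite -cexpect_sum; last by move=> c _; apply: cintZ; exact: (cint (fun=> (i, upd j k c))).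
congr (cexpect _ _); apply/funext => w; rewrite /y2 mxE mulr_suml; apply: eq_bigr => c _.
rewrite (bigD1 k) //= updE eqxx mulrA [M c _ * _]mulrC; congr (_ * _); apply: eq_bigr => l /andP[_ ne].
by rewrite updE (negbTE ne).
Qed.

Let col2 (a b : 'I_N) (z : K) : 'cV[K]_N := delta_mx a 0 + z *: delta_mx b 0.

Lemma lam_col2 a b z : a != b -> lam (col2 a b z *m ((col2 a b z) ^t*)%sesqui) = 0.
Proof.
move=> ab; pose n : K := \sum_x (col2 a b z x 0)^* * col2 a b z x 0.
have e : ((col2 a b z) ^t*)%sesqui *m col2 a b z = n%:M.
  apply/matrixP => x y; rewrite !ord1 mxE [RHS]mxE eqxx mulr1n; apply: eq_bigr => c _.
  by congr (_ * _); rewrite !mxE.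
apply: lam_proj e.
  apply/eqP => /eqP; rewrite psumr_eq0 => [|c _]; last by rewrite mulrC mul_conjC_ge0.
  move=> /allP /(_ a (mem_index_enum _)) /=; rewrite mulrC mul_conjC_eq0 !mxE !eqxx (negbTE ab) mulr0 addr0.
  by rewrite oner_eq0.
by rewrite /n rmorph_sum; apply: eq_bigr => x _; rewrite rmorphM /= conjCK mulrC.
Qed.

Lemma col2E a b z : col2 a b z *m ((col2 a b z) ^t*)%sesqui =
  delta_mx a a + (z * z^*) *: delta_mx b b + z^* *: delta_mx a b + z *: delta_mx b a.
Proof.
apply/matrixP => x y; rewrite !mxE big_ord1 !mxE rmorphD rmorphM /= !conjC_nat !eqxx !andbT.
rewrite -!mulnb !natrM; ring.
Qed.

(** Polarization: the rank-one matrices of the vectors e_a + z e_b with z = 0, 1, i yield all matrix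
    units. The first branch is that of a single index, where no second basis vector exists. *)
Lemma lam_delta a b : lam (delta_mx a b) = 0.
Proof.
have [[c ca]|h1] := pselect (exists c, c != a); last first.
  have Na c : c = a by apply/eqP; apply: contraT => ne; case: h1; exists c.
  rewrite (Na b); have u1 : ((delta_mx a 0 : 'cV[K]_N) ^t*)%sesqui *m (delta_mx a 0 : 'cV[K]_N) = 1%:M.
    apply/matrixP => x y; rewrite !ord1 !mxE eqxx (bigD1 a) //= big1 => [|c]; last by rewrite (Na c) eqxx.
    by rewrite !mxE !eqxx conjC1 mulr1 addr0.
  have := lam_proj (oner_neq0 _) (conjC1 _) u1; congr (lam _ = _).
  by apply/matrixP => x y; rewrite !mxE big_ord1 !mxE !(Na x) !(Na y) !eqxx conjC1 mulr1.
have aa x : lam (delta_mx x x) = 0.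
  have [e hx] : exists e, x != e.
    by case: (eqVneq x a) => [->|ne]; [exists c; rewrite eq_sym|exists a].
  have := lam_col2 0 hx; rewrite col2E mul0r conjC0 !scale0r !addr0 //.
case: (eqVneq a b) => [<-|ab]; first exact: aa.
have h1 : lam (delta_mx a b) + lam (delta_mx b a) = 0.
  by have := lam_col2 1 ab; rewrite col2E conjC1 mulr1 !scale1r !lamD !aa !add0r.
have h2 : - 'i * lam (delta_mx a b) + 'i * lam (delta_mx b a) = 0.
  by have := lam_col2 'i ab; rewrite col2E conjCi !lamD !lamZ !aa !(mulr0, add0r).
have h3 : lam (delta_mx b a) = lam (delta_mx a b).
  apply: (mulfI (neq0Ci K)); apply/eqP; rewrite -subr_eq0 -[X in _ == X]h2 mulNr addrC //.
move: h1; rewrite h3 -mulr2n => /eqP; by rewrite mulrn_eq0 => /eqP.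
Qed.

End UnitaryCommutation.

Section UnitaryCommutation2.
Context {R : realType} {disp : measure_display} {Omega : measurableType disp}.
Variables (P : probability Omega R) (N d : nat).
Local Notation T := 'I_d.
Variable A : Omega -> 'M[R[i]]_N.
Hypotheses (rA : random_mx A) (hA : has_moments P A) (inv : unitarily_invariant P A).
Variable h : T -> 'M[R[i]]_N -> 'M[R[i]]_N.
Hypothesis eh : forall k, equivariant (h k).

(** Changing an index in the block C leaves the factors of the other blocks alone, so the relation
    for one block suffices. *)
Lemma tens_commQ Q : isp Q -> commQ Q (tens P (fun k w => h k (A w)) Q).
Proof.
move=> hQ C a b i j CQ; set X := fun k w => h k (A w).
have other D k (i' : {ffun T -> 'I_N}) x : D \in Q -> D != C -> k \in C -> forall l, l \in D -> upd i' k x l = i' l.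
  move=> DQ ne kC l lD; rewrite updE; case: eqP => // e; case/eqP: ne.
  by rewrite -(isp_block hQ DQ lD) e (isp_block hQ CQ kC).
have t1 k : k \in C -> tens P X Q (upd i k b) j = tens1 P X C (upd i k b) j * \prod_(D in Q | D != C) tens1 P X D i j.
  move=> kC; rewrite /tens (bigD1 C) //=; congr (_ * _); apply: eq_bigr => D /andP[DQ ne].
  by congr (cexpect _ _); apply/funext => w; apply: eq_bigr => l lD; rewrite (other D k).
have t2 k : k \in C -> tens P X Q i (upd j k a) = tens1 P X C i (upd j k a) * \prod_(D in Q | D != C) tens1 P X D i j.
  move=> kC; rewrite /tens (bigD1 C) //=; congr (_ * _); apply: eq_bigr => D /andP[DQ ne].
  by congr (cexpect _ _); apply/funext => w; apply: eq_bigr => l lD; rewrite (other D k).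
have := lam_delta rA hA inv eh C i j a b; rewrite /lam sumrB => /eqP; rewrite subr_eq0 => /eqP e.
transitivity ((\sum_(k in C) (i k == a)%:R * tens1 P X C (upd i k b) j) * \prod_(D in Q | D != C) tens1 P X D i j).
  by rewrite mulr_suml; apply: eq_bigr => k kC; rewrite t1 // mulrA.
transitivity ((\sum_(k in C) (j k == b)%:R * tens1 P X C i (upd j k a)) * \prod_(D in Q | D != C) tens1 P X D i j); last first.
  by rewrite mulr_suml; apply: eq_bigr => k kC; rewrite t2 // mulrA.
congr (_ * _); move: e; congr (_ = _); apply: eq_bigr => k kC.
  rewrite (bigD1 b) //= mxE eqxx andbT big1 ?addr0 // => c ne.
  by rewrite mxE (negbTE ne) andbF mul0r.
rewrite (bigD1 a) //= mxE eqxx /= big1 ?addr0 // => c ne.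
by rewrite mxE (negbTE ne) mul0r.
Qed.

End UnitaryCommutation2.
Local Close Scope set_scope.
(** * Structure of mixed moments at finite N *)

Local Open Scope set_scope.
Section Refinement.
Variable d : nat.
Local Notation T := 'I_d.

Lemma cycles_inT (g : {perm T}) : cycles_in g [set: T] = porbits g.
Proof. by apply/setP => c; rewrite finset.inE finset.subsetT andbT. Qed.

Lemma card_porbits_mulC (a b : {perm T}) : #|porbits (a * b)%g| = #|porbits (b * a)%g|.
Proof.
have st : stab [set: T] a by move=> k; rewrite !finset.inE.
by have := card_cycles_conj (b * a)%g st; rewrite !cycles_inT mulgA mulgK => ->.
Qed.

Implicit Types (J C D : {set T}) (Q : {set {set T}}) (g : {perm T}) (k l : T).

Definition rfrel J Q : rel T := fun k l => (k == l) || [&& k \in J, l \in J & prel Q k l].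

Lemma rfrel_equiv J Q : equivalence_rel (rfrel J Q).
Proof.
move=> k l m; split; first by rewrite /rfrel eqxx.
rewrite /rfrel; case: (eqVneq k l) => [-> //|ne] /= /and3P[kJ lJ e]; rewrite kJ lJ /=.
case: (eqVneq k m) => [<-|_] /=.
  by rewrite eq_sym (negbTE ne) /= kJ prel_sym e.
case: (eqVneq l m) => [<-|_] /=; first by rewrite lJ e.
by case: (m \in J) => //=; apply/idP/idP; apply: prel_trans; rewrite // prel_sym.
Qed.

(* The trace of [Q] on [J], completed by singletons. *)
Definition rf J Q := eqpart (rfrel J Q).

Lemma isp_rf J Q : isp (rf J Q). Proof. exact: isp_eqpart (rfrel_equiv J Q). Qed.

Lemma prel_rf J Q k l : prel (rf J Q) k l = (k == l) || [&& k \in J, l \in J & prel Q k l].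
Proof. exact: (prel_eqpart k l (rfrel_equiv J Q)). Qed.

Lemma rf_le J Q : isp Q -> part_le (rf J Q) Q.
Proof.
move=> hQ; apply/part_leP => //; first exact: isp_rf.
by move=> k l; rewrite prel_rf => /orP[/eqP -> |/and3P[]//]; exact: prel_refl.
Qed.

Lemma rf_porbits J Q g : isp Q -> part_le (porbits g) (rf J Q) <->
  part_le (porbits g) Q /\ forall k, k \notin J -> g k = k.
Proof.
move=> hQ; split=> [h|[h fx]].
  split; first exact: part_le_trans (isp_porbits g) (isp_rf J Q) hQ h (rf_le J hQ).
  move=> k kJ; have := porbits_leP g (isp_rf J Q) h k; rewrite prel_rf (negbTE kJ) /= orbF.
  by move=> /eqP.
apply/porbits_leP; first exact: isp_rf.
move=> k; rewrite prel_rf; case: (boolP (k \in J)) => kJ; last by rewrite fx ?eqxx.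
case: (boolP (g k \in J)) => gJ; first by rewrite (porbits_leP g hQ h k) orbT.
by have /perm_inj e := fx _ gJ; rewrite e eqxx.
Qed.

Lemma rf_eq J Q Q' : (forall k l, k \in J -> l \in J -> prel Q k l = prel Q' k l) -> rf J Q = rf J Q'.
Proof.
move=> H; apply: isp_eq; rewrite ?isp_rf // => k l; rewrite !prel_rf.
by case: (boolP (k \in J)) => //= kJ; case: (boolP (l \in J)) => //= lJ; rewrite H.
Qed.

(** Indexing by nonempty traces makes Q and [rf J Q] comparable: their blocks differ, their traces
    on J are the same. *)
Lemma prod_trace (K : comNzRingType) J Q (t : {set T} -> K) : isp Q -> t finset.set0 = 1 ->
  \prod_(C in Q) t (C :&: J) = \prod_(E in [set finset.pblock Q k :&: J | k in J]) t E.
Proof.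
move=> hQ t0.
have -> : [set finset.pblock Q k :&: J | k in J] = [set C :&: J | C in [set C in Q | C :&: J != finset.set0]].
  apply/setP => E; apply/imsetP/imsetP => [[k kJ ->]|[C]].
    exists (finset.pblock Q k) => //; rewrite finset.inE isp_pblock //=.
    by apply/set0Pn; exists k; rewrite finset.inE kJ isp_mem.
  rewrite finset.inE => /andP[CQ /set0Pn[k]]; rewrite finset.inE => /andP[kC kJ] ->.
  by exists k => //; rewrite (isp_block hQ CQ kC).
rewrite big_imset /=; last first.
  move=> C D; rewrite !finset.inE => /andP[CQ /set0Pn[k kC]] /andP[DQ _] e.
  have kD : k \in D by move: kC; rewrite e finset.inE => /andP[].
  move: kC; rewrite finset.inE => /andP[kC _].
  by rewrite -(isp_block hQ CQ kC) (isp_block hQ DQ kD).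
rewrite [RHS]big_mkcond [LHS]big_mkcond; apply: eq_bigr => C _; rewrite finset.inE.
by case: (C \in Q) => //=; case: eqP => [->|].
Qed.

End Refinement.

(** * Coefficients of moments in the group algebra *)

Section FiniteN.
Context {R : realType} {disp : measure_display} {Omega : measurableType disp}.
Variables (P : probability Omega R) (N d : nat).
Hypothesis N0 : (0 < N)%N.
Local Notation K := R[i].
Local Notation MN := 'M[K]_N.
Local Notation T := 'I_d.
Local Notation idx := {ffun T -> 'I_N}.
Variables (A B : Omega -> MN).
Hypotheses (rA : random_mx A) (rB : random_mx B) (hA : has_moments P A) (hB : has_moments P B).
Hypothesis ind : independent_mx P A B.
Implicit Types (Q : {set {set T}}) (g : {perm T}) (i j : idx) (J : {set T}).

Section OneFamily.
Variables (W : T -> Omega -> MN) (J : {set T}).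
Hypothesis mW : forall k a b, mixf A B (fun w => W k w a b).
Hypothesis W1 : forall k w, k \notin J -> W k w = 1.

Let cint (D : {set T}) i j : cintegrable P (fun w => \prod_(k in D) W k w (i k) (j k)).
Proof. by apply: (mixf_cint rA rB hA hB ind); apply: mixf_prod => k _; exact: mW. Qed.

Lemma tens1_split (C : {set T}) i j : tens1 P W C i j =
  tens1 P W (C :&: J) i j * \prod_(k in C | k \notin J) (i k == j k)%:R.
Proof.
rewrite mulrC /tens1 -cexpectZ //; congr (cexpect _ _); apply/funext => w.
rewrite (bigID (fun k => k \in J)) /= mulrC; congr (_ * _).
  by apply: eq_bigr => k /andP[_ kJ]; rewrite W1 // mxE.
by apply: eq_bigl => k; rewrite finset.inE.
Qed.

Lemma tens_split Q i j : isp Q -> tens P W Q i j =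
  (\prod_(C in Q) tens1 P W (C :&: J) i j) * \prod_(k | k \notin J) (i k == j k)%:R.
Proof.
move=> hQ; rewrite /tens (eq_bigr _ (fun C _ => tens1_split C i j)) big_split; congr (_ * _).
rewrite [RHS](eq_bigl (fun k => (k \in finset.cover Q) && (k \notin J))) => [|k].
  by rewrite finset.big_trivIset_cond ?(partition_trivIset hQ).
by rewrite (finset.cover_partition hQ) finset.inE.
Qed.

Lemma tens_rf Q i j : isp Q -> tens P W Q i j = tens P W (rf J Q) i j.
Proof.
move=> hQ; have hr := isp_rf J Q; rewrite !tens_split //; congr (_ * _).
have t0 : tens1 P W finset.set0 i j = 1.
  by rewrite /tens1 -[RHS](cexpect_cst P); congr (cexpect _ _); apply/funext => w; rewrite big_set0.
rewrite (@prod_trace d K J Q (fun D => tens1 P W D i j)) //.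
rewrite (@prod_trace d K J (rf J Q) (fun D => tens1 P W D i j)) //.
suff -> : [set finset.pblock Q k :&: J | k in J] = [set finset.pblock (rf J Q) k :&: J | k in J] by [].
apply: eq_in_imset => k kJ.
apply/setP => l; rewrite !finset.inE !in_pblock // prel_rf kJ /=.
case: (boolP (l \in J)) => lJ; rewrite ?andbF //= !andbT.
by case: eqP => [->|//]; rewrite prel_refl.
Qed.

Lemma slotunit_tens Q k : isp Q -> k \notin J -> slotunit (tens P W Q) k.
Proof.
move=> hQ kJ; split=> [i j ne|i j a e]; rewrite !tens_split //.
  by rewrite [X in _ * X](bigD1 k) //= (negbTE ne) mul0r mulr0.
congr (_ * _); last first.
  apply: eq_bigr => l _; rewrite !updE; by case: (eqVneq l k) => [->|//]; rewrite e !eqxx.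
apply: eq_bigr => C _; congr (cexpect _ _); apply/funext => w; apply: eq_bigr => l.
rewrite finset.inE !updE => /andP[_ lJ]; case: (eqVneq l k) => // el.
by move: kJ; rewrite -el lJ.
Qed.

Lemma coef_sw : (3 * d <= N)%N -> (forall Q, isp Q -> commQ Q (tens P W Q)) ->
  exists c : {set {set T}} -> {perm T} -> K,
  (forall D g, ~~ part_le (porbits g) D -> c D g = 0) /\
  forall Q i j, isp Q -> tens P W Q i j = \sum_(g | part_le (porbits g) Q) c (rf J Q) g * rho K g i j.
Proof.
move=> hN cW.
exists (fun D g => if part_le (porbits g) D then swcoef hN (tens P W D) g else 0).
split=> [D g /negbTE -> //|Q i j hQ]; have hr := isp_rf J Q.
rewrite tens_rf // (schur_weyl hN hr (cW _ hr)) [LHS]big_mkcond [RHS]big_mkcond.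
apply: eq_bigr => g _; case: ifP => h; last by rewrite mul0r if_same.
by have [-> _] := (rf_porbits J g hQ).1 h.
Qed.

(** Without invariance the tensor need not be a combination of permutation operators. A combination
    with the same contractions is found at each trace [rf J Q], and [unit_ext] extends the agreement
    to all permutations below Q. *)
Lemma coef_solve : (0 < d)%N -> (2 * d`! <= N)%N ->
  exists c : {set {set T}} -> {perm T} -> K,
  (forall D g, ~~ part_le (porbits g) D -> c D g = 0) /\
  forall Q g, isp Q -> part_le (porbits g) Q ->
    LT (tens P W Q) g = gconv Q (c (rf J Q)) (@zz R N d) g.
Proof.
move=> d0 hN.
have H D : {c : {perm T} -> K | isp D -> forall g, part_le (porbits g) D ->
    gconv D c (@zz R N d) g = LT (tens P W D) g}.
  case: (boolP (isp D)) => hD; last by exists (fun=> 0).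
  apply: cid; have [c hc] := gconv_zz_solve N0 d0 hN (LT (tens P W D)) hD.
  by exists c.
exists (fun D g => if part_le (porbits g) D then sval (H D) g else 0).
split=> [D g /negbTE -> //|Q g hQ gQ]; have hr := isp_rf J Q.
set c := fun g => if _ then _ else _.
rewrite -LT_sum_rho //; apply/esym.
have cE i j : \sum_(s | part_le (porbits s) Q) c s * rho K s i j =
    \sum_(s | part_le (porbits s) (rf J Q)) c s * rho K s i j.
  rewrite [LHS]big_mkcond [RHS]big_mkcond; apply: eq_bigr => s _; rewrite /c.
  case: (boolP (part_le (porbits s) (rf J Q))) => h; last by rewrite mul0r if_same.
  by have [-> _] := (rf_porbits J s hQ).1 h.
apply: (unit_ext N0 (I := J) hQ _ _ _ gQ) => [k kJ|k kJ|{}g {}gQ fx].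
- have -> : (fun i j => \sum_(s | part_le (porbits s) Q) c s * rho K s i j) =
     (fun i j => \sum_(s | part_le (porbits s) (rf J Q)) c s * rho K s i j).
    by apply/funext => i; apply/funext => j; exact: cE.
  apply: slotunit_sum => s /(rf_porbits J s hQ)[_ fx]; apply: slotunit_rho; exact: fx.
- exact: slotunit_tens.
have gr : part_le (porbits g) (rf J Q) by apply/(rf_porbits J g hQ).
rewrite (eq_LT _ cE) LT_sum_rho // (eq_LT g (fun i j => tens_rf i j hQ)).
rewrite -(svalP (H (rf J Q)) hr g gr); apply: eq_gconv => // s hs.
by rewrite /c hs.
Qed.

End OneFamily.

Variables (J : {set T}) (hh : T -> MN -> MN).
Hypothesis eh : forall k, equivariant (hh k).

Definition famY k w := if k \in J then hh k (A w) else 1.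
Definition famZ k w := if k \in J then 1 else hh k (B w).
Definition famX k w := if k \in J then hh k (A w) else hh k (B w).

Let polyf1 (a b : 'I_N) : polyf (fun _ : MN => (1 : MN) a b).
Proof. exact: polyf_cst. Qed.

Lemma mixY k a b : mixf A B (fun w => famY k w a b).
Proof. rewrite /famY; case: (k \in J); [apply: (mixf_l A B (f := fun M => hh k M a b)); by have [pe _] := eh k|exact: mixf_cst]. Qed.
Lemma mixZ k a b : mixf A B (fun w => famZ k w a b).
Proof. rewrite /famZ; case: (k \in J); [exact: mixf_cst|apply: (mixf_r A B (f := fun M => hh k M a b)); by have [pe _] := eh k]. Qed.
Lemma mixX k a b : mixf A B (fun w => famX k w a b).
Proof.
rewrite /famX; have [pe _] := eh k.
by case: (k \in J); [apply: (mixf_l A B (f := fun M => hh k M a b))|apply: (mixf_r A B (f := fun M => hh k M a b))].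
Qed.

Let Y1 k w : k \notin J -> famY k w = 1. Proof. by rewrite /famY => /negbTE ->. Qed.
Let Z1 k w : k \notin ~: J -> famZ k w = 1. Proof. by rewrite /famZ finset.inE negbK => ->. Qed.

(** Y is the identity outside J and Z is the identity on J, which forces the intermediate index to
    be [l0]; independence then matches the remaining term with the joint expectation. *)
Lemma tens_tmul Q i j : isp Q -> tens P famX Q i j = tmul (tens P famY Q) (tens P famZ Q) i j.
Proof.
move=> hQ; pose l0 : idx := [ffun k => if k \in J then j k else i k].
rewrite /tmul (bigD1 l0) //= [X in _ + X]big1 ?addr0 => [|l ne]; last first.
  have [k hk] : exists k, l k != l0 k.
    by apply/existsP; apply: contraNT ne => /existsPn h; apply/eqP/ffunP => k; have := h k; rewrite negbK => /eqP.
  move: hk; rewrite ffunE; case: (boolP (k \in J)) => kJ hk.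
    have kC : k \notin ~: J by rewrite finset.inE kJ.
    by have [-> //] := slotunit_tens mixZ Z1 hQ kC; rewrite mulr0.
  have [-> //] := slotunit_tens mixY Y1 hQ kJ; last by rewrite eq_sym.
  by rewrite mul0r.
rewrite /tens -big_split; apply: eq_bigr => C CQ /=; rewrite /tens1.
have pY : polyf (fun M : MN => \prod_(k in C) (if k \in J then hh k M else 1) (i k) (l0 k)).
  by apply: polyf_prod => k _; case: (k \in J) => //; have [pe _] := eh k.
have pZ : polyf (fun M : MN => \prod_(k in C) (if k \in J then 1 else hh k M) (l0 k) (j k)).
  by apply: polyf_prod => k _; case: (k \in J) => //; have [pe _] := eh k.
have [_ e] := cexpect_indep rA rB hA hB ind pY pZ.
rewrite -[RHS]e; congr (cexpect _ _); apply/funext => w; rewrite -big_split; apply: eq_bigr => k _ /=.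
by rewrite /famX ffunE; case: (k \in J); rewrite [(1 : MN) _ _]mxE eqxx ?mulr1 ?mul1r.
Qed.

Hypothesis d0 : (0 < d)%N.
Hypotheses (hN3 : (3 * d <= N)%N) (hN : (2 * d`! <= N)%N).
Hypothesis inv : unitarily_invariant P A \/ unitarily_invariant P B.

Lemma zzC (a b : {perm T}) : @zz R N d (a * b)%g = @zz R N d (b * a)%g.
Proof. by rewrite /zz card_porbits_mulC. Qed.

(** Schur-Weyl duality serves the invariant matrix, [coef_solve] the other one. If B is the
    invariant one, [zz] comes out between the two coefficients, and its centrality moves it to the
    end. *)
Lemma finite_structure : exists cY cZ : {set {set T}} -> {perm T} -> K,
  [/\ forall D g, ~~ part_le (porbits g) D -> cY D g = 0,
      forall D g, ~~ part_le (porbits g) D -> cZ D g = 0,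
      forall Q g, isp Q -> part_le (porbits g) Q ->
        mom P famY g Q = gconv Q (cY (rf J Q)) (@zz R N d) g,
      forall Q g, isp Q -> part_le (porbits g) Q ->
        mom P famZ g Q = gconv Q (cZ (rf (~: J) Q)) (@zz R N d) g &
      forall Q g, isp Q -> part_le (porbits g) Q ->
        mom P famX g Q = gconv Q (cY (rf J Q)) (gconv Q (cZ (rf (~: J) Q)) (@zz R N d)) g].
Proof.
have momE (W : T -> Omega -> MN) (mW : forall k a b, mixf A B (fun w => W k w a b)) Q g :
    isp Q -> part_le (porbits g) Q -> mom P W g Q = LT (tens P W Q) g.
  by move=> hQ gQ; rewrite (LT_tens N0 rA rB hA hB ind mW).
have eY k : equivariant (fun M => if k \in J then hh k M else 1).
  case: (k \in J) => //; split=> // U M uU; by rewrite mulmx1 (unitarymxP uU).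
have eZ k : equivariant (fun M => if k \in J then 1 else hh k M).
  case: (k \in J) => //; split=> // U M uU; by rewrite mulmx1 (unitarymxP uU).
case: inv => iv.
  have [cY [sY HY]] := coef_sw mixY Y1 hN3 (fun Q hQ => tens_commQ rA hA iv eY hQ).
  have [cZ [sZ HZ]] := coef_solve mixZ Z1 d0 hN.
  exists cY, cZ; split=> // Q g hQ gQ; rewrite momE //.
  - by rewrite (eq_LT g (fun i j => HY Q i j hQ)) LT_sum_rho.
  - exact: mixY.
  - exact: HZ.
  - exact: mixZ.
  - rewrite (eq_LT g (fun i j => tens_tmul i j hQ)) (LT_tmul_l _ _ (fun i j => HY Q i j hQ)).
    by apply: eq_gconv => // s sQ; exact: HZ.
  exact: mixX.
have [cZ [sZ HZ]] := coef_sw mixZ Z1 hN3 (fun Q hQ => tens_commQ rB hB iv eZ hQ).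
have [cY [sY HY]] := coef_solve mixY Y1 d0 hN.
exists cY, cZ; split=> // Q g hQ gQ; rewrite momE //.
- exact: HY.
- exact: mixY.
- by rewrite (eq_LT g (fun i j => HZ Q i j hQ)) LT_sum_rho.
- exact: mixZ.
- rewrite (eq_LT g (fun i j => tens_tmul i j hQ)) (LT_tmul_r _ hQ gQ (fun i j => HZ Q i j hQ)).
  transitivity (gconv Q (gconv Q (cY (rf J Q)) (@zz R N d)) (cZ (rf (~: J) Q)) g).
    by apply: eq_gconv => // s sQ; exact: HY.
  rewrite -gconvA //; apply: eq_gconv => // s sQ.
  by rewrite [RHS]gconvC // => a b; rewrite zzC.
exact: mixX.
Qed.

End FiniteN.
Local Close Scope set_scope.
(** * Cumulants of traces *)

Local Open Scope set_scope.
Section CumulantAlgebra.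
Context {R : realType} {disp : measure_display} {Omega : measurableType disp}.
Variable P : probability Omega R.
Local Notation K := R[i].
Local Notation RV := (Omega -> K).
Implicit Types (Y s : seq RV).

Lemma cumulantE Y n : size Y = n -> cumulant P Y =
  \sum_(p : {set {set 'I_n}} | finset.partition p [set: 'I_n])
    cumf K #|p| * \prod_(B in p) cexpect P (fun w => \prod_(i in B) nth (fun=> 0) Y i w).
Proof. by move=> <-. Qed.

Definition cmom n Y (S : {set 'I_n}) := cexpect P (fun w => \prod_(i in S) nth (fun=> 0) Y i w).

Lemma cmom0 n Y : cmom Y (finset.set0 : {set 'I_n}) = 1.
Proof.
by rewrite -[RHS](cexpect_cst P); congr (cexpect _ _); apply/funext => w; rewrite big_set0.
Qed.

Lemma cumulant_perm Y n (s : {perm 'I_n}) (Y' : seq RV) : size Y = n -> size Y' = n ->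
  (forall i : 'I_n, nth (fun=> 0) Y i = nth (fun=> 0) Y' (s i)) ->
  cumulant P Y = kap predT (cmom Y') [set: 'I_n].
Proof.
move=> sY sY' H; rewrite (cumulantE sY).
have := @kap_transfer 'I_n 'I_n K (fun i => [set s i]) predT (cmom Y') (cmom Y).
have e0 (V : {set 'I_n}) : \bigcup_(i in V) [set s i] = s @: V.
  apply/setP => k; apply/bigcupP/imsetP => [[i iV]|[i iV ->]].
    by rewrite finset.inE => /eqP ->; exists i.
  by exists i => //; rewrite set11.
have eT : \bigcup_(i in [set: 'I_n]) [set s i] = [set: 'I_n].
  rewrite e0; apply/setP => k; rewrite finset.inE; apply/imsetP.
  by exists (s^-1%g k); rewrite ?finset.inE // permKV.
rewrite eT; apply.
- by move=> i; apply/set0Pn; exists (s i); rewrite set11.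
- by move=> i j k; rewrite !finset.inE => /eqP -> /eqP /perm_inj.
- move=> V; rewrite e0 /cmom; congr (cexpect _ _); apply/funext => w.
  rewrite big_imset /=; last by move=> i j _ _ /perm_inj.
  by apply: eq_bigr => i _; rewrite H.
move=> V _; apply/esym/eqP; apply/setP => k; apply/bigcupP/idP => [[ i]|kV].
  by rewrite !finset.inE => /fintype.subsetP h /eqP ->; apply: h; rewrite set11.
exists (s^-1%g k); last by rewrite permKV set11.
rewrite finset.inE; apply/fintype.subsetP => l; rewrite finset.inE permKV => /eqP -> //.
Qed.

Lemma cumulant_kap Y n : size Y = n -> cumulant P Y = kap predT (cmom Y) [set: 'I_n].
Proof. by move=> h; apply: (cumulant_perm (s := 1%g) h h) => i; rewrite perm1. Qed.

Lemma cumulant_perm_eq (I : eqType) (f : I -> RV) (r1 r2 : seq I) : perm_eq r1 r2 ->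
  cumulant P (map f r1) = cumulant P (map f r2).
Proof.
move=> h; have sz := perm_size h.
pose t1 : (size r2).-tuple I := Tuple (introT eqP sz); pose t2 := in_tuple r2.
have /tuple_permP[s e] : perm_eq t1 t2 by exact: h.
rewrite (@cumulant_perm _ (size r2) s (map f r2)) ?size_map // -?cumulant_kap ?size_map //.
move=> i; have x := tnth t2 i; rewrite !(nth_map x) ?sz ?ltn_ord //; congr f.
have -> : nth x r1 i = tnth t1 i by rewrite (tnth_nth x).
by rewrite (val_inj e : t1 = [tuple tnth t2 (s i) | i < size r2]) tnth_mktuple (tnth_nth x).
Qed.

(** Stands for the class [mixf]: integrability of finite products is what makes cumulants
    multilinear. *)
Variable G : RV -> Prop.
Hypothesis Gint : forall (I : finType) (p : pred I) (F : I -> RV), (forall i, G (F i)) ->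
  cintegrable P (fun w => \prod_(i | p i) F i w).

Lemma cumulant_const (c : K) s : (forall i, G (nth (fun=> 0) s i)) ->
  s != [::] -> cumulant P ((fun=> c) :: s) = 0.
Proof.
move=> Gs sn; rewrite (@cumulant_kap _ (size s).+1) //.
apply: (@kap_const _ K predT (cmom ((fun=> c) :: s)) (@cmom0 _ _) _ ord0 c) => //.
- move=> S S0; rewrite /cmom -cexpectZ; last first.
    have := @Gint 'I_(size s).+1 (fun i => i \in S :\ ord0) (fun i => nth (fun=> 0) s (val i).-1) (fun i => Gs _).
    congr (cintegrable _ _); apply/funext => w; apply: eq_bigr => i.
    by rewrite !finset.inE => /andP[]; case: i => [[|i] hi].
  congr (cexpect _ _); apply/funext => w; rewrite (bigD1 ord0) //=; congr (_ * _).
  by apply: eq_bigl => i; rewrite !finset.inE andbC.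
- apply/eqP => /setP /(_ (inord 1)); rewrite !finset.inE -val_eqE /= inordK ?ltnS ?lt0n ?size_eq0 //.
Qed.

Lemma cumulant_linear s1 s2 (c : K) (X Y : RV) : G X -> G Y -> (forall i, G (nth (fun=> 0) (s1 ++ s2) i)) ->
  cumulant P (s1 ++ (fun w => c * X w + Y w) :: s2) =
  c * cumulant P (s1 ++ X :: s2) + cumulant P (s1 ++ Y :: s2).
Proof.
move=> GX GY Gs; set n := (size s1 + (size s2).+1)%N.
have sz (Z : RV) : size (s1 ++ Z :: s2) = n by rewrite size_cat.
have k0n : (size s1 < n)%N by rewrite /n addnS ltnS leq_addr.
pose k0 := Ordinal k0n.
have nk (Z : RV) : nth (fun=> 0) (s1 ++ Z :: s2) k0 = Z by rewrite nth_cat ltnn subnn.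
have nk' (Z Z' : RV) (k : 'I_n) : k != k0 -> nth (fun=> 0) (s1 ++ Z :: s2) k = nth (fun=> 0) (s1 ++ Z' :: s2) k.
  rewrite -val_eqE /= !nth_cat => ne; case: ltnP => // h.
  by have := ltn_neqAle (size s1) k; rewrite h eq_sym ne /= -subn_gt0; case: (k - _)%N.
have Gk (k : 'I_n) : G (nth (fun=> 0) (s1 ++ X :: s2) k).
  rewrite nth_cat; case: ltnP => h.
    by have := Gs k; rewrite nth_cat h.
  case e: (k - size s1)%N => [//|m] /=.
  have := Gs (size s1 + m)%N; rewrite nth_cat ltnNge leq_addr /=.
  by rewrite addnC addnK.
have E (Z : RV) (B : {set 'I_n}) : k0 \in B -> cmom (s1 ++ Z :: s2) B =
    cexpect P (fun w => Z w * \prod_(i in B :\ k0) nth (fun=> 0) (s1 ++ X :: s2) i w).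
  move=> kB; congr (cexpect _ _); apply/funext => w; rewrite (bigD1 k0) //= nk; congr (_ * _).
  apply: eq_big => [i|i /andP[_ ne]]; first by rewrite !finset.inE andbC.
  by rewrite (nk' Z X).
have cint (Z : RV) (B : {set 'I_n}) : G Z ->
    cintegrable P (fun w => Z w * \prod_(i in B :\ k0) nth (fun=> 0) (s1 ++ X :: s2) i w).
  move=> hZ; have := @Gint _ (fun i => i \in k0 |: B) (fun i : 'I_n => if i == k0 then Z else nth (fun=> 0) (s1 ++ X :: s2) i) _.
  have GF (i : 'I_n) : G (if i == k0 then Z else nth (fun=> 0) (s1 ++ X :: s2) i) by case: eqP.
  move=> /(_ GF); congr (cintegrable _ _); apply/funext => w.
  rewrite (bigD1 k0) ?setU11 //= eqxx; congr (_ * _); apply: eq_big => [i|i /andP[_ /negbTE -> //]].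
  by rewrite !finset.inE; case: (i == k0) => //=; rewrite andbT.
have L (B : {set 'I_n}) : k0 \in B -> cmom (s1 ++ (fun w => c * X w + Y w) :: s2) B =
    c * cmom (s1 ++ X :: s2) B + cmom (s1 ++ Y :: s2) B.
  move=> kB; rewrite !E //.
  have iX := cint X B GX; have iY := cint Y B GY.
  rewrite -cexpectZ // -cexpectD //; last exact: cintZ.
  by congr (cexpect _ _); apply/funext => w; rewrite mulrDl mulrA.
have L' (Z : RV) (B : {set 'I_n}) : k0 \notin B -> cmom (s1 ++ Z :: s2) B = cmom (s1 ++ X :: s2) B.
  move=> kB; congr (cexpect _ _); apply/funext => w; apply: eq_bigr => i iB.
  by rewrite (nk' Z X) //; apply: contraNneq kB => <-.
rewrite !(cumulantE (sz _)) mulr_sumr -big_split; apply: eq_bigr => p hp /=.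
rewrite mulrCA -mulrDr; congr (_ * _).
have kp : finset.pblock p k0 \in p.
  by apply: pblock_mem; rewrite (finset.cover_partition hp) finset.inE.
have kB : k0 \in finset.pblock p k0 by rewrite mem_pblock (finset.cover_partition hp) finset.inE.
have CE (Z : RV) : \prod_(B in p) cexpect P (fun w => \prod_(i in B) nth (fun=> 0) (s1 ++ Z :: s2) i w)
   = cmom (s1 ++ Z :: s2) (finset.pblock p k0) *
     \prod_(B in p | B != finset.pblock p k0) cmom (s1 ++ X :: s2) B.
  rewrite (bigD1 (finset.pblock p k0)) //=; congr (_ * _).
  apply: eq_bigr => B /andP[Bp ne]; apply: L'.
  apply: contraNN ne => kB'; apply/eqP/esym.
  exact: (def_pblock (partition_trivIset hp)).
by rewrite !CE L // mulrDl mulrA.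
Qed.

End CumulantAlgebra.

(** * Cumulants of traces along the cycles of a permutation *)

Section TraceCumulants.
Context {R : realType} {disp : measure_display} {Omega : measurableType disp}.
Variables (P : probability Omega R) (N d : nat).
Local Notation K := R[i].
Local Notation T := 'I_d.
Variables (W : T -> Omega -> 'M[K]_N).
Implicit Types (Q : {set {set T}}) (a : {perm T}) (S B C c : {set T}).

Definition trc a c (w : Omega) : K := \tr (mcyc (W^~ w) a c).

Definition phiN Q a : K := \prod_(B in Q) cumulant P [seq trc a c | c <- enum (cycles_in a B)].

Definition stabb a : pred {set T} := fun S => [forall i, (a i \in S) == (i \in S)].

Lemma stabbP a S : reflect (stab S a) (stabb a S).
Proof. by apply: (iffP forallP) => h i; [apply/eqP|apply/eqP/h]. Qed.

Lemma stab_porbit a S i : stab S a -> i \in S -> porbit a i \subset S.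
Proof.
move=> h iS; apply/fintype.subsetP => j /porbitP[n ->]; elim: n => [|n IH].
  by rewrite expg0 perm1.
by rewrite expgSr permM h.
Qed.

Lemma stab_cover a S (D : {set {set T}}) : D = cycles_in a S -> stab S a -> \bigcup_(c in D) c = S.
Proof.
move=> -> h; apply/setP => k; apply/bigcupP/idP => [[c]|kS].
  by rewrite finset.inE => /andP[_ /fintype.subsetP s] /s.
by exists (porbit a k); rewrite ?porbit_id // finset.inE imset_f //= stab_porbit.
Qed.

(** Through their unions, subfamilies of cycles correspond to stable subsets of B, which is a case
    of [kap_transfer]. *)
Lemma cumulant_cycles a B : stab B a ->
  cumulant P [seq trc a c | c <- enum (cycles_in a B)] = kap (stabb a) (mom1 P W a) B.
Proof.
move=> hB; set cs := enum _; set n := size cs.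
have cP c : c \in cs -> c \in porbits a by rewrite mem_enum finset.inE => /andP[].
have nP (i : 'I_n) : nth finset.set0 cs i \in porbits a by apply/cP/mem_nth.
have nK (i j : 'I_n) k : k \in nth finset.set0 cs i -> k \in nth finset.set0 cs j -> i = j.
  move=> hi hj; apply: val_inj; apply/eqP; rewrite -(nth_uniq finset.set0 (ltn_ord i) (ltn_ord j) (enum_uniq _)); apply/eqP.
  by rewrite -(isp_block (isp_porbits a) (nP i) hi) -(isp_block (isp_porbits a) (nP j) hj).
rewrite (@cumulantE _ _ _ _ _ n) ?size_map //.
have := @kap_transfer 'I_n T K (fun i => nth finset.set0 cs i) (stabb a) (mom1 P W a) (cmom P [seq trc a c | c <- cs]).
have eT : \bigcup_(i in [set: 'I_n]) nth finset.set0 cs i = B.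
  rewrite -[RHS](stab_cover (erefl _) hB); apply/setP => k; apply/bigcupP/bigcupP => [[i _ ki]|[c hc kc]].
    by exists (nth finset.set0 cs i) => //; rewrite -mem_enum mem_nth.
  have hi : (index c cs < n)%N by rewrite index_mem mem_enum.
  by exists (Ordinal hi); rewrite ?finset.inE //= nth_index // mem_enum.
rewrite eT; apply.
- by move=> i; have [k hk] := isp_ex (isp_porbits a) (nP i); apply/set0Pn; exists k.
- exact: nK.
- move=> V; rewrite /cmom /mom1; congr (cexpect _ _); apply/funext => w.
  have -> : cycles_in a (\bigcup_(i in V) nth finset.set0 cs i) = [set nth finset.set0 cs (val i) | i : 'I_n in V].
    apply/setP => c; rewrite finset.inE; apply/andP/imsetP => [[cp cs']|[i iV ->]]; last first.
      by split; [exact: nP|apply/fintype.subsetP => k hk; apply/bigcupP; exists i].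
    have [k kc] := isp_ex (isp_porbits a) cp.
    have /bigcupP[i iV ki] := fintype.subsetP cs' _ kc.
    by exists i => //; rewrite -(isp_block (isp_porbits a) cp kc) (isp_block (isp_porbits a) (nP i) ki).
  rewrite big_imset /=; last first.
    move=> i j _ _ e; have [k hk] := isp_ex (isp_porbits a) (nP i).
    by apply: (nK i j k) => //; rewrite -e.
  by apply: eq_bigr => i _; rewrite (nth_map finset.set0).
move=> S SB; apply/stabbP/eqP => [h|<- k].
  apply/setP => k; apply/bigcupP/idP => [[ i]|kS].
    by rewrite finset.inE => /fintype.subsetP s /s.
  have kB := fintype.subsetP SB _ kS.
  have : k \in B by []; rewrite -{1}eT => /bigcupP[i _ ki]; exists i => //.
  rewrite finset.inE -(isp_block (isp_porbits a) (nP i) ki).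
  have /imsetP[l _ e] : finset.pblock (porbits a) k \in porbits a by apply: isp_pblock; exact: isp_porbits.
  have kl : k \in porbit a l by rewrite -e isp_mem //; exact: isp_porbits.
  rewrite e; move: kl; rewrite porbit_sym -eq_porbit_mem => /eqP ->; exact: stab_porbit.
suff H (i : 'I_n) : (a k \in nth finset.set0 cs i) = (k \in nth finset.set0 cs i).
  by apply/bigcupP/bigcupP => -[i hi hk]; exists i => //; move: hk; rewrite H.
have /imsetP[l _ ->] := nP i.
by rewrite -eq_porbit_mem -[RHS]eq_porbit_mem -[in LHS](expg1 a) porbit_perm.
Qed.

(** The moment-cumulant relation with stable sets as [ok]: a partition has stable blocks exactly
    when it lies above the orbits. *)
Lemma hat_phiN Q a : isp Q -> part_le (porbits a) Q -> hat phiN Q a = mom P W a Q.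
Proof.
move=> hQ aQ; have hg := isp_porbits a.
have okD B C : stabb a B -> stabb a C -> stabb a (B :\: C).
  by move=> /stabbP h1 /stabbP h2; apply/stabbP => i; rewrite !finset.inE h1 h2.
have okI B C : stabb a B -> stabb a C -> stabb a (B :&: C).
  by move=> /stabbP h1 /stabbP h2; apply/stabbP => i; rewrite !finset.inE h1 h2.
have okQ Q' : isp Q' -> part_le (porbits a) Q' -> forall C, C \in Q' -> stabb a C.
  move=> hQ' aQ' C CQ; apply/stabbP; apply: (stab_closed hQ' _ aQ').
  exact: (closed_block hQ' hQ' (part_le_refl hQ')).
have e0 : mom1 P W a finset.set0 = 1.
  rewrite /mom1 -[RHS](cexpect_cst P); congr (cexpect _ _); apply/funext => w.
  rewrite big1 // => c; rewrite finset.inE => /andP[cp]; rewrite finset.subset0 => /eqP c0.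
  by have [k] := isp_ex hg cp; rewrite c0 finset.inE.
have okT : stabb a [set: T] by apply/stabbP => i; rewrite !finset.inE.
have := moment_cumulant e0 okD okI hQ (okQ _ hQ aQ) okT.
rewrite (eq_bigr (mom1 P W a)) => [|C _]; last by rewrite finset.setTI.
rewrite -/(mom P W a Q) => <-; rewrite /hat; apply: eq_big => [p|p /andP[/andP[hp ap] _]]; last first.
  by apply: eq_bigr => B Bp; apply: cumulant_cycles; apply/stabbP; exact: okQ Bp.
rewrite /okp /okpart /part_le -andbA; case: (boolP (isp p)) => hp; last by rewrite /isp in hp; rewrite (negbTE hp).
rewrite (_ : finset.partition p _) //=; congr (_ && _).
  apply/idP/forallP => [h B|h]; first by apply/implyP; exact: (okQ p hp h B).
  apply/porbits_leP => // i; have /stabbP st := implyP (h (finset.pblock p i)) (isp_pblock i hp).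
  by rewrite -in_pblock // st isp_mem.
Qed.

End TraceCumulants.
Local Close Scope set_scope.
(** * Non-commutative polynomials *)

Section NCEvaluation.
Variable K : comNzRingType.
Implicit Types (x y Q : ncpoly K) (c : K) (p : {poly K}).

Definition wordmx N (A B : 'M[K]_N) (m : seq bool) : 'M[K]_N := \prod_(l <- m) (if l then B else A).

Definition pev N p (M : 'M[K]_N) : 'M[K]_N := \sum_(k < size p) p`_k *: M ^+ k.

Lemma horner_algE (x : ncpoly K) p : horner_alg x p = \sum_(k < size p) p`_k *: x ^+ k.
Proof.
rewrite -{1}[p]coefK poly_def linear_sum; apply: eq_bigr => k _.
by rewrite linearZ rmorphXn /= horner_algX; exact: mulr_algl.
Qed.

Lemma horner_alg_linear (x : ncpoly K) c p q :
  horner_alg x (c *: p + q) = c *: horner_alg x p + horner_alg x q.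
Proof. by rewrite linearP /=; congr (_ + _); exact: mulr_algl. Qed.

Variables (N : nat) (A B : 'M[K]_N).
Local Notation ev x := (nc_eval x A B).

Lemma nc_evalEw (E : {fset {fmonom bool}}) Q : (msupp Q `<=` E)%fset ->
  ev Q = \sum_(m <- E) Q@_m *: wordmx A B m.
Proof.
move=> h; rewrite /nc_eval; apply: (big_fset_incl _ h) => m _ nm.
by rewrite mcoeff_outdom // scale0r.
Qed.

Lemma nc_evalP c x y : ev (c *: x + y) = c *: ev x + ev y.
Proof.
pose E := (msupp x `|` msupp y)%fset.
have h1 : (msupp (c *: x + y) `<=` E)%fset.
  apply: fsubset_trans (msuppD_le _ _) _; apply: fsetSU; exact: msuppZ_le.
rewrite (nc_evalEw h1) (@nc_evalEw E x) ?fsubsetUl // (@nc_evalEw E y) ?fsubsetUr //.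
rewrite scaler_sumr -big_split; apply: eq_bigr => m _ /=.
by rewrite mcoeffD mcoeffZ scalerDl scalerA.
Qed.

Lemma nc_eval0 : ev 0 = 0.
Proof. by rewrite /nc_eval msupp0 big_seq_fset0. Qed.

Lemma nc_evalD x y : ev (x + y) = ev x + ev y.
Proof. by have := nc_evalP 1 x y; rewrite !scale1r. Qed.

Lemma nc_evalZ c x : ev (c *: x) = c *: ev x.
Proof. by have := nc_evalP c x 0; rewrite !addr0 nc_eval0 addr0. Qed.

Lemma nc_eval_sum (I : Type) (r : seq I) (q : pred I) (F : I -> ncpoly K) :
  ev (\sum_(k <- r | q k) F k) = \sum_(k <- r | q k) ev (F k).
Proof. exact: (big_morph _ nc_evalD nc_eval0). Qed.

Lemma nc_evalU c m : ev << c *g m >> = c *: wordmx A B m.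
Proof.
rewrite (@nc_evalEw [fset m]%fset) ?msuppU_le // big_seq_fset1.
by rewrite mcoeffUU.
Qed.

Lemma malgU_scale c (m : {fmonom bool}) : (<< c *g m >> : ncpoly K) = c *: << m >>.
Proof. apply/malgP => m'; rewrite mcoeffZ (mcoeffU m c) (mcoeffU m 1); by case: (m == m'); rewrite ?mulr1 ?mulr0. Qed.

Lemma wordmxM (m1 m2 : {fmonom bool}) : wordmx A B (mmul m1 m2) = wordmx A B m1 * wordmx A B m2.
Proof. have -> : mmul m1 m2 = FMonom (m1 ++ m2) := fmmulE m1 m2.
by rewrite /wordmx big_cat. Qed.

Lemma nc_evalM x y : ev (x * y) = ev x * ev y.
Proof.
rewrite malgME nc_eval_sum /nc_eval mulr_suml; apply: eq_bigr => m1 _.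
rewrite -/(nc_eval _ A B) nc_eval_sum mulr_sumr; apply: eq_bigr => m2 _.
rewrite nc_evalU wordmxM -scalerA.
by rewrite -[RHS]/((x@_m1 *: wordmx A B m1) *m (y@_m2 *: wordmx A B m2)) -scalemxAl -scalemxAr.
Qed.

Lemma nc_eval_trC x y : \tr (ev (x * y)) = \tr (ev (y * x)).
Proof.
apply: etrans (congr1 mxtrace (nc_evalM x y)) _; apply: etrans (mxtrace_mulC (ev x) (ev y)) _.
exact: (congr1 mxtrace (esym (nc_evalM y x))).
Qed.

Lemma nc_eval1 : ev 1 = 1.
Proof. have := nc_evalU 1 mone; rewrite scale1r /wordmx (fmoneE bool : mone = FMonom [::]) big_nil => <-.
by rewrite -(fmoneE bool). Qed.

Lemma nc_evala : ev (nc_a K) = A.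
Proof. by rewrite /nc_a nc_evalU scale1r /wordmx fmuE big_seq1. Qed.

Lemma nc_evalb : ev (nc_b K) = B.
Proof. by rewrite /nc_b nc_evalU scale1r /wordmx fmuE big_seq1. Qed.

Lemma nc_evalX x k : ev (x ^+ k) = ev x ^+ k.
Proof. by elim: k => [|k IH]; rewrite ?nc_eval1 // !exprS nc_evalM IH. Qed.

Lemma nc_eval_prod (I : Type) (r : seq I) (F : I -> ncpoly K) :
  ev (\prod_(k <- r) F k) = \prod_(k <- r) ev (F k).
Proof. exact: (big_morph _ nc_evalM nc_eval1). Qed.

Lemma nc_eval_horner x p : ev (horner_alg x p) = pev p (ev x).
Proof.
rewrite horner_algE nc_eval_sum; apply: eq_bigr => k _.
by rewrite nc_evalZ nc_evalX.
Qed.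

End NCEvaluation.

(** * Multilinear extension from a spanning family *)

Section LinearExtension.
Variables (K : nzRingType) (V : lmodType K) (I : Type) (b : I -> V) (L : seq V -> Prop).
Hypothesis Llin : forall s1 s2 (c : K) x y, L (s1 ++ x :: s2) -> L (s1 ++ y :: s2) ->
  L (s1 ++ (c *: x + y) :: s2).
Hypothesis L0 : forall s1 s2, L (s1 ++ 0 :: s2).
Hypothesis Lb : forall r : seq I, (0 < size r)%N -> L (map b r).
Hypothesis span : forall v, exists r : seq (K * I), v = \sum_(z <- r) z.1 *: b z.2.

Lemma linear_extension s : (0 < size s)%N -> L s.
Proof.
(* Entries are treated from the left: the prefix [map b r] already consists of generators. *)
suff H : forall s r, (0 < size r + size s)%N -> L (map b r ++ s) by move=> h; exact: (H s [::]).
elim=> [|v s' IH] r h; first by rewrite cats0; apply: Lb; rewrite addn0 in h.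
have [e ->] := span v; elim: e => [|[c i] e IHe]; first by rewrite big_nil.
rewrite big_cons; apply: Llin => //=.
have := IH (rcons r i); rewrite size_rcons => /(_ isT).
by rewrite map_rcons cat_rcons.
Qed.

End LinearExtension.

(** * Orders of expansion *)

Section Levels.
Definition lev (G0 n0 n : nat) : int := G0%:Z + Num.min 0 ((n0%:Z - n%:Z) *+ 2).

Lemma levE G0 n0 n : lev G0 n0 n = G0%:Z - ((n - n0)%N%:Z) *+ 2.
Proof. rewrite /lev; case: (leP 0 ((n0%:Z - n%:Z) *+ 2 : int)) => h; lia. Qed.

Lemma level_lev t n m d : in_xtyp t -> level t n m -> (0 < n <= d)%N ->
  exists G0 n0 : nat, [/\ (0 < n0)%N, m = lev G0 n0 n &
    forall n', (n' <= d)%N -> level t n' (lev G0 n0 n')].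
Proof.
case: t => [G0 n0|G0|] /= ht hl /andP[n1 nd].
- by exists G0, n0; split.
- exists G0, d; split; first exact: leq_trans n1 nd.
    by rewrite hl levE; lia.
  by move=> n' h; rewrite levE; lia.
exists (absz m), d; split; first exact: leq_trans n1 nd.
  by rewrite levE; lia.
by move=> n' h; rewrite levE; lia.
Qed.

Lemma level1 t m : in_xtyp t -> level t 1 m -> 0 <= m.
Proof. case: t => [G0 n0|G0|] //=; last by move=> _ ->.
by move=> h ->; have := levE G0 n0 1; rewrite /lev; move: h; lia. Qed.
End Levels.

(** * Cumulants of polynomials in the two matrices *)

Section Model.
Variables (R : realType) (disp : nat -> measure_display).
Variable Omega : forall N : nat, measurableType (disp N).
Variable P : forall N : nat, probability (Omega N) R.
Variables (A B : forall N : nat, Omega N -> 'M[R[i]]_N).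
Arguments A : clear implicits.
Arguments B : clear implicits.
Hypotheses (rA : forall N, random_mx (A N)) (rB : forall N, random_mx (B N)).
Hypotheses (mA : forall N, has_moments (P N) (A N)) (mB : forall N, has_moments (P N) (B N)).
Hypothesis ABind : forall N, independent_mx (P N) (A N) (B N).
Arguments rA : clear implicits.
Arguments rB : clear implicits.
Arguments mA : clear implicits.
Arguments mB : clear implicits.
Arguments ABind : clear implicits.
Local Notation K := R[i].
Local Notation NC := (ncpoly K).
Implicit Types (x y : NC) (s : seq NC) (c : K).

Definition evR x N w := nc_eval x (A N w) (B N w).
Definition trR x N : Omega N -> K := fun w => \tr (evR x w).
Definition cumN s N := cumulant (P N) [seq @trR x N | x <- s].

Lemma mixf_ev x N a b : mixf (A N) (B N) (fun w => evR x w a b).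
Proof.
have -> : (fun w => evR x w a b) = (fun w => \sum_(m <- msupp x) x@_m * wordmx (A N w) (B N w) m a b).
  by apply/funext => w; rewrite summxE; apply: eq_bigr => m _; rewrite mxE.
apply: mixf_sum => m _; apply: mixf_mul; first exact: mixf_cst.
elim: {m}(m : seq bool) a b => [|l m IH] a b.
  have -> : (fun w => wordmx (A N w) (B N w) [::] a b) = (fun=> (a == b)%:R).
    by apply/funext => w; rewrite /wordmx big_nil mxE.
  exact: mixf_cst.
have -> : (fun w => wordmx (A N w) (B N w) (l :: m) a b) =
   (fun w => \sum_k (if l then B N w else A N w) a k * wordmx (A N w) (B N w) m k b).
  by apply/funext => w; rewrite /wordmx big_cons mxE.
apply: mixf_sum => k _; apply: mixf_mul => //.
by case: l; [apply: (mixf_r _ _ (polyf_entry a k))|apply: (mixf_l _ _ (polyf_entry a k))].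
Qed.

Lemma mixf_tr x N : mixf (A N) (B N) (@trR x N).
Proof. by apply: mixf_sum => a _; exact: mixf_ev. Qed.

Lemma mixf_int N (I : finType) (p : pred I) (F : I -> Omega N -> K) :
  (forall i, mixf (A N) (B N) (F i)) -> cintegrable (P N) (fun w => \prod_(i | p i) F i w).
Proof.
move=> h; have hp : mixf (A N) (B N) (fun w => \prod_(i | p i) F i w) by apply: mixf_prod => i _; exact: h.
exact: (mixf_cint (rA N) (rB N) (mA N) (mB N) (ABind N) hp).
Qed.

Lemma cint_tr s N : cintegrable (P N) (fun w => \prod_(x <- s) \tr (evR x w)).
Proof.
have hp : mixf (A N) (B N) (fun w => \prod_(x <- s) trR x w) by apply: mixf_prod => x _; exact: mixf_tr.
exact: (mixf_cint (rA N) (rB N) (mA N) (mB N) (ABind N) hp).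
Qed.

Let mixs N s k : mixf (A N) (B N) (nth (fun=> 0) [seq @trR x N | x <- s] k).
Proof.
by elim: s k => [|x s IH] [|k] //=; first [exact: mixf_cst|exact: mixf_tr].
Qed.

Lemma cumN_linear s1 s2 c x y N :
  cumN (s1 ++ (c *: x + y) :: s2) N = c * cumN (s1 ++ x :: s2) N + cumN (s1 ++ y :: s2) N.
Proof.
rewrite /cumN !map_cat /=.
have -> : @trR (c *: x + y) N = (fun w => c * trR x w + trR y w).
  by apply/funext => w; rewrite /trR /evR nc_evalP mxtraceD mxtraceZ.
apply: (cumulant_linear (@mixf_int N)); [exact: mixf_tr|exact: mixf_tr|].
by move=> k; rewrite -map_cat; exact: mixs.
Qed.

Lemma cumN0 s1 s2 N : cumN (s1 ++ 0 :: s2) N = 0.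
Proof.
have := cumN_linear s1 s2 (-1) 0 0 N; rewrite scaler0 addr0 mulN1r addNr //.
Qed.

Lemma cumN_perm s1 s2 N : perm_eq s1 s2 -> cumN s1 N = cumN s2 N.
Proof. exact: cumulant_perm_eq. Qed.

Lemma cumN_tr s1 s2 x y N : cumN (s1 ++ x * y :: s2) N = cumN (s1 ++ y * x :: s2) N.
Proof.
have e : @trR (x * y) N = @trR (y * x) N.
  by apply/funext => w; exact: nc_eval_trC.
by move: e; move: (x * y) (y * x) => u v e; rewrite /cumN !map_cat /= e.
Qed.

Lemma tr_one N : @trR 1 N = fun=> N%:R.
Proof. by apply/funext => w; rewrite /trR /evR nc_eval1; exact: mxtrace1. Qed.

Lemma cumN_one s N : (0 < size s)%N -> cumN (1 :: s) N = 0.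
Proof.
move=> h; rewrite /cumN /= tr_one.
apply: (cumulant_const (@mixf_int N)); first exact: mixs.
by case: s h.
Qed.

Lemma cumulant1 N (X : Omega N -> K) : cumulant (P N) [:: X] = cexpect (P N) X.
Proof.
rewrite (@cumulant_kap _ _ _ _ _ 1%N) //.
have i0 : ord0 \in [set: 'I_1]%SET by rewrite finset.inE.
have c0 := @cmom0 _ _ _ (P N) 1 [:: X].
have := @kap_rec _ _ predT (cmom (P N) [:: X]) c0 (fun _ _ _ _ => isT) _ _ i0 isT.
rewrite (bigD1 [set: 'I_1]%SET) /=; last by rewrite finset.subsetT i0.
rewrite big1 => [|C /andP[/and3P[_ iC _] ne]]; last first.
  case/eqP: ne; apply/setP => k; rewrite finset.inE; case: k iC => [[|//] hk] iC; rewrite -{}iC; congr (_ \in C); exact: val_inj.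
rewrite finset.setDv c0 mulr1 addr0 => <-; rewrite /cmom; congr (cexpect _ _); apply/funext => w.
by rewrite (bigD1 ord0) //= big1 ?mulr1 // => k /andP[_]; case: k => [[|//] hk] /eqP; case; exact: val_inj.
Qed.

Lemma cumN_one1 N : cumN [:: 1] N = N%:R.
Proof. by rewrite /cumN /= tr_one cumulant1 cexpect_cst. Qed.

Definition expands m s := exists F, expd (size s)%N m (cumN s) F.

Lemma expands_linear m s1 s2 c x y : expands m (s1 ++ x :: s2) -> expands m (s1 ++ y :: s2) ->
  expands m (s1 ++ (c *: x + y) :: s2).
Proof.
move=> [F hF] [F' hF']; exists (fun G => c * F G + F' G).
have e x' y' : size (s1 ++ x' :: s2) = size (s1 ++ y' :: s2) by rewrite !size_cat.
rewrite (e _ x); rewrite (e _ x) in hF'; have := expd_linear c hF hF'.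
by apply: (expd_ext (N1 := 0%N)) => N _; rewrite cumN_linear.
Qed.

Lemma expands0 m s : (forall N, cumN s N = 0) -> expands m s.
Proof.
move=> h; exists (fun G => (0 : {poly K})`_G); apply: AppP_expd.
by apply: (AppP_ext (N1 := 0%N) _ (AppP0 _ _)) => N _; rewrite h.
Qed.

Lemma expands_perm m s1 s2 : perm_eq s1 s2 -> expands m s1 -> expands m s2.
Proof.
move=> h [F hF]; exists F; rewrite -(perm_size h).
by apply: (expd_ext (N1 := 0%N)) hF => N _; exact: cumN_perm.
Qed.

Lemma expd_one1 m : expd 1 m (cumN [:: 1]) (fun G => (1%:P : {poly K})`_G).
Proof.
apply: AppP_expd.
apply: (AppP_ext (N1 := 1%N) _ (AppP_poly _ _ 1%:P)) => N N1.
by rewrite cumN_one1 hornerC mulr1 /= (_ : - (1%:Z - 2) = 1).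
Qed.

Lemma expands_one1 m : expands m [:: 1].
Proof. by exists (fun G => (1%:P : {poly K})`_G); exact: expd_one1. Qed.

Lemma cumN_map (v : NC) (ks : seq nat) N :
  cumN [seq horner_alg v ('X^k : {poly K}) | k <- ks] N =
  cumulant (P N) [seq (fun w => \tr (evR v w ^+ k)) | k <- ks].
Proof.
rewrite /cumN -map_comp; congr cumulant; apply: eq_map => k /=; apply/funext => w.
by rewrite /trR /evR rmorphXn /= horner_algX nc_evalX.
Qed.

(** Monomials suffice by multilinearity. The hypothesis covers positive exponents only; X^0 has the
    constant trace N, whose cumulant is N when alone and vanishes in the presence of other
    entries. *)
Lemma expands_poly (t : xtyp) (v : NC) (X : forall N, Omega N -> 'M[K]_N) : admits_limit P X t ->
  (forall N w, evR v w = X N w) ->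
  forall (ps : seq {poly K}) m, (0 < size ps)%N -> level t (size ps) m ->
  expands m [seq horner_alg v p | p <- ps].
Proof.
move=> [_ [F hF]] ev ps m n0.
pose L (s : seq {poly K}) := level t (size s) m -> expands m [seq horner_alg v p | p <- s].
suff : L ps by apply.
apply: (@linear_extension K {poly K} nat (fun k => 'X^k) L) n0 => {ps}.
- move=> s1 s2 c x y; rewrite /L !map_cat /= !size_cat /= (horner_alg_linear v c x y) => h1 h2 hl.
  exact: (expands_linear c (h1 hl) (h2 hl)).
- by move=> s1 s2 _; apply: expands0 => N; rewrite map_cat /= linear0 cumN0.
- move=> ks n0; rewrite /L size_map -map_comp => hl.
  case: (boolP (all (leq 1) ks)) => h.
    have := (has_expansionE _ _ _ _).1 (hF ks n0 h) m hl => h'.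
    exists (fun G => F G ks); rewrite size_map; apply: (expd_ext (N1 := 0%N) _ h') => N _.
    by rewrite (cumN_map v); congr cumulant; apply: eq_map => k; apply/funext => w; rewrite ev.
  have k0 : 0%N \in ks.
    by move: h; rewrite -has_predC => /hasP[[|k] hk].
  have := perm_to_rem k0; set r := rem _ _ => pr.
  apply: (@expands_perm m (1 :: [seq horner_alg v ('X^k : {poly K}) | k <- r])).
    rewrite perm_sym -(rmorph1 (horner_alg v)) -(expr0 'X); exact: perm_map pr.
  case: (posnP (size r)) => [/size0nil -> //|r0]; first exact: expands_one1.
  by apply: expands0 => N; apply: cumN_one; rewrite size_map.
move=> p; exists [seq (p`_k, k) | k <- iota 0 (size p)].
by rewrite big_map /= -{1}[p]coefK poly_def -(big_mkord xpredT (fun k => p`_k *: 'X^k)) /index_iota subn0.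
Qed.

End Model.
(** * Error terms *)

Local Open Scope set_scope.
Section Smallness.
Variables (R : realType) (d : nat).
Local Notation K := R[i].
Local Notation T := 'I_d.
Local Notation normc := (@Normc.normc R).
Implicit Types (C D Q : {set {set T}}) (g a b : {perm T}) (J : {set T}).

Lemma bo_common (I : finType) (u : I -> nat -> K) : (forall k, exists e, bo (u k) e) ->
  exists2 e : int, 0 <= e & forall k, bo (u k) e.
Proof.
move=> H; have [e he] := choice H; exists (\sum_k `|e k|); first exact: sumr_ge0.
move=> k; apply: bo_le (he k); apply: le_trans (ler_norm _) _.
by rewrite (bigD1 k) //= lerDl sumr_ge0.
Qed.

Lemma hat_bo (f : nat -> {set {set T}} -> {perm T} -> K) E C g :
  (forall D a, okp D a -> bo (fun N => f N D a) E) -> bo (fun N => hat (f N) C g) E.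
Proof. by move=> H; apply: bo_sum => D /andP[/H]. Qed.

(** Moebius inversion: the value at C is [hat] at C minus the values at smaller partitions, which
    are bounded by induction. *)
Lemma hat_bo_inv (f : nat -> {set {set T}} -> {perm T} -> K) E :
  (forall C g, isp C -> part_le (porbits g) C -> bo (fun N => hat (f N) C g) E) ->
  forall C g, okp C g -> bo (fun N => f N C g) E.
Proof.
move=> H C g /andP[hC gC]; move: gC.
apply: (part_lt_ind (S := fun C => part_le (porbits g) C -> bo (fun N => f N C g) E)) hC => {}C hC IH gC.
have := boB (H C g hC gC) (bo_sum (index_enum {set {set T}})
  (p := fun D => (okp D g && part_le D C) && (D != C)) (f := fun D N => f N D g) (e := E) _).
have h D : (okp D g && part_le D C) && (D != C) -> bo (fun N => f N D g) E.
  by move=> /andP[/andP[/andP[hD gD] DC] ne]; exact: IH.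
move=> /(_ h); apply: eq_bo => N; rewrite /hat (bigD1 C) /=; last by rewrite /okp hC gC part_le_refl.
by rewrite addrK.
Qed.

Lemma gconv_bo C (F H : nat -> {perm T} -> K) e1 e2 g :
  (forall a, bo (fun N => F N a) e1) -> (forall a, bo (fun N => H N a) e2) ->
  bo (fun N => gconv C (F N) (H N) g) (e1 + e2).
Proof. by move=> h1 h2; apply: bo_sum => a _; apply: boM. Qed.

(** V inverts z up to e: it cancels z between the coefficients of Y and the moments of Z, and the
    error stays in the same place. *)
Lemma gconv_unit_l C (V z cY e h : {perm T} -> K) g : isp C -> part_le (porbits g) C ->
  (forall a b, z (a * b)%g = z (b * a)%g) ->
  (forall a, part_le (porbits a) C -> gconv C V z a = (a == 1%g)%:R + e a) ->
  gconv C (gconv C (gconv C cY z) V) h g = gconv C cY h g + gconv C (gconv C cY e) h g.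
Proof.
move=> hC gC zC Hz; rewrite -gconvDl; apply: eq_gconv => // a aC.
rewrite -gconvA // (@eq_gconv _ _ C cY cY (gconv C z V) (fun a => (a == 1%g)%:R + e a)) //.
  by rewrite gconvDr gconv1r.
by move=> b bC; rewrite -(gconvC V hC bC zC) Hz.
Qed.

Lemma gconv_unit_r C (V z cY cZ e : {perm T} -> K) g : isp C -> part_le (porbits g) C ->
  (forall a b, z (a * b)%g = z (b * a)%g) ->
  (forall a, part_le (porbits a) C -> gconv C V z a = (a == 1%g)%:R + e a) ->
  gconv C V (gconv C cY (gconv C cZ z)) g = gconv C cY cZ g + gconv C e (gconv C cY cZ) g.
Proof.
move=> hC gC zC Hz.
rewrite (@eq_gconv _ _ C V V _ (gconv C z (gconv C cY cZ))) //; last first.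
  by move=> b bC; rewrite gconvA // gconvC.
rewrite gconvA // (@eq_gconv _ _ C _ (fun a => (a == 1%g)%:R + e a) _ (gconv C cY cZ)) //.
by rewrite gconvDl gconv1l.
Qed.

Variables (J : {set T}) (N1 : nat) (fX fY fZ : nat -> {set {set T}} -> {perm T} -> K).
Hypotheses (d0 : (0 < d)%N) (N1_ge : (2 * d`! <= N1)%N).
Hypotheses (bY : forall C g, okp C g -> exists e, bo (fun N => fY N C g) e)
  (bZ : forall C g, okp C g -> exists e, bo (fun N => fZ N C g) e).
Hypothesis struct : forall N, (N1 <= N)%N -> exists cY cZ : {set {set T}} -> {perm T} -> K,
  [/\ forall D g, ~~ part_le (porbits g) D -> cY D g = 0,
      forall D g, ~~ part_le (porbits g) D -> cZ D g = 0,
      forall Q g, isp Q -> part_le (porbits g) Q ->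
        hat (fY N) Q g = gconv Q (cY (rf J Q)) (zt R N) g,
      forall Q g, isp Q -> part_le (porbits g) Q ->
        hat (fZ N) Q g = gconv Q (cZ (rf (~: J) Q)) (zt R N) g &
      forall Q g, isp Q -> part_le (porbits g) Q ->
        hat (fX N) Q g = gconv Q (cY (rf J Q)) (gconv Q (cZ (rf (~: J) Q)) (zt R N)) g].

Lemma N1_gt0 N : (N1 <= N)%N -> (0 < N)%N.
Proof. by apply: leq_trans; apply: leq_trans N1_ge; rewrite muln_gt0 fact_gt0. Qed.

Lemma ztC N a b : zt R N (a * b)%g = zt R N (b * a)%g.
Proof. by rewrite /zt card_porbits_mulC. Qed.

Lemma zt_zz N a : (0 < N)%N -> zt R N a = N%:R ^ (- d%:Z) * @zz R N d a.
Proof.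
by move=> N0; rewrite /zt /zz opprB addrC natXC_add // mulrC -exprnP.
Qed.

Lemma coef_bound N Q (c : {perm T} -> K) (B : R) : isp Q -> (N1 <= N)%N ->
  (forall g, part_le (porbits g) Q -> normc (gconv Q c (zt R N) g) <= B) ->
  forall g, part_le (porbits g) Q -> normc (c g) <= 2 * B.
Proof.
move=> hQ hN H g gQ; have N0 := N1_gt0 hN.
have Np : (0 : R) < N%:R ^+ d by rewrite exprn_gt0 // ltr0n.
have := gconv_zz_bound N0 d0 (leq_trans N1_ge hN) hQ (c := c) (B := B * N%:R ^+ d) _ gQ.
rewrite mulrA mulfK ?gt_eqF //; apply=> a aQ.
have -> : gconv Q c (@zz R N d) a = N%:R ^+ d * gconv Q c (zt R N) a.
  rewrite /gconv mulr_sumr; apply: eq_bigr => b _; rewrite zt_zz // mulrCA; congr (_ * _).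
  rewrite mulrA exprnP -natXC_add // subrr expr0z mul1r //.
rewrite Normc.normcM normcX normc_nat mulrC; apply: ler_wpM2r; first exact: ltW.
exact: H.
Qed.

(** Polynomial bounds on the moments become polynomial bounds on the coefficients by [coef_bound].
    The exponent e is obtained before any truncation order M enters. *)
Lemma structure_sequences : exists cY cZ : nat -> {set {set T}} -> {perm T} -> K, exists2 e : int, 0 <= e &
  (forall Q g, isp Q -> bo (fun N => cY N (rf J Q) g) e /\ bo (fun N => cZ N (rf (~: J) Q) g) e) /\
  forall N, (N1 <= N)%N ->
  [/\ forall D g, ~~ part_le (porbits g) D -> cY N D g = 0,
      forall D g, ~~ part_le (porbits g) D -> cZ N D g = 0,
      forall Q g, isp Q -> part_le (porbits g) Q ->
        hat (fY N) Q g = gconv Q (cY N (rf J Q)) (zt R N) g,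
      forall Q g, isp Q -> part_le (porbits g) Q ->
        hat (fZ N) Q g = gconv Q (cZ N (rf (~: J) Q)) (zt R N) g &
      forall Q g, isp Q -> part_le (porbits g) Q ->
        hat (fX N) Q g = gconv Q (cY N (rf J Q)) (gconv Q (cZ N (rf (~: J) Q)) (zt R N)) g].
Proof.
have H N : exists c : ({set {set T}} -> {perm T} -> K) * ({set {set T}} -> {perm T} -> K), (N1 <= N)%N ->
  [/\ forall D g, ~~ part_le (porbits g) D -> c.1 D g = 0,
      forall D g, ~~ part_le (porbits g) D -> c.2 D g = 0,
      forall Q g, isp Q -> part_le (porbits g) Q ->
        hat (fY N) Q g = gconv Q (c.1 (rf J Q)) (zt R N) g,
      forall Q g, isp Q -> part_le (porbits g) Q ->
        hat (fZ N) Q g = gconv Q (c.2 (rf (~: J) Q)) (zt R N) g &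
      forall Q g, isp Q -> part_le (porbits g) Q ->
        hat (fX N) Q g = gconv Q (c.1 (rf J Q)) (gconv Q (c.2 (rf (~: J) Q)) (zt R N)) g].
  case: (leqP N1 N) => h; last by exists (fun _ _ => 0, fun _ _ => 0).
  by have [cY [cZ h']] := struct h; exists (cY, cZ).
have [c hc] := choice H.
have hatb (f : nat -> {set {set T}} -> {perm T} -> K) :
    (forall C g, okp C g -> exists e, bo (fun N => f N C g) e) ->
    exists e, forall C g, bo (fun N => hat (f N) C g) e.
  move=> bf.
  have [|e e0 he] := @bo_common ({set {set T}} * {perm T})%type (fun z N => if okp z.1 z.2 then f N z.1 z.2 else 0).
    move=> [C g] /=; case: (boolP (okp C g)) => h; first exact: bf.
    by exists 0; exact: bo0.
  exists e => C g; apply: hat_bo => D a h; have := he (D, a) => /=; by rewrite h.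
have cb (f : nat -> {set {set T}} -> {perm T} -> K) (cc : nat -> {set {set T}} -> {perm T} -> K) (J' : {set T}) :
    (forall C g, okp C g -> exists e, bo (fun N => f N C g) e) ->
    (forall N, (N1 <= N)%N -> (forall D g, ~~ part_le (porbits g) D -> cc N D g = 0) /\
      forall Q g, isp Q -> part_le (porbits g) Q -> hat (f N) Q g = gconv Q (cc N (rf J' Q)) (zt R N) g) ->
    exists e, forall Q g, isp Q -> bo (fun N => cc N (rf J' Q) g) e.
  move=> bf hcc; have [e he] := hatb f bf; exists e => Q g hQ.
  (* [coef_bound] asks for one bound valid for all permutations; the sum of the moduli dominates
     each of them. *)
  have he' a : bo (fun N => (normc (hat (f N) Q a))%:C%C) e.
    have [k k0 [N0 h0]] := he Q a; exists k => //; exists N0 => N hN.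
    apply: le_trans (h0 N hN); rewrite /= expr0n addr0 sqrtr_sqr ger0_norm //; exact: normc_ge0.
  have [k k0 [N0 h0]] := bo_sum (index_enum {perm T}) (p := xpredT) (fun a _ => he' a).
  exists (2 * k); first by rewrite mulr_gt0.
  exists (maxn N0 N1) => N; rewrite geq_max => /andP[hN0 hN1].
  have [supp eqh] := hcc N hN1.
  case: (boolP (part_le (porbits g) (rf J' Q))) => gr; last first.
    by rewrite supp // Normc.normc0 !mulr_ge0 ?natX_ge0 // ltW.
  have [gQ _] := (rf_porbits J' g hQ).1 gr.
  rewrite -mulrA; apply: (coef_bound hQ hN1 _ gQ) => a aQ; rewrite -eqh //.
  apply: le_trans (h0 N hN0).
  rewrite -rmorph_sum /= expr0n addr0 sqrtr_sqr ger0_norm ?sumr_ge0 // => [|b _]; last exact: normc_ge0.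
  by rewrite (bigD1 a) //= lerDl sumr_ge0 // => b _; exact: normc_ge0.
have [eY hY] := cb fY (fun N => (c N).1) J bY (fun N hN => let: And5 s1 _ h _ _ := hc N hN in conj s1 h).
have [eZ hZ] := cb fZ (fun N => (c N).2) (~: J) bZ (fun N hN => let: And5 _ s1 _ h _ := hc N hN in conj s1 h).
exists (fun N => (c N).1), (fun N => (c N).2), (`|eY| + `|eZ|); first exact: addr_ge0.
split=> // Q g hQ; split.
  by apply: bo_le (hY Q g hQ); apply: le_trans (ler_norm _) _; rewrite lerDl.
by apply: bo_le (hZ Q g hQ); apply: le_trans (ler_norm _) _; rewrite lerDr.
Qed.

Lemma mu_error M C : isp C -> exists e : nat -> {perm T} -> K,
  (forall a, bo (fun N => e N a) (- (M.+1)%:Z)) /\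
  forall N a, (0 < N)%N -> part_le (porbits a) C ->
    gconv C (hat (muN R M N) C) (zt R N) a = (a == 1%g)%:R + e N a.
Proof.
move=> hC; have H a : exists e : nat -> K, bo e (- (M.+1)%:Z) /\ (part_le (porbits a) C ->
   forall N, (0 < N)%N -> gconv C (hat (muN R M N) C) (zt R N) a = (a == 1%g)%:R + e N).
  case: (boolP (part_le (porbits a) C)) => h; last by exists (fun=> 0); split; [exact: bo0|].
  by have [e he1 he2] := muN_zeta R M hC h; exists e.
have [e he] := choice H; exists (fun N a => e a N); split=> [a|N a N0 aC]; first by case: (he a).
by case: (he a) => _ ->.
Qed.

Lemma conv_small E : exists M0, forall M, (M0 <= M)%N -> forall C g, okp C g ->
  bo (fun N => conv (conv (fY N) (muN R M N)) (fZ N) C g - fX N C g) (- E).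
Proof.
have [cY [cZ [e e0 [hb hs]]]] := structure_sequences.
have [eZ eZ0 hZ] : exists2 eZ : int, 0 <= eZ & forall C g, isp C -> bo (fun N => gconv C (cZ N (rf (~: J) C)) (zt R N) g) eZ.
  exists (e + d%:Z); first by rewrite addr_ge0.
  move=> C g hC; apply: gconv_bo => a; first by have [] := hb C a hC.
  apply: bo_le (bo_pow R _); have := rank_perm a; lia.
(* The error is of order N^(e - (M + 1) + eZ), which is at most N^-E for such M. *)
exists (absz (E + e + eZ)) => M hM; apply: hat_bo_inv => C g hC gC.
have [er [her1 her2]] := mu_error M hC.
have : bo (fun N => gconv C (gconv C (cY N (rf J C)) (er N)) (gconv C (cZ N (rf (~: J) C)) (zt R N)) g) (- E).
  apply: (@bo_le _ _ (e + - (M.+1)%:Z + eZ)); first by lia.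
  apply: gconv_bo => a; last exact: hZ.
  apply: gconv_bo => b; last exact: her1.
  by have [] := hb C b hC.
apply: (bo_ext (N1 := N1)) => N hN; have N0 := N1_gt0 hN.
have [sY sZ hY' hZ' hX'] := hs N hN.
have -> : hat (fun D a => conv (conv (fY N) (muN R M N)) (fZ N) D a - fX N D a) C g =
   hat (conv (conv (fY N) (muN R M N)) (fZ N)) C g - hat (fX N) C g by rewrite /hat sumrB.
rewrite hat_conv // hX' //.
rewrite (@eq_gconv _ _ C (hat (conv (fY N) (muN R M N)) C) (gconv C (gconv C (cY N (rf J C)) (zt R N)) (hat (muN R M N) C)) (hat (fZ N) C)
   (gconv C (cZ N (rf (~: J) C)) (zt R N))) //; last 2 first.
- move=> a aC; rewrite hat_conv //; apply: eq_gconv => // b bC; exact: hY'.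
- by move=> a aC; exact: hZ'.
rewrite (gconv_unit_l _ _ hC gC (@ztC N) (fun a aC => her2 N a N0 aC)).
by rewrite addrAC subrr add0r.
Qed.

Definition bip := eqpart (fun k l => (k \in J) == (l \in J)).

Lemma bip_equiv : equivalence_rel (fun k l : T => (k \in J) == (l \in J)).
Proof. by move=> k l m; split=> // /eqP ->. Qed.

Lemma isp_bip : isp bip. Proof. exact: isp_eqpart bip_equiv. Qed.
Lemma prel_bip k l : prel bip k l = ((k \in J) == (l \in J)).
Proof. exact: prel_eqpart bip_equiv. Qed.

Definition meetb C := eqpart (fun k l => prel C k l && ((k \in J) == (l \in J))).

Lemma meetb_equiv C : equivalence_rel (fun k l : T => prel C k l && ((k \in J) == (l \in J))).
Proof.
move=> k l m; split; first by rewrite prel_refl eqxx.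
by rewrite /prel => /andP[/eqP -> /eqP ->].
Qed.

Lemma isp_meetb C : isp (meetb C). Proof. exact: isp_eqpart (meetb_equiv C). Qed.
Lemma prel_meetb C k l : prel (meetb C) k l = prel C k l && ((k \in J) == (l \in J)).
Proof. exact: prel_eqpart (meetb_equiv C). Qed.

Lemma le_meetb D C : isp D -> isp C -> part_le D (meetb C) = part_le D C && part_le D bip.
Proof.
move=> hD hC; apply/(part_leP hD (isp_meetb C))/andP => [h|[/(part_leP hD hC) h1 /(part_leP hD isp_bip) h2] k l hkl].
  split; apply/part_leP => //; rewrite ?isp_bip // => k l /h; rewrite prel_meetb => /andP[] //.
  by rewrite prel_bip.
by rewrite prel_meetb h1 //= -prel_bip h2.
Qed.

Lemma rf_meetb C : rf J (meetb C) = rf J C /\ rf (~: J) (meetb C) = rf (~: J) C.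
Proof.
split; apply: rf_eq => k l; rewrite ?finset.inE prel_meetb.
  by move=> -> ->; rewrite eqxx andbT.
by move=> /negbTE -> /negbTE ->; rewrite eqxx andbT.
Qed.

Lemma rf_le_meetb C : isp C -> part_le (rf J C) (meetb C) /\ part_le (rf (~: J) C) (meetb C).
Proof. by move=> hC; have [<- <-] := rf_meetb C; split; apply: rf_le; exact: isp_meetb. Qed.

(** Permutations below the traces of C on J and on its complement preserve both sets, so their
    products see only the meet of C with {J, complement}. *)
Lemma gconv_meetb C (c c' : {set {set T}} -> {perm T} -> K) g : isp C ->
  (forall D a, ~~ part_le (porbits a) D -> c D a = 0) ->
  (forall D a, ~~ part_le (porbits a) D -> c' D a = 0) ->
  gconv C (c (rf J C)) (c' (rf (~: J) C)) g =
  if part_le (porbits g) (meetb C) then gconv (meetb C) (c (rf J (meetb C))) (c' (rf (~: J) (meetb C))) g else 0.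
Proof.
move=> hC sc sc'; have [-> ->] := rf_meetb C; have [l1 l2] := rf_le_meetb hC.
have hm := isp_meetb C.
have up D a : isp D -> part_le D (meetb C) -> part_le (porbits a) D -> part_le (porbits a) (meetb C).
  by move=> hD h1 h2; exact: part_le_trans (isp_porbits a) hD hm h2 h1.
have up' a : part_le (porbits a) (meetb C) -> part_le (porbits a) C.
  move=> h; apply: (part_le_trans (isp_porbits a) hm hC h).
  by have := le_meetb hm hC; rewrite part_le_refl // => /esym /andP[].
case: ifP => gm; last first.
  apply: big1 => a aC; case: (boolP (part_le (porbits a) (rf J C))) => h1; last by rewrite sc ?mul0r.
  case: (boolP (part_le (porbits (g * a^-1)%g) (rf (~: J) C))) => h2; last by rewrite sc' ?mulr0.
  by move: gm; rewrite -[g](mulgKV a) porbits_leM //; [exact: up (isp_rf _ _) l2 h2|exact: up (isp_rf _ _) l1 h1].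
rewrite /gconv [LHS]big_mkcond [RHS]big_mkcond; apply: eq_bigr => a _.
case: (boolP (part_le (porbits a) (meetb C))) => h; first by rewrite up'.
case: ifP => // _; rewrite sc ?mul0r //; apply: contra h; exact: up (isp_rf _ _) l1.
Qed.

(* Up to small terms the sum over the partitions below [C] depends only on the meet
   of [C] with the partition {J, ~: J}, hence its Moebius inverse is small at every
   [C] which is not below that partition. *)
Lemma conv_mixed_small E : exists M0, forall M, (M0 <= M)%N -> forall C g, okp C g ->
  ~~ part_le C bip -> bo (fun N => conv (muN R M N) (fX N) C g) (- E).
Proof.
have [cY [cZ [e e0 [hb hs]]]] := structure_sequences.
exists (absz (E + e + e)) => M hM C g /andP[hC gC]; move: gC.
pose f N := conv (muN R M N) (fX N).
have qb C' g' : isp C' -> bo (fun N => gconv C' (cY N (rf J C')) (cZ N (rf (~: J) C')) g') (e + e).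
  by move=> hC'; apply: gconv_bo => a; have [] := hb C' a hC'.
pose q C' N g' := gconv C' (cY N (rf J C')) (cZ N (rf (~: J) C')) g'.
have hf C' g' : isp C' -> part_le (porbits g') C' -> bo (fun N => hat (f N) C' g' - q C' N g') (- E).
  move=> hC' gC'; have [er [her1 her2]] := mu_error M hC'.
  have : bo (fun N => gconv C' (er N) (gconv C' (cY N (rf J C')) (cZ N (rf (~: J) C'))) g') (- E).
    apply: (@bo_le _ _ (- (M.+1)%:Z + (e + e))); first by lia.
    by apply: gconv_bo => a //; exact: qb.
  apply: (bo_ext (N1 := N1)) => N hN; have N0 := N1_gt0 hN.
  have [sY sZ hY' hZ' hX'] := hs N hN.
  rewrite /f hat_conv //.
  rewrite (@eq_gconv _ _ C' (hat (muN R M N) C') (hat (muN R M N) C') (hat (fX N) C')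
     (gconv C' (cY N (rf J C')) (gconv C' (cZ N (rf (~: J) C')) (zt R N)))) //; last first.
    by move=> a aC; exact: hX'.
  by rewrite (gconv_unit_r _ _ hC' gC' (@ztC N) (fun a aC => her2 N a N0 aC)) addrC addKr.
apply: (part_lt_ind (S := fun C => part_le (porbits g) C -> ~~ part_le C bip ->
   bo (fun N => f N C g) (- E))) hC => {}C hC IH gC Cb.
have hm := isp_meetb C.
have CC : part_le (meetb C) C by have := le_meetb hm hC; rewrite part_le_refl // => /esym /andP[].
have IH' D : [&& okp D g, part_le D C, D != C & ~~ part_le D bip] -> bo (fun N => f N D g) (- E).
  by move=> /and4P[/andP[hD gD] DC ne nb]; exact: IH.
have hfm : bo (fun N => if part_le (porbits g) (meetb C) then hat (f N) (meetb C) g - q (meetb C) N g else 0) (- E).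
  by case: (boolP (part_le (porbits g) (meetb C))) => h; [exact: hf|exact: bo0].
have := boB (boB (hf C g hC gC) hfm) (bo_sum (index_enum {set {set T}}) IH').
apply: (bo_ext (N1 := N1)) => N hN; have [sY sZ _ _ _] := hs N hN.
have qm : q C N g = if part_le (porbits g) (meetb C) then q (meetb C) N g else 0 by exact: gconv_meetb.
have hm' : (if part_le (porbits g) (meetb C) then hat (f N) (meetb C) g else 0) =
   \sum_(D | [&& okp D g, part_le D C & part_le D bip]) f N D g.
  case: (boolP (part_le (porbits g) (meetb C))) => h.
    apply: eq_bigl => D; rewrite /okp; case: (boolP (isp D)) => //= hD.
    by rewrite le_meetb.
  rewrite big1 // => D /and3P[/andP[hD gD] DC Db]; case/negP: h.
  by apply: (part_le_trans (isp_porbits g) hD hm gD); rewrite le_meetb // DC.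
have -> : (if part_le (porbits g) (meetb C) then hat (f N) (meetb C) g - q (meetb C) N g else 0) =
   \sum_(D | [&& okp D g, part_le D C & part_le D bip]) f N D g - q C N g.
  by rewrite -hm' qm; case: ifP; rewrite ?subr0.
have -> : hat (f N) C g = \sum_(D | [&& okp D g, part_le D C & part_le D bip]) f N D g +
   (f N C g + \sum_(D | [&& okp D g, part_le D C, D != C & ~~ part_le D bip]) f N D g).
  rewrite /hat (bigID (fun D => part_le D bip)) /=; congr (_ + _).
    by apply: eq_bigl => D; rewrite andbA.
  rewrite (bigD1 C) /=; last by rewrite /okp hC gC part_le_refl.
  by congr (_ + _); apply: eq_bigl => D; case: (okp D g); case: (part_le D C); case: (D == C); case: (part_le D bip).
rewrite -/(f N) -/(q C N g); move: (\sum_(_ | _) _) (\sum_(_ | _) _) (q C N g) (f N C g) => s1 s2 s3 s4.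
ring.
Qed.

End Smallness.
Local Close Scope set_scope.
(** * Expansions of mixed cumulants *)

Local Open Scope set_scope.
Section Excess.
Variable d : nat.
Local Notation T := 'I_d.
Implicit Types (C : {set T}) (Q : {set {set T}}) (g a b c : {perm T}).

(** Each cycle beyond n0 in a block lowers by 2, in doubled genus, the order to which the cumulant
    of this block is known. *)
Definition exc n0 Q a : nat := \sum_(C in Q) (#|cycles_in a C| - n0)%N.

Lemma sum_cycles_in Q a : okp Q a -> (\sum_(C in Q) #|cycles_in a C|)%N = #|porbits a|.
Proof.
move=> /andP[hQ aQ]; have := sum_card_sub (isp_porbits a) hQ aQ.
by rewrite -(big_morph Posz PoszD (erefl _)) => -[].
Qed.

Lemma cycles_in_gt0 Q a C : okp Q a -> C \in Q -> (0 < #|cycles_in a C|)%N.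
Proof.
move=> /andP[hQ aQ] CQ; have [k kC] := isp_ex hQ CQ.
apply/card_gt0P; exists (porbit a k); rewrite finset.inE imset_f //=.
by rewrite (closed_sub (isp_porbits a) (closed_block (isp_porbits a) hQ aQ CQ) (imset_f _ _) (porbit_id a k)).
Qed.

(** A block with more than n0 cycles accounts for its excess and for n0 further cycles, and every
    other block for its own excess and at least one cycle. *)
Lemma exc_bound n0 Q a : okp Q a -> (0 < n0)%N ->
  exc n0 Q a = 0%N \/ (exc n0 Q a + n0.-1 + #|Q| <= #|porbits a|)%N.
Proof.
move=> h n0p; have [C CQ|h0] := pickP (fun C => (C \in Q) && (n0 < #|cycles_in a C|)%N); last first.
  left; apply: big1 => C CQ; have := h0 C; rewrite CQ /= => /negbT; rewrite -leqNgt.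
  by rewrite -subn_eq0 => /eqP.
right; case/andP: CQ => CQ hC; rewrite -(sum_cycles_in h) -sum1_card /exc -addnA addnC -addnA.
rewrite !(bigD1 C CQ) /= addnACA.
rewrite -big_split /= addnA; apply: leq_add.
  by move: hC n0p; move: #|_| => n; lia.
apply: leq_sum => D /andP[DQ _]; have := cycles_in_gt0 h (DQ : D \in Q).
by move: n0p; move: #|_| => n; lia.
Qed.

Lemma pn_top g : (0 < d)%N -> pn (ptop d) g = d%:Z - 2 + #|porbits g|%:Z.
Proof. by move=> d0; rewrite /pn pnorm_onT ?isp_top // cards1; lia. Qed.

Lemma pnE Q a : isp Q -> pn Q a = d%:Z - (#|Q|%:Z) *+ 2 + #|porbits a|%:Z.
Proof. by move=> h; rewrite /pn pnorm_onT //; lia. Qed.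

(** The first part records the surplus power w of 1/N, the second that the precision survives: what
    A and B' lose is regained from the growth of the norm, up to the excess of g itself. Cycle
    counts are compared by [porbits_triangle]. *)
Lemma exc_conv3 n0 A D B' a b c : (0 < d)%N -> (0 < n0)%N -> okp A a -> okp D b -> okp B' c ->
  part_join (part_join A D) B' = ptop d ->
  let g := (c * (b * a))%g in
  exists w : nat, [/\ pn A a + pn D b + pn B' c = pn (ptop d) g + w%:Z &
    pn (ptop d) g + lev 0 n0 #|porbits g| <= pn A a + pn D b + pn B' c - (exc n0 A a)%:Z *+ 2 - (exc n0 B' c)%:Z *+ 2].
Proof.
move=> d0 n0p hA hD hB e g.
have h1 := pn_join hA hD; have h2 := pn_join (okp_join hA hD) hB; rewrite e -/g in h2.
exists (absz (pn A a + pn D b + pn B' c - pn (ptop d) g)%R); split; first by move: h1 h2; lia.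
have t1 := porbits_triangle a b; have t2 := porbits_triangle (b * a)%g c; rewrite -/g in t2.
have q := card_porbits_ge hD.
have xA := exc_bound hA n0p; have xB := exc_bound hB n0p.
have [iA _] := andP hA; have [iD _] := andP hD; have [iB _] := andP hB.
have n1 : (0 < #|porbits g|)%N.
  by apply/card_gt0P; exists (porbit g (Ordinal d0)); exact: imset_f.
have kA := card_porbits_ge hA; have kB := card_porbits_ge hB.
move: h1 h2; rewrite levE pn_top // !pnE ?isp_join //.
move: t1 t2 q xA xB n1 kA kB; clear.
move: #|porbits g| #|porbits a| #|porbits b| #|porbits c| #|porbits (b * a)%g| #|part_join A D|.
move: #|A| #|D| #|B'| (exc n0 A a) (exc n0 B' c) => A1 D1 B1 xa xb pg pa pb pc pba pj.
move=> t1 t2 q [->|xA] [->|xB] n1 kA kB h1 h2; lia.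
Qed.

Lemma exc_conv2 n0 D B' b c : (0 < d)%N -> (0 < n0)%N -> okp D b -> okp B' c ->
  part_join D B' = ptop d -> let g := (c * b)%g in
  pn (ptop d) g + lev 0 n0 #|porbits g| <= pn D b + pn B' c - (exc n0 B' c)%:Z *+ 2.
Proof.
move=> d0 n0p hD hB e /=; set g := (c * b)%g.
have h2 := pn_join hD hB; rewrite e -/g in h2.
have t2 := porbits_triangle b c; rewrite -/g in t2.
have q := card_porbits_ge hD; have xB := exc_bound hB n0p.
have [iD _] := andP hD; have [iB _] := andP hB; have kB := card_porbits_ge hB.
move: h2; rewrite levE pn_top // !pnE //.
move: t2 q xB kB; clear.
move: #|porbits g| #|porbits b| #|porbits c| #|D| #|B'| (exc n0 B' c) => pg pb pc D1 B1 xb.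
move=> t2 q [->|xB] kB h2; lia.
Qed.

End Excess.

Section AppPExtra.
Variable R : realType.
Local Notation K := R[i].
Implicit Types (u : nat -> K) (k E : int) (P : {poly K}).

Lemma AppP_scale u k E P (D : int) : AppP u k E P -> AppP (fun N => N%:R ^ (- D) * u N) (k + D) (E + D) P.
Proof.
move=> h; have := bo_lo_mul (bo_pow R (- D)) h.
rewrite /AppP (_ : - D + - E = - (E + D)); last by lia.
apply: (lo_ext (N1 := 1%N)) => N N1; rewrite mulrBr mulrA -natXC_add //.
by rewrite (_ : - D + - k = - (k + D)); last by lia.
Qed.

Lemma AppP_sum_ex (I : Type) (r : seq I) (p : pred I) (f : I -> nat -> K) k E :
  (forall j, p j -> exists P, AppP (f j) k E P) -> exists P, AppP (fun N => \sum_(j <- r | p j) f j N) k E P.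
Proof.
move=> H; have h j : exists P, p j -> AppP (f j) k E P.
  by case: (boolP (p j)) => pj; [have [P hP] := H j pj; exists P|exists 0].
have [PP hPP] := choice h; exists (\sum_(j <- r | p j) PP j).
by apply: AppP_sum => j pj; exact: hPP.
Qed.

End AppPExtra.
Local Close Scope set_scope.
Local Open Scope set_scope.

(** * Unitary covariance of matrix polynomials *)

Section Equivariance.
Variables (R : realType) (N : nat).
Local Notation K := R[i].
Local Notation MN := 'M[K]_N.

Lemma equivariant_pev (p : {poly K}) : equivariant (@pev K N p).
Proof.
have pX k a b : polyf (fun M : MN => (M ^+ k) a b).
  elim: k a b => [|k IH] a b.
    have -> : (fun M : MN => (M ^+ 0) a b) = (fun=> (a == b)%:R) by apply/funext => M; rewrite expr0 mxE.
    exact: polyf_cst.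
  have -> : (fun M : MN => (M ^+ k.+1) a b) = (fun M => \sum_l M a l * (M ^+ k) l b).
    by apply/funext => M; rewrite exprS mxE.
  by apply: polyf_sum => l _; apply: polyf_mul; [exact: polyf_entry|exact: IH].
split=> [a b|U M uU].
  have -> : (fun M : MN => pev p M a b) = (fun M => \sum_(k < size p) p`_k * (M ^+ k) a b).
    by apply/funext => M; rewrite summxE; apply: eq_bigr => k _; rewrite mxE.
  by apply: polyf_sum => k _; apply: polyf_mul; [exact: polyf_cst|exact: pX].
have uX k : (U *m M *m (U ^t*)%sesqui) ^+ k = U *m (M ^+ k) *m (U ^t*)%sesqui.
  elim: k => [|k IH]; first by rewrite !expr0 [RHS](_ : _ = U *m (U ^t*)%sesqui) ?mulmx1 ?(unitarymxP uU).
  have uU' := mulmx1C (unitarymxP uU).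
  rewrite exprS IH [in RHS]exprS -[LHS]/((U *m M *m (U ^t*)%sesqui) *m (U *m (M ^+ k) *m (U ^t*)%sesqui)).
  rewrite -[M * M ^+ k]/(M *m M ^+ k) !mulmxA -[X in X *m _ *m _ = _]mulmxA.
  by rewrite uU' mulmx1.
rewrite /pev mulmx_sumr mulmx_suml; apply: eq_bigr => k _.
by rewrite uX -scalemxAr -scalemxAl.
Qed.

End Equivariance.

(** * Normalized cumulants and their expansions *)

Section Families.
Variables (R : realType) (disp : nat -> measure_display).
Variable Omega : forall N : nat, measurableType (disp N).
Variable P : forall N : nat, probability (Omega N) R.
Variables (A B : forall N : nat, Omega N -> 'M[R[i]]_N).
Arguments A : clear implicits.
Arguments B : clear implicits.
Local Notation K := R[i].
Local Notation NC := (ncpoly K).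
Variable d : nat.
Local Notation T := 'I_d.
Implicit Types (C D c : {set T}) (Q : {set {set T}}) (g a b : {perm T}) (x : T -> NC) (N : nat).

Definition cyl x a C : seq NC := [seq cycle_prod x a c | c <- enum (cycles_in a C)].

(** A block with n cycles has leading order N^(2 - n); thanks to N^-d the orders of the blocks
    combine to exactly N to the power -[pn Q a], in agreement with [evN]. *)
Definition nrm x N Q a : K := N%:R ^ (- d%:Z) * \prod_(C in Q) cumN P A B (cyl x a C) N.

Lemma size_cyl x a C : size (cyl x a C) = #|cycles_in a C|.
Proof. by rewrite size_map -cardE. Qed.

Lemma evR_cycle x a c N w : evR A B (cycle_prod x a c) w = mcyc (fun k => evR A B (x k) (w : Omega N)) a c.
Proof.
by rewrite /cycle_prod /mcyc /evR; case: pickP => [k _|_]; rewrite ?nc_eval_prod ?nc_eval1.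
Qed.

Lemma nrm_phiN x N Q a :
  nrm x N Q a = N%:R ^ (- d%:Z) * phiN (P N) (fun k w => evR A B (x k) w) Q a.
Proof.
congr (_ * _); apply: eq_bigr => C _; rewrite /cumN /cyl -map_comp; congr cumulant.
by apply: eq_map => c; apply/funext => w; rewrite /= /trR evR_cycle.
Qed.

Lemma hat_nrm x N Q g : isp Q -> part_le (porbits g) Q ->
  hat (nrm x N) Q g = N%:R ^ (- d%:Z) * mom (P N) (fun k w => evR A B (x k) w) g Q.
Proof.
move=> hQ gQ; rewrite -hat_phiN // /hat mulr_sumr; apply: eq_bigr => D _.
exact: nrm_phiN.
Qed.

(** The losses of precision of the blocks add up under [AppP_mul], while G0 is counted only once. *)
Lemma nrm_AppP x (F : {set T} -> nat -> K) (G0 n0 M : nat) Q a : okp Q a ->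
  (forall C, C \in Q -> expd #|cycles_in a C| (lev G0 n0 #|cycles_in a C|) (cumN P A B (cyl x a C)) (F C)) ->
  (G0 < M)%N ->
  AppP (fun N => nrm x N Q a) (pn Q a) (pn Q a + G0%:Z - (exc n0 Q a)%:Z *+ 2)
    (\prod_(C in Q) \poly_(G < M) F C G).
Proof.
move=> hQa hF hM; have [hQ aQ] := andP hQa.
pose n (C : {set T}) := #|cycles_in a C|; pose xx (C : {set T}) := (n C - n0)%N.
have H (S : seq {set T}) : {subset S <= Q} ->
  AppP (fun N => \prod_(C <- S) cumN P A B (cyl x a C) N) (\sum_(C <- S) ((n C)%:Z - 2))
   (\sum_(C <- S) ((n C)%:Z - 2) + G0%:Z - \sum_(C <- S) (xx C)%:Z *+ 2) (\prod_(C <- S) \poly_(G < M) F C G).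
  elim: S => [|C S IH] sub.
    rewrite !big_nil; apply: (AppP_ext (N1 := 0%N) _ (AppP_poly 0 _ 1)) => N _.
    by rewrite big_nil hornerC expr0z mulr1.
  rewrite !big_cons; apply: (AppP_ext (N1 := 0%N) (u := fun N => cumN P A B (cyl x a C) N * \prod_(D <- S) cumN P A B (cyl x a D) N)).
    by move=> N _; rewrite big_cons.
  have p0 (D : {set T}) : 0 <= (xx D)%:Z *+ 2 by rewrite mulrn_wge0.
  have ps : 0 <= \sum_(D <- S) (xx D)%:Z *+ 2 by apply: sumr_ge0 => D _; exact: p0.
  apply: (AppP_mul (isT : 0 <= G0%:Z) (p0 C) ps).
    have CQ : C \in Q by apply: sub; rewrite mem_head.
    have lM : lev G0 n0 (n C) < M%:Z by rewrite levE; move: hM; lia.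
    have := (expdP _ _ _ lM).1 (hF C CQ); congr AppP.
    by rewrite levE addrA.
  by apply: IH => D DS; apply: sub; rewrite finset.inE DS orbT.
have sQ : {subset enum Q <= Q} by move=> C; rewrite mem_enum.
have := AppP_scale d%:Z (H (enum Q) sQ); rewrite !big_enum /=.
have -> : \sum_(C in Q) ((n C)%:Z - 2) + d%:Z = pn Q a.
  rewrite pnE // sumrB -(big_morph Posz PoszD (erefl _)) sum_cycles_in // sumr_const.
  by rewrite -mulr_natr; lia.
have -> : \sum_(C in Q) ((n C)%:Z - 2) + G0%:Z - \sum_(C in Q) (xx C)%:Z *+ 2 + d%:Z = pn Q a + G0%:Z - (exc n0 Q a)%:Z *+ 2.
  rewrite sumrMnl -[in X in _ - X *+ 2](big_morph Posz PoszD (erefl _)) -/(exc n0 Q a).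
  rewrite pnE // sumrB -(big_morph Posz PoszD (erefl _)) sum_cycles_in // sumr_const.
  by rewrite -[2 *+ #|_|]mulr_natr; lia.
by apply: (AppP_ext (N1 := 0%N)) => N _; rewrite /nrm big_enum.
Qed.

Lemma nrm_AppP_ex x (G0 n0 : nat) Q a : okp Q a ->
  (forall C, C \in Q -> expands P A B (lev G0 n0 #|cycles_in a C|) (cyl x a C)) ->
  exists Pol, AppP (fun N => nrm x N Q a) (pn Q a) (pn Q a + G0%:Z - (exc n0 Q a)%:Z *+ 2) Pol.
Proof.
move=> h H; have h' C : exists F, C \in Q ->
    expd #|cycles_in a C| (lev G0 n0 #|cycles_in a C|) (cumN P A B (cyl x a C)) F.
  case: (boolP (C \in Q)) => CQ; last by exists (fun=> 0).
  by have [F] := H C CQ; rewrite size_cyl; exists F.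
have [F hF] := choice h'; exists (\prod_(C in Q) \poly_(G < G0.+1) F C G).
by apply: nrm_AppP.
Qed.

Lemma nrm_cum x g N : (0 < d)%N -> (0 < N)%N ->
  cumN P A B (cyl x g [set: T]) N = N%:R ^ d%:Z * nrm x N (ptop d) g.
Proof.
by move=> d0 N0; rewrite /nrm /ptop big_set1 mulrA -natXC_add // subrr expr0z mul1r.
Qed.

Lemma expands_nrm x g m Pol : (0 < d)%N ->
  AppP (fun N => nrm x N (ptop d) g) (pn (ptop d) g) (pn (ptop d) g + m) Pol ->
  expands P A B m (cyl x g [set: T]).
Proof.
move=> d0 h; exists (fun G => Pol`_G); rewrite size_cyl cycles_inT; apply: AppP_expd.
have := AppP_scale (- d%:Z) h; rewrite opprK pn_top //.
rewrite (_ : d%:Z - 2 + #|porbits g|%:Z - d%:Z = #|porbits g|%:Z - 2); last by lia.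
rewrite (_ : d%:Z - 2 + #|porbits g|%:Z + m - d%:Z = #|porbits g|%:Z - 2 + m); last by lia.
by apply: (AppP_ext (N1 := 1%N)) => N N1; rewrite nrm_cum // opprK.
Qed.

(* Joint asymptotics of a triple convolution at the top partition: by the genus
   inequality the exponents can only decrease, and the loss of precision caused
   by blocks with more than [n0] cycles is compensated by the genus. *)
Lemma conv3_AppP (G0 n0 : nat) (f h : nat -> {set {set T}} -> {perm T} -> K) (v : nat -> {set {set T}} -> {perm T} -> K) g :
  (0 < d)%N -> (0 < n0)%N ->
  (forall Q a, okp Q a -> exists Pol, AppP (fun N => f N Q a) (pn Q a) (pn Q a + G0%:Z - (exc n0 Q a)%:Z *+ 2) Pol) ->
  (forall Q a, okp Q a -> exists Pol, AppP (fun N => h N Q a) (pn Q a) (pn Q a + G0%:Z - (exc n0 Q a)%:Z *+ 2) Pol) ->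
  (forall Q a, okp Q a -> exists Pol, AppP (fun N => v N Q a) (pn Q a) (pn Q a + G0%:Z) Pol) ->
  exists Pol, AppP (fun N => conv (conv (f N) (v N)) (h N) (ptop d) g)
    (pn (ptop d) g) (pn (ptop d) g + lev G0 n0 #|porbits g|) Pol.
Proof.
move=> d0 n0p hf hh hv; apply: AppP_sum_ex => a _; apply: AppP_sum_ex => C _; apply: AppP_sum_ex => B' /andP[hB /eqP eC].
have [Pol hPol] : exists Pol, AppP (fun N => \sum_(b : {perm T}) \sum_(Q | okp Q b)
  \sum_(D | okp D (a * b^-1)%g && (part_join Q D == C)) f N Q b * v N D (a * b^-1)%g * h N B' (g * a^-1)%g)
    (pn (ptop d) g) (pn (ptop d) g + lev G0 n0 #|porbits g|) Pol.
  apply: AppP_sum_ex => b _; apply: AppP_sum_ex => Q hQ; apply: AppP_sum_ex => D /andP[hD /eqP eD].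
  have eC' : part_join (part_join Q D) B' = ptop d by rewrite eD.
  have [w []] := exc_conv3 (n0 := n0) d0 n0p hQ hD hB eC'; rewrite mulgKV mulgKV => hw hE.
  have [P1 h1] := hf _ _ hQ; have [P2 h2] := hv _ _ hD; have [P3 h3] := hh _ _ hB.
  have h2' : AppP (fun N => v N D (a * b^-1)%g) (pn D (a * b^-1)%g) (pn D (a * b^-1)%g + G0%:Z - 0) P2 by rewrite subr0.
  have p0 (n : nat) : 0 <= n%:Z *+ 2 by rewrite mulrn_wge0.
  have := AppP_mul (isT : 0 <= G0%:Z) (p0 _) (lexx 0) h1 h2'; rewrite addr0 => h12.
  have := AppP_mul (isT : 0 <= G0%:Z) (p0 _) (p0 _) h12 h3; rewrite hw => h123.
  exists (P1 * P2 * P3 * 'X^w); apply: AppP_shift; apply: AppP_le h123.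
  by move: hE; rewrite hw !levE; lia.
exists Pol; apply: (AppP_ext (N1 := 0%N) _ hPol) => N _; rewrite /conv.
rewrite mulr_suml; apply: eq_bigr => b _; rewrite mulr_suml; apply: eq_bigr => Q _.
by rewrite mulr_suml.
Qed.

(** Each term is one exact power of 1/N, whose exponent is a norm and therefore at least
    [pn Q a]. *)
Lemma muN_AppP (M G0 : nat) Q a : okp Q a ->
  exists Pol, AppP (fun N => muN R M N Q a) (pn Q a) (pn Q a + G0%:Z) Pol.
Proof.
move=> hQa; apply: AppP_sum_ex => u /and3P[hu /eqP e1 /eqP e2].
have hn : sn (bval u) = pn Q a + (absz (sn (bval u) - pn Q a)%R)%:Z.
  by have := sum_sgen_ge0 (bval u); rewrite snE e1 e2; move: (\sum_(_ in _) _) => s0; lia.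
exists ((smobius K (bval u))%:P * 'X^(absz (sn (bval u) - pn Q a)%R)); apply: AppP_shift; rewrite -hn.
by apply: (AppP_ext (N1 := 0%N) _ (AppP_poly _ _ _)) => N _; rewrite hornerC.
Qed.

End Families.
Local Close Scope set_scope.
Local Open Scope set_scope.

(** * Mixed families: expansions and vanishing cumulants *)

Section MixedFamilies.
Variables (R : realType) (disp : nat -> measure_display).
Variable Omega : forall N : nat, measurableType (disp N).
Variable P : forall N : nat, probability (Omega N) R.
Variables (A B : forall N : nat, Omega N -> 'M[R[i]]_N).
Arguments A : clear implicits.
Arguments B : clear implicits.
Hypotheses (rA : forall N, random_mx (A N)) (rB : forall N, random_mx (B N)).
Hypotheses (mA : forall N, has_moments (P N) (A N)) (mB : forall N, has_moments (P N) (B N)).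
Hypothesis ABind : forall N, independent_mx (P N) (A N) (B N).
Hypothesis inv : (forall N, unitarily_invariant (P N) (A N)) \/ (forall N, unitarily_invariant (P N) (B N)).
Arguments rA : clear implicits.
Arguments rB : clear implicits.
Arguments mA : clear implicits.
Arguments mB : clear implicits.
Arguments ABind : clear implicits.
Local Notation K := R[i].
Local Notation NC := (ncpoly K).
Variable t : xtyp.
Hypothesis tin : in_xtyp t.
Hypothesis limA : forall (ps : seq {poly K}) m, (0 < size ps)%N -> level t (size ps) m ->
  expands P A B m [seq horner_alg (nc_a K) p | p <- ps].
Hypothesis limB : forall (ps : seq {poly K}) m, (0 < size ps)%N -> level t (size ps) m ->
  expands P A B m [seq horner_alg (nc_b K) p | p <- ps].
Variable d : nat.
Hypothesis d0 : (0 < d)%N.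
Local Notation T := 'I_d.
Implicit Types (C c : {set T}) (D Q : {set {set T}}) (g a b : {perm T}) (N : nat).
Variables (p : T -> {poly K}) (J : {set T}).

Definition xfam k : NC := horner_alg (if k \in J then nc_a K else nc_b K) (p k).
(** The slots of the other matrix are filled with the unit, so that Y and Z keep d slots. *)
Let y k : NC := horner_alg (nc_a K) (if k \in J then p k else 1).
Let z k : NC := horner_alg (nc_b K) (if k \in J then 1 else p k).

Local Notation nr x := (@nrm R disp Omega P A B d x).

Lemma cyl_horner (v : NC) (pp : T -> {poly K}) a C : exists2 ps : seq {poly K}, size ps = #|cycles_in a C| &
  cyl (fun k => horner_alg v (pp k)) a C = [seq horner_alg v q | q <- ps].
Proof.
exists [seq (if [pick k in c] is Some k then \prod_(l < #|c|) pp ((a ^+ l)%g k) else 1) | c <- enum (cycles_in a C)].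
  by rewrite size_map -cardE.
rewrite -map_comp; apply: eq_map => c; rewrite /cycle_prod /=.
by case: pickP => [k _|_]; rewrite ?rmorph_prod ?rmorph1.
Qed.

Lemma card_cycles_le a C : (#|cycles_in a C| <= d)%N.
Proof.
apply: (@leq_trans #|porbits a|); last by have := rank_perm a; move: (\rank _) => r; lia.
by apply: subset_leq_card; apply/fintype.subsetP => c; rewrite finset.inE => /andP[].
Qed.

(** 3d for Schur-Weyl duality, 2 d! for the inversion of [zz]. *)
Let N1 := (3 * d + 2 * d`!)%N.

Lemma nrm_structure N : (N1 <= N)%N -> exists cY cZ : {set {set T}} -> {perm T} -> K,
  [/\ forall D g, ~~ part_le (porbits g) D -> cY D g = 0,
      forall D g, ~~ part_le (porbits g) D -> cZ D g = 0,
      forall Q g, isp Q -> part_le (porbits g) Q ->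
        hat (nr y N) Q g = gconv Q (cY (rf J Q)) (zt R N) g,
      forall Q g, isp Q -> part_le (porbits g) Q ->
        hat (nr z N) Q g = gconv Q (cZ (rf (~: J) Q)) (zt R N) g &
      forall Q g, isp Q -> part_le (porbits g) Q ->
        hat (nr xfam N) Q g = gconv Q (cY (rf J Q)) (gconv Q (cZ (rf (~: J) Q)) (zt R N)) g].
Proof.
rewrite /N1 => hN; have N0 : (0 < N)%N by move: hN d0; lia.
have hN3 : (3 * d <= N)%N by move: hN; lia.
have hN2 : (2 * d`! <= N)%N by move: hN; lia.
have iv : unitarily_invariant (P N) (A N) \/ unitarily_invariant (P N) (B N).
  by case: inv => h; [left|right]; exact: h.
have [cY [cZ [sY sZ hY hZ hX]]] := finite_structure N0 (rA N) (rB N) (mA N) (mB N) (ABind N) J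
  (fun k => equivariant_pev N (p k)) d0 hN3 hN2 iv.
have ze Q (c : {perm T} -> K) g : gconv Q c (zt R N) g = N%:R ^ (- d%:Z) * gconv Q c (@zz R N d) g.
  by rewrite /gconv mulr_sumr; apply: eq_bigr => a _; rewrite zt_zz // mulrCA.
exists cY, cZ; split=> // Q g hQ gQ; rewrite hat_nrm //.
- rewrite ze -hY //; congr (_ * _); congr (mom _ _ _ _); apply/funext => k; apply/funext => w.
  rewrite /famY /y /evR nc_eval_horner nc_evala; case: (k \in J) => //.
  by rewrite -[1]/(1%:P) /pev size_polyC oner_eq0 big_ord1 coefC eqxx scale1r expr0.
- rewrite ze -hZ //; congr (_ * _); congr (mom _ _ _ _); apply/funext => k; apply/funext => w.
  rewrite /famZ /z /evR nc_eval_horner nc_evalb; case: (k \in J) => //.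
  by rewrite -[1]/(1%:P) /pev size_polyC oner_eq0 big_ord1 coefC eqxx scale1r expr0.
have -> : (fun k w => evR A B (xfam k) w) = famX (A N) (B N) J (fun k M => pev (p k) M).
  apply/funext => k; apply/funext => w; rewrite /famX /xfam /evR nc_eval_horner.
  by case: (k \in J); rewrite ?nc_evala ?nc_evalb.
rewrite hX // {1}/gconv mulr_sumr; apply: eq_bigr => a _.
by rewrite ze mulrCA.
Qed.

Lemma nrm_bo (x : T -> NC) G0 n0 Q a : okp Q a ->
  (forall C, C \in Q -> expands P A B (lev G0 n0 #|cycles_in a C|) (cyl x a C)) ->
  exists e, bo (fun N => nr x N Q a) e.
Proof.
move=> h H; have [Pol hP] := nrm_AppP_ex h H.
have := AppP_bo (x := (exc n0 Q a)%:Z *+ 2) (AppP_le _ hP); rewrite mulrn_wge0 // => hb.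
eexists; apply: hb => //.
by lia.
Qed.

Section Level.
Variables G0 n0 : nat.
Hypothesis n0p : (0 < n0)%N.
Hypothesis hlev : forall n', (n' <= d)%N -> level t n' (lev G0 n0 n').

Lemma expands_famY Q a : okp Q a -> forall C, C \in Q -> expands P A B (lev G0 n0 #|cycles_in a C|) (cyl y a C).
Proof.
move=> h C CQ; have [ps sp e] := cyl_horner (nc_a K) (fun k => if k \in J then p k else 1) a C.
rewrite [cyl _ _ _]e -sp; apply: limA; first by rewrite sp (cycles_in_gt0 h CQ).
by apply: hlev; rewrite sp card_cycles_le.
Qed.

Lemma expands_famZ Q a : okp Q a -> forall C, C \in Q -> expands P A B (lev G0 n0 #|cycles_in a C|) (cyl z a C).
Proof.
move=> h C CQ; have [ps sp e] := cyl_horner (nc_b K) (fun k => if k \in J then 1 else p k) a C.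
rewrite [cyl _ _ _]e -sp; apply: limB; first by rewrite sp (cycles_in_gt0 h CQ).
by apply: hlev; rewrite sp card_cycles_le.
Qed.

Let N1_ge : (2 * d`! <= N1)%N. Proof. by rewrite /N1 leq_addl. Qed.

Lemma mixed_expansion g : expands P A B (lev G0 n0 #|porbits g|) (cyl xfam g [set: T]).
Proof.
set k0 := pn (ptop d) g; set E := k0 + lev G0 n0 #|porbits g|.
(* Asking for one order more than E turns the big-O estimate into the little-o that is wanted. *)
have [M0 hM0] := conv_small d0 N1_ge (fun Q a h => nrm_bo h (expands_famY h)) (fun Q a h => nrm_bo h (expands_famZ h))
  nrm_structure (E + 1).
have hg : okp (ptop d) g by rewrite /okp isp_top // le_top //; exact: isp_porbits.
have [Pol hPol] := conv3_AppP (v := fun N => muN R M0 N) g d0 n0p (fun Q a h => nrm_AppP_ex h (expands_famY h))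
   (fun Q a h => nrm_AppP_ex h (expands_famZ h)) (fun Q a h => muN_AppP R M0 G0 h).
apply: (expands_nrm (Pol := Pol - 0) d0); rewrite -/E.
have hlo : lo (fun N => - (conv (conv (nr y N) (muN R M0 N)) (nr z N) (ptop d) g - nr xfam N (ptop d) g)) (- E).
  apply: loN; apply: (bo_lt_lo (e := - (E + 1))); first by lia.
  exact: hM0.
have := AppP_add hPol (AppP_lo (pn (ptop d) g) hlo); rewrite subr0 addr0.
by apply: (AppP_ext (N1 := 0%N)) => N _; rewrite opprB addrC subrK.
Qed.

End Level.

Variable phi : nat -> seq NC -> K.
Hypothesis phiE : forall s, (0 < size s)%N -> forall m, level t (size s) m -> expd (size s) m (cumN P A B s) (phi^~ s).

Definition topg (g : {perm T}) (G : nat) : surfperm d :=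
  (ptop d, g, [ffun C : {set T} => if C == [set: T] then G else 0%N]).

Lemma sum_bsp M Q a (F : bsp d M -> K) : okp Q a ->
  \sum_(u : bsp d M | [&& is_surfperm (bval u), spart (bval u) == Q & sperm (bval u) == a]) F u =
  \sum_(f in pffun_on (ord0 : 'I_M.+1) (mem Q) predT) F (Q, a, f).
Proof.
move=> hQa; have [hQ aQ] := andP hQa.
rewrite (reindex_onto (fun f : {ffun {set T} -> 'I_M.+1} => (Q, a, f) : bsp d M) (fun u => u.2)) /=; last first.
  by move=> [[Q' a'] f] /and3P[_ /eqP <- /eqP <-].
apply: eq_bigl => f; rewrite !eqxx !andbT.
rewrite /is_surfperm /spart /sperm /sgen /= -/(isp Q) hQ aQ /=.
apply/forallP/pffun_onP => [h|[h _] C].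
  split; last by move=> v _.
  apply/fintype.subsetP => C; rewrite finset.inE => hC; have /implyP := h C; rewrite ffunE.
  case: (boolP (C \in Q)) => // CQ /(_ isT) /eqP e; case/eqP: hC; exact: val_inj.
apply/implyP => CQ; rewrite ffunE; apply: contraNT CQ => hC.
by apply: (fintype.subsetP h); rewrite finset.inE; apply: contra hC => /eqP ->.
Qed.

(** Distributivity: to choose a genus for every block of Q is to choose one term in every truncated
    generating polynomial. *)
Lemma evN_smoment (x : T -> NC) M N Q a : (0 < N)%N -> okp Q a ->
  evN M (smoment phi x) N Q a =
  N%:R ^ (- pn Q a) * (\prod_(C in Q) \poly_(G < M.+1) phi G (cyl x a C)).[N%:R^-1].
Proof.
move=> N0 hQa; have [hQ aQ] := andP hQa.
rewrite horner_prod.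
under eq_bigr => C _ do rewrite horner_poly.
rewrite (big_distr_big ord0 (mem Q) predT) /= mulr_sumr /evN sum_bsp //.
apply: eq_bigr => f _; rewrite snE /spart /sperm /= opprD natXC_add // -mulrA; congr (_ * _).
rewrite /smoment /spart /sperm /sgen /=.
have -> : N%:R ^ (- (\sum_(C in Q) ([ffun C => val (f C)] C)%:Z)) = \prod_(C in Q) (N%:R^-1 : K) ^+ f C.
  rewrite prodrXr exprVn [RHS]exprnN; congr (_ ^ (- _)).
  by rewrite (big_morph Posz PoszD (erefl _)); apply: eq_bigr => C _; rewrite ffunE.
rewrite mulrC -big_split; apply: eq_bigr => C _ /=; by rewrite ffunE.
Qed.

Lemma scumulant_mixed g G : (exists k l, (k \in J) != (l \in J)) -> typ_le G #|porbits g| t ->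
  scumulant phi xfam (topg g G) = 0.
Proof.
move=> [k1 [k2 mixed]] /typ_leE[m hm Gm].
have hg : okp (ptop d) g by rewrite /okp isp_top // le_top //; exact: isp_porbits.
have pg0 : (0 < #|porbits g| <= d)%N.
  have := card_cycles_le g [set: T]; rewrite cycles_inT => ->; rewrite andbT.
  by apply/card_gt0P; exists (porbit g k1); exact: imset_f.
have [G0 [n0 [n0p em hlev]]] := level_lev tin hm pg0.
set k0 := pn (ptop d) g.
have k00 : 0 <= k0 by rewrite /k0 pn_top //; move: pg0 d0; lia.
pose E := k0 + m.
have expY := expands_famY hlev; have expZ := expands_famZ hlev.
have N1_ge : (2 * d`! <= N1)%N by rewrite /N1 leq_addl.
have [M0 hM0] := conv_mixed_small d0 N1_ge (fun Q a h => nrm_bo h (expY Q a h)) (fun Q a h => nrm_bo h (expZ Q a h))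
  nrm_structure (E + 1).
(* At least M0 for the smallness, G0 for the truncated moments, and E + 1 so that terms of norm
   above M are negligible. *)
pose M := (M0 + G0 + absz (E + 1)%R)%N.
have hME : E + 1 <= M%:Z by rewrite /M; lia.
have mixT : ~~ part_le (ptop d) (bip J).
  apply/negP => /(part_leP (isp_top d0) (isp_bip J)) /(_ k1 k2).
  rewrite prel_bip (negbTE mixed) -in_pblock ?isp_top // (isp_block (isp_top d0) (set11 _) (finset.in_setT k1)).
  by rewrite finset.inE => /(_ isT).
pose u N := conv (muN R M N) (nr xfam N) (ptop d) g.
have lo1 : lo u (- E).
  apply: (bo_lt_lo (e := - (E + 1))); first by lia.
  by apply: hM0 => //; rewrite /M -addnA leq_addr.
have lo2 Q a : okp Q a -> lo (fun N => nr xfam N Q a - evN M (smoment phi xfam) N Q a)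
    (- (pn Q a + G0%:Z - (exc n0 Q a)%:Z *+ 2)).
  move=> hQa; have hM : (G0 < M.+1)%N by rewrite /M; lia.
  have hF C : C \in Q -> expd #|cycles_in a C| (lev G0 n0 #|cycles_in a C|) (cumN P A B (cyl xfam a C))
      (phi^~ (cyl xfam a C)).
    move=> CQ; rewrite -(size_cyl xfam a C); apply: phiE; rewrite size_cyl; first exact: cycles_in_gt0 hQa CQ.
    by apply: hlev; exact: card_cycles_le.
  have := nrm_AppP hQa hF hM; apply: (lo_ext (N1 := 1%N)) => N N0.
  by rewrite evN_smoment.
(* Cumulants are replaced by their truncated limits; the poorer precision in blocks with many cycles
   is made up for by [exc_conv2]. *)
have lo3 : lo (fun N => u N - conv (muN R M N) (evN M (smoment phi xfam) N) (ptop d) g) (- E).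
  have : lo (fun N => \sum_(a : {perm T}) \sum_(Q | okp Q a)
     \sum_(D | okp D (g * a^-1)%g && (part_join Q D == ptop d)) muN R M N Q a *
       (nr xfam N D (g * a^-1)%g - evN M (smoment phi xfam) N D (g * a^-1)%g)) (- E).
    apply: lo_sum => a _; apply: lo_sum => Q hQ; apply: lo_sum => D /andP[hD /eqP eD].
    have := exc_conv2 d0 n0p hQ hD eD; rewrite mulgKV /= -/k0 => hE.
    have hb : bo (fun N => muN R M N Q a) (- pn Q a) by exact: bo_evN.
    apply: lo_le (bo_lo_mul hb (lo2 _ _ hD)).
    move: hE; rewrite /E em (levE 0) (levE G0).
    clearbody k0.
    move: (pn Q a) (pn D _) (exc _ _ _) (#|porbits g| - n0)%N => z1 z2 z3 z4.
    clear.
    lia.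
  apply: eq_lo => N; rewrite /u /conv -sumrB; apply: eq_bigr => a _; rewrite -sumrB; apply: eq_bigr => Q _.
  by rewrite -sumrB; apply: eq_bigr => D _; rewrite mulrBr.
pose cond (w : bsp d M) := [&& is_surfperm (bval w), spart (bval w) == ptop d, sperm (bval w) == g & sn (bval w) <= M%:Z].
(* The part of the evaluated convolution of norm at most M; its coefficients are values of
   [scumulant]. *)
pose main N := \sum_(w : bsp d M | cond w) N%:R ^ (- sn (bval w)) * scumulant phi xfam (bval w).
have lo4 : lo main (- E).
  have lor : lo (fun N => \sum_(u : bsp d M | is_surfperm (bval u)) \sum_(v : bsp d M | is_surfperm (bval v) &&
     [&& part_join (spart (bval u)) (spart (bval v)) == ptop d,
      (sperm (bval v) * sperm (bval u))%g == g & M%:Z < sn (bval u) + sn (bval v)])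
    N%:R ^ (- (sn (bval u) + sn (bval v))) * (smobius K (bval u) * smoment phi xfam (bval v))) (- E).
    apply: lo_sum => u0 _; apply: lo_sum => v0 /andP[_ /and3P[_ _ hs]].
    apply: (bo_lt_lo _ (boM (bo_pow R (- (sn (bval u0) + sn (bval v0)))) (bo_cst _))).
    by move: hs hME; lia.
  apply: (lo_ext (N1 := 1%N) _ (loB (loB lo1 lo3) lor)) => N N0.
  rewrite subKr -[muN R M N]/(evN M (@smobius K d) N).
  rewrite (@conv_evN_sconv R d M (@smobius K d) (smoment phi xfam) N (ptop d) g N0).
  by rewrite addrK.
have gen_w (w : bsp d M) : cond w -> sn (bval w) = k0 + (sgen (bval w) [set: T])%:Z.
  by move=> /and4P[hw /eqP e1 /eqP e2 _]; rewrite snE e1 e2 /ptop big_set1.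
(* At the top partition the norm is [k0] plus the genus, so cumulants of different genus sit at
   different powers of 1/N. *)
pose Pol := \sum_(w : bsp d M | cond w) (scumulant phi xfam (bval w))%:P * 'X^(sgen (bval w) [set: T]).
have hPol : AppP main k0 (k0 + (absz m)%:Z) Pol.
  apply: AppP_sum => w hw; apply: AppP_shift; rewrite -(gen_w w hw).
  by apply: (AppP_ext (N1 := 0%N) _ (AppP_poly _ _ _)) => N _; rewrite hornerC.
have mE : m = (absz m)%:Z by move: Gm; lia.
have := AppP_lo_coef _ hPol; rewrite -mE -/E => /(_ lo4 G) h0.
have {h0} : Pol`_G = 0 by apply: h0; move: Gm; lia.
have GM : (G < M.+1)%N by move: Gm hME k00; rewrite /E; lia.
pose w0 : bsp d M := (ptop d, g, [ffun C : {set T} => if C == [set: T] then Ordinal GM else ord0]).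
have bw0 : bval w0 = topg g G.
  rewrite /bval /topg /w0 /=; congr (_, _, _); apply/ffunP => C; rewrite !ffunE.
  by case: (C == _).
have sw0 : is_surfperm (bval w0).
  rewrite bw0 /is_surfperm /spart /sperm /sgen /= -/(isp _) isp_top // le_top ?isp_porbits //=.
  apply/forallP => C; apply/implyP => hC; rewrite ffunE; case: (eqVneq C [set: T]) => // e.
  by move: hC; rewrite e set11.
have gw0 : sgen (bval w0) [set: T] = G by rewrite bw0 /sgen /= ffunE eqxx.
have sn0 : sn (bval w0) = k0 + G%:Z.
  by rewrite snE {1 2 3}bw0 /spart /sperm /= /ptop big_set1 gw0.
have cw0 : cond w0.
  by rewrite /cond sw0 sn0 bw0 /spart /sperm /= !eqxx /=; move: Gm hME; rewrite /E; lia.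
rewrite /Pol coef_sum (bigD1 w0) //= coefCM coefXn gw0 eqxx mulr1 big1 ?addr0 ?bw0 // => w /andP[hw ne].
rewrite coefCM coefXn; case: eqP => [e|_]; last by rewrite mulr0.
have {}e : sgen (bval w) [set: T] = G by exact: esym e.
case/eqP: ne; apply: bval_inj; rewrite bw0.
have /and4P[sw /eqP e1 /eqP e2 _] := hw.
have [_ _ _ h0] := is_surfpermP sw.
move: (bval w) e1 e2 e h0 => [[q s] f]; rewrite /spart /sperm /sgen /= => -> -> e h0.
rewrite /topg; congr (_, _, _); apply/ffunP => C; rewrite ffunE.
case: ifP => [/eqP ->|/negbT ne]; first by [].
by apply: h0; rewrite finset.inE.
Qed.

End MixedFamilies.
Local Close Scope set_scope.
(** * Words and standard permutations *)

Local Open Scope set_scope.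
Section StdCycles.
Variable lam : seq nat.
Hypothesis lam_pos : all (leq 1) lam.
Local Notation s := (std_perm lam).
Local Notation l r := (nth 0%N lam r).

Lemma nth_pos r : (r < size lam)%N -> (0 < l r)%N.
Proof. by move=> h; exact: (allP lam_pos _ (mem_nth _ h)). Qed.

Definition flat r (o : 'I_(l r)) : 'I_(sumn lam) := Ordinal (flatten_indexP (ltn_ord o)).

Lemma flat_inj r : injective (@flat r).
Proof.
move=> o o' /(congr1 val) /= e; apply: val_inj => /=.
by rewrite -(flatten_indexKr (ltn_ord o)) e (flatten_indexKr (ltn_ord o')).
Qed.

Lemma std_iter r (o : 'I_(l r)) k :
  val ((s ^+ k)%g (flat o)) = flatten_index lam r ((o + k) %% l r).
Proof.
have l0 : (0 < l r)%N by exact: leq_ltn_trans (leq0n o) (ltn_ord o).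
elim: k => [|k IH]; first by rewrite expg0 perm1 addn0 modn_small.
rewrite expgSr permM permE /= /std_next IH.
have h : ((o + k) %% l r < l r)%N by rewrite ltn_mod.
by rewrite (flatten_indexKl h) (flatten_indexKr h) -addn1 modnDml addn1 addnS.
Qed.

Definition start (r : 'I_(size lam)) : 'I_(sumn lam) := flat (Ordinal (nth_pos (ltn_ord r))).
Definition scyc (r : 'I_(size lam)) := porbit s (start r).

Lemma scycE r : scyc r = [set flat o | o : 'I_(l r)].
Proof.
apply/setP => j; apply/porbitP/imsetP => [[k ->]|[q _ ->]].
  have h : (k %% l r < l r)%N by rewrite ltn_mod nth_pos.
  by exists (Ordinal h) => //; apply: val_inj; rewrite std_iter /= add0n.
by exists (val q); apply: val_inj; rewrite std_iter /= add0n modn_small ?ltn_ord.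
Qed.

Lemma card_scyc r : #|scyc r| = l r.
Proof. by rewrite scycE card_imset ?card_ord //; exact: flat_inj. Qed.

Lemma scyc_inj : injective scyc.
Proof.
move=> r r' e; have : start r \in scyc r' by rewrite -e porbit_id.
rewrite scycE => /imsetP[ o _ /(congr1 val) /= e']; apply: val_inj => /=.
by rewrite -(flatten_indexKl (nth_pos (ltn_ord r))) e' (flatten_indexKl (ltn_ord o)).
Qed.

Lemma porbits_std : porbits s = [set scyc r | r : 'I_(size lam)].
Proof.
apply/setP => c; apply/imsetP/imsetP => [[i _ ->]|[r _ ->]]; last by exists (start r).
have hr : (reshape_index lam i < size lam)%N.
  have := reshape_indexP (ltn_ord i); by [].
exists (Ordinal hr) => //; apply/eqP; rewrite eq_porbit_mem -/(scyc (Ordinal hr)) scycE.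
have ho := reshape_offsetP (ltn_ord i).
by apply/imsetP; exists (Ordinal ho) => //; apply: val_inj; rewrite /= reshape_indexK.
Qed.

Lemma card_porbits_std : #|porbits s| = size lam.
Proof. by rewrite porbits_std card_imset ?card_ord //; exact: scyc_inj. Qed.

End StdCycles.

Lemma card_porbits_cast m n (e : m = n) (g : {perm 'I_m}) : #|porbits (cast_perm e g)| = #|porbits g|.
Proof. by case: n / e; rewrite cast_perm_id. Qed.

(** The starting point that [mcyc] picks is immaterial: moving it by one step rotates the factors,
    which the trace does not see. *)
Lemma mcyc_start (K : numFieldType) N d (X : 'I_d -> 'M[K]_N) (g : {perm 'I_d}) i :
  \tr (mcyc X g (porbit g i)) = \tr (\prod_(k < #|porbit g i|) X ((g ^+ k)%g i)).
Proof.
rewrite /mcyc; case: pickP => [j|/(_ i)]; last by rewrite porbit_id.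
set n := #|_|; move=> /porbitP[m ->].
have rot (j' : 'I_d) : porbit g j' = porbit g i -> \tr (\prod_(k < n) X ((g ^+ k)%g (g j'))) = \tr (\prod_(k < n) X ((g ^+ k)%g j')).
  move=> ej; have n0 : (0 < n)%N by apply/card_gt0P; exists i; exact: porbit_id.
  rewrite -(prednK n0) big_ord_recr [in RHS]big_ord_recl /= expg0 perm1.
  have -> : (g ^+ n.-1)%g (g j') = j'.
    by rewrite -permM -expgS prednK // permX /n -ej iter_porbit.
  rewrite -[LHS]/(\tr (_ *m X j')) -[RHS]/(\tr (X j' *m _)) mxtrace_mulC; congr (\tr (_ *m _)).
  by apply: eq_bigr => k _; rewrite /bump /= add1n expgS permM.
elim: m => [|m IH]; first by rewrite expg0 perm1.
by rewrite expgSr permM rot // porbit_perm.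
Qed.

(** * From words to arbitrary polynomials *)

Section Words.
Variables (R : realType) (disp : nat -> measure_display).
Variable Omega : forall N : nat, measurableType (disp N).
Variable P : forall N : nat, probability (Omega N) R.
Variables (A B : forall N : nat, Omega N -> 'M[R[i]]_N).
Arguments A : clear implicits.
Arguments B : clear implicits.
Hypotheses (rA : forall N, random_mx (A N)) (rB : forall N, random_mx (B N)).
Hypotheses (mA : forall N, has_moments (P N) (A N)) (mB : forall N, has_moments (P N) (B N)).
Hypothesis ABind : forall N, independent_mx (P N) (A N) (B N).
Hypothesis inv : (forall N, unitarily_invariant (P N) (A N)) \/ (forall N, unitarily_invariant (P N) (B N)).
Local Notation K := R[i].
Local Notation NC := (ncpoly K).
Variable t : xtyp.
Hypothesis tin : in_xtyp t.
Hypothesis limA : forall (ps : seq {poly K}) m, (0 < size ps)%N -> level t (size ps) m ->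
  expands P A B m [seq horner_alg (nc_a K) p | p <- ps].
Hypothesis limB : forall (ps : seq {poly K}) m, (0 < size ps)%N -> level t (size ps) m ->
  expands P A B m [seq horner_alg (nc_b K) p | p <- ps].

(* The empty word occupies one slot, filled with the unit. *)
Definition slots (m : seq bool) : seq (option bool) := if m is [::] then [:: None] else map Some m.

Lemma wordmx_slots N (X Y : 'M[K]_N) (m : seq bool) :
  wordmx X Y m = \prod_(o <- slots m) (if o is Some b then (if b then Y else X) else 1).
Proof.
rewrite /wordmx; case: m => [|b m]; first by rewrite big_nil big_seq1.
by rewrite /slots big_map.
Qed.

(** The words are laid end to end and read along the cycles of [std_perm], one slot per point; a
    list of words is then a mixed family in the sense of [mixed_expansion]. *)
Lemma expands_words (ms : seq {fmonom bool}) m : (0 < size ms)%N -> level t (size ms) m ->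
  expands P A B m [seq (<< w >> : NC) | w <- ms].
Proof.
move=> n0 hl; pose w0 : {fmonom bool} := FMonom [::]; pose ls := [seq slots (w : seq bool) | w : {fmonom bool} <- ms]; pose lam := shape ls.
have lpos : all (leq 1) lam.
  apply/allP => k /mapP[w /mapP[w' _ ->] ->]; by case: (w' : seq bool).
have sl : size lam = size ms by rewrite /lam /ls !size_map.
pose d := sumn lam; pose s := std_perm lam.
have sd : (size ms <= d)%N.
  by have := rank_perm s; rewrite (card_porbits_std lpos) sl -/d => <-; rewrite leq_addl.
have d0 : (0 < d)%N by exact: leq_trans n0 sd.
pose letter (k : 'I_d) : option bool := nth None (flatten ls) k.
pose p (k : 'I_d) : {poly K} := if letter k is Some _ then 'X else 1.
(* An empty slot is counted on the side of a, where it carries the polynomial 1. *)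
pose J := [set k | letter k != Some true].
have hn : (0 < size ms <= d)%N by rewrite n0.
have [G0 [n1 [n1p em hlev]]] := level_lev tin hl hn.
have := mixed_expansion rA rB mA mB ABind inv tin limA limB d0 p J n1p hlev s.
rewrite (card_porbits_std lpos) sl -em => -[F hF]; exists F.
move: hF; rewrite size_cyl cycles_inT (card_porbits_std lpos) sl size_map.
apply: (expd_ext (N1 := 0%N)) => N _; rewrite /cumN /cyl -!map_comp cycles_inT.
set f := _ \o cycle_prod _ _.
(* [enum] lists the cycles in an uncontrolled order; symmetry of the cumulant restores that of the
   words. *)
rewrite (cumulant_perm_eq (P N) f (r2 := [seq scyc lpos r | r <- enum 'I_(size lam)])); last first.
  apply: uniq_perm; first exact: enum_uniq.
    by rewrite map_inj_uniq ?enum_uniq //; exact: scyc_inj.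
  move=> c; rewrite mem_enum (porbits_std lpos); apply/imsetP/mapP => [[r _ ->]|[r _ ->]]; exists r => //.
  by rewrite mem_enum.
congr cumulant; rewrite -map_comp.
apply: (@eq_from_nth _ (fun=> 0)); first by rewrite size_map size_enum_ord sl size_map.
move=> r; rewrite size_map size_enum_ord => hr.
have hr' : (r < size ms)%N by rewrite -sl.
rewrite (nth_map (Ordinal hr)) ?size_enum_ord //.
rewrite (nth_map w0) //.
rewrite (_ : nth _ _ r = Ordinal hr); last by apply: val_inj; rewrite /= nth_enum_ord.
apply/funext => w; rewrite /f /= /trR evR_cycle /scyc mcyc_start -/(scyc lpos (Ordinal hr)) card_scyc.
congr (\tr _); rewrite /evR nc_evalU scale1r wordmx_slots.
have er : nth [::] ls r = slots (nth w0 ms r : seq bool) by rewrite (nth_map w0).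
have lr : nth 0%N lam r = size (slots (nth w0 ms r : seq bool)).
  by rewrite /lam (nth_map [::]) ?er // size_map.
rewrite -er (big_nth None) big_mkord.
have lr' : size (nth [::] ls r) = nth 0%N lam r by rewrite er lr.
rewrite lr'; apply: eq_bigr => o _.
have hs : val ((s ^+ o)%g (start lpos (Ordinal hr))) = flatten_index lam r o.
  by rewrite /start std_iter /= add0n modn_small.
have lt : letter ((s ^+ o)%g (start lpos (Ordinal hr))) = nth None (nth [::] ls r) o.
  rewrite /letter hs nth_flatten -/lam.
  by rewrite (flatten_indexKl (ltn_ord o)) (flatten_indexKr (ltn_ord o)).
rewrite /xfam nc_eval_horner /p finset.inE lt.
case: (nth None _ o) => [[]|] /=.
- by rewrite nc_evalb /pev size_polyX !big_ord_recl big_ord0 !coefX /= scale0r add0r addr0 scale1r expr1.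
- by rewrite nc_evala /pev size_polyX !big_ord_recl big_ord0 !coefX /= scale0r add0r addr0 scale1r expr1.
by rewrite -[1]/(1%:P) /pev size_polyC oner_eq0 big_ord1 coefC eqxx scale1r expr0.
Qed.

Lemma expands_all (s : seq NC) m : (0 < size s)%N -> level t (size s) m -> expands P A B m s.
Proof.
pose L (s : seq NC) := level t (size s) m -> expands P A B m s.
suff : forall s, (0 < size s)%N -> L s by move=> h s0; exact: h.
apply: (@linear_extension K NC {fmonom bool} (fun w => << w >>) L).
- move=> s1 s2 c x y; rewrite /L !size_cat /= => h1 h2 hl.
  exact: (expands_linear rA rB mA mB ABind c (h1 hl) (h2 hl)).
- by move=> s1 s2 _; apply: expands0 => N; exact: (cumN0 rA rB mA mB ABind).
- by move=> r r0; rewrite /L size_map; exact: expands_words.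
move=> v; exists [seq (v@_w, w) | w <- msupp v : seq _].
rewrite big_map {1}[v]monalgE; apply: eq_bigr => w _; exact: malgU_scale.
Qed.

End Words.
Local Close Scope set_scope.

(** * The surfaced space of limit moments *)

Section LimitMoments.
Variables (R : realType) (disp : nat -> measure_display).
Variable Omega : forall N : nat, measurableType (disp N).
Variable P : forall N : nat, probability (Omega N) R.
Variables (A B : forall N : nat, Omega N -> 'M[R[i]]_N).
Arguments A : clear implicits.
Arguments B : clear implicits.
Hypotheses (rA : forall N, random_mx (A N)) (rB : forall N, random_mx (B N)).
Hypotheses (mA : forall N, has_moments (P N) (A N)) (mB : forall N, has_moments (P N) (B N)).
Hypothesis ABind : forall N, independent_mx (P N) (A N) (B N).
Local Notation K := R[i].
Local Notation NC := (ncpoly K).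
Variable t : xtyp.
Hypothesis tin : in_xtyp t.
Hypothesis allexp : forall (s : seq NC) m, (0 < size s)%N -> level t (size s) m -> expands P A B m s.

(** Zero outside the types below t, because the axioms of [surfaced_space] range over all genera and
    lengths. *)
Definition limit_moment (G : nat) (s : seq NC) : K :=
  if (0 < size s)%N && typ_le G (size s) t then expcoef (size s) (cumN P A B s) G else 0.

Lemma limit_momentE s m : (0 < size s)%N -> level t (size s) m ->
  expd (size s) m (cumN P A B s) (limit_moment^~ s).
Proof.
move=> s0 hl; have [F hF] := allexp s0 hl.
apply: expd_eqF (expd_expcoef hF) => G Gm; rewrite /limit_moment s0 /=.
by have -> : typ_le G (size s) t by apply/typ_leE; exists m.
Qed.

Lemma limit_moment_coef s m G F : (0 < size s)%N -> level t (size s) m -> G%:Z <= m ->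
  expd (size s) m (cumN P A B s) F -> limit_moment G s = F G.
Proof. by move=> s0 hl Gm hF; exact: (expd_uniq (limit_momentE s0 hl) hF). Qed.

Lemma limit_moment_out s G : ~~ typ_le G (size s) t -> limit_moment G s = 0.
Proof. by move=> /negbTE h; rewrite /limit_moment h andbF. Qed.

Lemma limit_moment_eq s1 s2 G : size s1 = size s2 -> (forall N, cumN P A B s1 N = cumN P A B s2 N) ->
  limit_moment G s1 = limit_moment G s2.
Proof. by move=> e h; rewrite /limit_moment e (_ : cumN P A B s1 = cumN P A B s2) //; apply/funext. Qed.

Lemma limit_moment_surfaced : surfaced_space limit_moment.
Proof.
split.
- move=> G s1 s2 c x y; set s := s1 ++ _.
  have e z : size (s1 ++ z :: s2) = size s by rewrite !size_cat.
  case: (boolP (typ_le G (size s) t)) => h; last first.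
    by rewrite !limit_moment_out ?e // mulr0 addr0.
  have /typ_leE[m hl Gm] := h.
  have s0 z : (0 < size (s1 ++ z :: s2))%N by rewrite size_cat addnS.
  have hx := limit_momentE (s0 x); rewrite e in hx; have hy := limit_momentE (s0 y); rewrite e in hy.
  have := expd_linear c (hx m hl) (hy m hl) => hlin.
  rewrite (limit_moment_coef (F := fun G => c * limit_moment G (s1 ++ x :: s2) + limit_moment G (s1 ++ y :: s2)) (s0 _) hl Gm) //.
  apply: (expd_ext (N1 := 0%N) _ hlin) => N _.
  by rewrite (cumN_linear rA rB mA mB ABind).
- move=> G s1 s2 h; apply: limit_moment_eq; first exact: perm_size.
  by move=> N; exact: cumN_perm.
- move=> G s1 s2 x y.
  have e (u v : NC) : size (s1 ++ u :: s2) = size (s1 ++ v :: s2) by rewrite !size_cat.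
  exact: (limit_moment_eq G (e (x * y) (y * x)) (cumN_tr P A B s1 s2 x y)).
- have [m hl] : exists m, level t 1 m.
    by case: t => [G0 n0|G0|]; eexists; [reflexivity|reflexivity|exact: (lexx 0)].
  have m0 := level1 tin hl.
  rewrite (limit_moment_coef (s := [:: 1]) (m := m) (F := fun G => (1%:P : {poly K})`_G)) //; first by rewrite coefC.
  exact: expd_one1.
move=> G s ne.
case: (boolP (typ_le G (size (1 :: s)) t)) => h; last exact: limit_moment_out.
have /typ_leE[m hl Gm] := h.
(* Alone, the unit has cumulant exactly N, without terms of positive genus; next to other entries
   its cumulant is zero. *)
case: (posnP (size s)) => [s0|s0].
  have es := size0nil s0; rewrite es in hl *.
  rewrite (limit_moment_coef (s := [:: 1]) (m := m) (F := fun G => (1%:P : {poly K})`_G)) //; last exact: expd_one1.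
  by move: ne; rewrite es coefC; case: G {h Gm}.
rewrite (limit_moment_coef (s := 1 :: s) (m := m) (F := fun G => (0 : {poly K})`_G)) //; first by rewrite coef0.
apply: AppP_expd; apply: (AppP_ext (N1 := 0%N) _ (AppP0 _ _)) => N _.
by rewrite (cumN_one rA rB mA mB ABind).
Qed.

End LimitMoments.
Local Open Scope classical_set_scope.

Theorem theorem5p28 (R : realType) (disp : nat -> measure_display)
    (Omega : forall N : nat, measurableType (disp N))
    (P : forall N : nat, probability (Omega N) R)
    (A B : forall N : nat, Omega N -> 'M[R[i]]_N) (t : xtyp) :
  (forall N, random_mx (A N)) -> (forall N, random_mx (B N)) ->
  (forall N w, hermitian_mx (A N w)) -> (forall N w, hermitian_mx (B N w)) ->
  (forall N, unitarily_invariant (P N) (A N)) \/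
    (forall N, unitarily_invariant (P N) (B N)) ->
  (forall N, independent_mx (P N) (A N) (B N)) ->
  in_xtyp t ->
  admits_limit P A t -> admits_limit P B t ->
  (forall Q : ncpoly R[i],
     admits_limit P (fun N w => nc_eval Q (A N w) (B N w)) t) /\
  exists phi : nat -> seq (ncpoly R[i]) -> R[i],
    [/\ surfaced_space phi,
        forall (N : nat) (Qs : seq (ncpoly R[i])),
          cintegrable (P N)
            (fun w => \prod_(Q <- Qs) \tr (nc_eval Q (A N w) (B N w))),
        forall Qs : seq (ncpoly R[i]), (0 < size Qs)%N ->
          has_expansion t (size Qs)
            (fun N => cumulant (P N)
               [seq (fun w => \tr (nc_eval Q (A N w) (B N w))) | Q <- Qs])
            (fun G => phi G Qs) &
        surf_free phi t (range (horner_alg (nc_a R[i])))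
                        (range (horner_alg (nc_b R[i])))].
Proof.
move=> rA rB hA hB inv ABind tin limA limB.
have mA N : has_moments (P N) (A N).
  by have [h _] := limA; exact: (herm_moments (hA N) (h N)).
have mB N : has_moments (P N) (B N).
  by have [h _] := limB; exact: (herm_moments (hB N) (h N)).
have evA N w : evR A B (nc_a R[i]) w = A N w by exact: nc_evala.
have evB N w : evR A B (nc_b R[i]) w = B N w by exact: nc_evalb.
have eA := expands_poly rA rB mA mB ABind limA evA.
have eB := expands_poly rA rB mA mB ABind limB evB.
have allexp := expands_all rA rB mA mB ABind inv tin eA eB.
pose phi := limit_moment P A B t.
have phiE := limit_momentE allexp.
have phiX (Qs : seq (ncpoly R[i])) : (0 < size Qs)%N ->
    has_expansion t (size Qs) (cumN P A B Qs) (fun G => phi G Qs).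
  by move=> s0; apply/has_expansionE => m hl; exact: phiE.
split.
  (* Powers of Q evaluate to powers of the matrix, so the lists of powers of Q are a special case of
     lists of polynomials. *)
  move=> Q; split=> [N ks _|].
    have := cint_tr rA rB mA mB ABind [seq Q ^+ k | k <- ks] N.
    congr (cintegrable _ _); apply/funext => w; rewrite big_map; apply: eq_bigr => k _.
    by rewrite /evR nc_evalX.
  exists (fun G ks => phi G [seq Q ^+ k | k <- ks]) => ks s0 _.
  have := phiX [seq Q ^+ k | k <- ks]; rewrite size_map => /(_ s0).
  congr (has_expansion _ _ _ _); apply/funext => N; rewrite /cumN -map_comp; congr cumulant.
  by apply: eq_map => k; apply/funext => w; rewrite /= /trR /evR nc_evalX.
exists phi; split.
- exact: (limit_moment_surfaced rA rB mA mB ABind tin allexp).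
- by move=> N Qs; exact: (cint_tr rA rB mA mB ABind).
- by move=> Qs s0; exact: phiX.
move=> G ks s0 kpos hG i a ha hmix.
(* The flag [i k] is true for elements of C[b], so J collects the positions filled from C[a]. *)
pose J := [set k | ~~ i k]%SET.
have hp k : exists q, a k = horner_alg (if k \in J then nc_a R[i] else nc_b R[i]) q.
  by have := ha k; rewrite finset.inE; case: (i k) => /= -[q _ <-]; exists q.
have [p ep] := choice hp.
have -> : a = xfam p J by apply/funext => k; rewrite ep.
have d0 : (0 < sumn ks)%N by have [k _] := hmix; exact: leq_ltn_trans (leq0n k) (ltn_ord k).
have hcard : #|porbits (cast_perm (sumn_sort_geq ks) (std_perm (sort geq ks)))| = size ks.
  by rewrite card_porbits_cast card_porbits_std ?size_sort // all_sort.
rewrite -hcard in hG.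
have mixed : exists k l, (k \in J) != (l \in J).
  have [k [l ne]] := hmix; exists k, l; rewrite !finset.inE.
  by move: ne; case: (i k); case: (i l).
exact: (scumulant_mixed rA rB mA mB ABind inv tin eA eB d0 p (fun s s0 m hl => limit_momentE allexp s0 hl) mixed hG).
Qed.
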